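(* Let $\alpha\in(1,2)$ and let $X$ be either (a) the Taqqu–Levy process with $\mathbb P(T_1\ge n)=L(n)n^{-\alpha}$ for all $n\ge1$ ($L$ slowly varying) and $\sigma_W^2<\infty$, or (b) Parke's process with $\mathbb P(N\ge j)=L(j)j^{-\alpha}$ for all $j\ge1$ ($L$ slowly varying) and $\mathbb E[\epsilon_0^2]<\infty$. Let $D_{n,j}=\sum_{t=1}^nX_te^{\mathrm i t 2\pi j/n}$, let $U=T_1$ in case (a), $U=N$ in case (b), and $\ell(n)=n^{-1/\alpha}\inf\{t>0:\mathbb P(U>t)<n^{-1}\}$. Let $j_1<\dots<j_q$ be fixed positive integers. Then $$\ell(n)^{-1}n^{-1/\alpha}(D_{n,j_1},\dots,D_{n,j_q})\xrightarrow{\ d\ }\Big(\int_0^1e^{2\mathrm i\pi j_1s}\,d\Lambda_\alpha(s),\dots,\int_0^1e^{2\mathrm i\pi j_qs}\,d\Lambda_\alpha(s)\Big),$$ where $\Lambda_\alpha$ is the $\alpha$-stable Lévy process with characteristic function $$\mathbb E[e^{\mathrm i u\Lambda_\alpha(t)}]=\exp\Big\{-t|u|^\alpha\mu^{-1}\mathbb E[|\xi|^\alpha]\,\Gamma(1-\alpha)\cos(\pi\alpha/2)\big(1-\mathrm i\,\beta\,\mathrm{sign}(u)\tan(\pi\alpha/2)\big)\Big\},$$ $\beta=(\mathbb E[\xi_+^\alpha]-\mathbb E[\xi_-^\alpha])/\mathbb E[|\xi|^\alpha]$, with $\xi=W_1$ in case (a) and $\xi=\epsilon_1$, $\mu=1$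 in case (b).
   Context: Taqqu–Levy process: $(T_k)_{k\ge1}$ are i.i.d. positive integer-valued random variables with mean $\mu$ and $\mathbb P(T_1=1)>0$; $S_0$ is a non-negative integer-valued random variable independent of $(T_k)$ with $\mathbb P(S_0=u)=\mu^{-1}\mathbb P(T_1\ge u+1)$, $u=0,1,\dots$; $(W_k)_{k\ge0}$ are i.i.d. with $\mathbb E[W_k]=0$, $\mathrm{var}(W_k)=\sigma_W^2$, independent of $S_0$ and $(T_k)$. Set $S_{-1}=-1$, $S_k=S_0+T_1+\dots+T_k$ ($k\ge1$), and $X_t=\sum_{k=0}^\infty W_k\mathbf 1_{\{S_{k-1}\le t<S_k\}}$. Parke's process: $(\epsilon_t)_{t\in\mathbb Z}$ i.i.d. with zero mean, $(n_s)_{s\in\mathbb Z}$ i.i.d. non-negative integer-valued, independent of $(\epsilon_t)$, with generic copy $N$; $g_{s,t}=1$ if $s\le t\le s+n_s$ and $0$ otherwise; $X_t=\sum_{s\le t}g_{s,t}\epsilon_s$. $x_+=\max(x,0)$, $x_-=\max(-x,0)$. The integrals $\int_0^1 e^{2\mathrm i\pi js}d\Lambda_\alpha(s)$ are stochastic integrals of deterministic continuous functions against the Lévy process (real and imaginary parts integrated separately). A function $L$ is slowly varying at infinity if it is bounded on finite intervals and $L(at)/L(t)\to1$ for all $a>0$. *)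

(* Defs.v *)
From HB Require Import structures.
From mathcomp Require Import all_boot all_order all_algebra.
From mathcomp Require Import all_classical all_reals all_analysis.
Export Order.TTheory GRing.Theory Num.Theory.
Export numFieldNormedType.Exports.

Set Implicit Arguments.
Unset Strict Implicit.
Unset Printing Implicit Defensive.

Local Open Scope ring_scope.
Local Open Scope classical_set_scope.

Definition rv_events {d} {T : measurableType d} {d'} {V : measurableType d'}
  (X : T -> V) : set (set T) := [set X @^-1` B | B in measurable].

Definition mutually_indep {d} {T : measurableType d} {R : realType}
  (P : probability T R) {I : eqType} (F : I -> set (set T)) : Prop :=
  forall (J : seq I) (A : I -> set T), uniq J ->
    (forall i, i \in J -> F i (A i)) ->
    P (\big[setI/setT]_(i <- J) A i) = (\prod_(i <- J) fine (P (A i)))%:E.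

Definition same_law {d} {T : measurableType d} {R : realType}
  (P : probability T R) {d'} {V : measurableType d'} (X Y : T -> V) : Prop :=
  forall B, measurable B -> P (X @^-1` B) = P (Y @^-1` B).

Definition cvg_in_prob {d} {T : measurableType d} {R : realType}
  (P : probability T R) (Y : nat -> T -> R) (Z : T -> R) : Prop :=
  forall e : R, 0 < e ->
    (P [set w | e < `|Y m w - Z w|]) @[m --> \oo] --> 0%E.

Definition cvg_in_distribution {d1} {T1 : measurableType d1}
  {d2} {T2 : measurableType d2} {R : realType} {V : topologicalType}
  (P1 : probability T1 R) (Y : nat -> T1 -> V)
  (P2 : probability T2 R) (Z : T2 -> V) : Prop :=
  forall g : V -> R, continuous g -> (exists M : R, forall v, `|g v| <= M) ->
    (('E_P1[fun w => g (Y n w)]) @[n --> \oo] --> 'E_P2[fun w => g (Z w)])%E.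

Definition slowly_varying {R : realType} (L : R -> R) : Prop :=
  (forall a b : R, 0 < a -> exists M : R, forall x, a <= x <= b -> `|L x| <= M) /\
  (forall a : R, 0 < a -> L (a * t) / L t @[t --> +oo%R] --> (1 : R)).

(** Euler's Gamma function: the integral for [0 < z], extended to
    [-1 < z < 0] by the functional equation [Gamma z = Gamma (z+1) / z]
    (the only range needed here is [z = 1 - alpha], [alpha \in (1,2)]). *)
Definition gamma_integrand {R : realType} (z x : R) : R := x `^ (z - 1) * expR (- x).

Definition Gamma_int {R : realType} (z : R) : R :=
  fine (\int[@lebesgue_measure R]_(x in [set x : R | (0 < x)%R])
          EFin (gamma_integrand z x))%E.

Definition Gamma {R : realType} (z : R) : R :=
  if 0 < z then Gamma_int z else Gamma_int (z + 1) / z.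

Definition mom_abs {d} {T : measurableType d} {R : realType}
  (P : probability T R) (X : T -> R) (a : R) : R :=
  fine ('E_P[fun w => (`|X w| `^ a)%R])%E.
Definition mom_pos {d} {T : measurableType d} {R : realType}
  (P : probability T R) (X : T -> R) (a : R) : R :=
  fine ('E_P[fun w => (Num.max (X w) 0 `^ a)%R])%E.
Definition mom_neg {d} {T : measurableType d} {R : realType}
  (P : probability T R) (X : T -> R) (a : R) : R :=
  fine ('E_P[fun w => (Num.max (- X w) 0 `^ a)%R])%E.

(** [Lam] is (on the time interval [0,1]) a Levy process with
    E[exp(i u Lam(t))] = exp{ -t |u|^a c (1 - i beta sign(u) tan(pi a/2)) },
    the complex identity being written through its real and imaginary parts. *)
Definition stable_levy {d} {T : measurableType d} {R : realType}
  (P : probability T R) (Lam : R -> T -> R) (a c beta : R) : Prop :=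
  [/\ (forall t, measurable_fun setT (Lam t)),
      (forall w, Lam 0 w = 0),
      (forall (m : nat) (s : nat -> R), 0 <= s 0%N ->
         (forall i, (i < m)%N -> s i <= s i.+1) -> s m <= 1 ->
         mutually_indep P
           (fun i : 'I_m => rv_events (fun w => Lam (s i.+1) w - Lam (s i) w))),
      (forall s t : R, 0 <= s -> s <= t -> t <= 1 ->
         same_law P (fun w => Lam t w - Lam s w) (Lam (t - s)))
    & (forall t u : R, 0 <= t -> t <= 1 ->
         let A := t * `|u| `^ a * c in
         let B := A * beta * Num.sg u * tan (pi * a / 2) in
         'E_P[fun w => cos (u * Lam t w)]%E = (expR (- A) * cos B)%:E /\
         'E_P[fun w => sin (u * Lam t w)]%E = (expR (- A) * sin B)%:E)].

(** Riemann sums of f against Lam on the uniform partition of [0,1] in m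
    pieces; for continuous deterministic f they converge in probability to
    the stochastic integral \int_0^1 f dLam. *)
Definition riemann_sum {T : Type} {R : realType} (f : R -> R)
  (Lam : R -> T -> R) (m : nat) (w : T) : R :=
  \sum_(i < m) f (i%:R / m%:R) * (Lam (i.+1%:R / m%:R) w - Lam (i%:R / m%:R) w).

(** series are written as [limn] of partial sums ([limn u] = lim_{N->oo} u N).
    Taqqu-Levy: S_k = S_0 + T_1 + ... + T_k, S_{-1} = -1, and
    X_t = sum_{k>=0} W_k 1{S_{k-1} <= t < S_k}. *)
Definition renewal_S {T : Type} (S0 : T -> nat) (Tk : nat -> T -> nat)
  (k : nat) (w : T) : nat :=
  (S0 w + \sum_(1 <= i < k.+1) Tk i w)%N.

Definition taqqu_X {T : Type} {R : realType} (S0 : T -> nat)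
  (Tk : nat -> T -> nat) (W : nat -> T -> R) (t : nat) (w : T) : R :=
  limn (fun N => \sum_(0 <= k < N)
    (W k w * (if ((k == 0)%N || (renewal_S S0 Tk k.-1 w <= t)%N)
                 && (t < renewal_S S0 Tk k w)%N then 1 else 0))).

(** Parke: X_t = sum_{s <= t} g_{s,t} eps_s, g_{s,t} = 1{s <= t <= s + n_s};
    the sum over s = t - m, m = 0,1,2,... *)
Definition parke_X {T : Type} {R : realType} (eps : int -> T -> R)
  (nn : int -> T -> nat) (t : int) (w : T) : R :=
  limn (fun N => \sum_(0 <= m < N)
    (if (m <= nn (t - m%:Z)%R w)%N then eps (t - m%:Z)%R w else 0)).

Definition DRe {T : Type} {R : realType} (X : nat -> T -> R) (n j : nat) (w : T) : R :=
  \sum_(1 <= t < n.+1) X t w * cos (t%:R * 2 * pi * j%:R / n%:R).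
Definition DIm {T : Type} {R : realType} (X : nat -> T -> R) (n j : nat) (w : T) : R :=
  \sum_(1 <= t < n.+1) X t w * sin (t%:R * 2 * pi * j%:R / n%:R).

Definition ell {d} {T : measurableType d} {R : realType}
  (P : probability T R) (U : T -> nat) (a : R) (n : nat) : R :=
  n%:R `^ (- a^-1) * inf [set t : R | 0 < t /\ fine (P [set w | t < (U w)%:R]) < n%:R^-1].

(** the normalised vector l(n)^{-1} n^{-1/a} (D_{n,j_1},...,D_{n,j_q}),
    C^q being identified with R^q x R^q (real parts, imaginary parts) *)
Definition normalized_D {d} {T : measurableType d} {R : realType}
  (P : probability T R) (U : T -> nat) (a : R) (X : nat -> T -> R)
  (q : nat) (j : 'I_q -> nat) (n : nat) (w : T) : 'rV[R]_q * 'rV[R]_q :=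
  (\row_k ((ell P U a n)^-1 * n%:R `^ (- a^-1) * DRe X n (j k) w),
   \row_k ((ell P U a n)^-1 * n%:R `^ (- a^-1) * DIm X n (j k) w)).

(* Main.v *)
(** Both processes are shot noises: up to an asymptotically negligible
    remainder, [sum_(t <= n) X_t f(t/n)] is [sum_(k < n) xi_k B_k] with i.i.d.
    centred square-integrable [xi_k] and [B_k] the sum of [f(t/n)] over a window
    of random length [tau_k] with tail index [alpha], starting at a time [V_k]
    close to [mu k].  For Taqqu-Levy, [V_k] is the renewal epoch and a truncated
    weak law gives [V_k ~ mu k]; for Parke, [V_k = k+1], [tau_k = N_k + 1] and
    the contribution of sites [s <= 0] is a.s. a finite sum.

    Cut [0,1] into [m] pieces and replace [f(t/n)] by its value at the left end
    of the piece containing [mu k / n].  Long windows are rare, short ones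
    contribute little in mean square by orthogonality of the [xi_k], so the
    error is small in probability, uniformly in [n], as [m] grows.  What is left
    is a sum of blocks of i.i.d. variables [f(i/m) xi_k tau_k / c_n], where
    [c_n] is the quantile of the tail at [1/n].  By layer-cake integration and
    regular variation, [n (E[exp(i u xi tau / c_n)] - 1)] converges to the
    stable exponent; its constants are the integrals of [sin x * x^(-alpha)] and
    [(cos x - 1) * x^(-alpha)] over the half line, obtained by rotating the
    contour of the Gamma integral.  So the characteristic functions of the
    blocks converge to those of the Riemann sums of [f] against [Lam], and as
    [m] grows, to those of the stochastic integrals.  Levy's continuity theorem
    (for expectations of bounded continuous functions, via Bernstein
    polynomials in [sin (w y)]) concludes. *)
Require Import Defs.
From HB Require Import structures.
From mathcomp Require Import all_boot all_order all_algebra.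
From mathcomp Require Import all_classical all_reals all_analysis.
From mathcomp Require Import measurable_realfun ring lra zify.
From mathcomp Require complex.
Set Implicit Arguments.
Unset Strict Implicit.
Unset Printing Implicit Defensive.
Import Order.TTheory GRing.Theory Num.Theory.
Import numFieldNormedType.Exports.
Local Open Scope ring_scope.
Local Open Scope classical_set_scope.

(** * Expectation and independence *)

(** As [alpha < 2], the lengths [tau] have no variance, so mean squares are taken after a cut at
    [B c_n]: some length among the first [n] exceeds it with probability at most [n P(tau > B c_n)],
    small for large [B], and [n E[tau^2; tau <= B c_n] = O(c_n^2)], which is read off the limit of
    the cosine transform. To factor this second moment out, the coefficient of [tau_k] in the error
    must be independent of [tau_k]; a renewal epoch depends on earlier lengths only. The sine
    transform is centred: [sin y - y] has derivative [cos y - 1 = O(min(1,|y|))], integrable against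
    [x^(-alpha)] on the half line, whereas [cos] is not integrable against it near 0. The linear
    term costs nothing because [E[xi] = 0] and [tau] has a mean. The law of the stochastic integral
    is never computed: for fixed [m] the characteristic functions of block sum and Riemann sum are
    compared factor by factor. All other errors are measured by [E[min(1,|X - Y|)]], which needs no
    moments and controls both sines and cosines. *)

Section expectation.
Context {d} {T : measurableType d} {R : realType} (P : probability T R).
Implicit Types X Y : T -> R.

Definition Ex X : R := \int[P]_w X w.
Definition integ X : Prop := P.-integrable setT (EFin \o X).

Lemma integ_measurable X : integ X -> measurable_fun setT X.
Proof. by move=> /integrableP[/measurable_EFinP]. Qed.

Lemma integD X Y : integ X -> integ Y -> integ (fun w => X w + Y w).
Proof. exact: integrableD. Qed.

Lemma integN X : integ X -> integ (fun w => - X w).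
Proof. exact: integrableN. Qed.

Lemma integB X Y : integ X -> integ Y -> integ (fun w => X w - Y w).
Proof. by move=> iX iY; apply: integD => //; exact: integN. Qed.

Lemma integZ k X : integ X -> integ (fun w => k * X w).
Proof.
move=> iX; have := @integrableZl _ _ _ P setT measurableT k _ iX.
by apply: eq_integrable => // w _ /=; rewrite EFinM.
Qed.

Lemma le_integ Y X : measurable_fun setT X -> (forall w, `|X w| <= Y w) ->
  integ Y -> integ X.
Proof.
move=> mX XY iY; apply: (le_integrable measurableT _ _ iY) => /=.
  exact/measurable_EFinP.
by move=> w _; rewrite lee_fin (le_trans (XY w))// ler_norm.
Qed.

Lemma integ_cst k : integ (fun=> k).
Proof.
apply/integrableP; split; first exact/measurable_EFinP.
rewrite integral_cst//= -ge0_fin_numE ?mule_ge0//.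
by rewrite fin_numM// probability_setT.
Qed.

Lemma integ_bounded M X : measurable_fun setT X -> (forall w, `|X w| <= M) ->
  integ X.
Proof. by move=> mX XM; exact: (@le_integ (fun=> M) X mX XM (integ_cst M)). Qed.

Lemma integ_norm X : integ X -> integ (fun w => `|X w|).
Proof. exact: integrable_norm. Qed.

Lemma integ_sum (I : Type) (r : seq I) (p : pred I) (F : I -> T -> R) :
  (forall i, p i -> integ (F i)) -> integ (fun w => \sum_(i <- r | p i) F i w).
Proof.
move=> iF; elim: r => [|i r IH].
  by under eq_fun do rewrite big_nil; exact: integ_cst.
under eq_fun do rewrite big_cons.
by have := iF i; case: (p i) => [/(_ isT) iFi|_] //; exact: integD.
Qed.

Lemma eq_Ex X Y : X =1 Y -> Ex X = Ex Y.
Proof. by move=> /funext ->. Qed.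

Lemma ExD X Y : integ X -> integ Y -> Ex (fun w => X w + Y w) = Ex X + Ex Y.
Proof. by move=> iX iY; rewrite /Ex RintegralD. Qed.

Lemma ExB X Y : integ X -> integ Y -> Ex (fun w => X w - Y w) = Ex X - Ex Y.
Proof. by move=> iX iY; rewrite /Ex RintegralB. Qed.

Lemma ExZ k X : integ X -> Ex (fun w => k * X w) = k * Ex X.
Proof. by move=> iX; rewrite /Ex RintegralZl. Qed.

Lemma Ex_cst k : Ex (fun=> k) = k.
Proof.
by rewrite /Ex Rintegral_cst// [X in fine X](_ : _ = 1%E) ?mulr1//; exact: probability_setT.
Qed.

Lemma Ex_sum (I : Type) (r : seq I) (p : pred I) (F : I -> T -> R) :
  (forall i, p i -> integ (F i)) ->
  Ex (fun w => \sum_(i <- r | p i) F i w) = \sum_(i <- r | p i) Ex (F i).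
Proof.
move=> iF; elim: r => [|i r IH].
  by under eq_Ex do rewrite big_nil; rewrite Ex_cst big_nil.
under eq_Ex do rewrite big_cons; rewrite big_cons.
have := iF i; case: (p i) => [/(_ isT) iFi|_] //.
by rewrite ExD ?IH//; exact: integ_sum.
Qed.

Lemma Ex_ge0 X : (forall w, 0 <= X w) -> 0 <= Ex X.
Proof. by move=> X0; exact: Rintegral_ge0. Qed.

Lemma le_Ex X Y : integ X -> integ Y -> (forall w, X w <= Y w) -> Ex X <= Ex Y.
Proof. by move=> iX iY XY; exact: le_Rintegral. Qed.

Lemma Ex_norm X : integ X -> `|Ex X| <= Ex (fun w => `|X w|).
Proof. by move=> iX; exact: le_normr_Rintegral. Qed.

Lemma expectationE X : integ X -> ('E_P[X] = (Ex X)%:E)%E.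
Proof.
move=> iX; rewrite /Ex /Rintegral fineK ?unlock//; exact: integrable_fin_num.
Qed.

Lemma Ex_fine X : Ex X = fine 'E_P[X].
Proof. by rewrite /Ex unlock. Qed.

Lemma Ex_indic A : measurable A -> Ex (\1_A) = fine (P A).
Proof. by move=> mA; rewrite Ex_fine expectation_indic. Qed.

Lemma integ_indic A : measurable A -> integ (\1_A).
Proof.
move=> mA; apply: (@integ_bounded 1) => [|w]; first exact: measurable_indic.
by rewrite indicE; case: (w \in A); rewrite ?normr1 ?normr0.
Qed.

Lemma Ex_dominated_cvg (X : nat -> T -> R) Y B :
  (forall n, measurable_fun setT (X n)) ->
  (forall w, X n w @[n --> \oo] --> Y w) -> integ B ->
  (forall n w, `|X n w| <= B w) ->
  integ Y /\ Ex (X n) @[n --> \oo] --> Ex Y.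
Proof.
move=> mX XY iB XB.
have mY : measurable_fun setT Y by apply: (measurable_fun_cvg mX) => w _; exact: XY.
have [|||||iY _ cY] := @dominated_convergence _ _ _ P setT measurableT
  (fun n w => (X n w)%:E) (EFin \o Y) (EFin \o B).
- by move=> n; exact/measurable_EFinP.
- exact/measurable_EFinP.
- by apply: aeW => w _; apply: cvg_EFin; [exact: nearW|exact: XY].
- exact: iB.
- by apply: aeW => w n _; rewrite lee_fin XB.
split=> //; apply: fine_cvg.
by rewrite /Rintegral fineK//; exact: integrable_fin_num.
Qed.

(** Integrability on the product is checked slice by slice: by Tonelli it is enough that the means
    of the absolute slices have an integrable bound [g]. Extending [f] by zero outside [D] brings
    the domain back to the full space. *)
Lemma Ex_Fubini {d'} {S : measurableType d'}
    (mu : {sigma_finite_measure set S -> \bar R})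
    (D : set S) (f : T -> S -> R) (g : S -> R) :
  measurable D -> measurable_fun setT (fun z : T * S => f z.1 z.2) ->
  (forall w, mu.-integrable D (EFin \o f w)) ->
  mu.-integrable D (EFin \o g) ->
  (forall x, D x -> integ (f ^~ x) /\ Ex (fun w => `|f w x|) <= g x) ->
  integ (fun w => \int[mu]_(x in D) f w x) /\
  Ex (fun w => \int[mu]_(x in D) f w x) = \int[mu]_(x in D) Ex (f ^~ x).
Proof.
move=> mD mf fi gi fx.
pose F (z : T * S) : \bar R := (f z.1 z.2 * \1_D z.2)%:E.
have mF : measurable_fun setT F.
  apply/measurable_EFinP; apply: measurable_funM => //.
  by apply: measurableT_comp; [exact: measurable_indic|exact: measurable_snd].
have FE w x : F (w, x) = (((EFin \o f w) \_ D) x)%E.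
  by rewrite /F /= /patch indicE; case: ifPn => xD; rewrite ?mulr1 ?mulr0.
have iFx x : P.-integrable setT (fun w => F (w, x)).
  rewrite /F /=; have [xD|xD] := boolP (x \in D).
    rewrite (_ : (fun w => _) = EFin \o f ^~ x); last first.
      by apply/funext => w /=; rewrite indicE xD mulr1.
    by have [] := fx _ (set_mem xD).
  rewrite (_ : (fun w => _) = cst 0%E); first exact: integrable0.
  by apply/funext => w /=; rewrite indicE (negbTE xD) mulr0.
have iF : (P \x mu)%E.-integrable setT F.
  apply/(integrable21ltyP P mu mF).
  apply: (@le_lt_trans _ _ (\int[mu]_(x in D) (g x)%:E)%E); last first.
    by have := integrable_fin_num mD gi; rewrite fin_numE -ltey => /andP[].
  rewrite [leRHS]integral_mkcond; apply: ge0_le_integral => //.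
  - by move=> x _; exact: integral_ge0.
  - have mF' : measurable_fun setT (abse \o F) by exact: measurableT_comp.
    exact: (@measurable_fun_fubini_tonelli_G _ _ T S R P (abse \o F) mF' (fun z => abse_ge0 _)).
  - by apply/(measurable_restrictT _ mD) => //; case/integrableP : gi.
  move=> x _; rewrite patchE; case: ifPn => xD.
    have [ifx le] := fx _ (set_mem xD).
    rewrite (_ : (\int[P]_w _)%E = (Ex (fun w => `|f w x|))%:E) ?lee_fin//.
    rewrite -expectationE; last exact: integ_norm.
    rewrite unlock; apply: eq_integral => w _.
    by rewrite FE patchE xD.
  rewrite integral0_eq// => w _.
  by rewrite FE patchE (negbTE xD) abse0.
have inE w : (\int[mu]_x F (w, x) = (\int[mu]_(x in D) f w x)%:E)%E.
  rewrite /Rintegral fineK; last exact: (integrable_fin_num mD (fi w)).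
  by rewrite [RHS]integral_mkcond; apply: eq_integral => x _.
have inE' x : (\int[P]_w F (w, x) = ((EFin \o (fun x => Ex (f ^~ x))) \_ D) x)%E.
  rewrite patchE; case: ifPn => xD; last first.
    by rewrite integral0_eq// => w _; rewrite FE patchE (negbTE xD).
  rewrite /= -expectationE; last by case: (fx _ (set_mem xD)).
  by rewrite unlock; apply: eq_integral => w _; rewrite FE patchE xD.
split.
  have := integrable_fubini_F iF; rewrite /integ /fubini_F.
  by congr (_.-integrable _ _); apply/funext => w /=.
have := Fubini iF.
under eq_integral do rewrite inE.
under [X in _ = X -> _]eq_integral do rewrite inE'.
by rewrite -integral_mkcond /Ex /Rintegral => ->.
Qed.

End expectation.

(** * Independence of the sigma-algebras generated by disjoint sets of indices *)

Section independence.
Context {d} {T : measurableType d} {R : realType} (P : probability T R).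
Context {I : eqType} (F : I -> set (set T)).

Definition sigma_of (A : pred I) : set (set T) :=
  <<s \bigcup_(i in [set` A]) F i >>.

(** The pi-system on which mutual independence speaks and which generates [sigma_of A]. *)
Definition finite_inters (A : pred I) : set (set T) :=
  [set X | exists J : seq I, exists E : I -> set T,
    [/\ uniq J, {subset J <= A}, forall i, F i (E i) &
     X = \big[setI/setT]_(i <- J) E i]].

Hypothesis FT : forall i, F i setT.
Hypothesis FI : forall i, setI_closed (F i).
Hypothesis mF : forall i, F i `<=` measurable.

Lemma bigsetI_seqP (J : seq I) (E : I -> set T) w :
  (\big[setI/setT]_(i <- J) E i) w <-> forall i, i \in J -> E i w.
Proof.
elim: J => [|k J IH]; first by rewrite big_nil; split.
rewrite big_cons; split => [[Ek /IH EJ] i|EJ].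
  by rewrite inE => /predU1P[->|/EJ].
split; first by apply: EJ; rewrite mem_head.
by apply/IH => i iJ; apply: EJ; rewrite inE iJ orbT.
Qed.

(** An index occurring in both lists receives the intersection of its two events, which stays in
    [F i] by [FI]; [undup] then restores uniqueness of the indices. *)
Lemma finite_inters_cat (A B : pred I) (X Y : set T) (J K : seq I) E E' :
  (forall i, F i (E i)) -> (forall i, F i (E' i)) -> uniq J -> uniq K ->
  exists E'', (forall i, F i (E'' i)) /\
    \big[setI/setT]_(i <- J) E i `&` \big[setI/setT]_(i <- K) E' i =
    \big[setI/setT]_(i <- undup (J ++ K)) E'' i.
Proof.
move=> FE FE' uJ uK.
exists (fun i => (if i \in J then E i else setT) `&`
                 (if i \in K then E' i else setT)); split.
  by move=> i; apply: FI; case: ifP.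
apply/seteqP; split => w /=.
  move=> [/bigsetI_seqP wJ /bigsetI_seqP wK]; apply/bigsetI_seqP => i.
  rewrite mem_undup mem_cat => iJK.
  by split; case: ifP => // ?; [exact: wJ|exact: wK].
move=> /bigsetI_seqP wJK; split; apply/bigsetI_seqP => i iJ.
  by have := wJK i; rewrite mem_undup mem_cat iJ => /(_ isT)[].
by have := wJK i; rewrite mem_undup mem_cat iJ orbT => /(_ isT)[].
Qed.

Lemma setI_closed_finite_inters (A : pred I) : setI_closed (finite_inters A).
Proof.
move=> X Y [J [E [uJ JA FE ->]]] [K [E' [uK KA FE' ->]]].
have [E'' [FE'' ->]] := finite_inters_cat A A X Y FE FE' uJ uK.
exists (undup (J ++ K)), E''; split; rewrite ?undup_uniq//.
by move=> i; rewrite mem_undup mem_cat => /orP[/JA|/KA].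
Qed.

Lemma finite_intersT A : finite_inters A setT.
Proof. by exists [::], (fun=> setT); split => //; rewrite big_nil. Qed.

Lemma finite_inters_measurable A : finite_inters A `<=` measurable.
Proof.
move=> _ [J [E [_ _ FE ->]]]; apply: bigsetI_measurable => i _.
exact: mF (FE i).
Qed.

Lemma sigma_of_finite_inters A : sigma_of A `<=` <<s finite_inters A >>.
Proof.
apply: sub_sigma_algebra2 => X [i /= Ai FX].
exists [:: i], (fun k => if k == i then X else setT); split => //.
- by move=> k; rewrite inE => /eqP ->.
- by move=> k; case: eqP => // ->.
- by rewrite big_seq1 eqxx.
Qed.

Lemma sigma_of_measurable A : sigma_of A `<=` measurable.
Proof.
apply: smallest_sub; first exact: sigma_algebra_measurable.
by move=> X [i _]; exact: mF.
Qed.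

Lemma sub_sigma_of (A B : pred I) : {subset A <= B} -> sigma_of A `<=` sigma_of B.
Proof.
by move=> AB; apply: sub_sigma_algebra2 => X [i /= Ai FX]; exists i => //=; exact: AB.
Qed.

(** Two finite measures that agree on a pi-system containing the whole space agree on the
    sigma-algebra it generates; here the trace of [P] on [Y] and the multiple of [P] by the number
    [P Y]. *)
Let extend (G : set (set T)) (Y : set T) : G `<=` measurable -> setI_closed G ->
  G setT -> measurable Y ->
  (forall X, G X -> P (X `&` Y) = (P X * P Y)%E) ->
  forall X, <<s G >> X -> P (X `&` Y) = (P X * P Y)%E.
Proof.
move=> mG GI GT mY GP X sX.
have P0 : 0 <= fine (P Y) by rewrite fine_ge0.
pose m2 := mscale (NngNum P0) P.
have m2E Z : m2 Z = (P Z * P Y)%E.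
  by rewrite /m2 /mscale /= fineK ?fin_num_measure// muleC.
rewrite -m2E.
apply: (@g_sigma_algebra_measure_unique _ _ _ G mG (fun=> setT) _ _
  (mrestr P mY) m2) => //.
- by apply/seteqP; split => // x _; exists 0%N.
- by move=> Z GZ; have := m2E Z; rewrite -GP// => <-.
- by move=> k; rewrite /mrestr ltey_eq fin_num_measure//; exact: measurableI.
Qed.

(** [extend] is used twice, once for each side, to reduce to finite intersections. Since [A] and [B]
    are disjoint, the two lists of indices can then be concatenated and mutual independence applies
    to a single list. *)
Lemma indep_sigma_of (A B : pred I) :
  mutually_indep P F -> (forall i, A i -> ~~ B i) ->
  forall X Y, sigma_of A X -> sigma_of B Y -> P (X `&` Y) = (P X * P Y)%E.
Proof.
move=> indF AB X Y sX sY.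
have mY := sigma_of_measurable sY.
apply: (extend (@finite_inters_measurable A) (@setI_closed_finite_inters A)
  (finite_intersT A)) => //; last exact: sigma_of_finite_inters.
move=> {X sX} X fX; have mX := finite_inters_measurable fX.
rewrite setIC muleC.
apply: (extend (@finite_inters_measurable B) (@setI_closed_finite_inters B)
  (finite_intersT B)) => //; last exact: sigma_of_finite_inters.
move=> {Y sY mY} Y [K [E' [uK KB FE' ->]]].
move: fX => [J [E [uJ JA FE EX]]].
rewrite {mX}EX.
pose E'' i := if i \in J then E i else E' i.
have FE'' i : F i (E'' i) by rewrite /E''; case: ifP.
have disj i : i \in K -> i \in J = false.
  by move=> iK; apply/negbTE/negP => /JA /AB /negP; apply; exact: KB.
have EJ : \big[setI/setT]_(i <- J) E i = \big[setI/setT]_(i <- J) E'' i.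
  by apply: eq_big_seq => i iJ; rewrite /E'' iJ.
have EK : \big[setI/setT]_(i <- K) E' i = \big[setI/setT]_(i <- K) E'' i.
  by apply: eq_big_seq => i iK; rewrite /E'' disj.
rewrite EJ EK -big_cat/= !indF//; last first.
  rewrite cat_uniq uJ uK andbT/=; apply/hasPn => i iK.
  by apply/negP => /disj; rewrite iK.
by rewrite big_cat/= EFinM.
Qed.

End independence.

Section product_expectation.
Context {d} {T : measurableType d} {R : realType} (P : probability T R).

Lemma Ex_same_law {d'} {V : measurableType d'} (X Y : T -> V) (f : V -> R) :
  measurable_fun setT X -> measurable_fun setT Y -> same_law P X Y ->
  measurable_fun setT f -> integ P (f \o X) ->
  integ P (f \o Y) /\ Ex P (f \o X) = Ex P (f \o Y).
Proof.
move=> mX mY XY mf iX.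
have eqm A : measurable A -> A `<=` setT -> pushforward P X A = pushforward P Y A.
  by move=> mA _; exact: XY.
have mf' : measurable_fun setT (EFin \o f) by exact/measurable_EFinP.
have iY : integ P (f \o Y).
  apply/integrableP; split; first exact/measurable_EFinP/measurableT_comp.
  have /integrableP[_] := iX.
  have := @ge0_integral_pushforward _ _ _ _ R _ mX P setT (abse \o (EFin \o f)) measurableT.
  have := @ge0_integral_pushforward _ _ _ _ R _ mY P setT (abse \o (EFin \o f)) measurableT.
  rewrite !preimage_setT => /= <- //; last exact: measurableT_comp.
  move=> <- //; last exact: measurableT_comp.
  apply: le_lt_trans; rewrite le_eqVlt; apply/orP; left; apply/eqP.
  by apply: eq_measure_integral => A mA sA; rewrite /= -eqm.
split=> //; rewrite /Ex /Rintegral; congr fine.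
have := @integral_pushforward _ _ _ _ R _ mX P setT (EFin \o f) mf'.
have := @integral_pushforward _ _ _ _ R _ mY P setT (EFin \o f) mf'.
rewrite !preimage_setT => /= <- // <- //.
by apply: eq_measure_integral => A mA sA; rewrite /= -eqm.
Qed.

(** The joint law of [X] and [Y] coincides with the product of the marginal laws on rectangles,
    hence everywhere; the mean of the product is then an iterated integral. *)
Lemma Ex_indep (X Y : T -> R) :
  (forall A B, measurable A -> measurable B ->
    P (X @^-1` A `&` Y @^-1` B) = (P (X @^-1` A) * P (Y @^-1` B))%E) ->
  integ P X -> integ P Y ->
  integ P (fun w => X w * Y w) /\ Ex P (fun w => X w * Y w) = Ex P X * Ex P Y.
Proof.
move=> ind iX iY.
have mX := integ_measurable iX; have mY := integ_measurable iY.
have [m1 m1E] : exists m1 : probability R R, forall A, m1 A = P (X @^-1` A).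
  pose X' : {RV P >-> R} := HB.pack X (isMeasurableFun.Build _ _ _ _ X mX).
  by exists (distribution P X').
have [m2 m2E] : exists m2 : probability R R, forall A, m2 A = P (Y @^-1` A).
  pose Y' : {RV P >-> R} := HB.pack Y (isMeasurableFun.Build _ _ _ _ Y mY).
  by exists (distribution P Y').
pose XY w := (X w, Y w).
have mXY : measurable_fun setT XY by exact: measurable_fun_pair.
have int1 (g : R -> R) (U : T -> R) (m : probability R R) :
    (forall A, m A = P (U @^-1` A)) -> measurable_fun setT U ->
    measurable_fun setT g -> integ P (g \o U) ->
    m.-integrable setT (EFin \o g) /\ (\int[m]_x (g x)%:E = (Ex P (g \o U))%:E)%E.
  move=> mE mU mg iU.
  have mg' : measurable_fun setT (EFin \o g) by exact/measurable_EFinP.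
  have E A : measurable A -> A `<=` setT -> m A = pushforward P U A by move=> *; rewrite mE.
  split.
    have /integrableP[_ fin] := @integrable_pushforward _ _ _ _ R _ mU P setT _ mg' iU measurableT.
    apply/integrableP; split => //.
    by rewrite (eq_measure_integral (pushforward P U)).
  rewrite (eq_measure_integral (pushforward P U)) => [|A mA sA]; last exact: E.
  rewrite integral_pushforward// -expectationE// unlock.
  by apply: eq_integral.
have prodE : forall Z, measurable Z -> (m1 \x m2)%E Z = pushforward P XY Z.
  apply: product_measure_unique => A B mA mB.
  have := ind _ _ mA mB; rewrite -(m1E A) -(m2E B) => <-.
  by [].
pose f (z : R * R) : R := z.1 * z.2.
have mf : measurable_fun setT f by exact: measurable_funM.
have mf' : measurable_fun setT (EFin \o f) by exact/measurable_EFinP.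
have i1 := @int1 idfun _ _ m1E mX (@measurable_id _ _ _) iX.
have i2 := @int1 idfun _ _ m2E mY (@measurable_id _ _ _) iY.
have i1' := @int1 Num.norm _ _ m1E mX (@normr_measurable _ _) (integ_norm iX).
have i2' := @int1 Num.norm _ _ m2E mY (@normr_measurable _ _) (integ_norm iY).
have if_ : (m1 \x m2)%E.-integrable setT (EFin \o f).
  apply/integrable12ltyP => //.
  have inner x : (\int[m2]_y `|(EFin \o f) (x, y)| =
      (Ex P (Num.norm \o Y))%:E * `|x|%:E)%E.
    rewrite -i2'.2 muleC -integralZl//; last exact: i2'.1.
    by apply: eq_integral => y _ /=; rewrite -EFinM -normrM.
  under eq_integral do rewrite inner.
  rewrite integralZl//; last exact: i1'.1.
  by rewrite i1'.2 -EFinM ltry.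
have iXY : integ P (fun w => X w * Y w).
  apply/integrableP; split; first exact/measurable_EFinP/measurable_funM.
  have /integrableP[_] := if_.
  rewrite (eq_measure_integral (pushforward P XY)) => [|A mA sA]; last exact: prodE.
  by rewrite ge0_integral_pushforward//; exact: measurableT_comp.
split=> //; apply: EFin_inj.
rewrite -expectationE// unlock.
have := @integral_pushforward _ _ _ _ R _ mXY P setT (EFin \o f) mf'.
rewrite preimage_setT => /= <- //.
transitivity (\int[m1 \x m2]_z (EFin \o f) z)%E.
  by apply: eq_measure_integral => A mA _; exact/esym/prodE.
rewrite -integral12_prod_meas1// /fubini_F /=.
have inner x : (\int[m2]_y (EFin \o f) (x, y) = (Ex P Y)%:E * x%:E)%E.
  have -> : Ex P Y = Ex P (idfun \o Y) by [].
  rewrite -i2.2 muleC -integralZl//; exact: i2.1.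
under eq_integral do rewrite inner.
rewrite integralZl//; last exact: i1.1.
by rewrite i1.2 EFinM muleC.
Qed.

End product_expectation.

(** * Levy's continuity theorem *)
Section multivariate_bernstein.
Context {R : realType} {I : eqType}.
Implicit Types (l : seq I) (t : I -> R) (h : (I -> nat) -> R).

(* The expectation of [h] at the vector counting the successes, of each type,
   in independent trials: one trial of type [i], successful with probability
   [t i], for each occurrence of [i] in [l]. *)
Fixpoint bernstein l t h : R :=
  if l is i :: l' then
    t i * bernstein l' t (fun k => h (fun i' => ((i' == i) + k i')%N)) +
    (1 - t i) * bernstein l' t h
  else h (fun=> 0%N).

Lemma le_bernstein l t h1 h2 : (forall i, 0 <= t i <= 1) ->
  (forall k, h1 k <= h2 k) -> bernstein l t h1 <= bernstein l t h2.
Proof.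
move=> t01; elim: l h1 h2 => [|i l IH] h1 h2 h12 /=; first exact: h12.
have /andP[t0 t1] := t01 i.
by apply: lerD; apply: ler_wpM2l; rewrite ?subr_ge0//; apply: IH.
Qed.

Lemma bernstein_lin l t a b h1 h2 :
  bernstein l t (fun k => a * h1 k + b * h2 k) =
  a * bernstein l t h1 + b * bernstein l t h2.
Proof.
elim: l h1 h2 => [//|i l IH] h1 h2 /=; rewrite !IH; ring.
Qed.

Lemma bernsteinD l t h1 h2 :
  bernstein l t (fun k => h1 k + h2 k) = bernstein l t h1 + bernstein l t h2.
Proof.
rewrite -[RHS]mul1r mulrDr -bernstein_lin; congr bernstein.
by apply/funext => k; rewrite !mul1r.
Qed.

Lemma bernstein_cst l t a : bernstein l t (fun=> a) = a.
Proof. by elim: l => [//|i l /= ->]; ring. Qed.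

Lemma bernstein_sum (J : Type) (r : seq J) l t (h : J -> (I -> nat) -> R) :
  bernstein l t (fun k => \sum_(x <- r) h x k) =
  \sum_(x <- r) bernstein l t (h x).
Proof.
elim: r => [|x r IH].
  rewrite big_nil -[RHS](bernstein_cst l t); congr bernstein.
  by apply/funext => k; rewrite big_nil.
rewrite big_cons -IH -[X in X + _]mul1r -[X in _ + X]mul1r -bernstein_lin.
by congr bernstein; apply/funext => k; rewrite big_cons !mul1r.
Qed.

(** The right-hand side is the squared mean plus the variance of a shifted binomial variable. The
    free shift [a] carries the induction: a success of type [i] turns [a] into [a + 1]. *)
Lemma bernstein_variance l t i a :
  bernstein l t (fun k => ((k i)%:R + a) ^+ 2) =
  ((count_mem i l)%:R * t i + a) ^+ 2 + (count_mem i l)%:R * (t i * (1 - t i)).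
Proof.
elim: l a => [|i' l IH] a /=; first by rewrite !mul0r addr0.
have -> : (fun k : I -> nat => (((i == i') + k i)%N%:R + a) ^+ 2) =
          (fun k => ((k i)%:R + ((i == i')%:R + a)) ^+ 2).
  by apply/funext => k; rewrite natrD; congr (_ ^+ 2); ring.
rewrite !IH eq_sym natrD; case: eqP => [->|_] /=; ring.
Qed.

End multivariate_bernstein.

(** * Approximation of bounded functions by trigonometric polynomials *)

Section trigonometric_approximation.
Context {R : realType} {I : finType}.
Implicit Types (p q g : (I -> R) -> R) (th : I -> R).

Definition lincomb th (y : I -> R) : R := \sum_i th i * y i.

(** The linear span of cosines of affine forms: the functions whose means are determined by
    characteristic functions. The free phase [b] makes sines members as well. *)
Inductive trigpoly : ((I -> R) -> R) -> Prop :=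
| trigpoly_cos th b : trigpoly (fun y => cos (lincomb th y + b))
| trigpoly_lin a c p q : trigpoly p -> trigpoly q ->
    trigpoly (fun y => a * p y + c * q y).

Lemma trigpoly_cst a : trigpoly (fun=> a).
Proof.
have := trigpoly_lin a 0 (trigpoly_cos (fun=> 0) 0) (trigpoly_cos (fun=> 0) 0).
congr trigpoly; apply/funext => y.
rewrite /lincomb big1 => [|i _]; last by rewrite mul0r.
by rewrite addr0 cos0; ring.
Qed.

(** Product-to-sum formula. The product of a sine and a cosine is a half-sum of sines, and the
    phases [- pi / 2] and [+ pi / 2] turn these into cosines, the only generators. *)
Lemma trigpoly_mulsin p i om : trigpoly p ->
  trigpoly (fun y => sin (om * y i) * p y).
Proof.
elim => [th b|a c p1 p2 _ IH1 _ IH2]; last first.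
  have := trigpoly_lin a c IH1 IH2; congr trigpoly; apply/funext => y; ring.
pose th' s i' := th i' + (i' == i)%:R * (s * om).
have th'E s y : lincomb (th' s) y = lincomb th y + s * (om * y i).
  rewrite /lincomb /th'; under eq_bigr do rewrite mulrDl.
  rewrite big_split/=; congr (_ + _).
  rewrite (bigD1 i)//= eqxx big1 => [|k /negbTE ->]; last by rewrite !mul0r.
  by rewrite addr0 mul1r mulrA.
have := trigpoly_lin (2^-1) (2^-1) (trigpoly_cos (th' 1) (b - pi / 2))
  (trigpoly_cos (th' (-1)) (b + pi / 2)).
congr trigpoly; apply/funext => y; rewrite !th'E.
set u := lincomb th y; set x := om * y i.
have -> : u + 1 * x + (b - pi / 2) = (u + b + x) - pi / 2 by ring.
have -> : u + -1 * x + (b + pi / 2) = (u + b - x) + pi / 2 by ring.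
by rewrite cosBpihalf cosDpihalf sinD sinB; field.
Qed.

Lemma trigpoly_bernstein l om h :
  trigpoly (fun y => bernstein l (fun i => (1 + sin (om * y i)) / 2) h).
Proof.
elim: l h => [|i l IH] h /=; first exact: trigpoly_cst.
pose h' (k : I -> nat) := h (fun i' => ((i' == i) + k i')%N).
have := trigpoly_lin 1 1
  (trigpoly_lin (2^-1) (2^-1) (IH h') (trigpoly_mulsin i om (IH h')))
  (trigpoly_lin (2^-1) (- 2^-1) (IH h) (trigpoly_mulsin i om (IH h))).
by congr trigpoly; apply/funext => y; field.
Qed.

Lemma trigpoly_bounded p : trigpoly p -> exists M, forall y, `|p y| <= M.
Proof.
elim => [th b|a c p1 p2 _ [M1 H1] _ [M2 H2]].
  by exists 1 => y; rewrite ler_norml cos_geN1 cos_le1.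
exists (`|a| * M1 + `|c| * M2) => y.
by rewrite (le_trans (ler_normD _ _))// !normrM lerD// ler_wpM2l.
Qed.

(** What compactness gives for a continuous function of finitely many real variables, stated
    coordinatewise so that functions on [I -> R] can be handled without a topology. *)
Definition box_unif_continuous g := forall K e : R, 0 < e ->
  exists2 dl : R, 0 < dl & forall x y : I -> R,
    (forall i, `|x i| <= K) -> (forall i, `|y i| <= K) ->
    (forall i, `|x i - y i| < dl) -> `|g x - g y| <= e.

(* A Lipschitz left inverse of [sin] on [-1, 1]. *)
Definition arc (x : R) : R := asin (Num.max (- sin 1) (Num.min x (sin 1))).

Lemma sin1_itv : 0 < sin (1 : R) < 1.
Proof.
have h := @pihalf_ge1 R; have s0 : 0 < sin (1 : R).
  by apply: sin_gt0_pi; rewrite ltr01/=; have := @pi_ge2 R; lra.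
rewrite s0/= -(@expr_lt1 _ 2)//; last exact: ltW.
have := cos2Dsin2 (1 : R); have := @cos1_gt0 R.
by move=> c0; nra.
Qed.

Let lt_sin (x y : R) : - (pi / 2) <= x -> x < y -> y <= pi / 2 -> sin x < sin y.
Proof. by move=> x1 xy y1; rewrite ltr_sin ?in_itv//=; lra. Qed.

Let sin_itv1 (x : R) : -1 <= x <= 1 -> - sin 1 <= sin x <= sin 1.
Proof.
have h := @pihalf_ge1 R; move=> /andP[x1 x2]; rewrite -sinN.
move: x1 x2; rewrite le_eqVlt => /predU1P[<-|x1].
  by move=> _; rewrite lexx/= ltW// lt_sin//; lra.
rewrite le_eqVlt => /predU1P[->|x2]; first by rewrite lexx andbT ltW// lt_sin//; lra.
by rewrite !ltW//; apply: lt_sin => //; lra.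
Qed.

Lemma arc_sin x : -1 <= x <= 1 -> arc (sin x) = x.
Proof.
move=> x1; rewrite /arc; have /andP[h1 h2] := sin_itv1 x1.
rewrite min_l// max_r// sinK// in_itv/=.
by have := @pihalf_ge1 R; lra.
Qed.

Let arcE x : exists2 a : R, -1 <= a <= 1 &
  arc x = a /\ sin a = Num.max (- sin 1) (Num.min x (sin 1)).
Proof.
have /andP[s0 s1] := sin1_itv.
pose c : R := Num.max (- sin 1) (Num.min x (sin 1)).
rewrite -/c.
have /andP[c1 c2] : - sin 1 <= c <= sin 1.
  by rewrite le_max lexx ge_max ge_min lexx orbT andbT; lra.
have c11 : -1 <= c <= 1 by lra.
have h := @pihalf_ge1 R.
have e : sin (asin c) = c by rewrite asinK// in_itv.
exists (asin c) => //.
have /andP[ac1 ac2] : - (pi / 2) <= asin c <= pi / 2 by rewrite asin_geNpi2// asin_lepi2.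
apply/andP; split; rewrite leNgt; apply/negP => lt.
  have : sin (asin c) < sin (-1) by apply: lt_sin => //; lra.
  by rewrite e sinN ltNge c1.
have : sin 1 < sin (asin c) by apply: lt_sin => //; lra.
by rewrite e ltNge c2.
Qed.

Lemma arc_le1 x : `|arc x| <= 1.
Proof. by have [a a1 [-> _]] := arcE x; rewrite ler_norml. Qed.

(** On [[-1, 1]] the derivative of [sin] is at least [cos 1], and clamping to [[- sin 1, sin 1]]
    does not increase distances. *)
Lemma arc_lipschitz (x y : R) : cos 1 * `|arc x - arc y| <= `|x - y|.
Proof.
wlog xy : x y / arc x < arc y => [hw|].
  have [/hw//|/hw|->] := ltgtP (arc x) (arc y); last by rewrite subrr normr0 mulr0.
  by rewrite distrC (distrC y).
have [a /andP[a1 a2] [ax sa]] := arcE x; have [b /andP[b1 b2] [bx sb]] := arcE y.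
rewrite ax bx in xy *.
have dsin z : z \in `]a, b[%R -> is_derive z 1 sin (cos z).
  by move=> _; exact: is_derive_sin.
have csin : {within `[a, b], continuous (@sin R)}.
  by apply: continuous_subspaceT => z; exact: continuous_sin.
have [c cab E] := MVT xy dsin csin.
have c1 : cos 1 <= cos c.
  have h := @pihalf_ge1 R; have := @pi_ge2 R; move=> p2.
  move: cab; rewrite in_itv/= => /andP[ac cb].
  have : `|c| < 1 by rewrite ltr_norml; lra.
  have -> : cos c = cos `|c|.
    by case: (lerP 0 c) => c0; rewrite ?(ger0_norm c0)// (ltr0_norm c0) cosN.
  move=> nc; rewrite ltW// ltr_cos ?in_itv/= ?normr_ge0//; lra.
rewrite distrC ger0_norm ?subr_ge0 ?(ltW xy)//.
apply: (@le_trans _ _ (sin b - sin a)).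
  by rewrite E ler_wpM2r// subr_ge0 ltW.
have : sin a < sin b by apply: lt_sin => //; have := @pihalf_ge1 R; lra.
rewrite sa sb distrC.
have /andP[s0 s1] := sin1_itv.
move=> lt; apply: (le_trans _ (ler_norm _)).
apply: lerB.
  have : - sin 1 < Num.max (- sin 1) (Num.min y (sin 1)).
    by apply: le_lt_trans lt; rewrite le_max lexx.
  rewrite lt_max ltxx/= lt_min => /andP[h _].
  by rewrite ge_max (ltW h) ge_min lexx.
have : Num.max (- sin 1) (Num.min x (sin 1)) < sin 1.
  apply: lt_le_trans lt _; rewrite ge_max ge_min lexx orbT andbT.
  by have /andP[] := sin1_itv; lra.
rewrite gt_max gt_min ltxx orbF => /andP[_ h].
by rewrite le_max le_min lexx (ltW h) orbT.
Qed.

(** A Bernstein polynomial of [g] in the variables [(1 + sin (y i / K)) / 2]. These lie in [[0, 1]]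
    for every [y] and determine [y] through [arc] on the box of radius [K]. As an average of values
    of [g], the polynomial keeps the bound [M] outside the box too, where nothing is known about its
    closeness to [g]. *)
Lemma trig_approx g M K e : box_unif_continuous g ->
  (forall y, `|g y| <= M) -> 0 < K -> 0 < e ->
  exists p, [/\ trigpoly p, forall y, `|p y| <= M &
    forall y, (forall i, `|y i| <= K) -> `|p y - g y| <= e].
Proof.
move=> ucg gM K0 e0.
have M0 : 0 <= M by exact: le_trans (gM (fun=> 0)).
have e20 : 0 < e / 2 by rewrite divr_gt0.
have [dl dl0 Hdl] := ucg K _ e20.
have c0 := @cos1_gt0 R.
(* If all frequencies of success are within [eta] of their means, [arc_lipschitz] moves each
   coordinate by less than [2 * K * eta / cos 1 = dl]. *)
pose eta : R := dl * cos 1 / (2 * K).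
have eta0 : 0 < eta by rewrite /eta divr_gt0 ?mulr_gt0.
pose C : R := 2 * M / eta ^+ 2 * #|I|%:R.
have coef0 : 0 <= 2 * M / eta ^+ 2.
  by apply: divr_ge0; [exact: mulr_ge0|exact: sqr_ge0].
have C0 : 0 <= C by rewrite /C !(mulr_ge0, invr_ge0, exprn_ge0)// ltW.
pose N := (Num.truncn (2 * C / e)).+1.
have CN : C / N%:R <= e / 2.
  rewrite ler_pdivrMr ?ltr0n// -ler_pdivrMl// mulrC invf_div mulrA.
  by rewrite (mulrC C) ltW// truncnS_gt.
pose l := flatten (nseq N (enum I)).
have cl i : count_mem i l = N.
  rewrite /l; elim: (N) => [//|n IH] /=.
  by rewrite count_cat IH count_uniq_mem ?enum_uniq// mem_enum.
pose h (k : I -> nat) : R := g (fun i => K * arc (2 * ((k i)%:R / N%:R) - 1)).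
pose tt (y : I -> R) i : R := (1 + sin (K^-1 * y i)) / 2.
have tt01 (y : I -> R) i : 0 <= tt y i <= 1.
  by rewrite /tt; have := sin_geN1 (K^-1 * y i); have := sin_le1 (K^-1 * y i); lra.
exists (fun y => bernstein l (tt y) h); split.
- exact: trigpoly_bernstein.
- move=> y; rewrite ler_norml; apply/andP; split.
    rewrite -[leLHS](bernstein_cst l (tt y)); apply: le_bernstein => // k.
    by have := gM (fun i => K * arc (2 * ((k i)%:R / N%:R) - 1)); rewrite ler_norml => /andP[].
  rewrite -[leRHS](bernstein_cst l (tt y)); apply: le_bernstein => // k.
  exact: le_trans (ler_norm _) (gM _).
move=> y yK.
have yE i : y i = K * arc (2 * tt y i - 1).
  have -> : 2 * tt y i - 1 = sin (K^-1 * y i) by rewrite /tt; field.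
  rewrite arc_sin ?mulVKf ?gt_eqF//.
  rewrite -ler_norml normrM gtr0_norm ?invr_gt0// ler_pdivrMl// mulr1; exact: yK.
(* Chebyshev: if some frequency is off by at least [eta], the trivial bound [2 * M] is at most the
   second term. The number [N] of trials of each type makes the mean of that term at most
   [e / 2]. *)
pose dev (k : I -> nat) : R :=
  e / 2 + 2 * M / eta ^+ 2 * \sum_i ((k i)%:R / N%:R - tt y i) ^+ 2.
have hk k : `|h k - g y| <= dev k.
  have [near|] := boolP [forall i, `|(k i)%:R / N%:R - tt y i| < eta].
    apply: (@le_trans _ _ (e / 2)); last first.
      rewrite /dev lerDl; apply: mulr_ge0; first by [].
      by apply: sumr_ge0 => i _; exact: sqr_ge0.
    apply: Hdl => // i.
      by rewrite normrM gtr0_norm//; apply: ler_piMr; [exact: ltW|exact: arc_le1].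
    rewrite [in X in _ - X]yE -mulrBr normrM gtr0_norm//.
    set u := (k i)%:R / N%:R.
    have := arc_lipschitz (2 * u - 1) (2 * tt y i - 1).
    have -> : 2 * u - 1 - (2 * tt y i - 1) = 2 * (u - tt y i) by ring.
    rewrite normrM ger0_norm// => L.
    have /forallP/(_ i) := near; rewrite -/u => nu.
    rewrite -(ltr_pM2l c0) mulrCA.
    apply: (@le_lt_trans _ _ (K * (2 * `|u - tt y i|))); first by rewrite ler_wpM2l// ltW.
    move: nu; rewrite /eta ltr_pdivlMr ?mulr_gt0// => nu; lra.
  move=> /forallPn[i]; rewrite -leNgt => etai.
  rewrite /dev; apply: (@le_trans _ _ (2 * M)).
    by rewrite (le_trans (ler_normB _ _))// mulr_natl mulr2n lerD// gM.
  apply: (@le_trans _ _ (2 * M / eta ^+ 2 * ((k i)%:R / N%:R - tt y i) ^+ 2)).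
    rewrite mulrAC ler_pdivlMr ?exprn_gt0// ler_wpM2l ?mulr_ge0//.
    by rewrite -[leRHS]real_normK ?num_real// lerXn2r// ?nnegrE// ltW.
  rewrite -[leLHS]add0r lerD ?(ltW e20)//; apply: ler_wpM2l => //.
  rewrite (bigD1 i)//= lerDl; apply: sumr_ge0 => k' _; exact: sqr_ge0.
have bdev : bernstein l (tt y) dev <= e.
  have -> : dev = (fun k => 1 * (e / 2) + (2 * M / eta ^+ 2) *
      \sum_i ((k i)%:R / N%:R - tt y i) ^+ 2).
    by apply/funext => k; rewrite mul1r.
  rewrite (bernstein_lin _ _ _ _ (fun=> e / 2)) bernstein_cst bernstein_sum mul1r.
  rewrite [leRHS](splitr e) lerD2l.
  apply: (@le_trans _ _ (2 * M / eta ^+ 2 * \sum_(i : I) N%:R^-1)); last first.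
    by rewrite sumr_const -[X in _ * X]mulr_natl mulrA; exact: CN.
  apply: ler_wpM2l => //.
  apply: ler_sum => i _.
  have -> : (fun k : I -> nat => ((k i)%:R / N%:R - tt y i) ^+ 2) =
    (fun k => (N%:R^-1) ^+ 2 * ((k i)%:R + (- (N%:R * tt y i))) ^+ 2 + 0 * 0 :> R).
    apply/funext => k; rewrite mulr0 addr0 -exprMn mulrDr; congr (_ ^+ 2).
    by rewrite mulrN mulKf ?pnatr_eq0// mulrC.
  rewrite (bernstein_lin _ _ _ _ _ (fun=> 0)) mul0r addr0 bernstein_variance cl.
  rewrite subrr expr0n/= add0r.
  rewrite expr2 -mulrA mulKf ?pnatr_eq0// ler_piMr ?invr_ge0//.
  by have := tt01 y i; nra.
have tt01y := tt01 y.
rewrite ler_norml; apply/andP; split.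
  rewrite lerBrDr addrC lerBlDr -[g y](bernstein_cst l (tt y)).
  apply: (le_trans _ (lerD (lexx _) bdev)).
  rewrite -bernsteinD; apply: le_bernstein => // k.
  by have := hk k; rewrite ler_norml => /andP[]; lra.
rewrite lerBlDr addrC -[g y](bernstein_cst l (tt y)).
apply: (le_trans _ (lerD (lexx _) bdev)).
rewrite -bernsteinD; apply: le_bernstein => // k.
by have := hk k; rewrite ler_norml => /andP[]; lra.
Qed.

End trigonometric_approximation.

(** * From characteristic functions to bounded continuous functions *)

Section levy_continuity.
Context {R : realType} {I : finType}.

Lemma trigpoly_measurable {d} {T : measurableType d} (Y : I -> T -> R) p :
  (forall i, measurable_fun setT (Y i)) -> trigpoly p ->
  measurable_fun setT (fun w => p (Y ^~ w)).
Proof.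
move=> mY; elim => [th b|a c p1 p2 _ m1 _ m2].
  apply: measurableT_comp; first exact: continuous_measurable_fun (@continuous_cos R).
  apply: measurable_funD => //; apply: measurable_sum => i.
  exact: measurable_funM.
by apply: measurable_funD; apply: measurable_funM.
Qed.

Lemma trigpoly_integ {d} {T : measurableType d} (P : probability T R)
    (Y : I -> T -> R) p :
  (forall i, measurable_fun setT (Y i)) -> trigpoly p ->
  integ P (fun w => p (Y ^~ w)).
Proof.
move=> mY tp; have [M pM] := trigpoly_bounded tp.
by apply: (@integ_bounded _ _ _ _ M) => //; exact: trigpoly_measurable.
Qed.

(** A pointwise limit of trigonometric polynomials: the [m]-th is within [1 / (m + 1)] of [g] on the
    box of radius [m + 1], and every point lies in these boxes from some [m] on. *)
Lemma box_unif_continuous_measurable {d} {T : measurableType d}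
    (Y : I -> T -> R) (g : (I -> R) -> R) M :
  (forall i, measurable_fun setT (Y i)) -> box_unif_continuous g ->
  (forall y, `|g y| <= M) -> measurable_fun setT (fun w => g (Y ^~ w)).
Proof.
move=> mY ucg gM.
have /choice[p Hp] : forall m : nat, exists p, trigpoly p /\
    forall y, (forall i, `|y i| <= m.+1%:R) -> `|p y - g y| <= m.+1%:R^-1.
  move=> m; have [//|//|p [tp _ Hp]] := trig_approx ucg gM (K := m.+1%:R) (e := m.+1%:R^-1).
  by exists p.
apply: (@measurable_fun_cvg _ _ _ _ (fun m w => p m (Y ^~ w))) => [m|w _].
  by apply: trigpoly_measurable => //; case: (Hp m).
apply/cvgrPdist_le => e e0.
pose B : R := \sum_i `|Y i w|.
have BY i : `|Y i w| <= B.
  rewrite /B (bigD1 i)//= lerDl; exact: sumr_ge0.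
exists (Num.truncn (Num.max B e^-1)) => // m /= km.
have mB : Num.max B e^-1 <= m.+1%:R.
  apply: ltW; apply: lt_le_trans (truncnS_gt _) _; by rewrite ler_nat.
rewrite distrC; apply: le_trans ((Hp m).2 _ _) _.
  by move=> i; apply: le_trans (BY i) _; apply: le_trans mB; rewrite le_max lexx.
rewrite invf_ple ?posrE//; apply: le_trans mB; by rewrite le_max lexx orbT.
Qed.

(** Tightness of one variable in terms of [E[min(1, |Z| / K)]], which decreases in [K], so that one
    good value gives all larger ones. *)
Lemma tightness1 {d} {T : measurableType d} (P : probability T R) (Z : T -> R) (e : R) :
  measurable_fun setT Z -> 0 < e ->
  exists K0, forall K, K0 <= K -> Ex P (fun w => Num.min 1 (`|Z w| / K)) <= e.
Proof.
move=> mZ e0.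
pose X (n : nat) w : R := Num.min 1 (`|Z w| / n.+1%:R).
have X01 n w : 0 <= X n w <= 1.
  by rewrite /X le_min ler01 divr_ge0//= ge_min lexx.
have mX n : measurable_fun setT (X n).
  apply: measurable_minr => //; apply: measurable_funM => //.
  exact: measurableT_comp.
have [w|||_ cX] := @Ex_dominated_cvg _ _ _ P X (fun=> 0) (fun=> 1) mX.
- apply/cvgrPdist_le => e1 e10; exists (Num.truncn (`|Z w| / e1)) => // m /= km.
  rewrite sub0r normrN ger0_norm; last by case/andP: (X01 m w).
  rewrite /X ge_min ler_pdivrMr// mulrC -ler_pdivrMr//; apply/orP; right.
  by apply: ltW; apply: lt_le_trans (truncnS_gt _) _; rewrite ler_nat.
- exact: integ_cst.
- by move=> n w; rewrite ger0_norm; case/andP: (X01 n w).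
rewrite Ex_cst in cX.
have /cvgrPdist_le/(_ _ e0)[N _ HN] := cX.
exists N.+1%:R => K NK; apply: le_trans (_ : Ex P (X N) <= e); last first.
  by have := HN N (leqnn N); rewrite sub0r normrN; apply: le_trans; exact: ler_norm.
have K0 : 0 < K by apply: lt_le_trans NK.
apply: le_Ex => [||w].
- apply: (@integ_bounded _ _ _ _ 1) => [|w].
    by apply: measurable_minr => //; apply: measurable_funM => //; exact: measurableT_comp.
  by rewrite ger0_norm ?ge_min ?lexx// le_min ler01 divr_ge0// ltW.
- by apply: (@integ_bounded _ _ _ _ 1) => // w; rewrite ger0_norm; case/andP: (X01 N w).
by rewrite le_min !ge_min lexx/= ler_wpM2l ?orbT// lef_pV2// posrE.
Qed.

Lemma Ex_cosD {d} {T : measurableType d} (P : probability T R) (X : T -> R) b :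
  measurable_fun setT X ->
  Ex P (fun w => cos (X w + b)) =
  cos b * Ex P (fun w => cos (X w)) - sin b * Ex P (fun w => sin (X w)).
Proof.
move=> mX.
have ic : integ P (fun w => cos (X w)).
  apply: (@integ_bounded _ _ _ _ 1) => [|w]; last by rewrite ler_norml cos_geN1 cos_le1.
  by apply: measurableT_comp => //; exact: continuous_measurable_fun (@continuous_cos R).
have isn : integ P (fun w => sin (X w)).
  apply: (@integ_bounded _ _ _ _ 1) => [|w]; last by rewrite ler_norml sin_geN1 sin_le1.
  by apply: measurableT_comp => //; exact: continuous_measurable_fun (@continuous_sin R).
under eq_Ex do rewrite cosD mulrC (mulrC (sin _)).
by rewrite ExB ?ExZ//; exact: integZ.
Qed.

Context {d1} {T1 : measurableType d1} (P1 : probability T1 R).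
Context {d2} {T2 : measurableType d2} (P2 : probability T2 R).

(** Convergence of characteristic functions passes to trigonometric polynomials by linearity, and
    [g] is replaced by such a polynomial on both sides. Tightness of [Y] is a hypothesis instead of
    a consequence of the continuity of the limit at 0: for shot sums it is available directly from
    the mean-square estimate. *)
Theorem levy_continuity (Y : nat -> I -> T1 -> R) (Z : I -> T2 -> R) g M :
  (forall n i, measurable_fun setT (Y n i)) ->
  (forall i, measurable_fun setT (Z i)) ->
  (forall th, Ex P1 (fun w => cos (lincomb th (Y n ^~ w))) @[n --> \oo] -->
              Ex P2 (fun w => cos (lincomb th (Z ^~ w)))) ->
  (forall th, Ex P1 (fun w => sin (lincomb th (Y n ^~ w))) @[n --> \oo] -->
              Ex P2 (fun w => sin (lincomb th (Z ^~ w)))) ->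
  (forall i (e : R), 0 < e -> exists K0, forall K, K0 <= K -> \forall n \near \oo,
     Ex P1 (fun w => Num.min 1 (`|Y n i w| / K)) <= e) ->
  box_unif_continuous g -> (forall y, `|g y| <= M) ->
  Ex P1 (fun w => g (Y n ^~ w)) @[n --> \oo] --> Ex P2 (fun w => g (Z ^~ w)).
Proof.
move=> mY mZ cosY sinY tY ucg gM.
have M0 : 0 <= M by exact: le_trans (gM (fun=> 0)).
have mlin d0 (T : measurableType d0) (U : I -> T -> R) th :
    (forall i, measurable_fun setT (U i)) ->
    measurable_fun setT (fun w => lincomb th (U ^~ w)).
  by move=> mU; apply: measurable_sum => i; exact: measurable_funM.
have cvgp p : trigpoly p ->
    Ex P1 (fun w => p (Y n ^~ w)) @[n --> \oo] --> Ex P2 (fun w => p (Z ^~ w)).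
  elim => [th b|a c p1 p2 t1 c1 t2 c2].
    rewrite Ex_cosD; last exact: mlin.
    under eq_fun do (rewrite Ex_cosD; last exact: mlin).
    exact: (cvgB (cvgM (cvg_cst _) (cosY th)) (cvgM (cvg_cst _) (sinY th))).
  have E d0 (T : measurableType d0) (P : probability T R) (U : I -> T -> R) :
      (forall i, measurable_fun setT (U i)) ->
      Ex P (fun w => a * p1 (U ^~ w) + c * p2 (U ^~ w)) =
      a * Ex P (fun w => p1 (U ^~ w)) + c * Ex P (fun w => p2 (U ^~ w)).
    move=> mU; have i1 := trigpoly_integ P mU t1; have i2 := trigpoly_integ P mU t2.
    by rewrite ExD ?ExZ//; exact: integZ.
  rewrite (E _ _ _ _ mZ); under eq_fun do rewrite (E _ _ _ _ (mY _)).
  exact: (cvgD (cvgM (cvg_cst _) c1) (cvgM (cvg_cst _) c2)).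
have ming d0 (T : measurableType d0) (P : probability T R) (V : T -> R) (K : R) :
    0 < K -> measurable_fun setT V -> integ P (fun w => Num.min 1 (`|V w| / K)).
  move=> K0 mV; apply: (@integ_bounded _ _ _ _ 1) => [|w].
    by apply: measurable_minr => //; apply: measurable_funM => //; exact: measurableT_comp.
  by rewrite ger0_norm ?ge_min ?lexx// le_min ler01 divr_ge0// ltW.
have gint d0 (T : measurableType d0) (P : probability T R) (U : I -> T -> R) :
    (forall i, measurable_fun setT (U i)) -> integ P (fun w => g (U ^~ w)).
  move=> mU; apply: (@integ_bounded _ _ _ _ M) => //.
  exact: (box_unif_continuous_measurable (M := M)).
(* Inside the box the error is at most [e]. Outside, it is at most [2 * M] while some coordinate has
   [min 1 (|U i| / K) = 1], so the sum over coordinates pays for it. *)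
have approx (e K : R) p d0 (T : measurableType d0) (P : probability T R) (U : I -> T -> R) :
    0 < K -> trigpoly p -> (forall y, `|p y| <= M) ->
    (forall y, (forall i, `|y i| <= K) -> `|p y - g y| <= e) -> 0 < e ->
    (forall i, measurable_fun setT (U i)) ->
    (forall i, Ex P (fun w => Num.min 1 (`|U i w| / K)) <= e) ->
    `|Ex P (fun w => p (U ^~ w)) - Ex P (fun w => g (U ^~ w))| <=
      e * (1 + 2 * M * #|I|%:R).
  move=> K0 tp pM pg e0 mU tU.
  have ip := trigpoly_integ P mU tp; have ig := gint _ _ P _ mU.
  rewrite -ExB//; apply: le_trans (Ex_norm (integB ip ig)) _.
  apply: (@le_trans _ _ (Ex P (fun w => e + 2 * M * \sum_i Num.min 1 (`|U i w| / K)))).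
    apply: le_Ex.
    - exact/integ_norm/integB.
    - apply: integD; first exact: integ_cst.
      by apply: integZ; apply: integ_sum => i _; exact: ming.
    move=> w; have [/forallP bd|/forallPn[i]] := boolP [forall i, `|U i w| <= K].
      rewrite (le_trans (pg _ bd))// lerDl mulr_ge0 ?mulr_ge0//.
      by apply: sumr_ge0 => i _; rewrite le_min ler01 divr_ge0// ltW.
    rewrite -ltNge => Ki; apply: (@le_trans _ _ (2 * M)).
      by rewrite (le_trans (ler_normB _ _))// mulr_natl mulr2n lerD.
    rewrite -[leLHS]add0r lerD ?(ltW e0)// ler_peMr ?mulr_ge0//.
    rewrite (bigD1 i)//= min_l; last by rewrite ler_pdivlMr// mul1r ltW.
    by rewrite lerDl; apply: sumr_ge0 => k _; rewrite le_min ler01 divr_ge0// ltW.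
  rewrite ExD ?ExZ ?Ex_cst; [|by apply: integ_sum => i _; exact: ming|exact: integ_cst|
    by apply: integZ; apply: integ_sum => i _; exact: ming].
  rewrite Ex_sum => [|i _]; last exact: ming.
  rewrite mulrDr mulr1 lerD2l.
  have -> : e * (2 * M * #|I|%:R) = 2 * M * (#|I|%:R * e) by ring.
  apply: ler_wpM2l; first exact: mulr_ge0.
  apply: (@le_trans _ _ (\sum_(i : I) e)); first exact: ler_sum.
  by rewrite sumr_const -[_ *+ _]mulr_natl.
apply/cvgrPdist_le => e e0.
pose e1 : R := e / 3 / (1 + 2 * M * #|I|%:R).
have D0 : 0 < 1 + 2 * M * #|I|%:R by rewrite ltr_pwDl// mulr_ge0// mulr_ge0.
have e10 : 0 < e1 by rewrite divr_gt0// divr_gt0.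
have /choice[KY HKY] : forall i, exists K0 : R, forall K, K0 <= K -> \forall n \near \oo,
  Ex P1 (fun w => Num.min 1 (`|Y n i w| / K)) <= e1 by move=> i; exact: tY.
have /choice[KZ HKZ] : forall i, exists K0 : R, forall K, K0 <= K ->
  Ex P2 (fun w => Num.min 1 (`|Z i w| / K)) <= e1 by move=> i; exact: tightness1.
(* One radius above all the thresholds of the coordinates of [Y] and of [Z]. *)
pose K : R := 1 + \sum_i (`|KY i| + `|KZ i|).
have KYZ i : `|KY i| + `|KZ i| <= K.
  rewrite /K (bigD1 i)//= addrCA lerDl addr_ge0//.
  by apply: sumr_ge0 => k _; rewrite addr_ge0.
have K0 : 0 < K by rewrite ltr_pwDl//; apply: sumr_ge0 => i _; rewrite addr_ge0.
have [p [tp pM pg]] := trig_approx ucg gM K0 e10.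
have nearY : \forall n \near \oo, forall i,
    Ex P1 (fun w => Num.min 1 (`|Y n i w| / K)) <= e1.
  apply: filter_forall => i; apply: HKY.
  by apply: le_trans (KYZ i); rewrite -[leLHS]addr0 lerD// ler_norm.
have e30 : 0 < e / 3 by rewrite divr_gt0.
have /cvgrPdist_le/(_ _ e30) nearp := cvgp _ tp.
near=> n.
have A1 : `|Ex P1 (fun w => p (Y n ^~ w)) - Ex P1 (fun w => g (Y n ^~ w))| <= e / 3.
  rewrite -[leRHS](divfK (lt0r_neq0 D0)) -/e1.
  by apply: (approx _ K) => //; near: n.
have A2 : `|Ex P2 (fun w => p (Z ^~ w)) - Ex P2 (fun w => g (Z ^~ w))| <= e / 3.
  rewrite -[leRHS](divfK (lt0r_neq0 D0)) -/e1.
  apply: (approx _ K) => // i; apply: HKZ.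
  by apply: le_trans (KYZ i); rewrite -[leLHS]add0r lerD// ler_norm.
have A3 : `|Ex P2 (fun w => p (Z ^~ w)) - Ex P1 (fun w => p (Y n ^~ w))| <= e / 3.
  by near: n.
move: A1 A2 A3; rewrite !ler_norml => /andP[? ?] /andP[? ?] /andP[? ?]; lra.
Unshelve. all: by end_near. Qed.

End levy_continuity.

(** Heine's theorem: the product of the two closed boxes is compact, and a radius good near each of
    its points is eventually good on all of it. *)
Lemma continuous_box_unif_continuous {R : realType} q
    (g : 'rV[R]_q * 'rV[R]_q -> R) : continuous g ->
  box_unif_continuous (fun y : 'I_q + 'I_q -> R =>
    g (\row_k y (inl k), \row_k y (inr k))).
Proof.
move=> cg K e e0.
pose B := [set v : 'rV[R]_q | forall i, `[- K, K]%classic (v ord0 i)].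
have cB : compact B by exact: (@rV_compact R q (fun=> `[- K, K]%classic) (fun=> @segment_compact _ _ _)).
have /compact_near_coveringP nB := compact_setX cB cB.
pose Q (dl : R) (v : 'rV[R]_q * 'rV[R]_q) := forall v', ball v dl v' -> `|g v - g v'| <= e.
have nQ : \forall dl \near (0:R)^'+, B `*` B `<=` Q dl.
  apply: nB => x Bx.
  have e20 : 0 < e / 2 by rewrite divr_gt0.
  have /cvgrPdist_lt/(_ _ e20)/nbhs_ballP[r /= r0 xr] := cg x.
  have r20 : 0 < r / 2 by rewrite divr_gt0.
  exists (ball x (r / 2), [set dl : R | dl < r / 2]).
    split; first exact: nbhsx_ballx.
    exact: nbhs_right_lt.
  move=> [x' dl] /= [xx' dlr] v' x'v'.
  have h1 : `|g x - g x'| < e / 2.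
    by apply: xr; apply: le_ball xx'; rewrite ler_pdivrMr// ler_peMr// ?ltW// ltr1n.
  have h2 : `|g x - g v'| < e / 2.
    by apply: xr; apply: (ball_split xx'); apply: le_ball x'v'; exact: ltW.
  by move: h1 h2; rewrite ler_norml !ltr_norml => /andP[? ?] /andP[? ?]; lra.
near (0:R)^'+ => dl.
exists dl => // x y xK yK xy.
have QB : B `*` B `<=` Q dl by near: dl.
apply: QB => /=.
  by split=> i; rewrite /= in_itv/= mxE -ler_norml.
have dl0 : 0 < dl by [].
by split; split=> //= i k; rewrite !mxE; exact: xy.
Unshelve. all: by end_near. Qed.

(** * Fresnel-type integrals *)
Lemma Rintegral_dominated_cvg {d} {T : measurableType d} {R : realType}
    (mu : {measure set T -> \bar R}) (D : set T) (f_ : nat -> T -> R)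
    (f g : T -> R) :
  measurable D -> (forall n, measurable_fun D (f_ n)) ->
  (forall x, D x -> f_ n x @[n --> \oo] --> f x) ->
  mu.-integrable D (EFin \o g) -> (forall n x, D x -> `|f_ n x| <= g x) ->
  mu.-integrable D (EFin \o f) /\
  \int[mu]_(x in D) f_ n x @[n --> \oo] --> \int[mu]_(x in D) f x.
Proof.
move=> mD mf ff ig fg.
have mf' : measurable_fun D f by exact: (measurable_fun_cvg mf).
have [|||||iY _ cY] := @dominated_convergence _ _ _ mu D mD
  (fun n x => (f_ n x)%:E) (EFin \o f) (EFin \o g).
- by move=> n; exact/measurable_EFinP.
- exact/measurable_EFinP.
- by apply: aeW => x Dx; apply: cvg_EFin; [exact: nearW|exact: ff].
- exact: ig.
- by apply: aeW => x n Dx; rewrite lee_fin fg.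
split=> //; apply: fine_cvg.
by rewrite /Rintegral fineK//; exact: integrable_fin_num.
Qed.

(** * Integrals over the open half line *)

Section improper_integrals.
Context {R : realType}.
Notation mu := (@lebesgue_measure R).
Implicit Types (f F : R -> R) (l : R).

Definition pos_half : set R := `]0, +oo[%classic.

Lemma measurable_pos_half : measurable (pos_half : set (measurableTypeR R)).
Proof. exact: measurable_itv. Qed.

(** Both ends of the half line are improper; these compact segments exhaust it from the inside. *)
Let seg (n : nat) : set R := `[(n.+1%:R)^-1, n.+1%:R]%classic.

Let seg_bigcup : \bigcup_n seg n = pos_half.
Proof.
apply/seteqP; split=> [x [n _]|x]; rewrite /seg /pos_half /= !in_itv/= ?andbT.
  by move=> /andP[h _]; apply: lt_le_trans h; rewrite invr_gt0.
move=> x0; exists (Num.truncn (Num.max x x^-1)) => //.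
have h := truncnS_gt (Num.max x x^-1).
have h1 : x < (Num.truncn (Num.max x x^-1)).+1%:R.
  by apply: le_lt_trans h; rewrite le_max lexx.
have h2 : x^-1 < (Num.truncn (Num.max x x^-1)).+1%:R.
  by apply: le_lt_trans h; rewrite le_max lexx orbT.
by rewrite /seg /= in_itv/= (ltW h1) andbT invf_ple ?posrE// ltW.
Qed.

Let seg_nd : nondecreasing_seq seg.
Proof.
move=> m n mn; apply/subsetPset => x; rewrite /seg /= !in_itv/= => /andP[h1 h2].
have mn' : m.+1%:R <= n.+1%:R :> R by rewrite ler_nat.
rewrite (le_trans h2 mn') andbT (le_trans _ h1)//.
by rewrite lef_pV2 ?posrE.
Qed.

Let seg_sub n : seg n `<=` pos_half.
Proof. by rewrite -seg_bigcup => x; exists n. Qed.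

Let mseg n : measurable (seg n : set (measurableTypeR R)).
Proof. exact: measurable_itv. Qed.

Lemma integral_segments f :
  mu.-integrable pos_half (EFin \o f) ->
  \int[mu]_(x in seg n) f x @[n --> \oo] --> \int[mu]_(x in pos_half) f x.
Proof.
move=> intf.
have mf : measurable_fun pos_half f by apply/measurable_EFinP; exact: measurable_int intf.
pose f_ n x := f x * \1_(seg n) x.
have E n : \int[mu]_(x in seg n) f x = \int[mu]_(x in pos_half) f_ n x.
  rewrite -[in LHS](setIidr (seg_sub (n := n))) Rintegral_mkcondr.
  apply: eq_Rintegral => x _; rewrite patchE /f_ indicE.
  by case: ifPn => _; rewrite ?mulr1 ?mulr0.
under eq_fun do rewrite E.
have [||||//] := @Rintegral_dominated_cvg _ _ _ mu pos_half f_ f (fun x => `|f x|) measurable_pos_half.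
- by move=> n; apply: measurable_funM.
- move=> x; rewrite -[in X in X -> _]seg_bigcup => -[n _ xn].
  apply: cvg_near_cst; exists n => // m /= nm.
  rewrite /f_ indicE mem_set ?mulr1//.
  by have /subsetPset := seg_nd nm; apply.
- exact: integrable_norm.
- move=> n x _; rewrite /f_ normrM ler_piMr// indicE.
  by case: (_ \in _); rewrite ?normr1 ?normr0.
Qed.

Section FTC.
Variables (f F : R -> R) (l0 l1 : R).
Hypothesis dF : forall x : R, 0 < x -> is_derive x 1 F (f x).
Hypothesis cf : forall x : R, 0 < x -> {for x, continuous f}.

Let FTC_seg n : (0 < n)%N ->
  (\int[mu]_(x in seg n) (f x)%:E = (F n.+1%:R - F (n.+1%:R)^-1)%:E)%E.
Proof.
move=> n0.
have lt1 : (n.+1%:R)^-1 < n.+1%:R :> R.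
  by apply: (@lt_trans _ _ 1); rewrite ?invf_lt1 ?ltr1n.
have pos x : x \in `](n.+1%:R)^-1, n.+1%:R[%R -> 0 < x.
  by rewrite in_itv/= => /andP[h _]; apply: lt_trans h; rewrite invr_gt0.
have cF x : 0 < x -> {for x, continuous F}.
  by move=> /dF[/derivable1_diffP/differentiable_continuous].
rewrite /seg (@continuous_FTC2 _ f F)// ?EFinB//.
- apply: continuous_in_subspaceT => x; rewrite inE/= in_itv/= => /andP[h _].
  by apply: cf; apply: lt_le_trans h; rewrite invr_gt0.
- split.
  + by move=> x /pos/dF [].
  + by apply: cvg_at_right_filter; apply: cF; rewrite invr_gt0.
  + by apply: cvg_at_left_filter; exact: cF.
- by move=> x /pos/dF dFx; rewrite derive1E; exact: derive_val.
Qed.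

Hypothesis F0 : F x @[x --> 0^'+] --> l0.
Hypothesis F1 : F x @[x --> +oo%R] --> l1.

Let cvg_seg : F n.+1%:R - F (n.+1%:R)^-1 @[n --> \oo] --> l1 - l0.
Proof.
apply: cvgB.
  have h : n.+1%:R @[n --> \oo] --> (+oo%R : set_system R).
    apply/cvgryPge => A; exists (Num.truncn A) => // n /= An; apply: ltW.
    by apply: lt_le_trans (truncnS_gt _) _; rewrite ler_nat.
  exact: (cvg_comp _ _ h F1).
move/cvg_at_rightP : F0; apply; split; first by move=> n; rewrite invr_gt0.
exact: cvg_harmonic.
Qed.

Lemma FTC_pos_half : mu.-integrable pos_half (EFin \o f) ->
  \int[mu]_(x in pos_half) f x = l1 - l0.
Proof.
move=> intf; have cvgI := integral_segments intf.
rewrite -(cvg_lim (@Rhausdorff R) cvgI); apply: cvg_lim => //.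
apply: cvg_trans cvg_seg; apply: near_eq_cvg.
by exists 1%N => // n /= n0; rewrite /Rintegral FTC_seg.
Qed.

(** For a non-negative [f], monotone convergence identifies the integral with the total increase of
    [F], which is finite because [F] has limits at both ends. *)
Lemma ge0_FTC_pos_half : (forall x : R, 0 < x -> 0 <= f x) ->
  mu.-integrable pos_half (EFin \o f).
Proof.
move=> f0.
have mf n : measurable_fun (seg n : set (measurableTypeR R)) f.
  apply: subspace_continuous_measurable_fun; first exact: measurable_itv.
  apply: continuous_in_subspaceT => x; rewrite inE => /seg_sub.
  by rewrite /pos_half/= in_itv/= andbT; exact: cf.
have segE n : (0 < n)%N -> (\int[mu]_(x in seg n) (f x)%:E = (F n.+1%:R - F (n.+1%:R)^-1)%:E)%E.
  move=> n0; exact: FTC_seg.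
have mf0 : measurable_fun (pos_half : set (measurableTypeR R)) f.
  by rewrite -seg_bigcup; apply/measurable_fun_bigcup.
apply/integrableP; split; first exact/measurable_EFinP.
have -> : (\int[mu]_(x in pos_half) `|(EFin \o f) x| = \int[mu]_(x in pos_half) (f x)%:E)%E.
  apply: eq_integral => x; rewrite inE /pos_half/= in_itv/= andbT => x0.
  by rewrite ger0_norm// f0.
have cI := @ge0_nondecreasing_set_cvg_integral _ (measurableTypeR R) R seg (EFin \o f) mu seg_nd mseg
  (fun n => (measurable_EFinP _ _).2 (mf n)).
rewrite seg_bigcup in cI.
have cI' : (\int[mu]_(x in seg n) (f x)%:E)%E @[n --> \oo] --> (l1 - l0)%:E.
  have : (F n.+1%:R - F (n.+1%:R)^-1)%:E @[n --> \oo] --> (l1 - l0)%:E.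
    by apply: cvg_EFin; [exact: nearW|exact: cvg_seg].
  apply: cvg_trans; apply: near_eq_cvg; exists 1%N => // n /= n0; by rewrite segE.
rewrite (cvg_unique _ (cI _) cI') ?ltry//.
by move=> n x /seg_sub; rewrite /pos_half/= in_itv/= andbT lee_fin => /f0.
Qed.

End FTC.

End improper_integrals.

(** * The dominating functions of all integrals below *)

Section power_envelope.
Context {R : realType}.
Notation mu := (@lebesgue_measure R).

Lemma is_derive_powR (a x : R) : 0 < x ->
  is_derive x 1 (fun y => y `^ a) (a * x `^ (a - 1)).
Proof.
move=> x0; have xI : x \in `]0, +oo[%R by rewrite in_itv/= x0.
apply: DeriveDef; first exact: derivable_powR.
by rewrite -derive1E (powR_derive1 a xI).
Qed.

Lemma continuous_powR (a x : R) : 0 < x -> {for x, continuous (fun y => y `^ a)}.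
Proof.
by move=> /(is_derive_powR a)[/derivable1_diffP/differentiable_continuous].
Qed.

Lemma powR_cvgy0 (a : R) : 0 < a -> x `^ (- a) @[x --> +oo%R] --> 0.
Proof.
move=> a0; apply/cvgrPdist_le => e e0.
near=> x.
have x0 : 0 < x by near: x; exact: nbhs_pinfty_gt.
rewrite sub0r normrN ger0_norm ?powR_ge0// powRN invf_ple ?posrE ?powR_gt0//.
have : e^-1 `^ a^-1 <= x by near: x; exact: nbhs_pinfty_ge.
move=> /(ge0_ler_powR (ltW a0)); rewrite !nnegrE powR_ge0 (ltW x0) => /(_ isT isT).
by rewrite -powRrM mulVf ?gt_eqF// powRr1// invr_ge0 ltW.
Unshelve. all: by end_near. Qed.

(** Up to a factor 2 this bounds [min(1, x) * (x^(-p) + x^(-r))] for [1 < r <= p]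
    ([minr1_envelope]): the product of a kernel vanishing linearly at 0 and a two-sided bound on the
    tail. It is integrable when [p < 2] and [1 < r]. *)
Definition envelope (p r x : R) : R :=
  if x <= 1 then x `^ (1 - p) else x `^ (- r).

Lemma envelope_ge0 p r x : 0 <= envelope p r x.
Proof. by rewrite /envelope; case: ifP => _; exact: powR_ge0. Qed.

(** An explicit bounded antiderivative whose derivative behaves like [x^(c-1)] at 0 and like
    [x^(-c-1)] at infinity. Taking [c = 2 - p] and [c = r - 1] dominates the two pieces of the
    envelope; the factor 4 below bounds [(1 + x^c)^2] on []0, 1]]. *)
Let F (c x : R) := - (1 + x `^ c)^-1.
Let f (c x : R) := c * x `^ (c - 1) * (1 + x `^ c) ^- 2.

Let f_integrable (c : R) : 0 < c -> mu.-integrable pos_half (EFin \o f c).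
Proof.
move=> c0.
have pos x : 0 < 1 + x `^ c by rewrite ltr_pwDl ?powR_ge0.
apply: (@ge0_FTC_pos_half _ _ (F c) (- (1 + 0)^-1) (- 0)).
- move=> x x0.
  have d1 : is_derive x 1 (fun y : R => 1 + y `^ c) (0 + c * x `^ (c - 1)).
    by apply: is_deriveD; exact: is_derive_powR.
  have nz : (fun y : R => 1 + y `^ c) x != 0 by rewrite gt_eqF.
  have d2 := @is_deriveN _ _ _ _ _ _ _ (@is_deriveV R (fun y : R => 1 + y `^ c) x _ 1 nz d1).
  by apply: (is_derive_eq d2); rewrite add0r /GRing.scale /= mulNr opprK mulrC.
- move=> x x0; apply: cvgM; first by apply: cvgM; [exact: cvg_cst|exact: continuous_powR].
  apply: cvgV; first by rewrite expf_neq0// gt_eqF.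
  have cc : (1 + y `^ c) @[y --> x] --> 1 + x `^ c.
    by apply: cvgD; [exact: cvg_cst|exact: continuous_powR].
  exact: (cvgM cc cc).
- apply: cvgN; apply: cvgV; first by rewrite addr0 oner_neq0.
  by apply: cvgD; [exact: cvg_cst|exact: powR_cvg0].
- apply: cvgN; apply: (@squeeze_cvgr _ _ _ _ (fun=> 0) (fun x => x `^ (- c))).
  + near=> x; have x0 : 0 < x by near: x; exact: nbhs_pinfty_gt.
    rewrite invr_ge0 ltW//= powRN lef_pV2 ?posrE ?powR_gt0//.
    by rewrite lerDr ler01.
  + exact: cvg_cst.
  + exact: powR_cvgy0.
- move=> x x0; rewrite /f; apply: mulr_ge0; last by rewrite invr_ge0 sqr_ge0.
  by rewrite mulr_ge0 ?powR_ge0// ltW.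
Unshelve. all: by end_near. Qed.

Let f_low (c x : R) : 0 < c -> 0 < x <= 1 -> x `^ (c - 1) <= 4 / c * f c x.
Proof.
move=> c0 /andP[x0 x1]; rewrite /f.
have y1 : x `^ c <= 1.
  by have := @ge0_ler_powR R c (ltW c0) x 1; rewrite !nnegrE powR1; apply=> //; exact: ltW.
have y0 := powR_ge0 x c.
have -> : 4 / c * (c * x `^ (c - 1) * (1 + x `^ c) ^- 2) =
  x `^ (c - 1) * (4 / (1 + x `^ c) ^+ 2).
  by field; rewrite !gt_eqF//; lra.
rewrite ler_peMr ?powR_ge0// ler_pdivlMr ?mul1r; last by rewrite exprn_gt0//; lra.
by rewrite (_ : 4 = 2 ^+ 2 :> R) ?lerXn2r ?nnegrE//; [lra|lra|ring].
Qed.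

Let f_high (c x : R) : 0 < c -> 1 <= x -> x `^ (- (c + 1)) <= 4 / c * f c x.
Proof.
move=> c0 x1; rewrite /f.
have x0 : 0 < x by lra.
have y1 : 1 <= x `^ c.
  by have := @ge0_ler_powR R c (ltW c0) 1 x; rewrite !nnegrE powR1; apply=> //; exact: ltW.
have -> : x `^ (- (c + 1)) = x `^ (c - 1) * (x `^ c) ^- 2.
  rewrite -powR_mulrn ?powR_ge0// -powRrM -powRN -powRD; last by rewrite (gt_eqF x0) implybT.
  by congr (_ `^ _); ring.
set y := x `^ c in y1 *.
have -> : 4 / c * (c * x `^ (c - 1) * (1 + y) ^- 2) =
  x `^ (c - 1) * (4 / (1 + y) ^+ 2).
  by field; rewrite !gt_eqF//; lra.
apply: ler_wpM2l; first exact: powR_ge0.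
rewrite ler_pdivlMr ?exprn_gt0//; last lra.
rewrite mulrC ler_pdivrMr ?exprn_gt0//; last lra.
nra.
Qed.

Lemma envelope_integrable (p r : R) : p < 2 -> 1 < r ->
  mu.-integrable pos_half (EFin \o envelope p r).
Proof.
move=> p2 r1; pose a := 2 - p; have a0 : 0 < a by rewrite subr_gt0.
pose c := r - 1; have c0 : 0 < c by rewrite subr_gt0.
have := integrableD measurable_pos_half
  (integrableZl measurable_pos_half (4 / a) (f_integrable a0))
  (integrableZl measurable_pos_half (4 / c) (f_integrable c0)).
apply: le_integrable; first exact: measurable_pos_half.
  apply/measurable_EFinP; apply: measurable_funTS.
  apply: measurable_fun_ifT; [|exact: measurable_powR|exact: measurable_powR].
  exact: measurable_fun_ler.
move=> x; rewrite /pos_half /= in_itv/= andbT => x0.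
rewrite lee_fin ger0_norm ?envelope_ge0//; apply: le_trans (ler_norm _).
have f0 b : 0 < b -> 0 <= 4 / b * f b x.
  move=> b0; rewrite /f; apply: mulr_ge0; first by rewrite divr_ge0// ltW.
  apply: mulr_ge0; last by rewrite invr_ge0 sqr_ge0.
  by rewrite mulr_ge0 ?powR_ge0// ltW.
rewrite /envelope; have [x1|x1] := leP (x : R) 1.
  rewrite (_ : 1 - p = a - 1); last by rewrite /a; ring.
  by apply: le_trans (f_low a0 _) _; rewrite ?x0// lerDl f0.
rewrite (_ : r = c + 1); last by rewrite /c; ring.
by apply: le_trans (f_high c0 (ltW x1)) _; rewrite lerDr f0.
Qed.

End power_envelope.

Section trigo_bounds.
Context {R : realType}.
Implicit Types x y : R.

Lemma ler_norm_sin x : `|sin x| <= `|x|.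
Proof.
wlog x0 : x / 0 <= x => [hw|].
  have [/hw//|x0] := leP 0 x.
  by rewrite -normrN -sinN -[leRHS]normrN hw// oppr_ge0 ltW.
have : forall y, 0 <= y -> 0 <= y - sin y /\ 0 <= y + sin y.
  move=> y; rewrite le_eqVlt => /predU1P[<-|y0]; first by rewrite sin0 subr0 addr0.
  have dsin z : z \in `]0, y[%R -> is_derive z 1 sin (cos z).
    by move=> _; exact: is_derive_sin.
  have csin : {within `[0, y], continuous (@sin R)}.
    by apply: continuous_subspaceT => z; exact: continuous_sin.
  have [c _] := MVT y0 dsin csin; rewrite sin0 !subr0 => ->.
  by have := cos_le1 c; have := cos_geN1 c; nra.
by move=> /(_ _ x0)[? ?]; rewrite ler_norml (ger0_norm x0); lra.
Qed.

Lemma ler_norm_cosB1 x : `|cos x - 1| <= `|x|.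
Proof.
have -> : cos x - 1 = - 2 * sin (x / 2) ^+ 2.
  have -> : cos x = cos (x / 2 + x / 2) by congr cos; field.
  have := cos2Dsin2 (x / 2); rewrite cosD !expr2 => h; lra.
have h := ler_norm_sin (x / 2).
rewrite normrM normrN (ger0_norm (ler0n _ _)) expr2 normrM.
have s1 : `|sin (x / 2)| <= 1 by rewrite ler_norml sin_geN1 sin_le1.
have s0 := normr_ge0 (sin (x / 2)).
move: h; rewrite normrM (ger0_norm (_ : 0 <= 2^-1))// => h; nra.
Qed.

Lemma ler_norm_cosB1_2 x : `|cos x - 1| <= 2.
Proof. by rewrite ler_norml; have := cos_le1 x; have := cos_geN1 x; lra. Qed.

Lemma ler_norm_sin1 x : `|sin x| <= 1.
Proof. by rewrite ler_norml sin_geN1 sin_le1. Qed.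

Lemma ler_norm_cos1 x : `|cos x| <= 1.
Proof. by rewrite ler_norml cos_geN1 cos_le1. Qed.

End trigo_bounds.

(** * Rotation of the contour of the Gamma integral *)

Section fresnel.
Context {R : realType}.
Notation mu := (@lebesgue_measure R).
Variable alpha : R.
Hypothesis alpha12 : 1 < alpha < 2.
Implicit Types th x c : R.

(** [u th] and [v th] are the real and imaginary parts of [(exp(- x e^(- i th)) - 1) x^(- alpha)],
    and [u'], [v'] their derivatives in [th]. The angle 0 is linked to [Gamma (1 - alpha)], the
    angle [pi / 2] gives the two oscillating integrals. *)
Let u (th x : R) := (expR (- (x * cos th)) * cos (x * sin th) - 1) * x `^ (- alpha).
Let v (th x : R) := expR (- (x * cos th)) * sin (x * sin th) * x `^ (- alpha).
Let u' (th x : R) := x * expR (- (x * cos th)) *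
  (sin th * cos (x * sin th) - cos th * sin (x * sin th)) * x `^ (- alpha).
Let v' (th x : R) := x * expR (- (x * cos th)) *
  (sin th * sin (x * sin th) + cos th * cos (x * sin th)) * x `^ (- alpha).
Let dom := envelope alpha alpha.

Let dom_integrable : mu.-integrable pos_half (EFin \o dom).
Proof. by apply: envelope_integrable; case/andP: alpha12. Qed.

Let dom_bound (w C x : R) : 0 < x -> 0 <= C -> `|w| <= C * x -> `|w| <= C ->
  `|w * x `^ (- alpha)| <= C * dom x.
Proof.
move=> x0 C0 w1 w2; rewrite normrM (ger0_norm (powR_ge0 _ _)) /dom /envelope.
case: ifP => x1; last by rewrite ler_wpM2r// powR_ge0.
have -> : x `^ (1 - alpha) = x * x `^ (- alpha).
  by rewrite powRD ?powRr1 ?(ltW x0)// (gt_eqF x0) implybT.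
by rewrite mulrA ler_wpM2r// powR_ge0.
Qed.

Let exp_le1 (x th : R) : 0 < x -> 0 <= cos th -> 0 < expR (- (x * cos th)) <= 1.
Proof. by move=> x0 c0; rewrite expR_gt0 -[leRHS]expR0 ler_expR oppr_le0 mulr_ge0// ltW. Qed.

Let wu_bound th x : 0 < x -> 0 <= cos th ->
  `|expR (- (x * cos th)) * cos (x * sin th) - 1| <= 3 * x /\
  `|expR (- (x * cos th)) * cos (x * sin th) - 1| <= 3.
Proof.
move=> x0 c0; have /andP[e0 e1] := exp_le1 x0 c0.
have c1 := cos_le1 th.
have ex : 1 - x <= expR (- (x * cos th)).
  by apply: le_trans (expR_ge1Dx _); nra.
have h1 := ler_norm_cosB1 (x * sin th).
have h2 := ler_norm_cosB1_2 (x * sin th).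
have h3 := ler_norm_sin1 th; have h4 := ler_norm_cos1 (x * sin th).
rewrite normrM (gtr0_norm x0) in h1.
have h5 : `|cos (x * sin th) - 1| <= x by apply: le_trans h1 _; nra.
set e := expR _ in e0 e1 ex *; set c := cos (_ * _) in h2 h4 h5 *.
have -> : e * c - 1 = (e - 1) * c + (c - 1) by ring.
have b1 : `|(e - 1) * c| <= 1 - e.
  rewrite normrM (ler0_norm (_ : e - 1 <= 0)); last lra.
  have := normr_ge0 c; nra.
split; apply: (le_trans (ler_normD _ _)); lra.
Qed.

Let wv_bound th x : 0 < x -> 0 <= cos th ->
  `|expR (- (x * cos th)) * sin (x * sin th)| <= 1 * x /\
  `|expR (- (x * cos th)) * sin (x * sin th)| <= 1.
Proof.
move=> x0 c0; have /andP[e0 e1] := exp_le1 x0 c0.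
have h1 := ler_norm_sin (x * sin th); have h2 := ler_norm_sin1 (x * sin th).
have h3 := ler_norm_sin1 th.
rewrite normrM (gtr0_norm x0) in h1.
have h5 : `|sin (x * sin th)| <= x by apply: le_trans h1 _; nra.
have s0 := normr_ge0 (sin (x * sin th)).
by split; rewrite normrM (gtr0_norm e0) ?mul1r; nra.
Qed.

Let u_bound th x : 0 < x -> 0 <= cos th -> `|u th x| <= 3 * dom x.
Proof. by move=> x0 c0; have [? ?] := wu_bound x0 c0; exact: dom_bound. Qed.

Let v_bound th x : 0 < x -> 0 <= cos th -> `|v th x| <= 1 * dom x.
Proof. by move=> x0 c0; have [? ?] := wv_bound x0 c0; exact: dom_bound. Qed.

(** Differentiation in [th] brings down a factor [x] that only the exponential can absorb. The bound
    degenerates as [cos th] tends to 0, so the angle [pi / 2] is reached by a limit and not by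
    differentiation. *)
Let xexp_bound th c x : 0 < x -> 0 < c -> c <= cos th ->
  x * expR (- (x * cos th)) <= (1 + c^-1) * x /\
  x * expR (- (x * cos th)) <= 1 + c^-1.
Proof.
move=> x0 c0 cth; have cos0 : 0 <= cos th by lra.
have /andP[e0 e1] := exp_le1 x0 cos0.
have ci : 0 < c^-1 by rewrite invr_gt0.
split; first nra.
have : x * c * expR (- (x * cos th)) <= 1.
  apply: (@le_trans _ _ (expR (x * cos th) * expR (- (x * cos th)))).
    apply: ler_wpM2r; first exact: ltW.
    by apply: le_trans (expR_ge1Dx _); nra.
  by rewrite -expRD subrr expR0.
rewrite mulrAC -ler_pdivlMr// mul1r; lra.
Qed.

Let trig2_bound (a b c d : R) : `|a| <= 1 -> `|b| <= 1 -> `|c| <= 1 -> `|d| <= 1 ->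
  `|a * b + c * d| <= 2.
Proof.
move=> ? ? ? ?; apply: le_trans (ler_normD _ _) _.
by rewrite !normrM; rewrite (_ : 2 = 1 * 1 + 1 * 1)%R; [rewrite lerD ?ler_pM|ring].
Qed.

Let u'_bound th c x : 0 < x -> 0 < c -> c <= cos th ->
  `|u' th x| <= 2 * (1 + c^-1) * dom x.
Proof.
move=> x0 c0 cth; have [b1 b2] := xexp_bound x0 c0 cth.
have ci : 0 < c^-1 by rewrite invr_gt0.
have xe0 : 0 <= x * expR (- (x * cos th)) by rewrite mulr_ge0 ?expR_ge0// ltW.
have t : `|sin th * cos (x * sin th) - cos th * sin (x * sin th)| <= 2.
  by rewrite -mulNr; apply: trig2_bound; rewrite ?normrN ?ler_norm_sin1 ?ler_norm_cos1.
have cc : 0 <= 1 + c^-1 by rewrite addr_ge0// ltW.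
apply: (dom_bound x0); first exact: mulr_ge0.
  have -> : 2 * (1 + c^-1) * x = (1 + c^-1) * x * 2 by ring.
  by rewrite normrM (ger0_norm xe0); exact: ler_pM.
by rewrite (mulrC 2) normrM (ger0_norm xe0); exact: ler_pM.
Qed.

Let v'_bound th c x : 0 < x -> 0 < c -> c <= cos th ->
  `|v' th x| <= 2 * (1 + c^-1) * dom x.
Proof.
move=> x0 c0 cth; have [b1 b2] := xexp_bound x0 c0 cth.
have ci : 0 < c^-1 by rewrite invr_gt0.
have xe0 : 0 <= x * expR (- (x * cos th)) by rewrite mulr_ge0 ?expR_ge0// ltW.
have t : `|sin th * sin (x * sin th) + cos th * cos (x * sin th)| <= 2.
  by apply: trig2_bound; rewrite ?ler_norm_sin1 ?ler_norm_cos1.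
have cc : 0 <= 1 + c^-1 by rewrite addr_ge0// ltW.
apply: (dom_bound x0); first exact: mulr_ge0.
  have -> : 2 * (1 + c^-1) * x = (1 + c^-1) * x * 2 by ring.
  by rewrite normrM (ger0_norm xe0); exact: ler_pM.
by rewrite (mulrC 2) normrM (ger0_norm xe0); exact: ler_pM.
Qed.

Let dM (f g : R -> R) (z df dg : R) : is_derive z 1 f df -> is_derive z 1 g dg ->
  is_derive z 1 (fun y => f y * g y) (f z * dg + df * g z).
Proof.
move=> h1 h2; apply: (is_derive_eq (is_deriveM h1 h2)).
by rewrite /GRing.scale /= (mulrC df).
Qed.

Let dC (a z : R) : is_derive z 1 (fun=> a) 0.
Proof. exact: is_derive_cst. Qed.

Let dB (f : R -> R) (z df a : R) : is_derive z 1 f df -> is_derive z 1 (fun y => f y - a) df.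
Proof.
by move=> h1; apply: (is_derive_eq (is_deriveB h1 (dC a z))); rewrite subr0.
Qed.

Let dI (z : R) : is_derive z 1 (fun y : R => y) 1.
Proof. exact: is_derive_id. Qed.

Let dN (f : R -> R) (z df : R) : is_derive z 1 f df -> is_derive z 1 (fun y => - f y) (- df).
Proof. by move=> h1; exact: is_deriveN. Qed.

Let dexp (f : R -> R) (z df : R) : is_derive z 1 f df ->
  is_derive z 1 (fun y => expR (f y)) (expR (f z) * df).
Proof. by move=> h; exact: (is_derive1_comp (is_derive_expR _) h). Qed.

Let dcos (f : R -> R) (z df : R) : is_derive z 1 f df ->
  is_derive z 1 (fun y => cos (f y)) (- sin (f z) * df).
Proof. by move=> h; exact: (is_derive1_comp (is_derive_cos _) h). Qed.

Let dsin (f : R -> R) (z df : R) : is_derive z 1 f df ->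
  is_derive z 1 (fun y => sin (f y)) (cos (f z) * df).
Proof. by move=> h; exact: (is_derive1_comp (is_derive_sin _) h). Qed.

Let du x th : is_derive th 1 (fun th => u th x) (u' th x).
Proof.
have d := dM (dB 1 (dM (dexp (dN (dM (dC x th) (dcos (dI th)))))
  (dcos (dM (dC x th) (dsin (dI th)))))) (dC (x `^ (- alpha)) th).
by apply: (is_derive_eq d); rewrite /u'; ring.
Qed.

Let dv x th : is_derive th 1 (fun th => v th x) (v' th x).
Proof.
have d := dM (dM (dexp (dN (dM (dC x th) (dcos (dI th)))))
  (dsin (dM (dC x th) (dsin (dI th))))) (dC (x `^ (- alpha)) th).
by apply: (is_derive_eq d); rewrite /v'; ring.
Qed.

Let powR1B x : 0 < x -> x `^ (1 - alpha) = x * x `^ (- alpha).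
Proof.
by move=> x0; rewrite powRD ?powRr1 ?(ltW x0)// (gt_eqF x0) implybT.
Qed.

Let bu th x := (expR (- (x * cos th)) * cos (x * sin th) - 1) * x `^ (1 - alpha).
Let bv th x := expR (- (x * cos th)) * sin (x * sin th) * x `^ (1 - alpha).

(** Applied to [exp(- x e^(- i th))], the operator [x d/dx] is [i] times the derivative in [th].
    Hence integrating by parts in [x] trades the integrals of [u'] and [v'] for those of [v] and
    [u]. *)
Let dxu th x : 0 < x -> is_derive x 1 (bu th) (- v' th x - (alpha - 1) * u th x).
Proof.
move=> x0.
have d := dM (dB 1 (dM (dexp (dN (dM (dI x) (dC (cos th) x))))
  (dcos (dM (dI x) (dC (sin th) x))))) (is_derive_powR (1 - alpha) x0).
apply: (is_derive_eq d); rewrite (_ : 1 - alpha - 1 = - alpha); last ring.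
by rewrite powR1B// /v' /u; ring.
Qed.

Let dxv th x : 0 < x -> is_derive x 1 (bv th) (u' th x - (alpha - 1) * v th x).
Proof.
move=> x0.
have d := dM (dM (dexp (dN (dM (dI x) (dC (cos th) x))))
  (dsin (dM (dI x) (dC (sin th) x)))) (is_derive_powR (1 - alpha) x0).
apply: (is_derive_eq d); rewrite (_ : 1 - alpha - 1 = - alpha); last ring.
by rewrite powR1B// /u' /v; ring.
Qed.

Let cont_is_derive (f : R -> R) x df : is_derive x 1 f df -> {for x, continuous f}.
Proof. by move=> [/derivable1_diffP/differentiable_continuous]. Qed.

Let cont_u th x : 0 < x -> {for x, continuous (u th)}.
Proof.
move=> x0; exact: (cont_is_derive (dM (dB 1 (dM (dexp (dN (dM (dI x) (dC (cos th) x))))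
  (dcos (dM (dI x) (dC (sin th) x))))) (is_derive_powR (- alpha) x0))).
Qed.

Let cont_v th x : 0 < x -> {for x, continuous (v th)}.
Proof.
move=> x0; exact: (cont_is_derive (dM (dM (dexp (dN (dM (dI x) (dC (cos th) x))))
  (dsin (dM (dI x) (dC (sin th) x)))) (is_derive_powR (- alpha) x0))).
Qed.

Let cont_u' th x : 0 < x -> {for x, continuous (u' th)}.
Proof.
move=> x0; exact: (cont_is_derive (dM (dM (dM (dI x) (dexp (dN (dM (dI x) (dC (cos th) x)))))
  (is_deriveB (dM (dC (sin th) x) (dcos (dM (dI x) (dC (sin th) x))))
              (dM (dC (cos th) x) (dsin (dM (dI x) (dC (sin th) x))))))
  (is_derive_powR (- alpha) x0))).
Qed.

Let cont_v' th x : 0 < x -> {for x, continuous (v' th)}.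
Proof.
move=> x0; exact: (cont_is_derive (dM (dM (dM (dI x) (dexp (dN (dM (dI x) (dC (cos th) x)))))
  (is_deriveD (dM (dC (sin th) x) (dsin (dM (dI x) (dC (sin th) x))))
              (dM (dC (cos th) x) (dcos (dM (dI x) (dC (sin th) x))))))
  (is_derive_powR (- alpha) x0))).
Qed.

Let cont_measurable (f : R -> R) : (forall x : R, 0 < x -> {for x, continuous f}) ->
  measurable_fun (pos_half : set (measurableTypeR R)) f.
Proof.
move=> cf; apply: open_continuous_measurable_fun; first exact: interval_open.
by move=> x; rewrite inE /pos_half/= in_itv/= andbT; exact: cf.
Qed.

Let dominated_integrable (f : R -> R) C : (forall x : R, 0 < x -> {for x, continuous f}) ->
  (forall x : R, 0 < x -> `|f x| <= C * dom x) -> mu.-integrable pos_half (EFin \o f).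
Proof.
move=> cf fC; have := integrableZl measurable_pos_half C dom_integrable.
apply: le_integrable; first exact: measurable_pos_half.
  by apply/measurable_EFinP; exact: cont_measurable.
move=> x; rewrite /pos_half/= in_itv/= andbT => x0; rewrite lee_fin.
by apply: le_trans (fC _ x0) (ler_norm _).
Qed.

Let U th := \int[mu]_(x in pos_half) u th x.
Let V th := \int[mu]_(x in pos_half) v th x.

Let iu th : 0 <= cos th -> mu.-integrable pos_half (EFin \o u th).
Proof. by move=> c0; apply: (@dominated_integrable _ 3) => [x|x x0]; [exact: cont_u|exact: u_bound]. Qed.

Let iv th : 0 <= cos th -> mu.-integrable pos_half (EFin \o v th).
Proof. by move=> c0; apply: (@dominated_integrable _ 1) => [x|x x0]; [exact: cont_v|exact: v_bound]. Qed.

Let iu' th : 0 < cos th -> mu.-integrable pos_half (EFin \o u' th).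
Proof. by move=> c0; apply: dominated_integrable => [x|x x0]; [exact: cont_u'|exact: u'_bound c0 _]. Qed.

Let iv' th : 0 < cos th -> mu.-integrable pos_half (EFin \o v' th).
Proof. by move=> c0; apply: dominated_integrable => [x|x x0]; [exact: cont_v'|exact: v'_bound c0 _]. Qed.

(* The boundary terms [w x * x^(1 - alpha)] vanish at [0] and at infinity. *)
Let boundary (w : R -> R) (C : R) : (forall x : R, 0 < x -> `|w x| <= C * x) ->
  (forall x : R, 0 < x -> `|w x| <= C) ->
  w x * x `^ (1 - alpha) @[x --> 0^'+] --> 0 /\
  w x * x `^ (1 - alpha) @[x --> +oo%R] --> 0.
Proof.
move=> w1 w2; have /andP[a1 a2] := alpha12; split.
  have lim : C * x `^ (2 - alpha) @[x --> (0:R)^'+] --> 0.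
    rewrite -[X in _ --> X](mulr0 C); apply: cvgM; first exact: cvg_cst.
    by apply: powR_cvg0; rewrite subr_gt0.
  have limN : - (C * x `^ (2 - alpha)) @[x --> (0:R)^'+] --> 0.
    by rewrite -[X in _ --> X]oppr0; exact: cvgN.
  apply: (squeeze_cvgr _ limN lim).
  near=> x; have x0 : 0 < x by [].
  rewrite -ler_norml normrM (ger0_norm (powR_ge0 _ _)).
  have -> : x `^ (2 - alpha) = x * x `^ (1 - alpha).
    by rewrite powR1B// mulrA -expr2 powRD ?(gt_eqF x0) ?implybT// powR_mulrn// ltW.
  by rewrite mulrA ler_wpM2r ?powR_ge0 ?w1.
have lim : C * x `^ (- (alpha - 1)) @[x --> +oo%R] --> 0.
  rewrite -[X in _ --> X](mulr0 C); apply: cvgM; first exact: cvg_cst.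
  by apply: powR_cvgy0; rewrite subr_gt0.
have limN : - (C * x `^ (- (alpha - 1))) @[x --> +oo%R] --> 0.
  by rewrite -[X in _ --> X]oppr0; exact: cvgN.
apply: (squeeze_cvgr _ limN lim).
near=> x; have x0 : 0 < x by near: x; exact: nbhs_pinfty_gt.
rewrite -ler_norml normrM (ger0_norm (powR_ge0 _ _)) opprB.
by rewrite ler_wpM2r ?powR_ge0 ?w2.
Unshelve. all: by end_near. Qed.

Let intu' th : 0 < cos th -> \int[mu]_(x in pos_half) u' th x = (alpha - 1) * V th.
Proof.
move=> c0.
have [x x0|x x0|b0 b1] := @boundary (fun x => expR (- (x * cos th)) * sin (x * sin th)) 1.
- by have [] := wv_bound x0 (ltW c0).
- by have [] := wv_bound x0 (ltW c0).
have iav : mu.-integrable pos_half (EFin \o (fun x => (alpha - 1) * v th x)) :=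
  integrableZl measurable_pos_half (alpha - 1) (iv (ltW c0)).
have icomb : mu.-integrable pos_half (EFin \o (fun x => u' th x - (alpha - 1) * v th x)) :=
  integrableB measurable_pos_half (iu' c0) iav.
have cont x : 0 < x -> {for x, continuous (fun x => u' th x - (alpha - 1) * v th x)}.
  move=> x0; apply: cvgB; first exact: cont_u'.
  by apply: cvgM; [exact: cvg_cst|exact: cont_v].
have := FTC_pos_half (fun x => @dxv th x) cont b0 b1 icomb.
rewrite subr0 (RintegralB measurable_pos_half (iu' c0) iav).
rewrite (RintegralZl (alpha - 1) measurable_pos_half (iv (ltW c0))) -/(V th).
by move=> /eqP; rewrite subr_eq0 => /eqP.
Qed.

Let intv' th : 0 < cos th -> \int[mu]_(x in pos_half) v' th x = - (alpha - 1) * U th.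
Proof.
move=> c0.
have [x x0|x x0|b0 b1] := @boundary (fun x => expR (- (x * cos th)) * cos (x * sin th) - 1) 3.
- by have [] := wu_bound x0 (ltW c0).
- by have [] := wu_bound x0 (ltW c0).
have iau : mu.-integrable pos_half (EFin \o (fun x => (alpha - 1) * u th x)) :=
  integrableZl measurable_pos_half (alpha - 1) (iu (ltW c0)).
have inv : mu.-integrable pos_half (EFin \o (fun x => - v' th x)) :=
  integrableN (iv' c0).
have icomb : mu.-integrable pos_half (EFin \o (fun x => - v' th x - (alpha - 1) * u th x)) :=
  integrableB measurable_pos_half inv iau.
have cont x : 0 < x -> {for x, continuous (fun x => - v' th x - (alpha - 1) * u th x)}.
  move=> x0; apply: cvgB; first by apply: cvgN; exact: cont_v'.
  by apply: cvgM; [exact: cvg_cst|exact: cont_u].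
have := FTC_pos_half (fun x => @dxu th x) cont b0 b1 icomb.
rewrite subr0 (RintegralB measurable_pos_half inv iau).
rewrite (RintegralZl (alpha - 1) measurable_pos_half (iu (ltW c0))) -/(U th).
have -> : \int[mu]_(x in pos_half) - v' th x = - \int[mu]_(x in pos_half) v' th x.
  rewrite -mulN1r -(RintegralZl (-1) measurable_pos_half (iv' c0)).
  by apply: eq_Rintegral => x _; rewrite mulN1r.
lra.
Qed.

Let derive_under (w w' : R -> R -> R) (C : R -> R) th :
  (forall x th, is_derive th 1 (fun th => w th x) (w' th x)) ->
  (forall th, 0 <= cos th -> mu.-integrable pos_half (EFin \o w th)) ->
  (forall th c x, 0 < x -> 0 < c -> c <= cos th -> `|w' th x| <= C c * dom x) ->
  0 < cos th ->
  is_derive th 1 (fun th => \int[mu]_(x in pos_half) w th x)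
    (\int[mu]_(x in pos_half) w' th x).
Proof.
move=> dw iw bw c0; pose c := cos th / 2; have c20 : 0 < c by rewrite divr_gt0.
have [eta /= eta0 near_th] : exists2 eta : R, 0 < eta & forall y, `|th - y| < eta -> c <= cos y.
  have /cvgrPdist_lt/(_ c c20)[eta /= eta0 H] : cos y @[y --> th] --> cos th.
    exact: continuous_cos.
  by exists eta => // y /H /=; rewrite ltr_norml /c; lra.
have inI y : `]th - eta, th + eta[%classic y -> c <= cos y.
  by rewrite /= in_itv/= => yI; apply: near_th; rewrite ltr_norml; lra.
have thI : `]th - eta, th + eta[%classic th by rewrite /= in_itv/=; lra.
pose G x := `|C c| * dom x.
have G0 x : 0 <= G x by rewrite mulr_ge0// envelope_ge0.
have iG : mu.-integrable pos_half (EFin \o G) := integrableZl measurable_pos_half `|C c| dom_integrable.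
have pE y x : partial1of2 w y x = w' y x.
  by rewrite /partial1of2 derive1E; have d := dw x y; exact: derive_val.
have h1 y : `]th - eta, th + eta[%classic y -> mu.-integrable pos_half (EFin \o w y).
  by move=> /inI cy; apply: iw; lra.
have h2 y (x : measurableTypeR R) : `]th - eta, th + eta[%classic y -> pos_half x -> derivable (w^~ x) y 1.
  by move=> _ _; have [] := dw x y.
have h3 y (x : measurableTypeR R) : `]th - eta, th + eta[%classic y -> pos_half x -> `|partial1of2 w y x| <= G x.
  move=> /inI cy; rewrite /pos_half/= in_itv/= andbT => x0; rewrite pE.
  by apply: le_trans (bw y c x x0 c20 cy) _; rewrite ler_wpM2r ?envelope_ge0// ler_norm.
apply: DeriveDef.
  exact: (derivable_under_integral measurable_pos_half thI h1 h2 G0 iG h3).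
rewrite -derive1E (differentiation_under_integral measurable_pos_half thI h1 h2 G0 iG h3).
by apply: eq_Rintegral => x _; rewrite pE.
Qed.

Let dU th : 0 < cos th -> is_derive th 1 U ((alpha - 1) * V th).
Proof. by move=> c0; rewrite -intu'//; apply: (derive_under du iu u'_bound). Qed.

Let dV th : 0 < cos th -> is_derive th 1 V (- (alpha - 1) * U th).
Proof. by move=> c0; rewrite -intv'//; apply: (derive_under dv iv v'_bound). Qed.

Let pos_halfE : pos_half = [set x : R | 0 < x].
Proof. by apply/seteqP; split=> x; rewrite /pos_half/= in_itv/= andbT. Qed.

(** At angle 0, [v'] is [x^(1 - alpha) e^(- x)], the integrand of [Gamma (2 - alpha)], and the
    integration by parts becomes the functional equation that defines [Gamma] at the negative
    argument [1 - alpha]. *)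
Let U0 : U 0 = Gamma (1 - alpha).
Proof.
have /andP[a1 a2] := alpha12.
have c0 : 0 < cos (0 : R) by rewrite cos0.
have := intv' c0; rewrite /Gamma ltNge (_ : 1 - alpha <= 0)/=; last lra.
rewrite /Gamma_int -pos_halfE => h.
have -> : U 0 = (\int[mu]_(x in pos_half) v' 0 x) / (1 - alpha).
  by rewrite h; field; lra.
congr (_ / _); rewrite /Rintegral; congr fine; apply: eq_integral => x.
rewrite inE /pos_half/= in_itv/= andbT => x0; rewrite /v' /gamma_integrand sin0 cos0.
have -> : 0 * sin (x * 0) + 1 * cos (x * 0) = 1 :> R.
  by rewrite mulr0 cos0 mul0r add0r mulr1.
rewrite !mulr1.
by rewrite (_ : 1 - alpha + 1 - 1 = 1 - alpha) ?powR1B//; [congr EFin; ring|ring].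
Qed.

Let V0 : V 0 = 0.
Proof.
rewrite /V (@eq_Rintegral _ _ _ _ _ (fun=> 0)) ?Rintegral_cst ?mul0r//.
  exact: measurable_pos_half.
by move=> x _; rewrite /v sin0 mulr0 sin0 mulr0 mul0r.
Qed.

(** By [dU] and [dV] the vector [(U, V)] turns at constant speed [alpha - 1]; turned back, it has
    zero derivative and keeps its value [(Gamma (1 - alpha), 0)] at angle 0. *)
Let rotation th : 0 <= th < pi / 2 ->
  U th * cos ((alpha - 1) * th) - V th * sin ((alpha - 1) * th) = Gamma (1 - alpha) /\
  U th * sin ((alpha - 1) * th) + V th * cos ((alpha - 1) * th) = 0.
Proof.
move=> /andP[th0 th1].
have dl (y : R) : is_derive y 1 (fun y => (alpha - 1) * y) (alpha - 1).
  by apply: (is_derive_eq (dM (dC (alpha - 1) y) (dI y))); ring.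
have cp y : 0 <= y <= th -> 0 < cos y.
  by move=> /andP[y0 y1]; apply: cos_gt0_pihalf; have := @pi_gt0 R; lra.
have const (f : R -> R) : (forall y, 0 < cos y -> is_derive y 1 f 0) -> f th = f 0.
  move=> df; move: th0; rewrite le_eqVlt => /predU1P[<-//|th0].
  have df' y : y \in `]0, th[%R -> is_derive y 1 f ((fun=> 0) y).
    by rewrite in_itv/= => /andP[y0 y1]; apply: df; apply: cp; lra.
  have cf' : {within `[0, th], continuous f}.
    apply: continuous_in_subspaceT => y; rewrite inE/= in_itv/= => y01.
    exact: (cont_is_derive (df _ (cp _ y01))).
  have [y _] := MVT th0 df' cf'; rewrite mul0r; lra.
split.
  rewrite -[RHS]U0; pose f y := U y * cos ((alpha - 1) * y) - V y * sin ((alpha - 1) * y).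
  have -> : U 0 = f 0 by rewrite /f mulr0 cos0 sin0 mulr1 mulr0 subr0.
  apply: (const f) => y cy.
  by apply: (is_derive_eq (is_deriveB (dM (dU cy) (dcos (dl y))) (dM (dV cy) (dsin (dl y))))); ring.
pose f y := U y * sin ((alpha - 1) * y) + V y * cos ((alpha - 1) * y).
have -> : 0 = f 0 by rewrite /f V0 mulr0 sin0 mulr0 mul0r addr0.
apply: (const f) => y cy.
by apply: (is_derive_eq (is_deriveD (dM (dU cy) (dsin (dl y))) (dM (dV cy) (dcos (dl y))))); ring.
Qed.

(** Unlike their derivatives, [u] and [v] are dominated by multiples of [dom] uniformly up to the
    angle [pi / 2], so the relations of [rotation] pass to the limit along [t n]. The resulting
    linear system is orthogonal and is solved with [cos^2 + sin^2 = 1]. *)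
Let UVpihalf : U (pi / 2) = Gamma (1 - alpha) * sin (pi * alpha / 2) /\
  V (pi / 2) = Gamma (1 - alpha) * cos (pi * alpha / 2).
Proof.
pose t (n : nat) : R := pi / 2 - pi / 2 * n.+1%:R^-1.
have p2 : 0 < pi / 2 :> R by rewrite divr_gt0// pi_gt0.
have tI n : 0 <= t n < pi / 2.
  have : 0 < n.+1%:R^-1 :> R by rewrite invr_gt0.
  have : n.+1%:R^-1 <= 1 :> R by rewrite invf_le1// ler1n.
  rewrite /t; set h := n.+1%:R^-1; set q := pi / 2 in p2 * => h1 h0.
  by rewrite subr_ge0 ler_piMr ?(ltW p2)//= ltrBlDr ltrDl mulr_gt0.
have ct n : 0 <= cos (t n).
  by apply: cos_ge0_pihalf; have := tI n; lra.
have t_cvg : t n @[n --> \oo] --> pi / 2.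
  rewrite -[X in _ --> X]subr0; apply: cvgB; first exact: cvg_cst.
  by rewrite -[X in _ --> X](mulr0 (pi / 2)); apply: cvgM; [exact: cvg_cst|exact: cvg_harmonic].
have i3 : mu.-integrable pos_half (EFin \o (fun x => 3 * dom x)) := integrableZl measurable_pos_half 3 dom_integrable.
have i1 : mu.-integrable pos_half (EFin \o (fun x => 1 * dom x)) := integrableZl measurable_pos_half 1 dom_integrable.
have Ut : U (t n) @[n --> \oo] --> U (pi / 2).
  have [||||//] := @Rintegral_dominated_cvg _ _ _ mu pos_half (fun n => u (t n)) (u (pi / 2))
    (fun x => 3 * dom x) measurable_pos_half.
  - by move=> n; apply: cont_measurable => x; exact: cont_u.
  - move=> x _; exact: (cvg_comp _ _ t_cvg (cont_is_derive (du x (pi / 2)))).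
  - by [].
  - by move=> n x; rewrite /pos_half/= in_itv/= andbT => x0; exact: u_bound.
have Vt : V (t n) @[n --> \oo] --> V (pi / 2).
  have [||||//] := @Rintegral_dominated_cvg _ _ _ mu pos_half (fun n => v (t n)) (v (pi / 2))
    (fun x => 1 * dom x) measurable_pos_half.
  - by move=> n; apply: cont_measurable => x; exact: cont_v.
  - move=> x _; exact: (cvg_comp _ _ t_cvg (cont_is_derive (dv x (pi / 2)))).
  - by [].
  - by move=> n x; rewrite /pos_half/= in_itv/= andbT => x0; exact: v_bound.
have lt : (alpha - 1) * t n @[n --> \oo] --> (alpha - 1) * (pi / 2).
  by apply: cvgM => //; exact: cvg_cst.
have Ct : cos ((alpha - 1) * t n) @[n --> \oo] --> sin (pi * alpha / 2).
  rewrite -cosBpihalf (_ : pi * alpha / 2 - pi / 2 = (alpha - 1) * (pi / 2)); last by field.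
  exact: (cvg_comp _ _ lt (@continuous_cos R _)).
have St : sin ((alpha - 1) * t n) @[n --> \oo] --> - cos (pi * alpha / 2).
  rewrite -sinBpihalf (_ : pi * alpha / 2 - pi / 2 = (alpha - 1) * (pi / 2)); last by field.
  exact: (cvg_comp _ _ lt (@continuous_sin R _)).
have L1 : U (t n) * cos ((alpha - 1) * t n) - V (t n) * sin ((alpha - 1) * t n) @[n --> \oo] -->
    U (pi / 2) * sin (pi * alpha / 2) - V (pi / 2) * - cos (pi * alpha / 2).
  by apply: cvgB; apply: cvgM.
have L2 : U (t n) * sin ((alpha - 1) * t n) + V (t n) * cos ((alpha - 1) * t n) @[n --> \oo] -->
    U (pi / 2) * - cos (pi * alpha / 2) + V (pi / 2) * sin (pi * alpha / 2).
  by apply: cvgD; apply: cvgM.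
have E1 : U (pi / 2) * sin (pi * alpha / 2) - V (pi / 2) * - cos (pi * alpha / 2) = Gamma (1 - alpha).
  rewrite -(cvg_lim (@Rhausdorff R) L1); apply: cvg_lim => //.
  by apply: cvg_near_cst; apply: nearW => n; have [] := rotation (tI n).
have E2 : U (pi / 2) * - cos (pi * alpha / 2) + V (pi / 2) * sin (pi * alpha / 2) = 0.
  rewrite -(cvg_lim (@Rhausdorff R) L2); apply: cvg_lim => //.
  by apply: cvg_near_cst; apply: nearW => n; have [] := rotation (tI n).
have cs := cos2Dsin2 (pi * alpha / 2).
set S := sin _ in E1 E2 cs *; set C := cos _ in E1 E2 cs *.
rewrite -E1; split.
  transitivity (U (pi / 2) * (C ^+ 2 + S ^+ 2) + 0 * C); first by rewrite cs; ring.
  by rewrite -E2; ring.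
transitivity (V (pi / 2) * (C ^+ 2 + S ^+ 2) - 0 * S); first by rewrite cs; ring.
by rewrite -E2; ring.
Qed.

Let cpi2 : 0 <= cos (pi / 2 : R). Proof. by rewrite cos_pihalf. Qed.

Let u_pihalf : u (pi / 2) = fun x => (cos x - 1) * x `^ (- alpha).
Proof. by apply/funext => x; rewrite /u cos_pihalf sin_pihalf mulr0 oppr0 expR0 mul1r mulr1. Qed.

Let v_pihalf : v (pi / 2) = fun x => sin x * x `^ (- alpha).
Proof. by apply/funext => x; rewrite /v cos_pihalf sin_pihalf mulr0 oppr0 expR0 mul1r mulr1. Qed.

Lemma integrable_sin_powR :
  mu.-integrable pos_half (EFin \o (fun x => sin x * x `^ (- alpha))).
Proof. by rewrite -v_pihalf; exact: iv. Qed.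

Lemma integral_sin_powR : \int[mu]_(x in pos_half) (sin x * x `^ (- alpha)) =
  Gamma (1 - alpha) * cos (pi * alpha / 2).
Proof. by rewrite -UVpihalf.2 /V v_pihalf. Qed.

Lemma integral_cosB1_powR : \int[mu]_(x in pos_half) ((cos x - 1) * x `^ (- alpha)) =
  Gamma (1 - alpha) * sin (pi * alpha / 2).
Proof. by rewrite -UVpihalf.1 /U u_pihalf. Qed.

End fresnel.

(** * Regularly varying tails *)
Section regular_variation.
Context {R : realType}.
Variables (f : nat -> R) (alpha : R).
Hypothesis alpha1 : 1 < alpha.
Hypothesis f_gt0 : forall n, 0 < f n.
Hypothesis f_le1 : forall n, f n <= 1.
Hypothesis f_noninc : forall m n, (m <= n)%N -> f n <= f m.
Hypothesis f_scale : forall k, (0 < k)%N ->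
  f (k * n)%N / f n @[n --> \oo] --> k%:R `^ (- alpha).

(** With [f n = P(U >= n)] this is [P(U > t)] for [t >= 0]. *)
Definition rtail (t : R) : R := f (Num.truncn t).+1.

Lemma rtail_gt0 t : 0 < rtail t. Proof. exact: f_gt0. Qed.

Lemma rtail_le1 t : rtail t <= 1. Proof. exact: f_le1. Qed.

Lemma rtail_noninc s t : s <= t -> rtail t <= rtail s.
Proof. by move=> st; apply: f_noninc; rewrite ltnS; exact: le_truncn. Qed.

Let nat_ratio (a b : R) : 0 < a -> a < b ->
  exists p q, [/\ (0 < p)%N, (0 < q)%N & a < p%:R / q%:R < b].
Proof.
move=> a0 ab; pose q := (Num.truncn (b - a)^-1).+1.
have q0 : 0 < q%:R :> R by rewrite ltr0n.
have ba : 0 < b - a by rewrite subr_gt0.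
have hq : 1 < q%:R * (b - a).
  by rewrite -ltr_pdivrMr// mul1r; exact: truncnS_gt.
exists (Num.truncn (q%:R * a)).+1, q; split=> //.
rewrite ltr_pdivlMr// ltr_pdivrMr//.
have := truncnS_gt (q%:R * a); have : 0 <= q%:R * a by rewrite mulr_ge0// ltW.
move=> /truncn_itv/andP[h1 h2] _; move: h1 h2; rewrite -natr1 => h1 h2.
by apply/andP; split; nra.
Qed.

Let powR_continuous (x e : R) : 0 < x -> 0 < e ->
  exists2 dl : R, 0 < dl & forall y : R, `|x - y| < dl -> `|x `^ (- alpha) - y `^ (- alpha)| < e.
Proof.
move=> x0 e0; have /cvgrPdist_lt/(_ e e0) := @continuous_powR R (- alpha) x x0.
by move=> [dl /= dl0 H]; exists dl.
Qed.

Let ratio_cvg p q : (0 < p)%N -> (0 < q)%N ->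
  forall (u v : R -> nat), u t @[t --> +oo] --> \oo -> v t @[t --> +oo] --> \oo ->
  (f (v t) / f (q * v t)%N) * (f (p * u t)%N / f (u t)) @[t --> +oo%R] -->
  (p%:R / q%:R : R) `^ (- alpha).
Proof.
move=> p0 q0 u v u8 v8.
rewrite powRM ?invr_ge0// mulrC; apply: cvgM; last exact: (cvg_comp _ _ u8 (f_scale p0)).
have -> : (q%:R^-1) `^ (- alpha) = (q%:R `^ (- alpha))^-1 :> R.
  by rewrite -powR_inv1 ?ler0n// -powRrM mulN1r opprK powRN invrK.
under eq_fun do rewrite -invf_div.
apply: cvgV; first by rewrite gt_eqF// powR_gt0// ltr0n.
exact: (cvg_comp _ _ v8 (f_scale q0)).
Qed.

Let truncnS_cvg (x : R) : 0 < x -> (Num.truncn (x * t)).+1 @[t --> +oo%R] --> \oo.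
Proof.
move=> x0; apply/cvgnyPge => A; near=> t.
rewrite -(ler_nat R); apply: ltW; apply: le_lt_trans (truncnS_gt _).
rewrite mulrC -ler_pdivrMr//; near: t; exact: nbhs_pinfty_ge.
Unshelve. all: by end_near. Qed.

(** Scaling is given for integer factors only. For rationals [p1/q1 < x < p2/q2] close to [x] one
    has [p1 u <= q1 v] and [q2 v <= p2 u] for large [t], rounding included, so monotonicity of [f]
    squeezes [f v / f u] between two ratios whose limits are known by [ratio_cvg]. *)
Lemma rtail_regular (x : R) : 0 < x ->
  rtail (x * t) / rtail t @[t --> +oo%R] --> x `^ (- alpha).
Proof.
move=> x0; apply/cvgrPdist_le => e e0.
have e20 : 0 < e / 2 by rewrite divr_gt0.
have [dl dl0 Hdl] := powR_continuous x0 e20.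
pose u (t : R) := (Num.truncn t).+1; pose v (t : R) := (Num.truncn (x * t)).+1.
have u8 : u t @[t --> +oo] --> \oo.
  by have := truncnS_cvg ltr01; under eq_fun do rewrite mul1r.
have v8 : v t @[t --> +oo] --> \oo := truncnS_cvg x0.
have [p1 [q1 [p10 q10 /andP[]]]] : exists p q, [/\ (0 < p)%N, (0 < q)%N &
    Num.max (x / 2) (x - dl) < p%:R / q%:R < x].
  apply: nat_ratio; first by rewrite lt_max divr_gt0.
  by rewrite gt_max ltr_pdivrMr// ltr_pMr// ltr1n ltrBlDr ltrDl.
rewrite gt_max => /andP[_ pq1a] pq1b.
have [p2 [q2 [p20 q20 /andP[pq2a pq2b]]]] : exists p q, [/\ (0 < p)%N, (0 < q)%N &
    x < p%:R / q%:R < x + dl].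
  by apply: nat_ratio => //; rewrite ltrDl.
have d1 := Hdl (p1%:R / q1%:R); have d2 := Hdl (p2%:R / q2%:R).
have {}d1 : `|x `^ (- alpha) - (p1%:R / q1%:R) `^ (- alpha)| < e / 2.
  by apply: d1; rewrite ltr_norml; lra.
have {}d2 : `|x `^ (- alpha) - (p2%:R / q2%:R) `^ (- alpha)| < e / 2.
  by apply: d2; rewrite ltr_norml; lra.
have /cvgrPdist_le/(_ _ e20) L1 := ratio_cvg p10 q10 u8 v8.
have /cvgrPdist_le/(_ _ e20) L2 := ratio_cvg p20 q20 u8 v8.
have Q10 : 0 < q1%:R :> R by rewrite ltr0n.
have Q20 : 0 < q2%:R :> R by rewrite ltr0n.
near=> t.
have t0 : 0 < t by near: t; exact: nbhs_pinfty_gt.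
have xt0 : 0 <= x * t by rewrite mulr_ge0// ltW.
have /truncn_itv/andP[u1 u2] := ltW t0.
have /truncn_itv/andP[v1 v2] := xt0.
have hle : (p1 * u t <= q1 * v t)%N.
  rewrite -(ler_nat R) !natrM.
  apply: (@le_trans _ _ (q1%:R * (x * t))); last by rewrite ler_wpM2l ?ler0n// ltW.
  apply: (@le_trans _ _ (p1%:R * (t + 1))).
    by rewrite ler_wpM2l ?ler0n// /u -natr1 lerD2r.
  have : p1%:R / (q1%:R * x - p1%:R) <= t by near: t; apply: nbhs_pinfty_ge; exact: num_real.
  rewrite ler_pdivrMr; last by rewrite subr_gt0 mulrC -ltr_pdivrMr.
  lra.
have hge : (q2 * v t <= p2 * u t)%N.
  rewrite -(ler_nat R) !natrM.
  apply: (@le_trans _ _ (p2%:R * t)); last by rewrite ler_wpM2l ?ler0n// ltW.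
  apply: (@le_trans _ _ (q2%:R * (x * t + 1))).
    by rewrite ler_wpM2l ?ler0n// /v -natr1 lerD2r.
  have : q2%:R / (p2%:R - q2%:R * x) <= t by near: t; apply: nbhs_pinfty_ge; exact: num_real.
  rewrite ler_pdivrMr; last by rewrite subr_gt0 mulrC -ltr_pdivlMr.
  lra.
have A1 : `|(p1%:R / q1%:R) `^ (- alpha) - (f (v t) / f (q1 * v t)%N) * (f (p1 * u t)%N / f (u t))| <= e / 2.
  by near: t.
have A2 : `|(p2%:R / q2%:R) `^ (- alpha) - (f (v t) / f (q2 * v t)%N) * (f (p2 * u t)%N / f (u t))| <= e / 2.
  by near: t.
have E r1 r2 : (f (v t) / f r1) * (f r2 / f (u t)) = (f (v t) / f (u t)) * (f r2 / f r1).
  by field; rewrite !gt_eqF.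
have r0 : 0 < f (v t) / f (u t) by rewrite divr_gt0.
rewrite -[rtail (x * t)]/(f (v t)) -[rtail t]/(f (u t)).
rewrite E in A1; rewrite E in A2.
have B1 : f (v t) / f (u t) <= f (v t) / f (u t) * (f (p1 * u t)%N / f (q1 * v t)%N).
  by rewrite ler_peMr ?(ltW r0)// ler_pdivlMr// mul1r; exact: f_noninc.
have B2 : f (v t) / f (u t) * (f (p2 * u t)%N / f (q2 * v t)%N) <= f (v t) / f (u t).
  by rewrite ler_piMr ?(ltW r0)// ler_pdivrMr// mul1r; exact: f_noninc.
move: A1 A2 d1 d2 B1 B2; rewrite !ler_norml !ltr_norml.
move=> /andP[? ?] /andP[? ?] /andP[? ?] /andP[? ?] ? ?; lra.
Unshelve. all: by end_near. Qed.

(** * Potter bounds *)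

Section potter.
Variable dl : R.
Hypothesis dl0 : 0 < dl.
Hypothesis dl1 : 0 < alpha - dl.

Let two_bounds : exists2 t0 : R, 1 <= t0 & forall t, t0 <= t ->
  2 `^ (- (alpha + dl)) * rtail t <= rtail (2 * t) /\
  rtail (2 * t) <= 2 `^ (- (alpha - dl)) * rtail t.
Proof.
have h1 := dl0; have h2 := dl1; have h3 := alpha1.
have P2 : 1 < 2 :> R by rewrite ltr1n.
have mono (a b : R) : a < b -> 2 `^ a < 2 `^ b :> R.
  move=> ab; rewrite lt_neqAle ler_powR ?ltW// andbT; apply/eqP => E.
  have := congr1 (@ln R) E; rewrite !ln_powR => /eqP.
  by rewrite -subr_eq0 -mulrBl mulf_eq0 subr_eq0 (lt_eqF ab) /= gt_eqF// ln_gt0.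
have l1 : 2 `^ (- (alpha + dl)) < 2 `^ (- alpha) :> R by apply: mono; lra.
have l2 : 2 `^ (- alpha) < 2 `^ (- (alpha - dl)) :> R by apply: mono; lra.
have rr := rtail_regular (ltr0n R 2).
have [[M1 [M1r H1]] [M2 [M2r H2]]] := (cvgr_gt _ rr _ l1, cvgr_lt _ rr _ l2).
pose t0 := 1 + Num.max (Num.max M1 M2) 0.
have t01 : 1 <= t0 by rewrite lerDl le_max lexx orbT.
exists t0 => // t tt.
have tM : M1 < t /\ M2 < t.
  have : Num.max (Num.max M1 M2) 0 < t by apply: lt_le_trans tt; rewrite /t0 ltrDr.
  by rewrite !gt_max => /andP[/andP[]].
have := H1 t tM.1; have := H2 t tM.2 => /= k2 k1.
by split; [rewrite -ler_pdivlMr ?rtail_gt0//|rewrite -ler_pdivrMr ?rtail_gt0//]; exact: ltW.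
Qed.

Let pow2 (x : R) : 1 <= x -> exists k : nat, 2 ^+ k <= x < 2 ^+ k.+1.
Proof.
move=> x1; have ex : exists k : nat, x < 2 ^+ k.
  exists (Num.truncn x).+1; apply: lt_le_trans (truncnS_gt x) _.
  by rewrite -natrX ler_nat ltnW// ltn_expl.
case: (ex_minnP ex) => -[|k]; first by rewrite expr0 ltNge x1.
move=> xk min; exists k; rewrite xk andbT leNgt; apply/negP => /min.
by rewrite ltnn.
Qed.

Let pow2R (a : R) (k : nat) : (2 `^ a) ^+ k = (2 ^+ k) `^ a :> R.
Proof.
by rewrite -(powR_mulrn k (powR_ge0 2 a)) -(powR_mulrn k (ler0n R 2)) -!powRrM mulrC.
Qed.

(** Beyond [t0] each doubling changes the tail by a factor between [2^(- alpha - dl)] and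
    [2^(- alpha + dl)]; this is iterated. In the constant, [2^(alpha + dl)] pays for rounding to a
    power of two and [1 / rtail t0] for points [x * c] below [t0]. *)
Lemma potter : exists t0 C : R, [/\ 1 <= t0, 0 < C &
  forall c x, t0 <= c -> 0 < x ->
    rtail (x * c) <= C * (if x <= 1 then x `^ (- (alpha + dl)) else x `^ (- (alpha - dl))) * rtail c].
Proof.
have [t0 t01 H] := two_bounds.
have up (k : nat) t : t0 <= t -> rtail (2 ^+ k * t) <= (2 `^ (- (alpha - dl))) ^+ k * rtail t.
  move=> tt; elim: k => [|k IH]; first by rewrite !expr0 !mul1r.
  have kt : t0 <= 2 ^+ k * t.
    by rewrite (le_trans tt)// ler_peMl ?exprn_ege1 ?ler1n//; lra.
  rewrite !exprS -!mulrA; apply: le_trans (H _ kt).2 _.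
  by rewrite ler_wpM2l ?powR_ge0.
have down (k : nat) t : t0 <= t -> (2 `^ (- (alpha + dl))) ^+ k * rtail t <= rtail (2 ^+ k * t).
  move=> tt; elim: k => [|k IH]; first by rewrite !expr0 !mul1r.
  have kt : t0 <= 2 ^+ k * t.
    by rewrite (le_trans tt)// ler_peMl ?exprn_ege1 ?ler1n//; lra.
  rewrite !exprS -!mulrA; apply: le_trans _ (H _ kt).1.
  by rewrite ler_wpM2l ?powR_ge0.
have a1 : 0 < alpha - dl by [].
have d0 := dl0; have d1 := alpha1.
have a2 : 0 < alpha + dl by lra.
have K1 : 1 <= 2 `^ (alpha + dl) :> R.
  by rewrite -[leLHS](powRr0 2); apply: ler_powR; rewrite ?ler1n// ltW.
have ft0 := rtail_gt0 t0; have ft1 := rtail_le1 t0.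
have ftV : 1 <= (rtail t0)^-1 by rewrite invf_ge1.
pose C := 2 `^ (alpha + dl) / rtail t0.
have C0 : 0 < C by rewrite divr_gt0// powR_gt0.
have CK : 2 `^ (alpha + dl) <= C by rewrite /C ler_peMr ?powR_ge0.
have powN (a x : R) : 0 < x -> (x / 2) `^ (- a) = 2 `^ a * x `^ (- a).
  move=> x0; rewrite powRM ?invr_ge0 ?(ltW x0)// mulrC; congr (_ * _).
  by rewrite -powR_inv1// -powRrM mulN1r opprK.
have anti (a x y : R) : 0 < a -> 0 < x -> x <= y -> y `^ (- a) <= x `^ (- a).
  move=> a0 x0 xy; have y0 : 0 < y by apply: lt_le_trans xy.
  rewrite !powRN lef_pV2 ?posrE ?powR_gt0//.
  by apply: ge0_ler_powR; rewrite ?nnegrE ?(ltW a0) ?(ltW x0) ?(ltW y0).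
(* the case [x < 1], [t0 <= x c] *)
have low (c x : R) : 0 < x -> x <= 1 -> t0 <= x * c -> rtail (x * c) <= 2 `^ (alpha + dl) * x `^ (- (alpha + dl)) * rtail c.
  move=> x0 x1 xc.
  have [k /andP[k1 k2]] : exists k : nat, 2 ^+ k <= x^-1 < 2 ^+ k.+1.
    by apply: pow2; rewrite invf_ge1.
  have c0 : 0 < c by rewrite -(pmulr_rgt0 _ x0); lra.
  have := down k.+1 _ xc; rewrite pow2R.
  have e1 : c <= 2 ^+ k.+1 * (x * c).
    rewrite mulrA; apply: ler_peMl; first exact: ltW.
    by rewrite -ler_pdivrMr// mul1r; exact: ltW.
  move=> /le_trans/(_ (rtail_noninc e1)); rewrite -ler_pdivlMl ?powR_gt0 ?exprn_gt0//.
  move=> /le_trans; apply; rewrite ler_wpM2r ?(ltW (rtail_gt0 _))//.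
  have -> : 2 `^ (alpha + dl) * x `^ (- (alpha + dl)) = (2 * x^-1) `^ (alpha + dl).
    rewrite powRM ?invr_ge0 ?(ltW x0)//; congr (_ * _).
    by rewrite -[in RHS]powR_inv1 ?(ltW x0)// -powRrM mulN1r.
  rewrite powRN invrK; apply: ge0_ler_powR; rewrite ?nnegrE ?(ltW a2) ?exprn_ge0//.
    by rewrite mulr_ge0// invr_ge0 ltW.
  by rewrite exprS ler_wpM2l.
exists t0, C; split=> // c x tc x0.
case: ifPn => [x1|]; last rewrite -ltNge => x1.
  have [xc|xc] := leP t0 (x * c).
    apply: le_trans (low _ _ x0 x1 xc) _.
    by rewrite ler_wpM2r ?(ltW (rtail_gt0 _))// ler_wpM2r ?powR_ge0.
  have c0 : 0 < c by lra.
  (* Below [t0] only [rtail <= 1] is used. The bound [low] at the factor [t0 / c], where the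
     argument is [t0] itself, shows that the right-hand side is at least 1, since [x < t0 / c]. *)
  have y0 : 0 < t0 / c by rewrite divr_gt0//; lra.
  have y1 : t0 / c <= 1 by rewrite ler_pdivrMr// mul1r.
  have := low c _ y0 y1; rewrite divfK ?gt_eqF// => /(_ (lexx _)) h.
  apply: le_trans (rtail_le1 _) _.
  rewrite /C (mulrC _ (rtail t0)^-1) -!mulrA ler_pdivlMl// mulr1 mulrA.
  apply: le_trans h _; rewrite ler_wpM2r ?(ltW (rtail_gt0 _))// ler_wpM2l ?powR_ge0//.
  by apply: anti => //; rewrite ler_pdivlMr// ltW.
have [k /andP[k1 k2]] := pow2 (ltW x1).
have e1 : 2 ^+ k * c <= x * c by rewrite ler_wpM2r//; lra.
apply: le_trans (rtail_noninc e1) _; apply: le_trans (up k _ tc) _.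
rewrite ler_wpM2r ?(ltW (rtail_gt0 _))// pow2R.
apply: (@le_trans _ _ (2 `^ (alpha - dl) * x `^ (- (alpha - dl)))).
  rewrite -powN//; apply: anti => //; first by rewrite divr_gt0.
  by rewrite ler_pdivrMr// -exprSr ltW.
rewrite ler_wpM2r ?powR_ge0//; apply: le_trans CK.
by apply: ler_powR; rewrite ?ler1n//; lra.
Qed.

End potter.

(** The Potter bound at the fixed scale [t0], with exponent [r = (alpha + 1) / 2]. That [r] exceeds
    1 is what puts the quantile below linear order. *)
Lemma rtail_decay : exists r C t1 : R, [/\ 1 < r, 0 < t1 &
  forall t, t1 <= t -> rtail t <= C * t `^ (- r)].
Proof.
have h1 := alpha1.
have dl0 : 0 < (alpha - 1) / 2 by lra.
have dl1 : 0 < alpha - (alpha - 1) / 2 by lra.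
have [t0 [C [t01 C0 H]]] := potter dl0 dl1.
have t00 : 0 < t0 by lra.
exists (alpha - (alpha - 1) / 2), (C * t0 `^ (alpha - (alpha - 1) / 2)), (2 * t0).
split; [lra|lra|move=> t tt].
have x0 : 0 < t / t0 by rewrite divr_gt0//; lra.
have := H t0 (t / t0) (lexx _) x0; rewrite divfK ?gt_eqF//.
have -> : (t / t0 <= 1) = false.
  by apply: negbTE; rewrite -ltNge ltr_pdivlMr// mul1r; lra.
move=> /le_trans; apply; rewrite -[leRHS]mulr1; apply: ler_pM => //.
- by rewrite mulr_ge0 ?powR_ge0// ltW.
- exact/ltW/rtail_gt0.
- rewrite -mulrA ler_wpM2l ?(ltW C0)// powRM; [|lra|by rewrite invr_ge0; lra].
  rewrite mulrC ler_wpM2r ?powR_ge0//.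
  by rewrite -powR_inv1 ?(ltW t00)// -powRrM mulN1r opprK.
- exact: rtail_le1.
Qed.

(** The normalisation [c_n], that is [n^(1/alpha)] times [ell n]; see [ell_quantile]. *)
Definition quantile n : R := inf [set t : R | 0 < t /\ rtail t < n%:R^-1].

Let lbS n : has_lbound [set t : R | 0 < t /\ rtail t < n%:R^-1].
Proof. by exists 0 => t [/ltW]. Qed.

Lemma linear_rtail_small (e : R) : 0 < e -> \forall n \near \oo, rtail (e * n%:R) < n%:R^-1.
Proof.
move=> e0; have [r [C [t1 [r1 t10 H]]]] := rtail_decay.
have L : (fun x : R => C * (e `^ (- r)) * x `^ (- (r - 1))) @ +oo%R --> (0 : R).
  rewrite -(mulr0 (C * (e `^ (- r)))); apply: cvgM; first exact: cvg_cst.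
  by apply: powR_cvgy0; lra.
have LN : C * (e `^ (- r)) * n%:R `^ (- (r - 1)) @[n --> \oo] --> (0 : R).
  exact: (cvg_comp _ _ (@cvgr_idn R) L).
near=> n.
have n0 : 0 < n%:R :> R by rewrite ltr0n; near: n; exact: nbhs_infty_gt.
apply: le_lt_trans (H _ _) _.
  rewrite mulrC -ler_pdivrMr//; near: n; exact: nbhs_infty_ger.
rewrite powRM ?(ltW e0) ?(ltW n0)// mulrA.
have -> : n%:R `^ (- r) = n%:R `^ (- (r - 1)) * n%:R^-1 :> R.
  rewrite -[X in _ * X]powR_inv1 ?(ltW n0)// -powRD; first by congr (_ `^ _); lra.
  by rewrite (gt_eqF n0) implybT.
rewrite mulrA -[ltRHS]mul1r ltr_pM2r ?invr_gt0//.
near: n; exact: (cvgr_lt _ LN _ ltr01).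
Unshelve. all: by end_near. Qed.

Let nonempty : \forall n \near \oo, exists t : R, 0 < t /\ rtail t < n%:R^-1.
Proof.
near=> n; exists (1 * n%:R); split.
  by rewrite mul1r ltr0n; near: n; exact: nbhs_infty_gt.
near: n; exact: linear_rtail_small.
Unshelve. all: by end_near. Qed.

Lemma quantile_littleo : quantile n / n%:R @[n --> \oo] --> (0 : R).
Proof.
apply/cvgrPdist_le => e e0; near=> n.
have n0 : 0 < n%:R :> R by rewrite ltr0n; near: n; exact: nbhs_infty_gt.
have c0 : 0 <= quantile n.
  apply: lb_le_inf; last by move=> t [/ltW].
  near: n; exact: nonempty.
rewrite sub0r normrN ger0_norm ?divr_ge0// ler_pdivrMr//.
apply: ge_inf; first exact: lbS.
split; first by rewrite mulr_gt0.
near: n; exact: linear_rtail_small.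
Unshelve. all: by end_near. Qed.

Lemma quantile_ge (A : R) : \forall n \near \oo, A <= quantile n.
Proof.
near=> n; apply: lb_le_inf; first by near: n; exact: nonempty.
move=> t [t0 tn]; rewrite leNgt; apply/negP => /ltW/rtail_noninc At.
have := le_lt_trans At tn; apply/negP; rewrite -leNgt invf_ple ?posrE ?rtail_gt0//; last first.
  by rewrite ltr0n; near: n; exact: nbhs_infty_gt.
near: n; exact: nbhs_infty_ger.
Unshelve. all: by end_near. Qed.

Lemma quantile_cvgy : quantile n @[n --> \oo] --> +oo.
Proof. by apply/cvgryPge => A; exact: quantile_ge. Qed.

(** The tail is a step function and may jump at the quantile, so only factors strictly above 1
    (here) or below 1 (next) are usable; regular variation then closes the gap. *)
Lemma rtail_quantile_lt (x : R) : 1 < x -> \forall n \near \oo, n%:R * rtail (x * quantile n) < 1.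
Proof.
move=> x1; near=> n.
have n0 : 0 < n%:R :> R by rewrite ltr0n; near: n; exact: nbhs_infty_gt.
have c0 : 0 < quantile n.
  by apply: lt_le_trans ltr01 _; near: n; exact: quantile_ge.
have [t [t0 tn] tx] : exists2 t : R, 0 < t /\ rtail t < n%:R^-1 & t < x * quantile n.
  apply: inf_lt; last by rewrite ltr_pMl.
  near: n; exact: nonempty.
rewrite mulrC -ltr_pdivlMr// mul1r; apply: le_lt_trans tn.
exact/rtail_noninc/ltW.
Unshelve. all: by end_near. Qed.

Lemma rtail_quantile_ge (x : R) : 0 < x < 1 -> \forall n \near \oo, 1 <= n%:R * rtail (x * quantile n).
Proof.
move=> /andP[x0 x1]; near=> n.
have n0 : 0 < n%:R :> R by rewrite ltr0n; near: n; exact: nbhs_infty_gt.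
have c0 : 0 < quantile n.
  by apply: lt_le_trans ltr01 _; near: n; exact: quantile_ge.
rewrite mulrC -ler_pdivrMr// mul1r leNgt; apply/negP => h.
have : quantile n <= x * quantile n.
  by apply: ge_inf; [exact: lbS|split=> //; rewrite mulr_gt0].
by apply/negP; rewrite -ltNge gtr_pMl.
Unshelve. all: by end_near. Qed.

(** * Tails that differ from [rtail] by a shift of at most one unit *)

Section sandwich.
Variable G : R -> R.
Hypothesis G_ge : forall t, 0 <= t -> rtail t <= G t.
Hypothesis G_le : forall t, 0 <= t -> G t <= f (Num.truncn t).

Let ratio_q (x s : R) : 0 < x -> 0 < s ->
  rtail (x * quantile n) / rtail (s * quantile n) @[n --> \oo] --> (x / s) `^ (- alpha).
Proof.
move=> x0 s0.
have sq : s * quantile n @[n --> \oo] --> +oo.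
  apply/cvgryPge => A; near=> n; rewrite mulrC -ler_pdivrMr//.
  near: n; exact: quantile_ge.
have := cvg_comp _ _ sq (rtail_regular (divr_gt0 x0 s0)).
apply: cvg_trans; apply: near_eq_cvg; near=> n => /=.
by rewrite mulrA divfK ?gt_eqF.
Unshelve. all: by end_near. Qed.

Let powR_near1 (x e : R) : 0 < x -> 0 < e -> exists s : R, [/\ 1 < s,
   (x / s / s) `^ (- alpha) < x `^ (- alpha) + e & x `^ (- alpha) - e < (x * s) `^ (- alpha)].
Proof.
move=> x0 e0.
have [dl dl0 H] := powR_continuous x0 e0.
pose h := Num.min (dl / (4 * x)) (1/2).
have h0 : 0 < h by rewrite lt_min divr_gt0 ?mulr_gt0//; lra.
have hdl : h * x * 4 <= dl.
  have : h <= dl / (4 * x) by rewrite ge_min lexx.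
  rewrite ler_pdivlMr ?mulr_gt0//; lra.
have h2 : h <= 1 / 2 by rewrite ge_min lexx orbT.
have hx : 0 < h * x by rewrite mulr_gt0.
exists (1 + h); split; first by lra.
- have := H (x / (1 + h) / (1 + h)); rewrite !ltr_norml => /(_ _)/andP; case; last by move=> ? ?; lra.
  have p1 : x / (1 + h) / (1 + h) <= x.
    by rewrite !ler_pdivrMr; [nra|lra|lra].
  have p2 : x - 2 * h * x <= x / (1 + h) / (1 + h).
    rewrite !ler_pdivlMr; [|lra|lra].
    have : x * (1 - 2 * h) * (1 + h) * (1 + h) = x * (1 - 3 * h ^+ 2 - 2 * h ^+ 3) by ring.
    have q1 : 0 <= h ^+ 2 by rewrite sqr_ge0.
    have q2 : 0 <= h ^+ 3 by rewrite exprn_ge0// ltW.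
    nra.
  by apply/andP; split; lra.
- have := H (x * (1 + h)); rewrite !ltr_norml => /(_ _)/andP; case; last by move=> ? ?; lra.
  by apply/andP; split; lra.
Qed.

(** With [s] slightly above 1, the unit shift between [rtail] and [G] is smaller than
    [(x - x / s) * quantile n] for large [n], and comparing with the quantile at the factors [s] and
    [1 / s] gives limits within [e] of [x^(- alpha)]. *)
Lemma tail_quantile_cvg (x : R) : 0 < x ->
  n%:R * G (x * quantile n) @[n --> \oo] --> x `^ (- alpha).
Proof.
move=> x0; apply/cvgrPdist_le => e e0.
have e20 : 0 < e / 2 by lra.
have [s [s1 su sl]] := powR_near1 x0 e20.
have s0 : 0 < s by lra.
have U1 := ratio_q (divr_gt0 x0 s0) s0.
have L1 := ratio_q x0 (divr_gt0 ltr01 s0).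
rewrite div1r invrK in L1.
have U2 : \forall n \near \oo, n%:R * rtail (s * quantile n) < 1 by exact: rtail_quantile_lt.
have L2 : \forall n \near \oo, 1 <= n%:R * rtail (s^-1 * quantile n).
  by apply: rtail_quantile_ge; rewrite invr_gt0 s0 invf_lt1.
near=> n.
have n0 : 0 < n%:R :> R by rewrite ltr0n; near: n; exact: nbhs_infty_gt.
have c0 : 0 < quantile n.
  by apply: lt_le_trans ltr01 _; near: n; exact: quantile_ge.
have xc0 : 0 <= x * quantile n by rewrite mulr_ge0 ?ltW.
have A1 : rtail (x / s * quantile n) / rtail (s * quantile n) < x `^ (- alpha) + e.
  near: n; apply: (cvgr_lt _ U1); lra.
have A2 : x `^ (- alpha) - e < rtail (x * quantile n) / rtail (s^-1 * quantile n).
  near: n; apply: (cvgr_gt _ L1); lra.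
have B1 : n%:R * rtail (s * quantile n) < 1 by near: n.
have B2 : 1 <= n%:R * rtail (s^-1 * quantile n) by near: n.
have G1 : G (x * quantile n) <= rtail (x / s * quantile n).
  apply: le_trans (G_le xc0) _; apply: f_noninc.
  have xsc : 0 <= x / s * quantile n by rewrite !mulr_ge0 ?invr_ge0 ?ltW.
  rewrite -ltnS -(ltr_nat R).
  apply: le_lt_trans _ (truncnS_gt (x * quantile n)); rewrite -natr1.
  have /truncn_itv/andP[h1 _] := xsc.
  apply: le_trans (_ : x / s * quantile n + 1 <= _); first by rewrite lerD2r.
  have -> : x * quantile n = x / s * quantile n + (x - x / s) * quantile n by ring.
  have xs0 : 0 < x - x / s by rewrite subr_gt0 ltr_pdivrMr// ltr_pMr.
  rewrite lerD2l mulrC -ler_pdivrMr//; near: n; exact: quantile_ge.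
have G2 := G_ge xc0.
have t1 := rtail_gt0 (s * quantile n); have t2 := rtail_gt0 (s^-1 * quantile n).
have t3 := rtail_gt0 (x / s * quantile n); have t4 := rtail_gt0 (x * quantile n).
rewrite ler_norml; apply/andP; split.
- rewrite lerNl opprB lerBlDr addrC.
  apply: le_trans (ltW A1).
  apply: le_trans (_ : n%:R * rtail (x / s * quantile n) <= _); first by rewrite ler_pM2l.
  rewrite ler_pdivlMr// mulrAC -[leRHS]mul1r ler_pM2r//; exact: ltW.
- rewrite lerBlDr -lerBlDl.
  apply: le_trans (ltW A2) _.
  apply: le_trans (_ : n%:R * rtail (x * quantile n) <= _); last by rewrite ler_pM2l.
  by rewrite ler_pdivrMr// mulrAC -[leLHS]mul1r ler_pM2r.
Unshelve. all: by end_near. Qed.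

Hypothesis alpha2 : alpha < 2.

(** The Potter bound is applied at the scale [2 * quantile n], where [n * rtail < 1] is available,
    with [dl] so small that [alpha - dl > 1] and [alpha + dl < 2]. The factor [4^p] comes from
    [x * c / 2 = (x / 4) * (2 * c)]. *)
Lemma tail_quantile_bound : exists p r C : R, [/\ 1 < r, r <= p, p < 2, 0 <= C &
  \forall n \near \oo, forall x : R, 0 < x ->
    n%:R * G (x * quantile n) <= C * (x `^ (- p) + x `^ (- r))].
Proof.
have h1 := alpha1; have h2 := alpha2.
pose dl : R := Num.min (alpha - 1) (2 - alpha) / 2.
have dlb : [/\ 0 < dl, dl < alpha - 1 & dl < 2 - alpha].
  have m0 : 0 < Num.min (alpha - 1) (2 - alpha) by rewrite lt_min; apply/andP; split; lra.
  have m1 : Num.min (alpha - 1) (2 - alpha) <= alpha - 1 by rewrite ge_min lexx.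
  have m2 : Num.min (alpha - 1) (2 - alpha) <= 2 - alpha by rewrite ge_min lexx orbT.
  by rewrite /dl; split; lra.
have [dl0 dl1 dl2] := dlb.
have dl3 : 0 < alpha - dl by lra.
have [t0 [C [t01 C0 H]]] := potter dl0 dl3.
pose p := alpha + dl; pose r := alpha - dl.
have f1 := f_gt0 1.
exists p, r, ((f 1)^-1 * (C * 4 `^ p)); split.
- by rewrite /r; lra.
- by rewrite /r /p; lra.
- by rewrite /p; lra.
- by rewrite mulr_ge0 ?invr_ge0 ?(ltW f1)// mulr_ge0 ?powR_ge0// ltW.
have P2 : 1 < 2 :> R by rewrite ltr1n.
near=> n => x x0.
have n0 : 0 < n%:R :> R by rewrite ltr0n; near: n; exact: nbhs_infty_gt.
have c0 : t0 <= quantile n by near: n; exact: quantile_ge.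
have xc0 : 0 <= x * quantile n by rewrite mulr_ge0 ?(ltW x0)//; lra.
have B1 : n%:R * rtail (2 * quantile n) < 1 by near: n; exact: rtail_quantile_lt.
(* Halving the argument absorbs the unit shift once it is at least 2; below 2 the halved tail is at
   least [f 1] and the left side at most 1. *)
have G1 : G (x * quantile n) <= (f 1)^-1 * rtail (x * quantile n / 2).
  apply: le_trans (G_le xc0) _; rewrite ler_pdivlMl//.
  have [t2|t2] := ltP (x * quantile n) (2 : R).
    apply: le_trans (_ : f 1 * 1 <= _); first by rewrite ler_pM2l.
    rewrite mulr1; apply: f_noninc; rewrite ltnS truncn_le_nat.
    by rewrite ltr_pdivrMr// mul1r.
  apply: le_trans (_ : 1 * f (Num.truncn (x * quantile n)) <= _).
    by rewrite ler_pM2r.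
  rewrite mul1r; apply: f_noninc; rewrite -ltnS -(ltr_nat R).
  apply: le_lt_trans _ (truncnS_gt (x * quantile n)); rewrite -natr1.
  have xc2 : 0 <= x * quantile n / 2 by lra.
  by have /truncn_itv/andP[k1 _] := xc2; lra.
have K : rtail (x * quantile n / 2) <= C * 4 `^ p * (x `^ (- p) + x `^ (- r)) * rtail (2 * quantile n).
  have -> : x * quantile n / 2 = x / 4 * (2 * quantile n) by lra.
  apply: le_trans (H _ _ _ _) _; [lra|by rewrite divr_gt0|].
  rewrite ler_wpM2r ?(ltW (rtail_gt0 _))// -!mulrA ler_wpM2l ?(ltW C0)//.
  have N4 (a : R) : (x / 4) `^ (- a) = 4 `^ a * x `^ (- a).
    rewrite powRM ?invr_ge0 ?(ltW x0)// mulrC; congr (_ * _).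
    by rewrite -powR_inv1// -powRrM mulN1r opprK.
  case: ifP => _; rewrite N4.
    by rewrite ler_wpM2l ?powR_ge0// lerDl powR_ge0.
  apply: ler_pM; rewrite ?powR_ge0//; last by rewrite lerDr powR_ge0.
  by apply: ler_powR; [rewrite ler1n|rewrite /p; lra].
apply: le_trans (_ : n%:R * ((f 1)^-1 * (C * 4 `^ p * (x `^ (- p) + x `^ (- r)) * rtail (2 * quantile n))) <= _).
  rewrite ler_pM2l//; apply: le_trans G1 _; rewrite ler_wpM2l// invr_ge0 ltW//.
set u := x `^ (- p) + x `^ (- r).
have u0 : 0 <= u by rewrite addr_ge0 ?powR_ge0.
have -> : n%:R * ((f 1)^-1 * (C * 4 `^ p * u * rtail (2 * quantile n))) =
  (f 1)^-1 * (C * 4 `^ p) * u * (n%:R * rtail (2 * quantile n)) by ring.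
rewrite -[leRHS]mulr1; apply: ler_wpM2l; last exact: ltW.
by rewrite !mulr_ge0 ?invr_ge0 ?powR_ge0 ?(ltW f1) ?(ltW C0).
Unshelve. all: by end_near. Qed.

End sandwich.

End regular_variation.

(** * Heavy tails and shot characteristic functions *)

Section heavy_tails.
Context {d} {T : measurableType d} {R : realType} (P : probability T R).

Definition tail (tau : T -> nat) (t : R) : R := Ex P (fun w => (t < (tau w)%:R)%R%:R).

Lemma measurable_natr (tau : T -> nat) : measurable_fun setT tau ->
  measurable_fun setT (fun w => (tau w)%:R : R).
Proof. by move=> mt; apply: (@measurableT_comp _ _ _ _ _ _ (fun n : nat => n%:R : R)). Qed.

Lemma measurable_boolr (b : T -> bool) : measurable_fun setT b ->
  measurable_fun setT (fun w => (b w)%:R : R).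
Proof. by move=> mb; apply: (@measurableT_comp _ _ _ _ _ _ (fun n : bool => n%:R : R)). Qed.

Lemma tailE tau t : measurable_fun setT tau ->
  tail tau t = fine (P [set w | t < (tau w)%:R]).
Proof.
move=> mt; rewrite -Ex_indic; last first.
  rewrite -[X in measurable X]setTI.
  by apply: (measurable_fun_ltr (measurable_cst t) (measurable_natr mt)) => //; exact: measurableT.
by apply: eq_Ex => w; rewrite indicE mem_setE.
Qed.

(** Together with [ell_quantile], all that the limit theorem retains of slow variation: [c] diverges
    but is negligible against [n], the rescaled tails converge, and they are dominated with
    exponents inside []1, 2[]. *)
Definition heavy_tail (tau : T -> nat) (alpha : R) (c : nat -> R) : Prop :=
  [/\ c n @[n --> \oo] --> +oo, c n / n%:R @[n --> \oo] --> (0 : R),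
      (forall x : R, 0 < x -> n%:R * tail tau (x * c n) @[n --> \oo] --> x `^ (- alpha)) &
      exists p r C : R, [/\ 1 < r, r <= p, p < 2, 0 <= C &
        \forall n \near \oo, forall x : R, 0 < x ->
          n%:R * tail tau (x * c n) <= C * (x `^ (- p) + x `^ (- r))]].

Section regularly_varying.
Variables (U : T -> nat) (L : R -> R) (alpha : R).
Hypothesis mU : measurable_fun setT U.
Hypothesis alpha12 : 1 < alpha < 2.
Hypothesis svL : slowly_varying L.
Hypothesis UL : forall n : nat, (1 <= n)%N ->
  fine (P [set w | (n <= U w)%N]) = L n%:R * n%:R `^ (- alpha).

Let f n := fine (P [set w | (n <= U w)%N]).

Let mset (A : set nat) : measurable (U @^-1` A).
Proof. by rewrite -[X in measurable X]setTI; exact: mU. Qed.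

Let f_le1 n : f n <= 1.
Proof.
by rewrite -lee_fin fineK ?probability_le1 ?fin_num_measure//; exact: (mset [set k | (n <= k)%N]).
Qed.

Let f_noninc m n : (m <= n)%N -> f n <= f m.
Proof.
move=> mn; rewrite fine_le ?fin_num_measure//;
  [exact: (mset [set k | (n <= k)%N])|exact: (mset [set k | (m <= k)%N])|].
apply: le_measure; rewrite ?inE;
  [exact: (mset [set k | (n <= k)%N])|exact: (mset [set k | (m <= k)%N])|].
by move=> w /=; exact: leq_trans.
Qed.

Let L_ratio (k : nat) : (0 < k)%N -> L (k%:R * n%:R) / L n%:R @[n --> \oo] --> (1 : R).
Proof.
move=> k0; have k0' : 0 < k%:R :> R by rewrite ltr0n.
exact: (cvg_comp _ _ (@cvgr_idn R) (svL.2 _ k0')).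
Qed.

(** The quotient by 0 is 0, so a ratio of values of [L] that tends to 1 forces [L n] to be non-zero
    for large [n]. Monotonicity then makes every [f n] positive. *)
Let f_neq0 : \forall n \near \oo, f n != 0.
Proof.
near=> n; have n1 : (1 <= n)%N by near: n; exact: nbhs_infty_gt.
rewrite /f UL// mulf_neq0//; last by rewrite gt_eqF// powR_gt0// ltr0n.
have : 0 < L (2%:R * n%:R) / L n%:R by near: n; exact: (cvgr_gt _ (L_ratio (ltn0Sn 1)) _ ltr01).
by apply: contraTneq => ->; rewrite invr0 mulr0 ltxx.
Unshelve. all: by end_near. Qed.

Let f_gt0 n : 0 < f n.
Proof.
have [N _ H] := f_neq0.
have h := H (maxn N n) (leq_maxl N n).
apply: (@lt_le_trans _ _ (f (maxn N n))); last exact/f_noninc/leq_maxr.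
by rewrite lt_neqAle eq_sym h fine_ge0.
Qed.

Let f_scale k : (0 < k)%N -> f (k * n)%N / f n @[n --> \oo] --> k%:R `^ (- alpha).
Proof.
move=> k0; rewrite -[X in _ --> X]mul1r.
have H : L (k%:R * n%:R) / L n%:R * k%:R `^ (- alpha) @[n --> \oo] --> 1 * k%:R `^ (- alpha).
  by apply: cvgM; [exact: L_ratio|exact: cvg_cst].
apply: cvg_trans H; apply: near_eq_cvg; near=> n.
have n1 : (1 <= n)%N by near: n; exact: nbhs_infty_gt.
have : f n != 0 by near: n.
have fE m : (0 < m)%N -> f m = L m%:R * m%:R `^ (- alpha) := @UL m.
rewrite !fE ?muln_gt0 ?k0// natrM powRM// mulf_eq0 negb_or => /andP[l0 p0].
by field; rewrite l0 p0.
Unshelve. all: by end_near. Qed.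

Let U_rtail t : 0 <= t -> tail U t = rtail f t.
Proof.
move=> t0; rewrite tailE// /rtail /f; congr (fine (P _)).
by apply/seteqP; split => w /=; rewrite truncn_lt_nat.
Qed.

Lemma ell_quantile n : (0 < n)%N ->
  (ell P U alpha n)^-1 * n%:R `^ (- alpha^-1) = (quantile f n)^-1.
Proof.
move=> n0; have a0 : n%:R `^ (- alpha^-1) != 0 :> R by rewrite gt_eqF// powR_gt0// ltr0n.
rewrite /ell invfM mulrAC mulVf// mul1r /quantile; congr (inf _)^-1.
by apply/seteqP; split => t /= [t0]; rewrite -tailE// U_rtail// ltW.
Qed.

(** The shift [r = 0] serves the renewal lengths, [r = 1] Parke's windows, which contain [N + 1]
    times; the normalisation is the quantile of [U] in both cases. *)
Lemma heavy_tail_slowly_varying r : (r <= 1)%N ->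
  heavy_tail (fun w => U w + r)%N alpha (quantile f).
Proof.
move=> r1; have /andP[a1 a2] := alpha12.
have mUr : measurable_fun setT (fun w => U w + r)%N.
  by apply: (@measurableT_comp _ _ _ _ _ _ (fun n : nat => (n + r)%N)).
have G_ge t : 0 <= t -> rtail f t <= tail (fun w => U w + r)%N t.
  move=> t0; rewrite -U_rtail//; apply: le_Ex => [||w].
  - apply: (@integ_bounded _ _ _ _ 1) => [|w]; last by case: (_ < _); rewrite ?normr1 ?normr0.
    by apply/measurable_boolr/measurable_fun_ltr => //; exact: measurable_natr.
  - apply: (@integ_bounded _ _ _ _ 1) => [|w]; last by case: (_ < _); rewrite ?normr1 ?normr0.
    by apply/measurable_boolr/measurable_fun_ltr => //; exact: measurable_natr.
  - have [h|_] := ltP t (U w)%:R; last exact: ler0n.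
    by rewrite (lt_le_trans h)// ler_nat leq_addr.
have G_le t : 0 <= t -> tail (fun w => U w + r)%N t <= f (Num.truncn t).
  move=> t0; rewrite tailE//.
  have mG : measurable [set w | t < (U w + r)%:R] := mset [set k | t < (k + r)%:R].
  rewrite fine_le ?fin_num_measure//; first exact: (mset [set k | (Num.truncn t <= k)%N]).
  apply: le_measure; rewrite ?inE//; first exact: (mset [set k | (Num.truncn t <= k)%N]).
  move=> w /=; rewrite -truncn_lt_nat// => h.
  by rewrite -ltnS; apply: leq_trans h _; rewrite -addn1 leq_add2l.
split.
- by apply: (@quantile_cvgy _ f alpha).
- by apply: (@quantile_littleo _ f alpha).
- by move=> x x0; apply: (@tail_quantile_cvg _ f alpha).
- by apply: (@tail_quantile_bound _ f alpha).
Qed.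

End regularly_varying.

End heavy_tails.

Section envelope_facts.
Context {R : realType}.
Notation mu := (@lebesgue_measure R).

Lemma le_envelope_integrable (p r C : R) (f : R -> R) : p < 2 -> 1 < r ->
  measurable_fun (pos_half : set (measurableTypeR R)) f ->
  (forall x, 0 < x -> `|f x| <= C * envelope p r x) ->
  mu.-integrable pos_half (EFin \o f).
Proof.
move=> p2 r1 mf fC; have := integrableZl measurable_pos_half C (envelope_integrable p2 r1).
apply: le_integrable; first exact: measurable_pos_half.
  exact/measurable_EFinP.
move=> x; rewrite /pos_half/= in_itv/= andbT => x0; rewrite lee_fin.
by apply: le_trans (fC _ x0) (ler_norm _).
Qed.

Lemma minr1_envelope (p r x : R) : 1 < r -> r <= p -> 0 < x ->
  Num.min 1 x * (x `^ (- p) + x `^ (- r)) <= 2 * envelope p r x.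
Proof.
move=> r1 rp x0; rewrite /envelope.
have h (a b : R) : x `^ a * x `^ b = x `^ (a + b) by rewrite powRD// (gt_eqF x0) implybT.
have [x1|x1] := leP (x : R) 1.
  rewrite mulrDr.
  rewrite -[X in X * _ + _](powRr1 (ltW x0)) -[X in _ + X * _](powRr1 (ltW x0)) !h.
  have : x `^ (1 - r) <= x `^ (1 - p).
    have -> : 1 - r = (1 - p) + (p - r) by lra.
    rewrite -h -[leRHS]mulr1; apply: ler_wpM2l; first exact: powR_ge0.
    have := @ge0_ler_powR R (p - r) _ x 1; rewrite powR1; apply; rewrite ?nnegrE ?(ltW x0)//; lra.
  lra.
rewrite mul1r.
have : x `^ (- p) <= x `^ (- r) by apply: ler_powR; [exact: ltW|lra].
lra.
Qed.

(** The substitution is made on compact segments. Their images [[a / (n + 1), a * (n + 1)]] also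
    exhaust the half line, so both sides pass to the limit. *)
Lemma Rintegral_pos_half_scale (f : R -> R) (a : R) : 0 < a ->
  (forall x : R, 0 < x -> {for x, continuous f}) ->
  mu.-integrable pos_half (EFin \o f) ->
  mu.-integrable pos_half (EFin \o (fun x => f (a * x))) ->
  \int[mu]_(x in pos_half) f x = a * \int[mu]_(x in pos_half) f (a * x).
Proof.
move=> a0 cf fi fai.
pose lo (n : nat) : R := a * (n.+1%:R)^-1; pose hi (n : nat) : R := a * n.+1%:R.
pose J n : set R := `[lo n, hi n]%classic.
have mf : measurable_fun (pos_half : set (measurableTypeR R)) f.
  by apply/measurable_EFinP; case/integrableP : fi.
have L1 : \int[mu]_(x in pos_half) (f x * \1_(J n) x) @[n --> \oo] -->
    \int[mu]_(x in pos_half) f x.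
  apply: (@Rintegral_dominated_cvg _ _ _ mu pos_half _ _ (fun x => `|f x|)
    measurable_pos_half _ _ _ _).2.
  - move=> n; apply: measurable_funM => //.
    by apply: measurable_funTS; apply: measurable_indic; exact: measurable_itv.
  - move=> x; rewrite /pos_half/= in_itv/= andbT => x0.
    apply: cvg_near_cst; near=> n.
    rewrite indicE mem_set ?mulr1// /J/= in_itv/= /lo /hi; apply/andP; split.
      rewrite ler_pdivrMr ?ltr0n// -ler_pdivrMl//.
      apply: ltW; apply: lt_le_trans (truncnS_gt _) _; rewrite ler_nat ltnS.
      near: n; exact: nbhs_infty_ge.
    rewrite -ler_pdivrMl//.
    apply: ltW; apply: lt_le_trans (truncnS_gt _) _; rewrite ler_nat ltnS.
    near: n; exact: nbhs_infty_ge.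
  - exact: integrable_norm fi.
  - move=> n x _; rewrite normrM ler_piMr// indicE.
    by case: (_ \in _); rewrite ?normr1 ?normr0.
have L2 : a * \int[mu]_(x in `[(n.+1%:R)^-1, n.+1%:R]%classic) f (a * x) @[n --> \oo] -->
    a * \int[mu]_(x in pos_half) f (a * x).
  by apply: cvgM; [exact: cvg_cst|exact: (integral_segments fai)].
suff E n : \int[mu]_(x in pos_half) (f x * \1_(J n) x) =
    a * \int[mu]_(x in `[(n.+1%:R)^-1, n.+1%:R]%classic) f (a * x).
  move: L1; under eq_fun do rewrite E.
  by move=> L1; exact: (cvg_unique _ L1 L2).
have lo0 : 0 < lo n by rewrite mulr_gt0// invr_gt0.
have -> : \int[mu]_(x in pos_half) (f x * \1_(J n) x) = \int[mu]_(x in J n) f x.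
  have -> : J n = pos_half `&` J n.
    apply/seteqP; split => x; last by case.
    rewrite /J /pos_half/= !in_itv/= andbT => /andP[h1 h2]; split; last by rewrite h1.
    exact: lt_le_trans h1.
  rewrite Rintegral_mkcondr; apply: eq_Rintegral => x xp.
  rewrite patchE indicE in_setI xp /=.
  by case: (_ \in _); rewrite ?mulr1 ?mulr0.
have le1 : (n.+1%:R)^-1 <= n.+1%:R :> R.
  by apply: (@le_trans _ _ 1); rewrite ?invf_le1 ?ler1n.
have dF (x : R) : is_derive x 1 (fun x => a * x) a.
  by have := is_deriveZ a (is_derive_id x 1); rewrite scaler1.
have dE : (fun x : R => a * x)^`() = cst a.
  by apply/funext => x; rewrite derive1E; exact: derive_val.
have cl (x : R) : {for x, continuous (fun x => a * x)}.
  by apply: cvgM; [exact: cvg_cst|exact: cvg_id].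
rewrite /Rintegral.
have := @integration_by_substitution_increasing R (fun x => a * x) f (n.+1%:R)^-1 n.+1%:R le1.
move=> -> //.
- rewrite dE -[RHS]RintegralZl//.
    by congr fine; apply: eq_integral => x _ /=; rewrite mulrC.
  apply: integrableS fai; [exact: measurable_pos_half|exact: measurable_itv|].
  move=> x; rewrite /pos_half/= !in_itv/= andbT => /andP[h1 _].
  by apply: lt_le_trans h1; rewrite invr_gt0.
- by move=> x y _ _ xy; rewrite ltr_pM2l.
- by rewrite dE => x _; exact: cst_continuous.
- by rewrite dE; exact: is_cvg_cst.
- by rewrite dE; exact: is_cvg_cst.
- split; first by move=> x _; exact: ex_derive.
  + exact/cvg_at_right_filter/cl.
  + exact/cvg_at_left_filter/cl.
- apply: continuous_in_subspaceT => x; rewrite inE/= in_itv/= => /andP[h1 _].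
  exact/cf/(lt_le_trans lo0).
Unshelve. all: by end_near. Qed.

End envelope_facts.

Lemma Ex_measurable {d} {T : measurableType d} {d'} {S : measurableType d'}
    {R : realType} (P : probability T R) (f : T -> S -> R) :
  measurable_fun setT (fun z : T * S => f z.1 z.2) ->
  measurable_fun setT (fun x => Ex P (f ^~ x)).
Proof.
move=> mf; rewrite /Ex /Rintegral.
apply: (@measurableT_comp _ _ _ _ _ _ fine); first exact: fine_measurable.
under eq_fun do rewrite integralE.
have mF : measurable_fun setT (fun z : T * S => (f z.1 z.2)%:E) by exact/measurable_EFinP.
have H (g : T * S -> \bar R) : measurable_fun setT g -> (forall z, (0 <= g z)%E) ->
    measurable_fun setT (fun x => \int[P]_w g (w, x))%E.
  by move=> mg g0; exact: (@measurable_fun_fubini_tonelli_G _ _ T S R P g mg g0).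
apply: emeasurable_funB.
- rewrite (_ : (fun x => _) = fun x => (\int[P]_w (fun z : T * S => (f z.1 z.2)%:E)^\+ (w, x))%E).
    by apply: H => [|z]; [exact: measurable_funepos|exact: funepos_ge0].
  by apply/funext => x; apply: eq_integral => w _; rewrite !funeposE.
- rewrite (_ : (fun x => _) = fun x => (\int[P]_w (fun z : T * S => (f z.1 z.2)%:E)^\- (w, x))%E).
    by apply: H => [|z]; [exact: measurable_funeneg|exact: funeneg_ge0].
  by apply/funext => x; apply: eq_integral => w _; rewrite !funenegE.
Qed.

Lemma powR_le1Dsqr {R : realType} (a y : R) : 1 < a < 2 -> `|y| `^ a <= 1 + y ^+ 2.
Proof.
move=> /andP[a1 a2]; rewrite -(real_normK (num_real y)).
have y0 := normr_ge0 y; set z := `|y| in y0 *.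
have z2 : 0 <= z ^+ 2 by rewrite sqr_ge0.
have [z1|z1] := leP z (1 : R).
  have := @ge0_ler_powR R a _ z 1; rewrite powR1 => /(_ _ _ _ z1) h.
  have : z `^ a <= 1 by apply: h; rewrite ?nnegrE//; lra.
  lra.
have : z `^ a <= z `^ 2 by apply: ler_powR; lra.
by rewrite powR_mulrn//; lra.
Qed.

(** * Layer-cake formula for the mean of [K (eta * tau / c)], and its limit *)

Section layer_cake.
Context {R : realType}.
Notation mu := (@lebesgue_measure R).
Variables (h K : R -> R).
Hypothesis ch : continuous h.
Hypothesis h2 : forall y : R, `|h y| <= 2.
Hypothesis h1 : forall y : R, `|h y| <= `|y|.
Hypothesis dK : forall y : R, is_derive y 1 K (h y).
Hypothesis K0 : K 0 = 0.

Let measurable_h : measurable_fun setT h.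
Proof. exact: continuous_measurable_fun. Qed.

Let path_measurable (y b : R) : measurable_fun setT (fun x : R => y * h (y * x) * (x < b)%R%:R).
Proof.
apply: measurable_funM; last first.
  by apply/measurable_boolr/measurable_fun_ltr => //; exact: measurable_cst.
apply: measurable_funM; first exact: measurable_cst.
by apply: measurableT_comp => //; apply: measurable_funM => //; exact: measurable_cst.
Qed.

Let path_integrable (y b : R) :
  mu.-integrable pos_half (EFin \o (fun x => y * h (y * x) * (x < b)%R%:R)).
Proof.
apply: (@le_envelope_integrable _ 1 2 (`|y| * 2 * (1 + b ^+ 2))); [lra|lra| |].
  by apply: measurable_funTS; exact: path_measurable.
move=> x x0; rewrite !normrM -!mulrA; apply: ler_wpM2l => //.
apply: ler_pM => //; rewrite /envelope.
have b0 : 0 <= b ^+ 2 by rewrite sqr_ge0.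
have [xb|xb] := ltP x b; last by rewrite normr0 mulr_ge0 ?addr_ge0//; case: ifP; rewrite powR_ge0.
rewrite normr1; have [x1|x1] := leP (x : R) 1.
  by rewrite subrr powRr0; lra.
rewrite powRN -ler_pdivrMr ?invr_gt0 ?powR_gt0// invrK mul1r.
rewrite -(natr1 1) -[1 + 1]/(2%:R) powR_mulrn ?(ltW x0)//.
have : x ^+ 2 <= b ^+ 2 by apply: lerXn2r; rewrite ?nnegrE ?(ltW x0)//; lra.
lra.
Qed.

(** [K (y * b)] as the integral of its derivative in [b]. The upper limit [b] is put into an
    indicator so that a random [b] can be averaged under the integral. *)
Let path_integral (y b : R) : 0 <= b ->
  \int[mu]_(x in pos_half) (y * h (y * x) * (x < b)%R%:R) = K (y * b).
Proof.
rewrite le_eqVlt => /predU1P[<-|b0].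
  rewrite mulr0 K0 /Rintegral integral0_eq// => x.
  rewrite /pos_half/= in_itv/= andbT => /ltW x0.
  by rewrite ltNge x0 mulr0.
pose F x := K (y * x); pose f x := y * h (y * x).
have dF (x : R) : is_derive x 1 F (f x).
  have dl : is_derive x 1 (fun x => y * x) y.
    by have := is_deriveZ y (is_derive_id x 1); rewrite scaler1.
  have := @is_derive1_comp _ K (fun x => y * x) x _ _ (dK _) dl.
  by rewrite mulrC.
have cf : continuous f.
  move=> x; apply: cvgM; first exact: cvg_cst.
  apply: (@continuous_comp _ _ _ (fun x => y * x) h); last exact: ch.
  by apply: cvgM; [exact: cvg_cst|exact: cvg_id].
have cF (x : R) : {for x, continuous F}.
  by have /derivable1_diffP/differentiable_continuous := @ex_derive _ _ _ _ _ _ _ (dF x).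
have E : (\int[mu]_(x in `[0%R, b]%classic) (f x)%:E = (F b)%:E - (F 0)%:E)%E.
  apply: (@continuous_FTC2 _ f F) => //.
  - exact: continuous_subspaceT.
  - split; first by move=> x _; exact: ex_derive.
    + exact/cvg_at_right_filter/cF.
    + exact/cvg_at_left_filter/cF.
  - by move=> x _; rewrite derive1E; exact: derive_val.
rewrite /Rintegral; transitivity (fine (\int[mu]_(x in `[(0:R), b]%classic) (f x)%:E)); last first.
  by rewrite E /F mulr0 K0 /= subr0.
congr fine; have mf A : measurable_fun A (EFin \o f).
  have m : measurable_fun setT f := continuous_measurable_fun cf.
  by apply: measurable_funTS; exact/measurable_EFinP.
rewrite -integral_itv_obnd_cbnd// -integral_itv_bndo_bndc//.
have -> : `]0, b[%classic = pos_half `&` [set x | x < b].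
  apply/seteqP; split => x; rewrite /pos_half/= !in_itv/= andbT; first by move=> /andP[].
  by move=> [-> ->].
rewrite [RHS]integral_mkcondr; apply: eq_integral => x _.
rewrite patchE; have [xb|xb] := ltP (x : R) b.
  by rewrite mem_set//= /f mulr1.
by rewrite memNset ?mulr0//=; apply/negP; rewrite -leNgt.
Qed.

Context {d} {T : measurableType d} (P : probability T R).
Variables (eta : T -> R) (tau : T -> nat).
Hypothesis meta : measurable_fun setT eta.
Hypothesis mtau : measurable_fun setT tau.
Hypothesis eta_tau : forall A B, measurable A -> measurable B ->
  P (eta @^-1` A `&` tau @^-1` B) = (P (eta @^-1` A) * P (tau @^-1` B))%E.
Hypothesis ieta2 : integ P (fun w => eta w ^+ 2).

Let ieta : integ P eta.
Proof.
apply: (@le_integ _ _ _ _ (fun w => 1 + eta w ^+ 2)) => // [w|].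
  have := sqr_ge0 (`|eta w| - 1); rewrite sqrrB1 -(real_normK (num_real (eta w))).
  have := normr_ge0 (eta w); lra.
by apply: integD => //; exact: integ_cst.
Qed.

Let M := Ex P (fun w => 2 * `|eta w| + eta w ^+ 2).

Let iM : integ P (fun w => 2 * `|eta w| + eta w ^+ 2).
Proof. by apply: integD => //; apply: integZ; exact: integ_norm. Qed.

Let k x := Ex P (fun w => eta w * h (eta w * x)).

Let mk x : measurable_fun setT (fun w => eta w * h (eta w * x)).
Proof.
apply: measurable_funM => //; apply: measurableT_comp => //.
by apply: measurable_funM => //; exact: measurable_cst.
Qed.

Let kbound x w : 0 < x -> `|eta w * h (eta w * x)| <= Num.min 1 x * (2 * `|eta w| + eta w ^+ 2).
Proof.
move=> x0; rewrite normrM -(real_normK (num_real (eta w))).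
have := h1 (eta w * x); have := h2 (eta w * x); rewrite normrM (gtr0_norm x0).
have e0 := normr_ge0 (eta w).
have [x1|x1] := leP (x : R) 1.
  by nra.
by nra.
Qed.

Let ik x : 0 < x -> integ P (fun w => eta w * h (eta w * x)).
Proof.
by move=> x0; apply: le_integ (mk x) (fun w => kbound w x0) _; exact: integZ.
Qed.

Let Ek x : 0 < x -> Ex P (fun w => `|eta w * h (eta w * x)|) <= Num.min 1 x * M.
Proof.
move=> x0; rewrite -ExZ//; apply: le_Ex => [||w]; last exact: kbound.
- exact/integ_norm/ik.
- exact: integZ.
Qed.

Let mtail (t : R) : measurable_fun setT (fun w => (t < (tau w)%:R)%R%:R : R).
Proof. by apply/measurable_boolr/measurable_fun_ltr => //; exact: measurable_natr. Qed.

Let itail (t : R) : integ P (fun w => (t < (tau w)%:R)%R%:R : R).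
Proof.
by apply: (@integ_bounded _ _ _ _ 1) => // w; case: (_ < _); rewrite ?normr1 ?normr0.
Qed.

Let factor (x t : R) (g : R -> R) : measurable_fun setT g -> integ P (g \o eta) ->
  integ P (fun w => g (eta w) * (t < (tau w)%:R)%R%:R) /\
  Ex P (fun w => g (eta w) * (t < (tau w)%:R)%R%:R) = Ex P (g \o eta) * tail P tau t.
Proof.
move=> mg ig.
apply: (@Ex_indep _ _ _ P (g \o eta) (fun w => (t < (tau w)%:R)%R%:R)) => // A B mA mB.
apply: (@eta_tau (g @^-1` A) ((fun n : nat => (t < n%:R)%R%:R) @^-1` B)) => //.
by rewrite -[X in measurable X]setTI; exact: mg.
Qed.

Section fixed_scale.
Variables (c p r C : R).
Hypotheses (c0 : 0 < c) (r1 : 1 < r) (rp : r <= p) (p2 : p < 2).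
Hypothesis bound : forall x, 0 < x -> tail P tau (x * c) <= C * (x `^ (- p) + x `^ (- r)).

Lemma tail_ge0 t : 0 <= tail P tau t.
Proof. by apply: Ex_ge0 => w; exact: ler0n. Qed.

Let C0 : 0 <= C.
Proof.
have := le_trans (tail_ge0 _) (bound ltr01).
by rewrite !powR1; lra.
Qed.

(** After [path_integral], Fubini and independence split the mean at level [x] into [k x], from
    [eta], and a tail value, from the indicator [x < tau / c]. As [|h y|] is at most 2 and at most
    [|y|], [k x] is [O(min(1, x))]; with the bound on the tail this is dominated by an envelope. *)
Lemma layer_cake : integ P (fun w => K (eta w * ((tau w)%:R / c))) /\
  Ex P (fun w => K (eta w * ((tau w)%:R / c))) =
  \int[mu]_(x in pos_half) (k x * tail P tau (x * c)).
Proof.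
pose f w x := eta w * h (eta w * x) * (x < (tau w)%:R / c)%R%:R.
have bE x w : (x < (tau w)%:R / c)%R = (x * c < (tau w)%:R)%R by rewrite ltr_pdivlMr.
have mg (x : R) : measurable_fun setT (fun y : R => y * h (y * x)).
  apply: measurable_funM => //; apply: measurableT_comp => //.
  by apply: measurable_funM => //; exact: measurable_cst.
have E1 w : \int[mu]_(x in pos_half) f w x = K (eta w * ((tau w)%:R / c)).
  by rewrite path_integral// divr_ge0// ltW.
have H : forall x : R, pos_half x -> integ P (f ^~ x) /\
    Ex P (fun w => `|f w x|) <= (M * C * 2) * envelope p r x.
  move=> x; rewrite /pos_half/= in_itv/= andbT => x0; rewrite /f.
  have [i1 _] := factor x (x * c) (mg x) (ik x0).
  split; first by under eq_fun do rewrite bE; exact: i1.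
  have m2 : measurable_fun setT (fun y : R => `|y * h (y * x)|) by exact: measurableT_comp.
  have [_ e2] := factor x (x * c) m2 (integ_norm (ik x0)).
  under eq_Ex do rewrite bE normrM [X in _ * X]ger0_norm ?ler0n//.
  rewrite e2.
  apply: le_trans (_ : Num.min 1 x * M * (C * (x `^ (- p) + x `^ (- r))) <= _).
    apply: ler_pM; [by apply: Ex_ge0 => w /=; exact: normr_ge0|exact: tail_ge0|exact: Ek|exact: bound].
  have M0 : 0 <= M by apply: Ex_ge0 => w; rewrite addr_ge0 ?sqr_ge0// mulr_ge0.
  have := ler_wpM2l (mulr_ge0 M0 C0) (minr1_envelope r1 rp x0).
  by congr (_ <= _); ring.
have mf : measurable_fun setT (fun z : T * R => f z.1 z.2).
  rewrite /f; apply: measurable_funM; last first.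
    apply/measurable_boolr/measurable_fun_ltr; first exact: measurable_snd.
    apply: measurable_funM; last exact: measurable_cst.
    by apply: measurableT_comp (measurable_natr mtau) _; exact: measurable_fst.
  have me : measurable_fun setT (fun z : T * R => eta z.1).
    by apply: measurableT_comp => //; exact: measurable_fst.
  apply: measurable_funM => //; apply: measurableT_comp => //.
  by apply: measurable_funM => //; exact: measurable_snd.
have [] := @Ex_Fubini _ _ _ P _ _ mu pos_half f (fun x => (M * C * 2) * envelope p r x)
  measurable_pos_half mf _ _ H.
- by move=> w; exact: path_integrable.
- exact: (integrableZl measurable_pos_half (M * C * 2) (envelope_integrable p2 r1)).
under eq_fun do rewrite E1.
move=> i -> ; split=> //.
apply: eq_Rintegral => x; rewrite inE /pos_half/= in_itv/= andbT => x0.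
have [_ <-] := factor x (x * c) (mg x) (ik x0).
by apply: eq_Ex => w; rewrite /f bE.
Qed.

End fixed_scale.

Section limit.
Variables (alpha : R) (c : nat -> R).
Hypothesis alpha12 : 1 < alpha < 2.
Hypothesis ht : heavy_tail P tau alpha c.

Let J y := \int[mu]_(x in pos_half) (y * h (y * x) * x `^ (- alpha)).

Let min_env x : 0 < x -> Num.min 1 x * x `^ (- alpha) <= envelope alpha alpha x.
Proof.
move=> x0; have /andP[a1 a2] := alpha12.
by have := minr1_envelope a1 (lexx _) x0; rewrite mulrDr; lra.
Qed.

Let mpow : measurable_fun (setT : set (measurableTypeR R)) (fun x : R => x `^ (- alpha)).
Proof. exact: measurable_powR. Qed.

Lemma integrable_layer y : mu.-integrable pos_half (EFin \o (fun x => y * h (y * x) * x `^ (- alpha))).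
Proof.
have /andP[a1 a2] := alpha12.
apply: (@le_envelope_integrable _ alpha alpha (2 * `|y| + y ^+ 2)) => //.
  apply: measurable_funTS; apply: measurable_funM => //.
  by apply: measurable_funM => //; apply: measurableT_comp => //.
move=> x x0; rewrite normrM (ger0_norm (powR_ge0 _ _)).
apply: le_trans (_ : (2 * `|y| + y ^+ 2) * (Num.min 1 x * x `^ (- alpha)) <= _); last first.
  by apply: ler_wpM2l (min_env x0); rewrite addr_ge0 ?sqr_ge0// mulr_ge0.
rewrite mulrA ler_wpM2r ?powR_ge0// normrM -(real_normK (num_real y)).
have := h1 (y * x); have := h2 (y * x); rewrite normrM (gtr0_norm x0).
have e0 := normr_ge0 y.
by have [x1|x1] := leP (x : R) 1; nra.
Qed.

(** Dominated convergence in the layer-cake formula: [n * tail (x * c n)] tends to [x^(- alpha)]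
    under a bound uniform in [n]. A second use of Fubini puts the limit back into the form of a mean
    over [eta]. *)
Lemma layer_cake_limit :
  n%:R * Ex P (fun w => K (eta w * ((tau w)%:R / c n))) @[n --> \oo] -->
  Ex P (fun w => J (eta w)).
Proof.
have /andP[a1 a2] := alpha12.
have [c8 _ tc [p [r [C [r1 rp p2 C0 [N0 _ HN0]]]]]] := ht.
have [N1 _ HN1] : \forall n \near \oo, 1 <= c n by move/cvgryPge : c8; exact.
(* Shifting the sequence makes the eventual bounds valid for all indices, as dominated convergence
   requires. *)
pose N := (maxn N0 N1).+1.
have cN n : 1 <= c (n + N)%N.
  by apply: HN1; rewrite /= /N addnS; apply: leq_trans (leq_maxr N0 N1) _; rewrite leqW// leq_addl.
have bN n x : 0 < x -> (n + N)%:R * tail P tau (x * c (n + N)%N) <= C * (x `^ (- p) + x `^ (- r)).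
  by apply: HN0; rewrite /= /N addnS; apply: leq_trans (leq_maxl N0 N1) _; rewrite leqW// leq_addl.
rewrite -(cvg_shiftn N).
have M0 : 0 <= M by apply: Ex_ge0 => w; rewrite addr_ge0 ?sqr_ge0// mulr_ge0.
have ipow : mu.-integrable pos_half (EFin \o (fun x => M * envelope alpha alpha x)).
  exact: (integrableZl measurable_pos_half M (envelope_integrable a2 a1)).
have mkx : measurable_fun (setT : set (measurableTypeR R)) k.
  apply: (@Ex_measurable _ _ _ (measurableTypeR R) R P (fun w x => eta w * h (eta w * x))).
  have me : measurable_fun setT (fun z : T * R => eta z.1).
    by apply: measurableT_comp => //; exact: measurable_fst.
  apply: measurable_funM => //; apply: measurableT_comp => //.
  by apply: measurable_funM => //; exact: measurable_snd.
have mtc (b : R) : measurable_fun (setT : set (measurableTypeR R)) (fun x => tail P tau (x * b)).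
  apply: (@Ex_measurable _ _ _ (measurableTypeR R) R P (fun w x => (x * b < (tau w)%:R)%R%:R)).
  apply/measurable_boolr/measurable_fun_ltr.
    by apply: measurable_funM; [exact: measurable_snd|exact: measurable_cst].
  by apply: measurableT_comp (measurable_natr mtau) _; exact: measurable_fst.
have [] := @Ex_Fubini _ _ _ P _ _ mu pos_half
  (fun w x => eta w * h (eta w * x) * x `^ (- alpha)) (fun x => M * envelope alpha alpha x)
  measurable_pos_half.
- have me : measurable_fun setT (fun z : T * R => eta z.1).
    by apply: measurableT_comp => //; exact: measurable_fst.
  apply: measurable_funM; last by apply: measurableT_comp mpow _; exact: measurable_snd.
  apply: measurable_funM => //; apply: measurableT_comp => //.
  by apply: measurable_funM => //; exact: measurable_snd.
- by move=> w; exact: integrable_layer.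
- exact: ipow.
- move=> x; rewrite /pos_half/= in_itv/= andbT => x0; split.
    under eq_fun do rewrite mulrC.
    exact/integZ/ik.
  under eq_Ex do rewrite normrM mulrC.
  rewrite ExZ; last exact/integ_norm/ik.
  rewrite (ger0_norm (powR_ge0 _ _)).
  apply: le_trans (ler_wpM2l (powR_ge0 _ _) (Ek x0)) _.
  have := ler_wpM2l M0 (min_env x0); by congr (_ <= _); ring.
move=> _ ->.
have -> : \int[mu]_(x in pos_half) Ex P (fun w => eta w * h (eta w * x) * x `^ (- alpha)) =
    \int[mu]_(x in pos_half) (k x * x `^ (- alpha)).
  apply: eq_Rintegral => x; rewrite inE /pos_half/= in_itv/= andbT => x0.
  under eq_Ex do rewrite mulrC.
  by rewrite ExZ; [rewrite mulrC|exact: ik].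
have E n : (n + N)%:R * Ex P (fun w => K (eta w * ((tau w)%:R / c (n + N)%N))) =
    \int[mu]_(x in pos_half) (k x * ((n + N)%:R * tail P tau (x * c (n + N)%N))).
  have n0 : 0 < (n + N)%:R :> R by rewrite ltr0n /N addnS.
  have c0 : 0 < c (n + N)%N by apply: lt_le_trans (cN n).
  have bd x : 0 < x -> tail P tau (x * c (n + N)%N) <= (C / (n + N)%:R) * (x `^ (- p) + x `^ (- r)).
    by move=> x0; rewrite mulrAC ler_pdivlMr// mulrC; exact: bN.
  rewrite (layer_cake c0 r1 rp p2 bd).2 -RintegralZl//; last first.
  - apply: (@le_envelope_integrable _ p r (M * (C / (n + N)%:R) * 2)) => //.
      by apply: measurable_funTS; apply: measurable_funM => //; exact: mtc.
    move=> x x0; rewrite normrM (ger0_norm (tail_ge0 _)).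
    have := ler_wpM2l (mulr_ge0 M0 (divr_ge0 C0 (ltW n0))) (minr1_envelope r1 rp x0).
    move=> Hh; rewrite -[leRHS]mulrA; apply: le_trans Hh.
    apply: le_trans (_ : (Num.min 1 x * M) * ((C / (n + N)%:R) * (x `^ (- p) + x `^ (- r))) <= _).
      apply: ler_pM; [exact: normr_ge0|exact: tail_ge0| |exact: bd].
      by apply: le_trans (Ex_norm (ik x0)) (Ek x0).
    by rewrite le_eqVlt; apply/orP; left; apply/eqP; ring.
  - exact: measurable_pos_half.
  by apply: eq_Rintegral => x _; rewrite mulrCA.
under eq_fun do rewrite E.
apply: (@Rintegral_dominated_cvg _ _ _ mu pos_half _ _ (fun x => (M * C * 2) * envelope p r x)
    measurable_pos_half _ _ _ _).2.
- move=> n; apply: measurable_funTS; apply: measurable_funM => //.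
  by apply: measurable_funM; [exact: measurable_cst|exact: mtc].
- move=> x; rewrite /pos_half/= in_itv/= andbT => x0.
  apply: cvgM; first exact: cvg_cst.
  by rewrite (cvg_shiftn N (fun n => n%:R * tail P tau (x * c n))); exact: tc.
- exact: (integrableZl measurable_pos_half (M * C * 2) (envelope_integrable p2 r1)).
- move=> n x; rewrite /pos_half/= in_itv/= andbT => x0.
  rewrite normrM [X in _ * X]ger0_norm ?mulr_ge0 ?tail_ge0//.
  have := ler_wpM2l (mulr_ge0 M0 C0) (minr1_envelope r1 rp x0).
  move=> Hh; rewrite -[leRHS]mulrA; apply: le_trans Hh.
  apply: le_trans (_ : (Num.min 1 x * M) * (C * (x `^ (- p) + x `^ (- r))) <= _).
    apply: ler_pM; [exact: normr_ge0|by rewrite mulr_ge0 ?tail_ge0| |exact: bN].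
    by apply: le_trans (Ex_norm (ik x0)) (Ek x0).
  by rewrite le_eqVlt; apply/orP; left; apply/eqP; ring.
Qed.

(** Homogeneity, by the substitution of [y * x] for [x]. *)
Let J_pos y : 0 < y -> J y = y `^ alpha * \int[mu]_(x in pos_half) (h x * x `^ (- alpha)).
Proof.
move=> y0.
have powM x : 0 < x -> (y * x) `^ (- alpha) = y `^ (- alpha) * x `^ (- alpha).
  by move=> x0; rewrite powRM// ltW.
have i1 := integrable_layer 1.
have e1 : mu.-integrable pos_half (EFin \o (fun x => h x * x `^ (- alpha))).
  by move: i1; under eq_fun do rewrite !mul1r.
have yy : y `^ alpha * y `^ (- alpha) = 1 by rewrite powRN divff// gt_eqF// powR_gt0.
rewrite (@Rintegral_pos_half_scale _ (fun x => h x * x `^ (- alpha)) y)//.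
- rewrite -RintegralZl; last 2 first.
  + exact: measurable_pos_half.
  + have := integrableZl measurable_pos_half (y^-1 * y `^ (- alpha)) (integrable_layer y).
    apply: eq_integrable; first exact: measurable_pos_half.
    move=> x; rewrite inE /pos_half/= in_itv/= andbT => x0; congr EFin.
    by rewrite powM//; field; rewrite gt_eqF.
  rewrite -RintegralZl; last 2 first.
  + exact: measurable_pos_half.
  + have := integrableZl measurable_pos_half (y `^ (- alpha)) (integrable_layer y).
    apply: eq_integrable; first exact: measurable_pos_half.
    move=> x; rewrite inE /pos_half/= in_itv/= andbT => x0; congr EFin.
    by rewrite powM//; ring.
  apply: eq_Rintegral => x; rewrite inE /pos_half/= in_itv/= andbT => x0.
  rewrite powM// -[LHS]mul1r -yy; ring.
- move=> x x0; apply: cvgM; [exact: ch|exact: continuous_powR].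
- have := integrableZl measurable_pos_half (y^-1 * y `^ (- alpha)) (integrable_layer y).
  apply: eq_integrable; first exact: measurable_pos_half.
  move=> x; rewrite inE /pos_half/= in_itv/= andbT => x0; congr EFin.
  by rewrite powM//; field; rewrite gt_eqF.
Qed.

Let J0 : J 0 = 0.
Proof. by rewrite /J /Rintegral integral0_eq// => x _; rewrite !mul0r. Qed.

Let JN y : J (- y) = \int[mu]_(x in pos_half) (y * - h (- (y * x)) * x `^ (- alpha)).
Proof. by apply: eq_Rintegral => x _; rewrite !mulNr mulrN mulNr. Qed.

(** For odd [h] the function [y * h (y * x)] is even in [y], and absolute moments appear. For even
    [h], in the next lemma, it is odd in [y], and the positive and negative parts enter with
    opposite signs. *)
Lemma layer_cake_limit_odd : (forall x, h (- x) = - h x) ->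
  n%:R * Ex P (fun w => K (eta w * ((tau w)%:R / c n))) @[n --> \oo] -->
  Ex P (fun w => `|eta w| `^ alpha) * \int[mu]_(x in pos_half) (h x * x `^ (- alpha)).
Proof.
move=> hN; have /andP[a1 _] := alpha12.
set I := \int[mu]_(x in _) _.
have JE y : J y = I * `|y| `^ alpha.
  have [y0|y0|->] := ltgtP y 0.
  - rewrite -(opprK y) JN normrN mulrC gtr0_norm ?oppr_gt0// -J_pos ?oppr_gt0//.
    by apply: eq_Rintegral => x _; rewrite hN opprK.
  - by rewrite gtr0_norm// mulrC J_pos.
  - by rewrite J0 normr0 powR0 ?mulr0// gt_eqF//; lra.
have ip : integ P (fun w => `|eta w| `^ alpha).
  apply: (@le_integ _ _ _ _ (fun w => 1 + eta w ^+ 2)).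
  - by apply: (@measurableT_comp _ _ _ _ _ _ (fun y : R => y `^ alpha)); [exact: measurable_powR|exact: measurableT_comp].
  - move=> w; rewrite ger0_norm ?powR_ge0//.
    exact: powR_le1Dsqr.
  - by apply: integD => //; exact: integ_cst.
have := layer_cake_limit; under [X in _ --> X -> _]eq_Ex do rewrite JE.
by rewrite ExZ// mulrC.
Qed.

Lemma layer_cake_limit_even : (forall x, h (- x) = h x) ->
  n%:R * Ex P (fun w => K (eta w * ((tau w)%:R / c n))) @[n --> \oo] -->
  (Ex P (fun w => Num.max (eta w) 0 `^ alpha) - Ex P (fun w => Num.max (- eta w) 0 `^ alpha)) *
  \int[mu]_(x in pos_half) (h x * x `^ (- alpha)).
Proof.
move=> hN; have /andP[a1 _] := alpha12.
set I := \int[mu]_(x in _) _.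
have JE y : J y = I * (Num.max y 0 `^ alpha - Num.max (- y) 0 `^ alpha).
  have a0 : alpha != 0 by rewrite gt_eqF//; lra.
  have [y0|y0|->] := ltgtP y 0.
  - rewrite -{1}(opprK y) JN.
    have yN : 0 <= - y by rewrite oppr_ge0 ltW.
    rewrite (max_idPl yN) powR0// sub0r mulrN mulrC -J_pos ?oppr_gt0//.
    rewrite -mulN1r -RintegralZl; [|exact: measurable_pos_half|exact: integrable_layer].
    by apply: eq_Rintegral => x _; rewrite hN; ring.
  - have yN : - y <= 0 by rewrite oppr_le0 ltW.
    rewrite (max_idPr yN) powR0// subr0 mulrC.
    by rewrite J_pos.
  - by rewrite oppr0 maxxx J0 subrr mulr0.
have ip (s : R) : integ P (fun w => Num.max (s * eta w) 0 `^ alpha).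
  apply: (@le_integ _ _ _ _ (fun w => 1 + (s * eta w) ^+ 2)).
  - apply: (@measurableT_comp _ _ _ _ _ _ (fun y : R => y `^ alpha)); first exact: measurable_powR.
    by apply: measurable_maxr; [apply: measurable_funM => //; exact: measurable_cst|exact: measurable_cst].
  - move=> w; rewrite ger0_norm ?powR_ge0//.
    apply: le_trans (powR_le1Dsqr (s * eta w) alpha12).
    apply: ge0_ler_powR; rewrite ?nnegrE ?le_max ?lexx ?orbT//; first lra.
    by rewrite ge_max ler_norm normr_ge0.
  - apply: integD; first exact: integ_cst.
    by under eq_fun do rewrite exprMn; exact: integZ.
have ip1 := ip 1; have ipN := ip (-1).
move: ip1 ipN; under eq_fun do rewrite mul1r; under [X in _ -> integ _ X -> _]eq_fun do rewrite mulN1r.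
move=> ip1 ipN.
have := layer_cake_limit; under [X in _ --> X -> _]eq_Ex do rewrite JE.
by rewrite ExZ; [rewrite ExB// mulrC|exact: integB].
Qed.

End limit.

End layer_cake.

(** * Limits of the rescaled cosine and sine transforms of one shot *)

Section shot_characteristic_function.
Context {d} {T : measurableType d} {R : realType} (P : probability T R).
Variables (eta : T -> R) (tau : T -> nat) (alpha : R) (c : nat -> R).
Hypothesis meta : measurable_fun setT eta.
Hypothesis mtau : measurable_fun setT tau.
Hypothesis eta_tau : forall A B, measurable A -> measurable B ->
  P (eta @^-1` A `&` tau @^-1` B) = (P (eta @^-1` A) * P (tau @^-1` B))%E.
Hypothesis ieta2 : integ P (fun w => eta w ^+ 2).
Hypothesis alpha12 : 1 < alpha < 2.
Hypothesis ht : heavy_tail P tau alpha c.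

Let X n w := eta w * ((tau w)%:R / c n).

Let mX n : measurable_fun setT (X n).
Proof.
apply: measurable_funM => //; apply: measurable_funM; last exact: measurable_cst.
exact: measurable_natr.
Qed.

Lemma integ_cos (Y : T -> R) : measurable_fun setT Y -> integ P (fun w => cos (Y w)).
Proof.
move=> mY; apply: (@integ_bounded _ _ _ _ 1) => [|w]; last exact: ler_norm_cos1.
by apply: (@measurableT_comp _ _ _ _ _ _ (@cos R)) => //; apply: continuous_measurable_fun; exact: continuous_cos.
Qed.

Lemma integ_sin (Y : T -> R) : measurable_fun setT Y -> integ P (fun w => sin (Y w)).
Proof.
move=> mY; apply: (@integ_bounded _ _ _ _ 1) => [|w]; last exact: ler_norm_sin1.
by apply: (@measurableT_comp _ _ _ _ _ _ (@sin R)) => //; apply: continuous_measurable_fun; exact: continuous_sin.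
Qed.

Lemma shot_cos_limit :
  n%:R * (Ex P (fun w => cos (eta w * ((tau w)%:R / c n))) - 1) @[n --> \oo] -->
  - (Ex P (fun w => `|eta w| `^ alpha) * (Gamma (1 - alpha) * cos (pi * alpha / 2))).
Proof.
have dK (y : R) : is_derive y 1 (fun y : R => cos y - 1) (- sin y).
  by have := is_deriveB (is_derive_cos y) (is_derive_cst (1:R) y 1); rewrite subr0.
have H := @layer_cake_limit_odd R (fun y => - sin y) (fun y => cos y - 1) _ _ _ dK _
  d T P eta tau meta mtau eta_tau ieta2 alpha c alpha12 ht.
have {}H := H _ _ _ _ _.
have E n : Ex P (fun w => cos (eta w * ((tau w)%:R / c n)) - 1) =
    Ex P (fun w => cos (eta w * ((tau w)%:R / c n))) - 1.
  rewrite ExB ?Ex_cst//; [exact: integ_cos (mX n)|exact: integ_cst].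
under eq_fun do rewrite -E.
rewrite -(integral_sin_powR alpha12) -mulrN.
rewrite -mulN1r -RintegralZl; [|exact: measurable_pos_half|exact: integrable_sin_powR].
under eq_Rintegral do rewrite mulrA mulN1r.
apply: H.
- by move=> y; apply: cvgN; exact: continuous_sin.
- by move=> y; rewrite normrN; apply: le_trans (ler_norm_sin1 _) _; rewrite ler1n.
- by move=> y; rewrite normrN; exact: ler_norm_sin.
- by rewrite cos0 subrr.
- by move=> x; rewrite sinN.
Qed.

Let dsinB (y : R) : is_derive y 1 (fun y : R => sin y - y) (cos y - 1).
Proof. exact: is_deriveB (is_derive_sin y) (is_derive_id y 1). Qed.

Let ccosB1 : continuous (fun y : R => cos y - 1).
Proof. by move=> y; apply: cvgB; [exact: continuous_cos|exact: cvg_cst]. Qed.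

Let heavy_fixed : exists p r C cn : R, [/\ 0 < cn, 1 < r, r <= p, p < 2 &
  forall x, 0 < x -> tail P tau (x * cn) <= C * (x `^ (- p) + x `^ (- r))].
Proof.
have [c8 _ _ [p [r [C [r1 rp p2 C0 H]]]]] := ht.
have [n [n0 cn Hn]] : exists n, [/\ (0 < n)%N, 0 < c n & forall x : R, 0 < x ->
    n%:R * tail P tau (x * c n) <= C * (x `^ (- p) + x `^ (- r))].
  near \oo => n; exists n; split.
  - by near: n; exact: nbhs_infty_gt.
  - apply: lt_le_trans ltr01 _; near: n; by move/cvgryPge : c8; exact.
  - by near: n.
have n0' : 0 < n%:R :> R by rewrite ltr0n.
exists p, r, (C / n%:R), (c n); split=> // x x0.
by rewrite mulrAC ler_pdivlMr// mulrC; exact: Hn.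
Unshelve. all: by end_near. Qed.

(** The layer-cake formula with [eta = 1] makes [sin y - y] integrable at [y = tau / c]; as the sine
    is bounded, so is [tau] itself integrable. *)
Lemma integ_heavy_tail : integ P (fun w => (tau w)%:R : R).
Proof.
have [p [r [C [c1 [c0 r1 rp p2 bd]]]]] := heavy_fixed.
have [] := @layer_cake R (fun y => cos y - 1) (fun y => sin y - y) ccosB1 _ _ dsinB _ d T P
  (cst 1) tau _ mtau _ _ c1 p r C c0 r1 rp p2 bd.
- exact: ler_norm_cosB1_2.
- exact: ler_norm_cosB1.
- by rewrite sin0 subrr.
- exact: measurable_cst.
- move=> A B mA mB; rewrite preimage_cst; case: ifP => _.
    by rewrite setTI probability_setT mul1e.
  by rewrite set0I measure0 mul0e.
- exact: (integ_cst P (1 ^+ 2)).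
move=> i _.
have ms : measurable_fun setT (fun w => (tau w)%:R / c1 : R).
  by apply: measurable_funM; [exact: measurable_natr|exact: measurable_cst].
have := integZ c1 (integB (integ_sin ms) i).
congr integ; apply/funext => w /=; rewrite mul1r.
by field; rewrite gt_eqF.
Qed.

(** The layer-cake formula is applied to [sin y - y], whose derivative vanishes at 0, unlike that of
    [sin]. The linear term has mean zero by independence and centring. *)
Lemma shot_sin_limit : Ex P eta = 0 ->
  n%:R * Ex P (fun w => sin (eta w * ((tau w)%:R / c n))) @[n --> \oo] -->
  (Ex P (fun w => Num.max (eta w) 0 `^ alpha) - Ex P (fun w => Num.max (- eta w) 0 `^ alpha)) *
  (Gamma (1 - alpha) * sin (pi * alpha / 2)).
Proof.
move=> eta0.
have H := @layer_cake_limit_even R (fun y => cos y - 1) (fun y => sin y - y) ccosB1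
  ler_norm_cosB1_2 ler_norm_cosB1 dsinB _
  d T P eta tau meta mtau eta_tau ieta2 alpha c alpha12 ht.
have ieta : integ P eta.
  apply: (@le_integ _ _ _ _ (fun w => 1 + eta w ^+ 2)) => // [w|].
    have := sqr_ge0 (`|eta w| - 1); rewrite sqrrB1 -(real_normK (num_real (eta w))).
    have := normr_ge0 (eta w); lra.
  by apply: integD => //; exact: integ_cst.
have [iet Eet] : integ P (fun w => eta w * (tau w)%:R) /\
    Ex P (fun w => eta w * (tau w)%:R) = Ex P eta * Ex P (fun w => (tau w)%:R).
  apply: Ex_indep => //; last exact: integ_heavy_tail.
  by move=> A B mA mB; apply: (@eta_tau A ((fun n : nat => n%:R) @^-1` B)).
have E n : Ex P (fun w => sin (eta w * ((tau w)%:R / c n)) - eta w * ((tau w)%:R / c n)) =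
    Ex P (fun w => sin (eta w * ((tau w)%:R / c n))).
  have f w : eta w * ((tau w)%:R / c n) = (c n)^-1 * (eta w * (tau w)%:R) by ring.
  rewrite ExB; [|exact: integ_sin (mX n)|by under eq_fun do rewrite f; exact: integZ].
  under [X in _ - X]eq_Ex do rewrite f.
  by rewrite ExZ// Eet eta0 mul0r mulr0 subr0.
under eq_fun do rewrite -E.
rewrite -(integral_cosB1_powR alpha12); apply: H.
- by rewrite sin0 subrr.
- by move=> x; rewrite cosN.
Qed.

End shot_characteristic_function.

(** * Second moments truncated at the scale of the quantile *)

Section truncated_moments.
Context {d} {T : measurableType d} {R : realType} (P : probability T R).
Variables (tau : T -> nat) (alpha : R) (c : nat -> R).
Hypothesis mtau : measurable_fun setT tau.
Hypothesis alpha12 : 1 < alpha < 2.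
Hypothesis ht : heavy_tail P tau alpha c.

(** Since [1 - cos y = 2 sin^2 (y / 2)], it is enough that [sin (y / 2) >= y / 4], which the mean
    value theorem gives because the cosine is at least [1/2] on [[0, 1/2]]. *)
Let cos_quadratic (y : R) : 0 <= y <= 1 -> y ^+ 2 <= 8 * (1 - cos y).
Proof.
move=> /andP[]; rewrite le_eqVlt => /predU1P[<- _|y0 y1].
  by rewrite cos0 subrr expr0n mulr0.
have y20 : 0 < y / 2 by lra.
have [z zy] : exists2 z : R, z \in `]0, (y / 2)[%R & sin (y / 2) - sin 0 = cos z * (y / 2 - 0).
  apply: (@MVT R sin cos) => //.
  by apply: continuous_subspaceT => x; exact: continuous_sin.
rewrite sin0 !subr0 => E.
have := ler_norm_cosB1 z; move: zy; rewrite in_itv/= => /andP[z0 zy].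
rewrite (gtr0_norm z0) ler_norml => /andP[cz _].
have s4 : y / 4 <= sin (y / 2) by rewrite E; nra.
have -> : cos y = 1 - sin (y / 2) ^+ 2 *+ 2.
  rewrite {1}(_ : y = y / 2 + y / 2); last lra.
  by rewrite cosD -!expr2 cos2sin2 mulr2n opprD addrA.
have : (y / 4) ^+ 2 <= sin (y / 2) ^+ 2 by apply: lerXn2r; rewrite ?nnegrE//; lra.
rewrite -mulr_natr; lra.
Qed.

Definition truncated_moment2 (a : R) : R :=
  Ex P (fun w => (tau w)%:R ^+ 2 * ((tau w)%:R <= a)%R%:R).

Lemma truncated_moment2_ge0 a : 0 <= truncated_moment2 a.
Proof. by apply: Ex_ge0 => w; rewrite mulr_ge0 ?sqr_ge0. Qed.

Lemma integ_truncated_moment2 (a : R) : integ P (fun w => (tau w)%:R ^+ 2 * ((tau w)%:R <= a)%R%:R : R).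
Proof.
have mt := measurable_natr mtau.
apply: (@integ_bounded _ _ _ _ (a ^+ 2)) => [|w].
  apply: measurable_funM; first exact: measurable_funX.
  by apply/measurable_boolr/measurable_fun_ler => //; exact: measurable_cst.
rewrite normrM !ger0_norm ?sqr_ge0//.
have [ta|_] := leP (tau w)%:R a; last by rewrite mulr0 sqr_ge0.
by rewrite mulr1; apply: lerXn2r; rewrite ?nnegrE ?ler0n// (le_trans _ ta) ?ler0n.
Qed.

(** On [tau <= A * c n] the square of [tau / (A * c n)] is at most eight times one minus its cosine,
    and the mean of the latter is [O(1/n)] by [shot_cos_limit] for the constant variable [1 / A].
    This replaces Karamata's theorem. *)
Lemma truncated_moment2_bound (A : R) : 0 < A -> exists2 C : R, 0 <= C &
  \forall n \near \oo, n%:R * truncated_moment2 (A * c n) <= C * c n ^+ 2.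
Proof.
move=> A0.
have indep : forall A0 B, measurable A0 -> measurable B ->
    P ((cst (A^-1)%R : T -> R) @^-1` A0 `&` tau @^-1` B) =
    (P ((cst (A^-1)%R : T -> R) @^-1` A0) * P (tau @^-1` B))%E.
  move=> D B mD mB; rewrite preimage_cst; case: ifP => _.
    by rewrite setTI probability_setT mul1e.
  by rewrite set0I measure0 mul0e.
have := shot_cos_limit (measurable_cst _) mtau indep (integ_cst P (A^-1 ^+ 2)) alpha12 ht.
set l := - (_ * (Gamma _ * _)) => L.
have [c8 _ _ _] := ht.
exists (8 * A ^+ 2 * (`|l| + 1)); first by rewrite mulr_ge0 ?addr_ge0// mulr_ge0 ?sqr_ge0.
near=> n.
have cn : 0 < c n.
  by apply: lt_le_trans ltr01 _; near: n; by move/cvgryPge : c8; exact.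
have Ac : 0 < A * c n by rewrite mulr_gt0.
have : - (`|l| + 1) <= n%:R * (Ex P (fun w => cos (A^-1 * ((tau w)%:R / c n))) - 1).
  apply: ltW; near: n; apply: (cvgr_gt _ L).
  by have := ler_norm (- l); rewrite normrN; lra.
set e := Ex P _ => h1.
have mc : measurable_fun setT (fun w => A^-1 * ((tau w)%:R / c n) : R).
  apply: measurable_funM; first exact: measurable_cst.
  by apply: measurable_funM; [exact: measurable_natr|exact: measurable_cst].
have h2 : truncated_moment2 (A * c n) <= 8 * (A * c n) ^+ 2 * (1 - e).
  have -> : 1 - e = Ex P (fun w => 1 - cos (A^-1 * ((tau w)%:R / c n))).
    by rewrite ExB ?Ex_cst//; [exact: integ_cst|exact: integ_cos].
  rewrite -ExZ; last by apply: integB; [exact: integ_cst|exact: integ_cos].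
  apply: le_Ex => [||w]; first exact: integ_truncated_moment2.
    by apply: integZ; apply: integB; [exact: integ_cst|exact: integ_cos].
  have [ta|_] := leP (tau w)%:R (A * c n); last first.
    by rewrite mulr0; apply: mulr_ge0; [rewrite mulr_ge0 ?sqr_ge0|rewrite subr_ge0 cos_le1].
  rewrite mulr1; set y := A^-1 * _.
  have -> : (tau w)%:R = A * c n * y by rewrite /y; field; rewrite !gt_eqF.
  have y01 : 0 <= y <= 1.
    have -> : y = (tau w)%:R / (A * c n) by rewrite /y; field; rewrite !gt_eqF.
    by apply/andP; split; [exact: divr_ge0 (ler0n _ _) (ltW Ac)|rewrite ler_pdivrMr// mul1r].
  have := ler_wpM2l (sqr_ge0 (A * c n)) (cos_quadratic y01).
  by congr (_ <= _); ring.
have n0 : 0 <= n%:R :> R by [].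
apply: le_trans (ler_wpM2l n0 h2) _.
have K0 : 0 <= 8 * (A * c n) ^+ 2 by rewrite mulr_ge0 ?sqr_ge0.
have -> : n%:R * (8 * (A * c n) ^+ 2 * (1 - e)) = 8 * (A * c n) ^+ 2 * (n%:R * (1 - e)) by ring.
have -> : 8 * A ^+ 2 * (`|l| + 1) * c n ^+ 2 = 8 * (A * c n) ^+ 2 * (`|l| + 1) by ring.
apply: ler_wpM2l => //; lra.
Unshelve. all: by end_near. Qed.

End truncated_moments.

(** * Orthogonal sums and truncation *)

Section measurable_wrt.
Context {d} {T : measurableType d} {R : realType} (P : probability T R).
Context {I : eqType} (F : I -> set (set T)).
Hypothesis FT : forall i, F i setT.
Hypothesis FI : forall i, setI_closed (F i).
Hypothesis mF : forall i, F i `<=` measurable.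
Hypothesis indepF : mutually_indep P F.

(** Measurability for the sigma-algebra of the variables with index in [A]. Changing the measurable
    structure of the source keeps all closure properties of measurable functions usable as they
    are. *)
Definition measurable_wrt {d'} {V : measurableType d'} (A : pred I) (X : T -> V) : Prop :=
  @measurable_fun _ _ (g_sigma_algebraType (\bigcup_(i in [set` A]) F i)) V setT X.

Lemma measurable_wrtP {d'} {V : measurableType d'} A (X : T -> V) :
  measurable_wrt A X <-> forall B, measurable B -> sigma_of F A (X @^-1` B).
Proof.
split=> [mX B mB|H _ B mB]; last by rewrite setTI; exact: H.
by have := mX measurableT B mB; rewrite setTI.
Qed.

Lemma sub_measurable_wrt {d'} {V : measurableType d'} A B (X : T -> V) :
  {subset A <= B} -> measurable_wrt A X -> measurable_wrt B X.
Proof.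
move=> AB /measurable_wrtP mX; apply/measurable_wrtP => D mD.
exact: sub_sigma_of AB _ (mX _ mD).
Qed.

Lemma measurable_wrt_rv {d'} {V : measurableType d'} (A : pred I) i (X : T -> V) :
  rv_events X `<=` F i -> A i -> measurable_wrt A X.
Proof.
move=> XF Ai; apply/measurable_wrtP => D mD.
by apply: sub_sigma_algebra; exists i => //; apply: XF; exists D.
Qed.

Lemma measurable_wrt_measurable {d'} {V : measurableType d'} A (X : T -> V) :
  measurable_wrt A X -> measurable_fun setT X.
Proof.
move=> /measurable_wrtP mX _ B mB; rewrite setTI.
exact: (sigma_of_measurable mF (mX _ mB)).
Qed.

Lemma measurable_wrt_indep {d1 d2} {V1 : measurableType d1} {V2 : measurableType d2}
    (A B : pred I) (X : T -> V1) (Y : T -> V2) : (forall i, A i -> ~~ B i) ->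
  measurable_wrt A X -> measurable_wrt B Y ->
  forall D E, measurable D -> measurable E ->
  P (X @^-1` D `&` Y @^-1` E) = (P (X @^-1` D) * P (Y @^-1` E))%E.
Proof.
move=> AB /measurable_wrtP mX /measurable_wrtP mY D E mD mE.
by apply: (indep_sigma_of FT FI mF indepF AB); [exact: mX|exact: mY].
Qed.

Lemma Ex_measurable_wrt (A B : pred I) (X Y : T -> R) : (forall i, A i -> ~~ B i) ->
  measurable_wrt A X -> measurable_wrt B Y -> integ P X -> integ P Y ->
  integ P (fun w => X w * Y w) /\ Ex P (fun w => X w * Y w) = Ex P X * Ex P Y.
Proof.
by move=> AB mX mY iX iY; apply: Ex_indep => // D E mD mE; exact: (measurable_wrt_indep AB).
Qed.

Section orthogonality.
Variables (xi : nat -> T -> R) (ixi : nat -> I) (isxi : pred I) (C : nat -> T -> R) (b s2 : R).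
Hypothesis xiF : forall k, rv_events (xi k) `<=` F (ixi k).
Hypothesis isxiP : forall k, isxi (ixi k).
Hypothesis ixi_inj : injective ixi.
Hypothesis xi2 : forall k, integ P (fun w => xi k w ^+ 2) /\ Ex P (fun w => xi k w ^+ 2) = s2.
Hypothesis xi0 : forall k, integ P (xi k) /\ Ex P (xi k) = 0.
Hypothesis mC : forall k, measurable_wrt (predC isxi) (C k).
Hypothesis bC : forall k w, `|C k w| <= b.

Let mxi k (A : pred I) : A (ixi k) -> measurable_wrt A (xi k).
Proof. exact: measurable_wrt_rv. Qed.

Let mCk k : measurable_fun setT (C k) := measurable_wrt_measurable (mC k).

Let iC2 k : integ P (fun w => C k w ^+ 2).
Proof.
apply: (@integ_bounded _ _ _ _ (b ^+ 2)) => [|w]; first exact: measurable_funX.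
by rewrite normrX; apply: lerXn2r; rewrite ?nnegrE ?(le_trans _ (bC k w)).
Qed.

Let S N w := \sum_(k < N) xi k w * C k w.

Let mS N : measurable_wrt (predU (predC isxi) [pred i | i \in [seq ixi k | k <- iota 0 N]]) (S N).
Proof.
apply: measurable_sum => k; apply: measurable_funM.
  apply: mxi; apply/orP; right; apply/mapP; exists (val k) => //.
  by rewrite mem_iota add0n ltn_ord.
by apply: sub_measurable_wrt _ (mC k) => i ?; apply/orP; left.
Qed.

(** The coefficients involve no [xi] at all, and [S N] only earlier ones, so [xi N] is independent
    of [S N * C N] and the cross term vanishes by centring. In the square term [C N] is independent
    of [xi N]. *)
Lemma Ex_sqr_sum_orthogonal N :
  integ P (fun w => S N w ^+ 2) /\
  Ex P (fun w => S N w ^+ 2) = \sum_(k < N) s2 * Ex P (fun w => C k w ^+ 2).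
Proof.
elim: N => [|N [iS ES]].
  rewrite /S big_ord0; under eq_fun do rewrite big_ord0.
  by split; [exact: integ_cst|rewrite Ex_cst expr0n].
have e w : S N.+1 w ^+ 2 = S N w ^+ 2 + (2 * (xi N w * (S N w * C N w)) +
    xi N w ^+ 2 * C N w ^+ 2).
  by rewrite /S big_ord_recr /=; ring.
have iSC : integ P (fun w => S N w * C N w).
  rewrite /S; under eq_fun do rewrite mulr_suml.
  apply: integ_sum => k _; apply: (@le_integ _ _ _ P (fun w => b * b * `|xi k w|)).
  - apply: measurable_funM => //; apply: measurable_funM => //.
    exact: integ_measurable (xi0 k).1.
  - move=> w; rewrite !normrM -mulrA mulrC; apply: ler_wpM2r => //.
    by apply: ler_pM.
  - exact/integZ/integ_norm/(xi0 k).1.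
have mSC : measurable_wrt (predC1 (ixi N)) (fun w => S N w * C N w).
  have m1 : measurable_wrt (predC1 (ixi N)) (S N).
    apply: sub_measurable_wrt _ (@mS N) => i; rewrite !inE => /orP[].
      by apply: contra => /eqP ->.
    move=> /mapP[k kN ->]; apply/eqP => /ixi_inj kE; move: kN.
    by rewrite kE mem_iota add0n ltnn.
  have m2 : measurable_wrt (predC1 (ixi N)) (C N).
    by apply: sub_measurable_wrt _ (mC N) => i; rewrite !inE; apply: contra => /eqP ->.
  exact: measurable_funM.
have [i1 E1] : integ P (fun w => xi N w * (S N w * C N w)) /\
    Ex P (fun w => xi N w * (S N w * C N w)) = Ex P (xi N) * Ex P (fun w => S N w * C N w).
  apply: (@Ex_measurable_wrt (pred1 (ixi N)) (predC1 (ixi N))) => //.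
  - by move=> i; rewrite /= negbK.
  - by apply: mxi; rewrite /= eqxx.
  - exact: (xi0 N).1.
have [i2 E2] : integ P (fun w => xi N w ^+ 2 * C N w ^+ 2) /\
    Ex P (fun w => xi N w ^+ 2 * C N w ^+ 2) =
    Ex P (fun w => xi N w ^+ 2) * Ex P (fun w => C N w ^+ 2).
  apply: (@Ex_measurable_wrt isxi (predC isxi)) => //.
  - by move=> i /=; rewrite negbK.
  - by apply: measurable_funX; exact: mxi.
  - by apply: measurable_funX; exact: mC.
  - exact: (xi2 N).1.
have i12 := integD (integZ 2 i1) i2.
under eq_fun do rewrite e; split; first exact: integD.
rewrite ExD// ExD//; last exact: integZ.
by rewrite ES ExZ// E1 E2 (xi0 N).2 (xi2 N).2 mul0r mulr0 add0r big_ord_recr.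
Qed.

End orthogonality.

(** * Mean-square bound after truncation of the lengths *)

Section truncation.
Variables (xi : nat -> T -> R) (ixi : nat -> I) (isxi : pred I) (s2 : R).
Variables (tau : nat -> T -> nat) (itau : nat -> I).
Hypothesis xiF : forall k, rv_events (xi k) `<=` F (ixi k).
Hypothesis tauF : forall k, rv_events (tau k) `<=` F (itau k).
Hypothesis isxiP : forall k, isxi (ixi k).
Hypothesis isxiN : forall k, ~~ isxi (itau k).
Hypothesis ixi_inj : injective ixi.
Hypothesis xi2 : forall k, integ P (fun w => xi k w ^+ 2) /\ Ex P (fun w => xi k w ^+ 2) = s2.
Hypothesis xi0 : forall k, integ P (xi k) /\ Ex P (xi k) = 0.
Hypothesis tau_law : forall k, same_law P (tau k) (tau 0%N).

Let mtau k : measurable_fun setT (tau k).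
Proof.
apply: (@measurable_wrt_measurable _ _ (pred1 (itau k))).
by apply: measurable_wrt_rv (@tauF k) _; rewrite /= eqxx.
Qed.

Let law_Ex (k : nat) (g : nat -> R) (M : R) : (forall n, `|g n| <= M) ->
  integ P (fun w => g (tau k w)) /\ Ex P (fun w => g (tau k w)) = Ex P (fun w => g (tau 0%N w)).
Proof.
move=> gM; have i0 : integ P (g \o tau k).
  apply: (@integ_bounded _ _ _ _ M) => [|w]; last exact: gM.
  exact: (@measurableT_comp _ _ _ _ _ _ g).
have mg : measurable_fun setT g by [].
by have [_ E] := Ex_same_law (mtau k) (mtau 0) (@tau_law k) mg i0.
Qed.

(** The first term bounds the probability that some length exceeds [a]. Otherwise the sum equals its
    truncated version [S'], whose second moment is computed by orthogonality; [E k] does not involve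
    [tau k], so the mean of the squared coefficient splits into that of [E k ^+ 2] and the truncated
    second moment of the length. *)
Lemma truncation_bound (N : nat) (C E : nat -> T -> R) (A : nat -> pred I) (M a e : R) :
  0 <= M -> 0 < e ->
  (forall k, measurable_wrt (predC isxi) (C k)) ->
  (forall k, measurable_wrt (A k) (E k)) ->
  (forall k, ~~ A k (itau k)) ->
  (forall k w, 0 <= E k w <= M) ->
  (forall k w, (tau k w)%:R <= a -> `|C k w| <= E k w * (tau k w)%:R) ->
  Ex P (fun w => Num.min 1 `|\sum_(k < N) xi k w * C k w|) <=
  N%:R * tail P (tau 0%N) a +
  (e + e^-1 * s2 * truncated_moment2 P (tau 0%N) a * \sum_(k < N) Ex P (fun w => E k w ^+ 2)).
Proof.
move=> M0 e0 mC mE Atau E01 CE.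
pose t k w : R := ((tau k w)%:R <= a)%R%:R.
pose C' k w := C k w * t k w.
have mt k (B : pred I) : B (itau k) -> measurable_wrt B (t k).
  move=> Bk; have mtk : measurable_wrt B (tau k) := measurable_wrt_rv (@tauF k) Bk.
  exact: (@measurableT_comp _ _ _ _ _ _ (fun n : nat => (n%:R <= a)%R%:R : R) _ _ _ mtk).
have mC' k : measurable_wrt (predC isxi) (C' k).
  by apply: measurable_funM; [exact: mC|apply: mt; exact: isxiN].
have C'E k w : `|C' k w| <= E k w * (tau k w)%:R * t k w.
  rewrite /C' /t; have [h|h] := leP (tau k w)%:R a; last by rewrite !mulr0 normr0.
  by rewrite !mulr1; exact: CE.
have bC' k w : `|C' k w| <= M * `|a|.
  apply: le_trans (C'E k w) _; rewrite /t.
  have /andP[h0 hM] := E01 k w.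
  have [h|h] := leP (tau k w)%:R a; last by rewrite mulr0 mulr_ge0.
  by rewrite mulr1; apply: ler_pM => //; apply: le_trans h (ler_norm _).
have [iS ES] := Ex_sqr_sum_orthogonal xiF isxiP ixi_inj xi2 xi0 mC' bC' N.
have mxi k : measurable_fun setT (xi k) := integ_measurable (xi0 k).1.
have mS (D : nat -> T -> R) : (forall k, measurable_fun setT (D k)) ->
    measurable_fun setT (fun w => \sum_(k < N) xi k w * D k w).
  by move=> mD; apply: measurable_sum => k; apply: measurable_funM.
have itl k : integ P (fun w => (a < (tau k w)%:R)%R%:R) /\
    Ex P (fun w => (a < (tau k w)%:R)%R%:R) = tail P (tau 0%N) a.
  apply: (@law_Ex k (fun n => (a < n%:R)%R%:R) 1) => n.
  by case: (_ < _); rewrite ?normr1 ?normr0.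
have s20 : 0 <= s2 by have [_ <-] := xi2 0; apply: Ex_ge0 => w; exact: sqr_ge0.
pose S' w := \sum_(k < N) xi k w * C' k w.
have bound w : Num.min 1 `|\sum_(k < N) xi k w * C k w| <=
    \sum_(k < N) (a < (tau k w)%:R)%R%:R + (e + e^-1 * S' w ^+ 2).
  have r0 : 0 <= e + e^-1 * S' w ^+ 2.
    by rewrite addr_ge0 ?(ltW e0)// mulr_ge0 ?sqr_ge0// invr_ge0 ltW.
  have [/existsP[k hk]|/existsPn H] := boolP [exists k : 'I_N, a < (tau k w)%:R].
    apply: (@le_trans _ _ 1); first by rewrite ge_min lexx.
    rewrite (bigD1 k)//= hk -addrA lerDl addr_ge0//.
    exact: sumr_ge0.
  have -> : \sum_(k < N) (a < (tau k w)%:R)%R%:R = 0 :> R.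
    by rewrite big1// => k _; rewrite (negbTE (H k)).
  have -> : \sum_(k < N) xi k w * C k w = S' w.
    by apply: eq_bigr => k _; rewrite /C' /t leNgt H mulr1.
  rewrite add0r ge_min; apply/orP; right.
  (* The inequality [|S'| <= e + S'^2 / e] passes from the second moment to the first without a
     square root. *)
  rewrite -(real_normK (num_real (S' w))) -(ler_pM2l e0).
  have n0 := normr_ge0 (S' w); set x := `|S' w| in n0 *.
  have -> : e * (e + e^-1 * x ^+ 2) = e ^+ 2 + x ^+ 2 by field; rewrite gt_eqF.
  have := sqr_ge0 (x - e); nra.
apply: (@le_trans _ _ (Ex P (fun w => \sum_(k < N) (a < (tau k w)%:R)%R%:R + (e + e^-1 * S' w ^+ 2)))).
  apply: le_Ex => //.
    apply: (@integ_bounded _ _ _ _ 1) => [|w].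
      apply: measurable_minr; first exact: measurable_cst.
      by apply: measurableT_comp => //; apply: mS => k; exact: measurable_wrt_measurable (mC k).
    by rewrite ger0_norm ?ge_min ?lexx// le_min ler01 normr_ge0.
  apply: integD; first by apply: integ_sum => k _; exact: (itl k).1.
  by apply: integD; [exact: integ_cst|exact: integZ].
rewrite ExD; last 2 first.
- by apply: integ_sum => k _; exact: (itl k).1.
- by apply: integD; [exact: integ_cst|exact: integZ].
rewrite ExD ?Ex_cst ?ExZ//; last 2 first.
- exact: integ_cst.
- exact: integZ.
rewrite Ex_sum => [|k _]; last exact: (itl k).1.
under eq_bigr do rewrite (itl _).2.
rewrite sumr_const card_ord -(mulr_natl (tail P (tau 0%N) a)) lerD2l lerD2l -!mulrA.
apply: ler_wpM2l; first by rewrite invr_ge0 ltW.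
rewrite ES -mulr_sumr; apply: ler_wpM2l => //.
rewrite mulr_sumr; apply: ler_sum => k _.
have mEk : measurable_wrt (A k) (fun w => E k w ^+ 2) by apply: measurable_funX; exact: mE.
have iE2 : integ P (fun w => E k w ^+ 2).
  apply: (@integ_bounded _ _ _ _ (M ^+ 2)) => [|w].
    exact: measurable_wrt_measurable mEk.
  have /andP[h0 hM] := E01 k w.
  by rewrite ger0_norm ?sqr_ge0//; apply: lerXn2r; rewrite ?nnegrE.
pose u n : R := n%:R ^+ 2 * (n%:R <= a)%R%:R.
have [iu Eu] : integ P (fun w => u (tau k w)) /\ Ex P (fun w => u (tau k w)) =
    truncated_moment2 P (tau 0%N) a.
  apply: (@law_Ex k u (a ^+ 2)) => n; rewrite /u ger0_norm ?mulr_ge0 ?sqr_ge0//.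
  have [h|h] := leP n%:R a; last by rewrite mulr0 sqr_ge0.
  by rewrite mulr1; apply: lerXn2r; rewrite ?nnegrE ?ler0n// (le_trans _ h) ?ler0n.
have [ip Ep] : integ P (fun w => E k w ^+ 2 * u (tau k w)) /\
    Ex P (fun w => E k w ^+ 2 * u (tau k w)) =
    Ex P (fun w => E k w ^+ 2) * Ex P (fun w => u (tau k w)).
  apply: (@Ex_measurable_wrt (A k) (predC (A k))) => //.
  - by move=> i /=; rewrite negbK.
  - have mtk : measurable_wrt (predC (A k)) (tau k) := measurable_wrt_rv (@tauF k) (Atau k).
    exact: (@measurableT_comp _ _ _ _ _ _ u _ _ _ mtk).
rewrite -Eu mulrC -Ep; apply: le_Ex => //.
  apply: (@integ_bounded _ _ _ _ ((M * `|a|) ^+ 2)) => [|w].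
    by apply: measurable_funX; exact: measurable_wrt_measurable (mC' k).
  by rewrite normrX; apply: lerXn2r; rewrite ?nnegrE ?mulr_ge0.
move=> w; rewrite -(real_normK (num_real (C' k w))).
have h : `|C' k w| ^+ 2 <= (E k w * (tau k w)%:R * t k w) ^+ 2.
  apply: lerXn2r; rewrite ?nnegrE//.
  by have /andP[h0 hM] := E01 k w; rewrite !mulr_ge0.
apply: le_trans h _; rewrite /u /t.
by have [_|_] := leP (tau k w)%:R a; [rewrite !mulr1 exprMn|rewrite !mulr0 expr0n].
Qed.

End truncation.

End measurable_wrt.

(** * Characteristic functions *)


Section characteristic_functions.
Import complex.
Context {R : realType}.
Local Notation normc := ComplexField.Normc.normc.

Definition cf {d} {T : measurableType d} (P : probability T R) (X : T -> R) : complex R :=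
  Complex (Ex P (fun w => cos (X w))) (Ex P (fun w => sin (X w))).

Definition cexp (a b : R) : complex R := Complex (expR (- a) * cos b) (expR (- a) * sin b).

Lemma cexpD a b a' b' : cexp (a + a') (b + b') = cexp a b * cexp a' b'.
Proof.
apply/eqP; rewrite eq_complex /= cosD sinD opprD expRD.
by apply/andP; split; apply/eqP; ring.
Qed.

Lemma cexp_exp k a b : cexp (k%:R * a) (k%:R * b) = cexp a b ^+ k.
Proof.
elim: k => [|k IH].
  by rewrite !mul0r /cexp oppr0 expR0 cos0 sin0 mulr0 mulr1.
by rewrite exprS -IH -cexpD; congr cexp; rewrite -natr1; ring.
Qed.

Lemma normc_ge0 (x : complex R) : 0 <= normc x.
Proof. by case: x => a b; rewrite /= sqrtr_ge0. Qed.

Lemma normc_le_ReIm (a b : R) : normc (Complex a b) <= `|a| + `|b|.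
Proof.
rewrite /= -(ger0_norm (addr_ge0 (normr_ge0 a) (normr_ge0 b))) -sqrtr_sqr ler_sqrt ?sqr_ge0//.
rewrite -(real_normK (num_real a)) -(real_normK (num_real b)).
have := normr_ge0 a; have := normr_ge0 b; nra.
Qed.

Lemma Re_le_normc (a b : R) : `|a| <= normc (Complex a b).
Proof. by rewrite /= -sqrtr_sqr ler_sqrt ?addr_ge0 ?sqr_ge0// lerDl sqr_ge0. Qed.

Lemma Im_le_normc (a b : R) : `|b| <= normc (Complex a b).
Proof. by rewrite /= -sqrtr_sqr ler_sqrt ?addr_ge0 ?sqr_ge0// lerDr sqr_ge0. Qed.

Lemma normc_cexp a b : 0 <= a -> normc (cexp a b) <= 1.
Proof.
move=> a0; rewrite /= -[leRHS]sqrtr1 ler_sqrt ?ler01// !exprMn -mulrDr cos2Dsin2 mulr1.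
by apply: exprn_ile1; [exact: expR_ge0|rewrite expR_le1 oppr_le0].
Qed.

Lemma normc_prod_le1 (J : Type) (r : seq J) (x : J -> complex R) :
  (forall j, normc (x j) <= 1) -> normc (\prod_(j <- r) x j) <= 1.
Proof.
move=> x1; elim: r => [|j r IH]; first by rewrite big_nil ComplexField.Normc.normc1.
rewrite big_cons ComplexField.Normc.normcM.
by apply: mulr_ile1 => //; exact: normc_ge0.
Qed.

(** Telescoping: the factors are exchanged one at a time, and all the others have modulus at most
    1. *)
Lemma normc_prodB (J : Type) (r : seq J) (x y : J -> complex R) :
  (forall j, normc (x j) <= 1) -> (forall j, normc (y j) <= 1) ->
  normc (\prod_(j <- r) x j - \prod_(j <- r) y j) <= \sum_(j <- r) normc (x j - y j).
Proof.
move=> x1 y1; elim: r => [|j r IH]; first by rewrite !big_nil subrr ComplexField.Normc.normc0.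
rewrite !big_cons.
set X := \prod_(i <- r) x i; set Y := \prod_(i <- r) y i.
have -> : x j * X - y j * Y = (x j - y j) * X + y j * (X - Y) by ring.
apply: le_trans (@complex.le_normcD R _ _) _; apply: lerD.
  rewrite ComplexField.Normc.normcM ler_piMr ?normc_ge0//.
  exact: normc_prod_le1.
rewrite ComplexField.Normc.normcM; apply: le_trans _ IH.
by rewrite ler_piMl// normc_ge0.
Qed.

Lemma ler_norm_trigB (x y : R) : `|cos x - cos y| <= 2 * Num.min 1 `|x - y| /\
  `|sin x - sin y| <= 2 * Num.min 1 `|x - y|.
Proof.
have := ler_norm_cosB1 (x - y); have := ler_norm_sin (x - y).
have := ler_norm_cos1 y; have := ler_norm_sin1 y.
have := ler_norm_cos1 x; have := ler_norm_sin1 x.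
have := cosD (x - y) y; have := sinD (x - y) y; rewrite subrK => -> ->.
set C := cos (x - y); set S := sin (x - y); set c := cos y; set s := sin y.
move=> h1 h2 h3 h4 h5 h6.
have p1 : `|(C - 1) * c| <= `|x - y| by rewrite normrM; have := normr_ge0 (C - 1); nra.
have p2 : `|(C - 1) * s| <= `|x - y| by rewrite normrM; have := normr_ge0 (C - 1); nra.
have p3 : `|S * c| <= `|x - y| by rewrite normrM; have := normr_ge0 S; nra.
have p4 : `|S * s| <= `|x - y| by rewrite normrM; have := normr_ge0 S; nra.
move: h1 h2 h3 h4 p1 p2 p3 p4; rewrite !ler_norml.
have [m1|m1] := leP 1 `|x - y|.
  by move=> /andP[? ?] /andP[? ?] /andP[? ?] /andP[? ?] _ _ _ _; split; apply/andP; split; lra.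
by move=> _ _ _ _ /andP[? ?] /andP[? ?] /andP[? ?] /andP[? ?]; split; apply/andP; split; lra.
Qed.

Section one_space.
Context {d} {T : measurableType d} (P : probability T R).
Implicit Types X Y : T -> R.

(** The squared modulus [N^2 = a^2 + b^2] is the mean of [a cos X + b sin X], which is at most [N]
    by the Cauchy-Schwarz inequality in the plane; hence [N^2 <= N]. *)
Lemma normc_cf X : measurable_fun setT X -> normc (cf P X) <= 1.
Proof.
move=> mX; rewrite /cf /=; set a := Ex P _; set b := Ex P _.
set N := Num.sqrt _.
have N0 : 0 <= N := sqrtr_ge0 _.
have NE : N ^+ 2 = a ^+ 2 + b ^+ 2 by rewrite sqr_sqrtr// addr_ge0 ?sqr_ge0.
have : N ^+ 2 <= N.
  have -> : N ^+ 2 = Ex P (fun w => a * cos (X w) + b * sin (X w)).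
    rewrite ExD ?ExZ -?expr2//; [exact: integ_sin|exact: integ_cos| |];
    by apply: integZ; [exact: integ_cos||exact: integ_sin].
  rewrite -[leRHS](Ex_cst P); apply: le_Ex => [||w].
  - by apply: integD; apply: integZ; [exact: integ_cos|exact: integ_sin].
  - exact: integ_cst.
  apply: le_trans (ler_norm _) _; rewrite -sqrtr_sqr ler_sqrt ?addr_ge0 ?sqr_ge0//.
  rewrite -[leRHS]mulr1 -(cos2Dsin2 (X w)).
  have := sqr_ge0 (a * sin (X w) - b * cos (X w)); nra.
by move=> h; rewrite leNgt; apply/negP => N1; move: h; rewrite leNgt expr2 ltr_pMl ?N1// (lt_trans ltr01).
Qed.

Lemma cf_add X Y : measurable_fun setT X -> measurable_fun setT Y ->
  (forall A B, measurable A -> measurable B ->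
    P (X @^-1` A `&` Y @^-1` B) = (P (X @^-1` A) * P (Y @^-1` B))%E) ->
  cf P (fun w => X w + Y w) = cf P X * cf P Y.
Proof.
move=> mX mY XY.
have mc : measurable_fun setT (@cos R) by apply: continuous_measurable_fun; exact: continuous_cos.
have ms : measurable_fun setT (@sin R) by apply: continuous_measurable_fun; exact: continuous_sin.
have H (g h : R -> R) : measurable_fun setT g -> measurable_fun setT h ->
    (forall y, `|g y| <= 1) -> (forall y, `|h y| <= 1) ->
    integ P (fun w => g (X w) * h (Y w)) /\
    Ex P (fun w => g (X w) * h (Y w)) = Ex P (fun w => g (X w)) * Ex P (fun w => h (Y w)).
  move=> mg mh g1 h1; apply: (@Ex_indep _ _ _ P (g \o X) (h \o Y)).
  - move=> A B mA mB; apply: (XY (g @^-1` A) (h @^-1` B)).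
      by rewrite -[X in measurable X]setTI; exact: mg.
    by rewrite -[X in measurable X]setTI; exact: mh.
  - by apply: (@integ_bounded _ _ _ _ 1) => [|w]; [exact: measurableT_comp|exact: g1].
  - by apply: (@integ_bounded _ _ _ _ 1) => [|w]; [exact: measurableT_comp|exact: h1].
have [i1 E1] := H _ _ mc mc ler_norm_cos1 ler_norm_cos1.
have [i2 E2] := H _ _ ms ms ler_norm_sin1 ler_norm_sin1.
have [i3 E3] := H _ _ ms mc ler_norm_sin1 ler_norm_cos1.
have [i4 E4] := H _ _ mc ms ler_norm_cos1 ler_norm_sin1.
apply/eqP; rewrite eq_complex /=; apply/andP; split; apply/eqP.
  by under eq_Ex do rewrite cosD; rewrite ExB// E1 E2.
by under eq_Ex do rewrite sinD; rewrite ExD// E3 E4 addrC.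
Qed.

Lemma cf_sum (X : nat -> T -> R) N : (forall k, measurable_fun setT (X k)) ->
  (forall n, (n < N)%N -> forall A B, measurable A -> measurable B ->
    P ((fun w => \sum_(k < n) X k w) @^-1` A `&` X n @^-1` B) =
    (P ((fun w => \sum_(k < n) X k w)%R @^-1` A) * P (X n @^-1` B))%E) ->
  cf P (fun w => \sum_(k < N) X k w) = \prod_(k < N) cf P (X k).
Proof.
move=> mX; elim: N => [|N IH] H.
  rewrite big_ord0 /cf; under eq_Ex do rewrite big_ord0 cos0.
  by under [X in Complex _ X]eq_Ex do rewrite big_ord0 sin0; rewrite !Ex_cst.
rewrite big_ord_recr -IH /=; last by move=> n nN; apply: H; exact: ltnW.
rewrite -cf_add//; last 2 first.
- by apply: measurable_sum => k; exact: mX.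
- by move=> A B mA mB; exact: (H N (ltnSn N)).
congr (cf P _); apply/funext => w; exact: big_ord_recr.
Qed.

Lemma integ_min1 X : measurable_fun setT X -> integ P (fun w => Num.min 1 `|X w|).
Proof.
move=> mX; apply: (@integ_bounded _ _ _ _ 1) => [|w].
  by apply: measurable_minr; [exact: measurable_cst|exact: measurableT_comp].
by rewrite ger0_norm ?ge_min ?lexx// le_min ler01 normr_ge0.
Qed.

Lemma Ex_min1_triangle X Y : measurable_fun setT X -> measurable_fun setT Y ->
  Ex P (fun w => Num.min 1 `|X w + Y w|) <=
  Ex P (fun w => Num.min 1 `|X w|) + Ex P (fun w => Num.min 1 `|Y w|).
Proof.
move=> mX mY; rewrite -ExD; [|exact: integ_min1|exact: integ_min1].
apply: le_Ex => [||w]; first by apply: integ_min1; exact: measurable_funD.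
  by apply: integD; exact: integ_min1.
have h := ler_normD (X w) (Y w); have h0 := normr_ge0 (X w); have h1 := normr_ge0 (Y w).
have [|] := leP 1 `|X w|; have [|] := leP 1 `|Y w|; have [|] := leP 1 `|X w + Y w|; lra.
Qed.

Lemma cf_dist X Y : measurable_fun setT X -> measurable_fun setT Y ->
  `|Ex P (fun w => cos (X w)) - Ex P (fun w => cos (Y w))| <=
    2 * Ex P (fun w => Num.min 1 `|X w - Y w|) /\
  `|Ex P (fun w => sin (X w)) - Ex P (fun w => sin (Y w))| <=
    2 * Ex P (fun w => Num.min 1 `|X w - Y w|).
Proof.
move=> mX mY.
have iXY : integ P (fun w => Num.min 1 `|X w - Y w|) by apply: integ_min1; exact: measurable_funB.
split.
- rewrite -ExB; [|exact: integ_cos|exact: integ_cos].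
  have i := integB (integ_cos P mX) (integ_cos P mY).
  apply: le_trans (Ex_norm i) _; rewrite -ExZ//.
  by apply: le_Ex => [||w]; [exact: integ_norm|exact: integZ|exact: (ler_norm_trigB _ _).1].
- rewrite -ExB; [|exact: integ_sin|exact: integ_sin].
  have i := integB (integ_sin P mX) (integ_sin P mY).
  apply: le_trans (Ex_norm i) _; rewrite -ExZ//.
  by apply: le_Ex => [||w]; [exact: integ_norm|exact: integZ|exact: (ler_norm_trigB _ _).2].
Qed.

End one_space.

End characteristic_functions.

(** * Windows and blocks *)

Lemma same_law_pair {d} {T : measurableType d} {R : realType} (P : probability T R)
    {d1} {V1 : measurableType d1} {d2} {V2 : measurableType d2}
    (X X' : T -> V1) (Y Y' : T -> V2) :
  measurable_fun setT X -> measurable_fun setT X' ->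
  measurable_fun setT Y -> measurable_fun setT Y' ->
  same_law P X X' -> same_law P Y Y' ->
  (forall A B, measurable A -> measurable B ->
    P (X @^-1` A `&` Y @^-1` B) = (P (X @^-1` A) * P (Y @^-1` B))%E) ->
  (forall A B, measurable A -> measurable B ->
    P (X' @^-1` A `&` Y' @^-1` B) = (P (X' @^-1` A) * P (Y' @^-1` B))%E) ->
  same_law P (fun w => (X w, Y w)) (fun w => (X' w, Y' w)).
Proof.
move=> mX mX' mY mY' lX lY iXY iXY' B mB.
pose X1 : {mfun T >-> V1} := HB.pack X (isMeasurableFun.Build _ _ _ _ X mX).
pose Y1 : {mfun T >-> V2} := HB.pack Y (isMeasurableFun.Build _ _ _ _ Y mY).
have mZ : measurable_fun setT (fun w => (X w, Y w)) by exact: measurable_fun_pair.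
have mZ' : measurable_fun setT (fun w => (X' w, Y' w)) by exact: measurable_fun_pair.
pose Z1 : {mfun T >-> (V1 * V2)%type} := HB.pack (fun w => (X w, Y w)) (isMeasurableFun.Build _ _ _ _ _ mZ).
pose Z1' : {mfun T >-> (V1 * V2)%type} := HB.pack (fun w => (X' w, Y' w)) (isMeasurableFun.Build _ _ _ _ _ mZ').
have H := @product_measure_unique _ _ V1 V2 R (distribution P X1) (distribution P Y1).
rewrite -[LHS](H (distribution P Z1) _ B mB); last by move=> A C mA mC; exact: iXY.
apply: (H (distribution P Z1') _ B mB) => A C mA mC.
have := iXY' _ _ mA mC; rewrite -lX// -lY//.
Qed.

Section windows.
Context {R : realType}.

(** The indicator of [v <= t < v + u], written with comparisons of reals so that measurability in a
    random start and a random length follows from that of real comparisons. *)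
Definition window (v u t : nat) : R := (v%:R <= t%:R :> R)%R%:R * (t%:R < v%:R + u%:R :> R)%R%:R.

Lemma windowE v u t : window v u t = (v <= t < v + u)%N%:R.
Proof. by rewrite /window -natrD ler_nat ltr_nat; case: (_ <= _)%N; rewrite ?mul1r ?mul0r. Qed.

Lemma window_ge0 v u t : 0 <= window v u t.
Proof. by rewrite windowE. Qed.

Let windowS v u t : window v u.+1 t = window v u t + (t == v + u)%N%:R.
Proof. by rewrite !windowE -natrD; congr _%:R; lia. Qed.

Lemma sum_window_le (a b v u : nat) : \sum_(a <= t < b) window v u t <= u%:R.
Proof.
elim: u => [|u IH].
  by rewrite big1// => t _; rewrite windowE (_ : (v <= t < v + 0)%N = false)//; lia.
under eq_bigr do rewrite windowS.
rewrite big_split/= -natr1 lerD//.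
under eq_bigr do rewrite mulrb.
by rewrite -big_mkcond/= big_nat1_eq; case: ifP.
Qed.

Lemma sum_window (a b v u : nat) : (a <= v)%N -> (v + u <= b)%N ->
  \sum_(a <= t < b) window v u t = u%:R.
Proof.
move=> av; elim: u => [_|u IH vb].
  by rewrite big1// => t _; rewrite windowE (_ : (v <= t < v + 0)%N = false)//; lia.
under eq_bigr do rewrite windowS.
rewrite big_split/= IH; last by lia.
under eq_bigr do rewrite mulrb.
rewrite -big_mkcond/= big_nat1_eq -natr1; congr (_ + _).
by have -> : (a <= v + u < b)%N by lia.
Qed.

Variable f : R -> R.

Definition window_sum (n v u : nat) : R :=
  \sum_(1 <= t < n.+1) f (t%:R / n%:R) * window v u t.

Lemma window_sum_late n v u : (n < v)%N -> window_sum n v u = 0.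
Proof.
move=> nv; rewrite /window_sum big_nat big1// => t tn.
by rewrite windowE (_ : (v <= t < v + u)%N = false) ?mulr0//; lia.
Qed.

Variables (M Lf : R).
Hypothesis fM : forall x, `|f x| <= M.
Hypothesis fL : forall x y, `|f x - f y| <= Lf * `|x - y|.

Let M0 : 0 <= M. Proof. exact: le_trans (fM 0). Qed.

Let Lf0 : 0 <= Lf.
Proof. by have := fL 1 0; rewrite subr0 normr1 mulr1; exact: le_trans. Qed.

Lemma window_sum_bound n v u : `|window_sum n v u| <= M * u%:R.
Proof.
apply: le_trans (ler_norm_sum _ _ _) _.
apply: le_trans (ler_wpM2l M0 (sum_window_le 1 n.+1 v u)).
rewrite mulr_sumr; apply: ler_sum => t _.
by rewrite normrM (ger0_norm (window_ge0 _ _ _)) ler_wpM2r ?window_ge0.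
Qed.

(* The summand indexed by [t] differs from [f s] by at most [Lf * dl] on the window. *)
Lemma window_sum_near n v u (s dl : R) : (0 < v)%N -> (v + u <= n.+1)%N ->
  (forall t, (v <= t < v + u)%N -> `|t%:R / n%:R - s| <= dl) ->
  `|window_sum n v u - f s * u%:R| <= Lf * dl * u%:R.
Proof.
move=> v0 vn H; rewrite -(sum_window v0 vn) mulr_sumr -sumrB.
apply: le_trans (ler_norm_sum _ _ _) _.
rewrite mulr_sumr; apply: ler_sum => t _.
rewrite -mulrBl normrM (ger0_norm (window_ge0 _ _ _)) windowE.
have [vt|_] := boolP (v <= t < v + u)%N; last by rewrite !mulr0.
rewrite !mulr1; apply: le_trans (fL _ _) _.
by rewrite ler_wpM2l// H.
Qed.

(** Windows start at mean distance [mu], so a piece of [n / m] time units holds about [n / (mu * m)]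
    of them. *)
Definition block_size (mu : R) (m n : nat) : nat := Num.truncn (n%:R / (mu * m%:R)).

(** The weight is constant on each block. The indices from [m * block_size] on have expected start
    [mu * k] near or after [n] and get weight 0. *)
Definition block_weight (mu : R) (m n k : nat) : R :=
  if (k < m * block_size mu m n)%N then f ((k %/ block_size mu m n)%:R / m%:R) else 0.

Lemma block_weight_bound mu m n k : `|block_weight mu m n k| <= M.
Proof. by rewrite /block_weight; case: ifP => // _; rewrite normr0. Qed.

(* The block containing [k] starts within [m^-1] of the rescaled time [mu k / n]. *)
Lemma block_start (mu : R) (m n k : nat) : 1 <= mu -> (0 < m)%N ->
  mu * m%:R ^+ 2 <= n%:R -> (k < m * block_size mu m n)%N ->
  `|mu * k%:R / n%:R - (k %/ block_size mu m n)%:R / m%:R| <= m%:R^-1.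
Proof.
move=> mu1 m0 mn; set ka := block_size mu m n => kk.
have ka0 : (0 < ka)%N by case: (ka) kk => //; rewrite muln0.
have mu0 : 0 < mu by lra.
have m0' : 1 <= m%:R :> R by rewrite ler1n.
have n0 : 0 < n%:R :> R by apply: lt_le_trans mn; rewrite mulr_gt0 ?exprn_gt0//; lra.
have mm0 : 0 < mu * m%:R by rewrite mulr_gt0//; lra.
have /truncn_itv/andP[k1 k2] : 0 <= n%:R / (mu * m%:R) by rewrite divr_ge0// ltW.
rewrite -/(block_size mu m n) -/ka in k1 k2.
rewrite ler_pdivlMr// in k1; rewrite ltr_pdivrMr// -natr1 in k2.
set i := (k %/ ka)%N; have im : (i < m)%N by rewrite ltn_divLR.
have kE : k%:R = i%:R * ka%:R + (k %% ka)%N%:R :> R by rewrite {1}(divn_eq k ka) natrD natrM.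
have r1 : (k %% ka)%N%:R <= ka%:R :> R by rewrite ler_nat ltnW// ltn_pmod.
have r0 : 0 <= (k %% ka)%N%:R :> R by [].
have im' : i%:R + 1 <= m%:R :> R by rewrite natr1 ler_nat.
have i0 : 0 <= i%:R :> R by [].
have ka0' : 0 <= ka%:R :> R by [].
rewrite kE; set r : R := (k %% ka)%N%:R in r0 r1 *; set K : R := ka%:R in k1 k2 r1 ka0' *.
set j : R := i%:R in im' i0 *; set mr : R := m%:R in m0' im' k1 k2 mn mm0 *.
have -> : mu * (j * K + r) / n%:R - j / mr = (mr * mu * (j * K + r) - j * n%:R) / (n%:R * mr).
  by field; apply/andP; split; rewrite gt_eqF//; lra.
have nm0 : 0 < n%:R * mr by rewrite mulr_gt0//; lra.
rewrite normrM normfV (gtr0_norm nm0) ler_pdivrMr//.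
have -> : mr^-1 * (n%:R * mr) = n%:R by field; rewrite gt_eqF//; lra.
rewrite ler_norml; apply/andP; split.
  have : j * (n%:R - mr * mu * K) <= mr * (mu * mr).
    have d0 : 0 <= n%:R - mr * mu * K by lra.
    apply: (@le_trans _ _ (mr * (n%:R - mr * mu * K))); first by rewrite ler_wpM2r//; lra.
    by rewrite ler_wpM2l; lra.
  have : 0 <= mr * mu * r by rewrite !mulr_ge0//; lra.
  lra.
have : mr * mu * r <= mr * mu * K by rewrite ler_wpM2l//; lra.
have : 0 <= j * (n%:R - mr * mu * K) by rewrite mulr_ge0//; lra.
lra.
Qed.

Section block_error.
Variables (mu eta : R) (m n k : nat).
Hypotheses (mu1 : 1 <= mu) (m0 : (0 < m)%N) (eta0 : 0 < eta) (n0 : 0 < n%:R :> R).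

(* [v] is the starting time of the window and [mu k] its expected value. The three cases are: the
   window lies inside the observed interval; it starts too late; no information. *)
Definition block_error (v : nat) : R :=
  if `|v%:R - mu * k%:R| <= eta * n%:R then
    (if mu * k%:R + 2 * eta * n%:R <= n%:R then Lf * (2 * eta + m%:R^-1)
     else if n%:R + eta * n%:R < mu * k%:R then 0 else 2 * M)
  else 2 * M.

Let dl0 : 0 <= Lf * (2 * eta + m%:R^-1).
Proof. by rewrite mulr_ge0// addr_ge0 ?invr_ge0//; have := eta0; lra. Qed.

Lemma block_error_itv v : 0 <= block_error v <= 2 * M + Lf * (2 * eta + m%:R^-1).
Proof.
have M20 : 0 <= 2 * M by rewrite mulr_ge0.
rewrite /block_error; case: ifP => _; [case: ifP => _; [|case: ifP => _]|];
  apply/andP; split; rewrite ?lexx ?addr_ge0 ?lerDl ?lerDr//.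
Qed.

(** The trivial bound [2 * M] is met only if the start deviates from [mu * k] by more than
    [eta * n], or if [mu * k] lies so close to [n] that the window may straddle the end; the latter
    concerns an interval of [k] of length [3 * eta * n / mu]. *)
Lemma block_error_sqr v : block_error v ^+ 2 <= (Lf * (2 * eta + m%:R^-1)) ^+ 2 +
  4 * M ^+ 2 * ((eta * n%:R < `|v%:R - mu * k%:R|)%R%:R +
    ((n%:R - 2 * eta * n%:R) / mu <= k%:R <= (n%:R + eta * n%:R) / mu)%R%:R).
Proof.
have mu0 : 0 < mu by have := mu1; lra.
have dd : 0 <= (Lf * (2 * eta + m%:R^-1)) ^+ 2 by rewrite sqr_ge0.
have MM : 0 <= M ^+ 2 by rewrite sqr_ge0.
set p : R := (_ <= k%:R <= _)%R%:R.
have p0 : 0 <= p by [].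
have Mp : 0 <= M ^+ 2 * p by rewrite mulr_ge0.
rewrite ltNge /block_error; case: (_ <= eta * n%:R); last first.
  by rewrite mulr1n exprMn; lra.
rewrite mulr0n add0r.
case: ifP => [_|/negbT g1]; first by lra.
case: ifP => [_|/negbT g2]; first by rewrite expr0n/=; lra.
have -> : p = 1.
  rewrite /p (_ : (_ <= k%:R <= _) = true)//.
  rewrite ler_pdivrMr// ler_pdivlMr// mulrC.
  by rewrite -ltNge in g1; rewrite -leNgt in g2; apply/andP; split; lra.
by rewrite exprMn; lra.
Qed.

(** In rescaled time the deviation of the start and the length of the window cost [eta] each, and
    the distance to the left end of the piece at most [1 / m]. *)
Lemma window_sum_block v u : mu * m%:R ^+ 2 <= n%:R -> mu * m%:R <= 2 * eta * n%:R ->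
  (k < v)%N -> u%:R <= eta * n%:R ->
  `|window_sum n v u - block_weight mu m n k * u%:R| <= block_error v * u%:R.
Proof.
move=> h3 h4 kv un.
have mu0 : 0 < mu by have := mu1; lra.
have m0' : 0 < m%:R :> R by rewrite ltr0n.
have u0 : 0 <= u%:R :> R by [].
have gen : `|window_sum n v u - block_weight mu m n k * u%:R| <= 2 * M * u%:R.
  apply: le_trans (ler_normB _ _) _.
  have := window_sum_bound n v u.
  have := ler_wpM2r u0 (block_weight_bound mu m n k).
  by rewrite (normrM (block_weight _ _ _ _)) (ger0_norm u0); lra.
rewrite /block_error; case: ifP => // gd.
have mm0 : 0 < mu * m%:R by rewrite mulr_gt0.
have /truncn_itv/andP[k1 k2] : 0 <= n%:R / (mu * m%:R) by rewrite divr_ge0// ltW.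
rewrite ler_pdivlMr// -/(block_size mu m n) in k1.
rewrite ltr_pdivrMr// -natr1 -/(block_size mu m n) in k2.
case: ifP => [inn|_].
  (* The margin [2 * eta * n] covers [mu * m], the most that truncation in [block_size] can lose
     over the [m] blocks. *)
  have kb : (k < m * block_size mu m n)%N.
    by rewrite -(ltr_nat R) natrM -(ltr_pM2l mu0); lra.
  rewrite {1}/block_weight kb.
  move: gd; rewrite ler_norml => /andP[g1 g2].
  apply: window_sum_near; first by apply: leq_trans kv.
    by rewrite -(ler_nat R) natrD -natr1; lra.
  move=> t /andP[]; rewrite -(ler_nat R) -(ltr_nat R) natrD => t1 t2.
  have := block_start mu1 m0 h3 kb.
  set s := _ / m%:R => hs.
  have : `|t%:R / n%:R - mu * k%:R / n%:R| <= 2 * eta.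
    rewrite -mulrBl normrM normfV (gtr0_norm n0) ler_pdivrMr// ler_norml.
    by apply/andP; split; lra.
  move=> ht1; have := ler_normD (t%:R / n%:R - mu * k%:R / n%:R) (mu * k%:R / n%:R - s).
  by rewrite addrA subrK; lra.
case: ifP => // late.
move: gd; rewrite ler_norml => /andP[g1 g2].
have en : 0 < eta * n%:R by rewrite mulr_gt0.
rewrite window_sum_late; last by rewrite -(ltr_nat R); lra.
rewrite /block_weight ifF ?mul0r ?subrr ?normr0//.
by apply: negbTE; rewrite -leqNgt -(ler_nat R) natrM -(ler_pM2l mu0); lra.
Qed.

End block_error.

(** The minimum with [n] records how much of the interval has been passed; without it the bound
    could not grow along the induction. *)
Lemma count_interval (n : nat) (a b : R) : a <= b + 1 ->
  \sum_(k < n) (a <= k%:R <= b)%R%:R <= Num.max 0 (Num.min n%:R (b + 1) - a + 1) :> R.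
Proof.
move=> ab; elim: n => [|n IH]; first by rewrite big_ord0 le_max lexx.
rewrite big_ord_recr/= -natr1.
have [/andP[h1 h2]|_] := boolP (a <= n%:R <= b)%R; last first.
  rewrite addr0; apply: le_trans IH _; rewrite ge_max !le_max lexx/=; apply/orP; right.
  rewrite !lerD2r; rewrite le_min !ge_min lexx orbT andbT; apply/orP; left; lra.
have m1 : Num.min (n%:R + 1) (b + 1) = n%:R + 1 by apply/min_idPl; lra.
have m2 : Num.min n%:R (b + 1) = n%:R by apply/min_idPl; lra.
rewrite m1; rewrite m2 in IH.
have : Num.max 0 (n%:R - a + 1) = n%:R - a + 1 by apply/max_idPr; lra.
move=> mE; rewrite mE in IH.
by rewrite le_max -[true%:R]/(1 : R); apply/orP; right; lra.
Qed.

End windows.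

Lemma rv_eventsT {d} {T : measurableType d} {d'} {V : measurableType d'} (X : T -> V) :
  rv_events X setT.
Proof. by exists setT => //; rewrite preimage_setT. Qed.

Lemma setI_closed_rv_events {d} {T : measurableType d} {d'} {V : measurableType d'}
  (X : T -> V) : setI_closed (rv_events X).
Proof.
by move=> _ _ [A mA <-] [B mB <-]; exists (A `&` B); [exact: measurableI|rewrite preimage_setI].
Qed.

Lemma rv_events_measurable {d} {T : measurableType d} {d'} {V : measurableType d'}
  (X : T -> V) : measurable_fun setT X -> rv_events X `<=` measurable.
Proof. by move=> mX _ [A mA <-]; rewrite -[X in measurable X]setTI; exact: mX. Qed.

Lemma cvg_in_prob_min1 {d} {T : measurableType d} {R : realType} (P : probability T R)
    (Y : nat -> T -> R) (Z : T -> R) :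
  (forall n, measurable_fun setT (Y n)) -> measurable_fun setT Z -> cvg_in_prob P Y Z ->
  Ex P (fun w => Num.min 1 `|Y n w - Z w|) @[n --> \oo] --> (0 : R).
Proof.
move=> mY mZ YZ; apply/cvgrPdist_le => e e0; have e20 : 0 < e / 2 by lra.
have H := YZ _ e20.
have {}H : fine (P [set w | e / 2 < `|Y n w - Z w|]) @[n --> \oo] --> (0 : R).
  by apply: (@fine_cvg R _ _ _ _ 0).
near=> n.
have mE : measurable [set w | e / 2 < `|Y n w - Z w|].
  rewrite -[X in measurable X]setTI.
  have mm : measurable_fun setT (fun w => `|Y n w - Z w|).
    by apply: measurableT_comp => //; exact: measurable_funB.
  by apply: (measurable_fun_ltr (measurable_cst (e / 2)) mm) => //; exact: measurableT.
have i1 : integ P (fun w => Num.min 1 `|Y n w - Z w|) by apply: integ_min1; exact: measurable_funB.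
rewrite sub0r normrN ger0_norm; last by apply: Ex_ge0 => w; rewrite le_min ler01 normr_ge0.
apply: (@le_trans _ _ (Ex P (fun w => e / 2 + \1_[set w | e / 2 < `|Y n w - Z w|] w))).
  apply: le_Ex => //; first by apply: integD; [exact: integ_cst|exact: integ_indic].
  move=> w; rewrite indicE.
  have [h|h] := ltP (e / 2) `|Y n w - Z w|.
    rewrite mem_set// ge_min -[true%:R]/(1 : R); apply/orP; left; lra.
  rewrite memNset ?addr0 ?ge_min ?h ?orbT//=; apply/negP; rewrite -leNgt//.
rewrite ExD; [|exact: integ_cst|exact: integ_indic].
rewrite Ex_cst Ex_indic//.
have : fine (P [set w | e / 2 < `|Y n w - Z w|]) < e / 2 by near: n; exact: (cvgr_lt _ H _ e20).
lra.
Unshelve. all: by end_near. Qed.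

Lemma prod_blocks {S : comPzRingType} (m k : nat) (G : nat -> S) : (0 < k)%N ->
  \prod_(i < m * k) G (i %/ k)%N = \prod_(i < m) G i ^+ k.
Proof.
move=> k0; rewrite -(big_mkord xpredT (fun i => G (i %/ k)%N)).
elim: m => [|m IH]; first by rewrite mul0n big_geq// big_ord0.
rewrite big_ord_recr -IH /= (@big_cat_nat _ _ _ (m * k))//=; last by rewrite leq_mul2r leqnSn orbT.
congr (_ * _); rewrite mulSn addnC -{1}[(m * k)%N]add0n big_addn addKn.
rewrite big_mkord (eq_bigr (fun=> G m)); first by rewrite prodr_const card_ord.
by move=> i _; rewrite addnC divnMDl// divn_small// addn0.
Qed.

Lemma sum_blocks {S : zmodType} (m k : nat) (G : nat -> S) : (0 < k)%N ->
  \sum_(i < m * k) G (i %/ k)%N = \sum_(i < m) G i *+ k.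
Proof.
move=> k0; rewrite -(big_mkord xpredT (fun i => G (i %/ k)%N)).
elim: m => [|m IH]; first by rewrite mul0n big_geq// big_ord0.
rewrite big_ord_recr -IH /= (@big_cat_nat _ _ _ (m * k))//=; last by rewrite leq_mul2r leqnSn orbT.
congr (_ + _); rewrite mulSn addnC -{1}[(m * k)%N]add0n big_addn addKn.
rewrite big_mkord (eq_bigr (fun=> G m)); first by rewrite sumr_const card_ord.
by move=> i _; rewrite addnC divnMDl// divn_small// addn0.
Qed.

(** * First-order expansion of characteristic exponents *)

Section small_time.
Context {R : realType}.

Lemma difference_quotient_cvg (g : R -> R) (l : R) (y : nat -> R) :
  is_derive (0:R) 1 g l -> y n @[n --> \oo] --> +oo ->
  y n * (g (y n)^-1 - g 0) @[n --> \oo] --> l.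
Proof.
move=> dg y8.
have D : h^-1 *: (g (h *: (1:R) + 0) - g 0) @[h --> (0:R)^'] --> l.
  have dv : derivable g 0 1 by exact: ex_derive.
  have := dv; rewrite /derivable => /cvg_ex[l' Hl'].
  suff <- : l' = l by [].
  by rewrite -(@derive_val _ _ _ _ _ _ _ dg) /derive; exact/esym/(cvg_lim (@Rhausdorff R)).
apply/cvgrPdist_le => e e0.
move/cvgrPdist_le : D => /(_ e e0)[dl /= dl0 H].
near=> n.
have yn : 0 < y n by near: n; move/cvgryPgt : y8; exact.
have := H (y n)^-1; rewrite invrK scaler1 addr0; apply.
  rewrite /ball_/= sub0r normrN ger0_norm ?invr_ge0 ?(ltW yn)//.
  rewrite -[ltRHS]invrK ltf_pV2 ?posrE ?invr_gt0//.
  by near: n; move/cvgryPgt : y8; exact.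
by rewrite invr_eq0 gt_eqF.
Unshelve. all: by end_near. Qed.

Lemma cexp_small_time (a b : R) (y : nat -> R) : y n @[n --> \oo] --> +oo ->
  y n * (expR (- (a / y n)) * cos (b / y n) - 1) @[n --> \oo] --> - a /\
  y n * (expR (- (a / y n)) * sin (b / y n)) @[n --> \oo] --> b.
Proof.
move=> y8.
have dl (k x : R) : is_derive x 1 (fun x => k * x) k.
  by have := is_deriveZ k (is_derive_id x 1); rewrite scaler1.
have de : is_derive (0:R) 1 (fun x => expR (- (a * x))) (- a).
  have dn : is_derive (0:R) 1 (fun x => - (a * x)) (- a) by exact: is_deriveN (dl a 0).
  have := @is_derive1_comp _ expR (fun x => - (a * x)) 0 _ _ (is_derive_expR _) dn.
  by rewrite mulr0 oppr0 expR0 mul1r.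
have dc : is_derive (0:R) 1 (fun x => cos (b * x)) 0.
  have := @is_derive1_comp _ cos (fun x => b * x) 0 _ _ (is_derive_cos _) (dl b 0).
  by rewrite mulr0 sin0 oppr0 mul0r.
have ds : is_derive (0:R) 1 (fun x => sin (b * x)) b.
  have := @is_derive1_comp _ sin (fun x => b * x) 0 _ _ (is_derive_sin _) (dl b 0).
  by rewrite mulr0 cos0 mul1r.
split.
- have d1 : is_derive (0:R) 1 (fun x => expR (- (a * x)) * cos (b * x)) (- a).
    have := is_deriveM de dc; rewrite scaler0 add0r mulr0 cos0 scale1r; exact.
  have := difference_quotient_cvg d1 y8.
  by rewrite !mulr0 oppr0 expR0 cos0 mulr1.
- have d1 : is_derive (0:R) 1 (fun x => expR (- (a * x)) * sin (b * x)) b.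
    have := is_deriveM de ds; rewrite !mulr0 oppr0 expR0 sin0 scale0r addr0 scale1r; exact.
  have := difference_quotient_cvg d1 y8.
  rewrite !mulr0 sin0 mulr0.
  by under eq_fun do rewrite subr0.
Qed.

End small_time.

Section riemann_sum_characteristic_function.
Import complex.
Context {R : realType} {d} {T : measurableType d} (P : probability T R).
Variables (Lam : R -> T -> R) (a b : R -> R).
Hypothesis mLam : forall t, measurable_fun setT (Lam t).
Hypothesis incr_indep : forall (m : nat) (s : nat -> R), 0 <= s 0%N ->
  (forall i, (i < m)%N -> s i <= s i.+1) -> s m <= 1 ->
  mutually_indep P (fun i : 'I_m => rv_events (fun w => Lam (s i.+1) w - Lam (s i) w)).
Hypothesis incr_law : forall s t : R, 0 <= s -> s <= t -> t <= 1 ->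
  same_law P (fun w => Lam t w - Lam s w) (Lam (t - s)).
Hypothesis cfLam : forall t u : R, 0 <= t -> t <= 1 ->
  cf P (fun w => u * Lam t w) = cexp (t * a u) (t * b u).

Lemma measurable_riemann_sum f m : measurable_fun setT (riemann_sum f Lam m).
Proof.
apply: measurable_sum => i; apply: measurable_funM; first exact: measurable_cst.
exact: measurable_funB.
Qed.

Lemma cf_riemann_sum (f : R -> R) m : (0 < m)%N ->
  cf P (riemann_sum f Lam m) =
  \prod_(i < m) cexp (m%:R^-1 * a (f (i%:R / m%:R))) (m%:R^-1 * b (f (i%:R / m%:R))).
Proof.
move=> m0; have m0' : 0 < m%:R :> R by rewrite ltr0n.
pose s (i : nat) : R := i%:R / m%:R.
have s_le i : s i <= s i.+1 by rewrite /s ler_pM2r ?invr_gt0// ler_nat.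
have s0 i : 0 <= s i by rewrite /s divr_ge0.
have s1 i : (i <= m)%N -> s i <= 1 by move=> im; rewrite /s ler_pdivrMr// mul1r ler_nat.
pose D (i : nat) w := Lam (s i.+1) w - Lam (s i) w.
have mD i : measurable_fun setT (D i) by exact: measurable_funB.
pose F (i : 'I_m) := rv_events (D i).
have FT i : F i setT by exact: rv_eventsT.
have FI i : setI_closed (F i) by exact: setI_closed_rv_events.
have mF i : F i `<=` measurable by exact: rv_events_measurable.
have indep : mutually_indep P F := incr_indep (s0 0) (fun i _ => s_le i) (s1 _ (leqnn m)).
have wrt (A : pred 'I_m) (i : 'I_m) : A i -> measurable_wrt F A (fun w => f (s i) * D i w).
  move=> Ai; apply: measurable_funM; first exact: measurable_cst.
  exact: (@measurable_wrt_rv _ _ _ _ _ _ A i).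
rewrite (_ : riemann_sum f Lam m = (fun w => \sum_(i < m) f (s i) * D i w))//.
rewrite (@cf_sum _ _ _ P (fun i w => f (s i) * D i w)) => [|k|n nm A B mA mB].
- apply: eq_bigr => i _; rewrite -[RHS]cfLam ?invr_ge0 ?invf_le1 ?ler1n//.
  have sE : s i.+1 - s i = m%:R^-1 by rewrite /s -mulrBl -natr1 addrAC subrr add0r mul1r.
  have L := incr_law (s0 i) (s_le i) (s1 _ (ltn_ord i)); rewrite sE in L.
  have H (g : R -> R) : measurable_fun setT g -> (forall y, `|g y| <= 1) ->
      Ex P (fun w => g (f (s i) * D i w)) = Ex P (fun w => g (f (s i) * Lam m%:R^-1 w)).
    move=> mg g1; have mg' : measurable_fun setT (fun x => g (f (s i) * x)).
      by apply: measurableT_comp => //; apply: measurable_funM => //; exact: measurable_cst.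
    have := @Ex_same_law _ _ _ P _ _ (D i) (Lam m%:R^-1) (fun x => g (f (s i) * x)) (mD i)
      (mLam _) L mg'.
    case=> //; apply: (@integ_bounded _ _ _ _ 1) => [|w]; last exact: g1.
    exact: (measurableT_comp mg' (mD i)).
  rewrite /cf; congr (Complex _ _); apply: H.
  + by apply: continuous_measurable_fun; exact: continuous_cos.
  + exact: ler_norm_cos1.
  + by apply: continuous_measurable_fun; exact: continuous_sin.
  + exact: ler_norm_sin1.
- by apply: measurable_funM; [exact: measurable_cst|exact: mD].
- apply: (@measurable_wrt_indep _ _ _ P _ F FT FI mF indep _ _ _ _
    [pred i : 'I_m | (i < n)%N] (pred1 (Ordinal nm))) => //.
  + by move=> i /= ni; apply/eqP => E; move: ni; rewrite E /= ltnn.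
  + apply: measurable_sum => k.
    exact: (wrt [pred i : 'I_m | (i < n)%N] (Ordinal (ltn_trans (ltn_ord k) nm)) (ltn_ord k)).
  + by apply: (wrt _ (Ordinal nm)); rewrite /= eqxx.
Qed.

End riemann_sum_characteristic_function.

(** * Limit theorem for shot sums *)

(** Here [E], [p], [m] stand for the absolute, positive and negative moments, [v] for [|u|^alpha],
    [S / C] for the tangent. The skewness divides by [E]; when [E = 0] both partial moments vanish
    and the identity reads [0 = 0]. *)
Lemma skew_constant {R : realFieldType} (mu E p m G C S v u : R) : mu != 0 -> C != 0 ->
  (E = 0 -> p = 0 /\ m = 0) -> (u = 0 -> v = 0) ->
  (v * (if 0 <= u then p else m) - v * (if 0 <= u then m else p)) * (G * S) =
  mu * (v * (mu^-1 * E * G * C) * ((p - m) / E) * Num.sg u * (S / C)).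
Proof.
move=> mu0 C0 HE Hu; have [E0|E0] := eqVneq E 0.
  by have [-> ->] := HE E0; rewrite !if_same !subrr !(mul0r, mulr0).
have [u0|u0|u0] := ltgtP u 0.
- by rewrite ltr0_sg//; field; rewrite C0 E0 mu0.
- by rewrite gtr0_sg//; field; rewrite C0 E0 mu0.
- by rewrite Hu// u0 sgr0 !(mul0r, mulr0) subrr mul0r.
Qed.

Lemma min1_triangle_div {R : realFieldType} (x y K : R) : 1 <= K ->
  Num.min 1 (`|x| / K) <= Num.min 1 `|x - y| + Num.min 1 (`|y| / K).
Proof.
move=> K1; have K0 : 0 < K by lra.
have h3 : `|x| / K <= `|x - y| + `|y| / K.
  rewrite ler_pdivrMr// mulrDl divfK ?gt_eqF//.
  have := ler_normD (x - y) y; rewrite subrK.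
  have := normr_ge0 (x - y); nra.
have h4 := normr_ge0 (x - y).
have h5 : 0 <= `|y| / K by rewrite divr_ge0// ltW.
have [|] := leP 1 (`|x| / K); have [|] := leP 1 `|x - y|; have [|] := leP 1 (`|y| / K); lra.
Qed.

Section shot_sums.
Context {d} {T : measurableType d} {R : realType} (P : probability T R).
Context {I : eqType} (F : I -> set (set T)).
Hypothesis FT : forall i, F i setT.
Hypothesis FI : forall i, setI_closed (F i).
Hypothesis mF : forall i, F i `<=` measurable.
Hypothesis indepF : mutually_indep P F.

Variables (xi : nat -> T -> R) (ixi : nat -> I) (isxi : pred I).
Variables (tau : nat -> T -> nat) (itau : nat -> I).
Variables (V : nat -> T -> nat) (A : nat -> pred I).
Variables (mu alpha : R) (c : nat -> R).
Hypothesis xiF : forall k, rv_events (xi k) `<=` F (ixi k).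
Hypothesis tauF : forall k, rv_events (tau k) `<=` F (itau k).
Hypothesis isxiP : forall k, isxi (ixi k).
Hypothesis isxiN : forall k, ~~ isxi (itau k).
Hypothesis ixi_inj : injective ixi.
Hypothesis itau_inj : injective itau.
Hypothesis mV : forall k, measurable_wrt F (A k) (V k).
Hypothesis A_isxi : forall k i, A k i -> ~~ isxi i.
Hypothesis A_itau : forall k, ~~ A k (itau k).
Hypothesis V_gt : forall k w, (k < V k w)%N.
Hypothesis mu1 : 1 <= mu.
Hypothesis V_lln : forall eta : R, 0 < eta ->
  n%:R^-1 * \sum_(k < n) Ex P (fun w => (eta * n%:R < `|(V k w)%:R - mu * k%:R|)%R%:R)
  @[n --> \oo] --> (0 : R).
Hypothesis xi_law : forall k, same_law P (xi k) (xi 0%N).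
Hypothesis tau_law : forall k, same_law P (tau k) (tau 0%N).
Hypothesis ixi0 : integ P (xi 0%N).
Hypothesis ixi2 : integ P (fun w => xi 0%N w ^+ 2).
Hypothesis xi_mean : Ex P (xi 0%N) = 0.
Hypothesis alpha12 : 1 < alpha < 2.
Hypothesis ht : heavy_tail P (tau 0%N) alpha c.

Let mxi k : measurable_fun setT (xi k).
Proof.
apply: (@measurable_wrt_measurable _ _ _ F mF _ _ (pred1 (ixi k))).
by apply: measurable_wrt_rv (@xiF k) _; rewrite /= eqxx.
Qed.

Let mtau k : measurable_fun setT (tau k).
Proof.
apply: (@measurable_wrt_measurable _ _ _ F mF _ _ (pred1 (itau k))).
by apply: measurable_wrt_rv (@tauF k) _; rewrite /= eqxx.
Qed.

Let sym_law {d'} {U : measurableType d'} (X Y : T -> U) : same_law P X Y -> same_law P Y X.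
Proof. by move=> h B mB; rewrite h. Qed.

Let s2 := Ex P (fun w => xi 0%N w ^+ 2).

Let s20 : 0 <= s2. Proof. by apply: Ex_ge0 => w; exact: sqr_ge0. Qed.

Let xi0 k : integ P (xi k) /\ Ex P (xi k) = 0.
Proof.
have [i E] := @Ex_same_law _ _ _ P _ _ (xi 0%N) (xi k) id (mxi 0) (mxi k)
  (sym_law (@xi_law k)) (@measurable_id _ _ _) ixi0.
by split=> //; rewrite -xi_mean; exact/esym.
Qed.

Let xi2 k : integ P (fun w => xi k w ^+ 2) /\ Ex P (fun w => xi k w ^+ 2) = s2.
Proof.
have mX : measurable_fun setT (fun x : R => x ^+ 2) by apply: measurable_funX.
have [i E] := @Ex_same_law _ _ _ P _ _ (xi 0%N) (xi k) (fun x => x ^+ 2) (mxi 0) (mxi k)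
  (sym_law (@xi_law k)) mX ixi2.
by split=> //; rewrite E.
Qed.

Let c_gt0 : \forall n \near \oo, 0 < c n.
Proof. by have [+ _ _ _] := ht; move/cvgryPgt; exact. Qed.

Let tail_small (e : R) : 0 < e -> exists2 B : R, 0 < B &
  \forall n \near \oo, n%:R * tail P (tau 0%N) (B * c n) <= e.
Proof.
move=> e0; have /andP[a1 _] := alpha12; have [_ _ tc _] := ht.
have a0 : 0 < alpha by lra.
have [B [B0 BE]] : exists B : R, 0 < B /\ B `^ (- alpha) < e.
  near (pinfty_nbhs R) => B; exists B; split.
    by near: B; exact: nbhs_pinfty_gt.
  near: B; exact: (cvgr_lt _ (powR_cvgy0 a0) _ e0).
exists B => //; near=> n; apply: ltW; near: n.
exact: (cvgr_lt _ (tc _ B0) _ BE).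
Unshelve. all: by end_near. Qed.

Let boolr_norm (b : bool) : `|b%:R| <= 1 :> R.
Proof. by case: b; rewrite ?normr1 ?normr0. Qed.

Section one_function.
Variables (f : R -> R) (M Lf : R).
Hypothesis fM : forall x, `|f x| <= M.
Hypothesis fL : forall x y, `|f x - f y| <= Lf * `|x - y|.

Let M0 : 0 <= M. Proof. exact: le_trans (fM 0). Qed.

Let Lf0 : 0 <= Lf.
Proof. by have := fL 1 0; rewrite subr0 normr1 mulr1; exact: le_trans. Qed.

(** The start [V k] is a function of the variables with index in [A k]. These exclude every [xi] and
    the length [tau k] but may include other lengths, which covers renewal epochs and deterministic
    starts alike. *)
Definition shot_sum n w : R :=
  (c n)^-1 * \sum_(k < n) xi k w * window_sum f n (V k w) (tau k w).

Definition block_sum m n w : R :=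
  (c n)^-1 * \sum_(k < n) xi k w * (block_weight f mu m n k * (tau k w)%:R).

Let mV' k : measurable_wrt F (predC isxi) (V k).
Proof. by apply: sub_measurable_wrt _ (@mV k) => i; exact: A_isxi. Qed.

Let mtau' k (B : pred I) : B (itau k) -> measurable_wrt F B (tau k).
Proof. exact: measurable_wrt_rv. Qed.

Let mnatr (B : pred I) (X : T -> nat) : measurable_wrt F B X ->
  measurable_wrt F B (fun w => (X w)%:R : R).
Proof. by move=> mX; exact: (@measurableT_comp _ _ _ _ _ _ (fun n : nat => n%:R : R)). Qed.

Let mwindow_sum n k : measurable_wrt F (predC isxi) (fun w => window_sum f n (V k w) (tau k w)).
Proof.
have m1 := mnatr (@mV' k); have m2 : measurable_wrt F (predC isxi) (fun w => (tau k w)%:R : R).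
  by apply: mnatr; apply: mtau'; exact: isxiN.
apply: measurable_sum => t; apply: measurable_funM; first exact: measurable_cst.
apply: measurable_funM.
  apply: (@measurable_boolr _ (g_sigma_algebraType _)); apply: measurable_fun_ler => //; exact: measurable_cst.
apply: (@measurable_boolr _ (g_sigma_algebraType _)); apply: measurable_fun_ltr; first exact: measurable_cst.
exact: measurable_funD.
Qed.

Lemma measurable_shot_sum n : measurable_fun setT (shot_sum n).
Proof.
apply: measurable_funM; first exact: measurable_cst.
apply: measurable_sum => k; apply: measurable_funM => //.
exact: (measurable_wrt_measurable mF (mwindow_sum n k)).
Qed.

Lemma measurable_block_sum m n : measurable_fun setT (block_sum m n).
Proof.
apply: measurable_funM; first exact: measurable_cst.
apply: measurable_sum => k; apply: measurable_funM => //.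
by apply: measurable_funM; [exact: measurable_cst|exact: measurable_natr].
Qed.

(** [truncation_bound] for the sum divided by [K], with the constant coefficient [M / (c n * K)].
    The long lengths and the additive constant cost [e / 4] each, the second moment costs
    [Q / K^2]. *)
Lemma shot_sum_tight (e : R) : 0 < e -> exists K0 : R, forall K, K0 <= K ->
  \forall n \near \oo, Ex P (fun w => Num.min 1 (`|shot_sum n w| / K)) <= e.
Proof.
move=> e0; have e40 : 0 < e / 4 by lra.
have [B B0 HB] := tail_small e40.
have [C C0 HC] := truncated_moment2_bound (mtau 0) alpha12 ht B0.
pose Q := (e / 4)^-1 * s2 * C * M ^+ 2.
have Q0 : 0 <= Q.
  by rewrite /Q !mulr_ge0 ?sqr_ge0// invr_ge0 ltW.
exists (1 + Q / (e / 4)) => K KK.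
have K1 : 1 <= K by apply: le_trans KK; rewrite lerDl divr_ge0// ltW.
have K0 : 0 < K by lra.
near=> n.
have n0 : 0 < n%:R :> R by rewrite ltr0n; near: n; exact: nbhs_infty_gt.
have cn : 0 < c n by near: n.
have cK : 0 < c n * K by rewrite mulr_gt0.
have h1 : n%:R * tail P (tau 0%N) (B * c n) <= e / 4 by near: n.
have h2 : n%:R * truncated_moment2 P (tau 0%N) (B * c n) <= C * c n ^+ 2 by near: n.
have MK0 : 0 <= M / (c n * K) by rewrite divr_ge0// ltW.
have := @truncation_bound _ _ _ P _ F FT FI mF indepF xi ixi isxi s2 tau itau xiF tauF
  isxiP isxiN ixi_inj xi2 xi0 tau_law n
  (fun k w => (c n * K)^-1 * window_sum f n (V k w) (tau k w)) (fun k w => M / (c n * K))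
  (fun=> pred0) (M / (c n * K)) (B * c n) (e / 4) MK0 e40 _ _ _ _ _.
have E w : Num.min 1 (`|shot_sum n w| / K) =
    Num.min 1 `|\sum_(k < n) xi k w * ((c n * K)^-1 * window_sum f n (V k w) (tau k w))|.
  congr Num.min; rewrite -[X in _ / X](gtr0_norm K0) -normf_div; congr `|_|.
  rewrite /shot_sum mulrAC -invfM mulr_sumr; apply: eq_bigr => k _; ring.
move=> H; under eq_Ex do rewrite E.
apply: le_trans (H _ _ _ _ _) _.
- by move=> k; apply: measurable_funM; [exact: measurable_cst|exact: mwindow_sum].
- by move=> k; exact: measurable_cst.
- by [].
- by move=> k w; rewrite lexx andbT.
- move=> k w _; rewrite normrM gtr0_norm ?invr_gt0// mulrC mulrAC.
  by rewrite ler_wpM2r ?invr_ge0 ?(ltW cK)//; exact: window_sum_bound.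
rewrite Ex_cst sumr_const card_ord -(mulr_natl ((M / (c n * K)) ^+ 2)).
have -> : (e / 4)^-1 * s2 * truncated_moment2 P (tau 0%N) (B * c n) * (n%:R * (M / (c n * K)) ^+ 2) =
   (e / 4)^-1 * s2 * M ^+ 2 * (n%:R * truncated_moment2 P (tau 0%N) (B * c n) / c n ^+ 2) / K ^+ 2.
  by field; rewrite !gt_eqF.
have : n%:R * truncated_moment2 P (tau 0%N) (B * c n) / c n ^+ 2 <= C.
  by rewrite ler_pdivrMr ?exprn_gt0.
move/(ler_wpM2l (_ : 0 <= (e / 4)^-1 * s2 * M ^+ 2)) => /(_ _) H2.
have K2 : 0 <= K ^- 2 by rewrite invr_ge0 exprn_ge0// ltW.
have := ler_wpM2r K2 (H2 _); rewrite !mulr_ge0 ?sqr_ge0 ?invr_ge0 ?(ltW e40)// => /(_ isT) {H2 H} H3.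
have H4 : (e / 4)^-1 * s2 * M ^+ 2 * C / K ^+ 2 <= e / 4.
  have -> : (e / 4)^-1 * s2 * M ^+ 2 * C = Q by rewrite /Q; ring.
  rewrite ler_pdivrMr ?exprn_gt0//.
  have : Q <= e / 4 * K.
    by rewrite mulrC -ler_pdivrMr//; apply: le_trans KK; rewrite lerDr ler01.
  move/le_trans; apply; rewrite ler_wpM2l ?(ltW e40)// expr2; nra.
lra.
Unshelve. all: by end_near. Qed.

(** The parameters are chosen in the order [B] (cut of the lengths), [C], [eta] (tolerance in
    rescaled time), [m], [n]. Since [Q] does not depend on [eta], a small [eta] makes the
    second-moment term small. *)
Lemma block_comparison (e : R) : 0 < e -> exists m0 : nat, forall m, (m0 < m)%N ->
  \forall n \near \oo, Ex P (fun w => Num.min 1 `|shot_sum n w - block_sum m n w|) <= e.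
Proof.
move=> e0; have e40 : 0 < e / 4 by lra.
have [B B0 HB] := tail_small e40.
have [C C0 HC] := truncated_moment2_bound (mtau 0) alpha12 ht B0.
(* [9] comes from [2 * eta + 1/m <= 3 * eta]; [20] is [4 * 5], with [4 * M^2] the squared trivial
   bound and [5 * eta] the share of indices subject to it: [eta] for deviating starts, [4 * eta] for
   starts near the end. *)
pose Q := (e / 4)^-1 * s2 * C; pose D := 9 * Lf ^+ 2 + 20 * M ^+ 2.
have Q0 : 0 <= Q by rewrite /Q !mulr_ge0// invr_ge0 ltW.
have D0 : 0 <= D by rewrite addr_ge0// mulr_ge0 ?sqr_ge0.
pose eta : R := Num.min (1/2) (e / (2 * (Q + 1) * (D + 1))).
have den0 : 0 < 2 * (Q + 1) * (D + 1) by rewrite !mulr_gt0//; lra.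
have eta0 : 0 < eta by rewrite lt_min; apply/andP; split; [lra|exact: divr_gt0].
have eta1 : eta <= 1/2 by rewrite ge_min lexx.
have etaQ : Q * (eta * D) <= e / 2.
  have : eta * (2 * (Q + 1) * (D + 1)) <= e by rewrite -ler_pdivlMr// ge_min lexx orbT.
  have : 0 <= eta * Q by rewrite mulr_ge0// ltW.
  have : 0 <= eta * D by rewrite mulr_ge0// ltW.
  nra.
exists (Num.truncn eta^-1) => m mm.
have m0 : (0 < m)%N by apply: leq_ltn_trans mm.
have m0' : 1 <= m%:R :> R by rewrite ler1n.
have meta : m%:R^-1 <= eta.
  rewrite -[leRHS]invrK lef_pV2 ?posrE ?invr_gt0//; last by lra.
  apply: ltW; apply: lt_le_trans (truncnS_gt _) _.
  by rewrite ler_nat.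
pose dl := Lf * (2 * eta + m%:R^-1).
have dl0 : 0 <= dl by rewrite mulr_ge0// addr_ge0 ?invr_ge0//; lra.
have dl2 : dl ^+ 2 <= eta * (9 * Lf ^+ 2).
  have : dl <= Lf * (3 * eta) by rewrite ler_wpM2l//; lra.
  have h3 : 0 <= Lf * (3 * eta) by rewrite mulr_ge0//; lra.
  move=> h; apply: (@le_trans _ _ ((Lf * (3 * eta)) ^+ 2)).
    by apply: lerXn2r; rewrite ?nnegrE.
  have : 0 <= Lf ^+ 2 by rewrite sqr_ge0.
  have : eta ^+ 2 <= eta by nra.
  rewrite !exprMn; nra.
have [_ cn0 _ _] := ht.
near=> n.
have n0 : 0 < n%:R :> R by rewrite ltr0n; near: n; exact: nbhs_infty_gt.
have cn : 0 < c n by near: n.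
have h1 : n%:R * tail P (tau 0%N) (B * c n) <= e / 4 by near: n.
have h2 : n%:R * truncated_moment2 P (tau 0%N) (B * c n) <= C * c n ^+ 2 by near: n.
have h3 : mu * m%:R ^+ 2 <= n%:R by near: n; exact: nbhs_infty_ger.
have h4 : mu * m%:R <= 2 * eta * n%:R.
  rewrite mulrC -ler_pdivrMl ?mulr_gt0//; near: n; exact: nbhs_infty_ger.
(* As [c n] is negligible against [n], the lengths kept by the truncation are short in rescaled
   time. *)
have h5 : B * c n <= eta * n%:R.
  have : c n / n%:R <= eta / B.
    apply: ltW; near: n; apply: (cvgr_lt _ cn0); exact: divr_gt0.
  by rewrite ler_pdivrMr// mulrAC ler_pdivlMr// mulrC.
have h6 : n%:R^-1 * \sum_(k < n) Ex P (fun w => (eta * n%:R < `|(V k w)%:R - mu * k%:R|)%R%:R) <= eta.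
  apply: ltW; near: n; exact: (cvgr_lt _ (V_lln eta0)).
have h7 : 2 / n%:R <= eta.
  rewrite ler_pdivrMr// mulrC -ler_pdivrMr//; near: n; exact: nbhs_infty_ger.
have mu0 : 0 < mu by have := mu1; lra.
pose ek k w := block_error M Lf mu eta m n k (V k w).
have ek0 k w : 0 <= ek k w <= 2 * M + dl by exact: (block_error_itv fM fL).
have mek k : measurable_wrt F (A k) (ek k).
  exact: (@measurableT_comp _ _ _ _ _ _ (block_error M Lf mu eta m n k : nat -> R) _ _ _ (@mV k)).
pose bad k : R := Ex P (fun w => (eta * n%:R < `|(V k w)%:R - mu * k%:R|)%R%:R).
pose lo := (n%:R - 2 * eta * n%:R) / mu; pose hi := (n%:R + eta * n%:R) / mu.
have ek2 k : Ex P (fun w => ek k w ^+ 2) <= dl ^+ 2 + 4 * M ^+ 2 * (bad k + (lo <= k%:R <= hi)%R%:R).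
  have mgm : measurable_fun setT (fun w => (eta * n%:R < `|(V k w)%:R - mu * k%:R|)%R%:R : R).
    apply: measurable_boolr; apply: measurable_fun_ltr; first exact: measurable_cst.
    apply: measurableT_comp => //; apply: measurable_funB; last exact: measurable_cst.
    exact: measurable_natr (measurable_wrt_measurable mF (@mV k)).
  have igm : integ P (fun w => (eta * n%:R < `|(V k w)%:R - mu * k%:R|)%R%:R).
    exact: (@integ_bounded _ _ _ _ 1).
  rewrite -(Ex_cst P (dl ^+ 2)) -(Ex_cst P (lo <= k%:R <= hi)%R%:R) /bad -ExD//; last exact: integ_cst.
  rewrite -ExZ; last by apply: integD => //; exact: integ_cst.
  rewrite -ExD; [|exact: integ_cst|by apply: integZ; apply: integD => //; exact: integ_cst].
  apply: le_Ex => [||w].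
  - apply: (@integ_bounded _ _ _ _ ((2 * M + dl) ^+ 2)) => [|w].
      apply: measurable_funX; exact: (measurable_wrt_measurable mF (mek k)).
    have /andP[? ?] := ek0 k w.
    by rewrite ger0_norm ?sqr_ge0//; apply: lerXn2r; rewrite ?nnegrE//; lra.
  - apply: integD; first exact: integ_cst.
    by apply: integZ; apply: integD => //; exact: integ_cst.
  exact: (block_error_sqr M Lf eta m n k mu1).
have sum_ek : \sum_(k < n) Ex P (fun w => ek k w ^+ 2) <= n%:R * (eta * D).
  apply: (@le_trans _ _ (\sum_(k < n) (dl ^+ 2 + 4 * M ^+ 2 * (bad k + (lo <= k%:R <= hi)%R%:R)))).
    by apply: ler_sum => k _; exact: ek2.
  rewrite big_split/= sumr_const card_ord -mulr_sumr big_split/=.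
  have b1 : \sum_(k < n) bad k <= n%:R * eta by rewrite -ler_pdivrMl.
  (* The interval has length at most [3 * eta * n]; the two units added by [count_interval] are
     absorbed by [h7]. *)
  have b2 : \sum_(k < n) (lo <= k%:R <= hi)%R%:R <= n%:R * (4 * eta) :> R.
    have lh : lo <= hi.
      have en : 0 < eta * n%:R by rewrite mulr_gt0.
      by rewrite /lo /hi ler_wpM2r ?invr_ge0 ?(ltW mu0)//; lra.
    apply: le_trans (count_interval n (_ : lo <= hi + 1)) _; first by lra.
    have en : 0 < eta * n%:R by rewrite mulr_gt0.
    have e2 : 2 <= eta * n%:R by rewrite -ler_pdivrMr.
    rewrite ge_max; apply/andP; split; first by lra.
    apply: (@le_trans _ _ (hi + 1 - lo + 1)); first by rewrite !lerD2r ge_min lexx orbT.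
    have : hi - lo <= 3 * (eta * n%:R).
      have h : eta * n%:R <= eta * n%:R * mu by rewrite ler_peMr// ltW.
      rewrite /hi /lo -mulrBl ler_pdivrMr//; lra.
    lra.
  have MM : 0 <= M ^+ 2 by rewrite sqr_ge0.
  have b3 : \sum_(k < n) bad k + \sum_(k < n) (lo <= k%:R <= hi)%R%:R <= n%:R * (5 * eta) by lra.
  have MM4 : 0 <= 4 * M ^+ 2 by lra.
  have := ler_wpM2l MM4 b3.
  rewrite -(mulr_natl (dl ^+ 2)).
  have := ler_wpM2l (ltW n0) dl2.
  rewrite /D; lra.
have DM0 : 0 <= (2 * M + dl) / c n.
  by rewrite divr_ge0// ?(ltW cn)// addr_ge0// mulr_ge0.
have := @truncation_bound _ _ _ P _ F FT FI mF indepF xi ixi isxi s2 tau itau xiF tauF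
  isxiP isxiN ixi_inj xi2 xi0 tau_law n
  (fun k w => (c n)^-1 * (window_sum f n (V k w) (tau k w) - block_weight f mu m n k * (tau k w)%:R))
  (fun k w => (c n)^-1 * ek k w) A ((2 * M + dl) / c n) (B * c n) (e / 4) DM0 e40.
have E w : Num.min 1 `|shot_sum n w - block_sum m n w| =
    Num.min 1 `|\sum_(k < n) xi k w *
     ((c n)^-1 * (window_sum f n (V k w) (tau k w) - block_weight f mu m n k * (tau k w)%:R))|.
  congr (Num.min 1 `|_|); rewrite /shot_sum /block_sum -mulrBr -sumrB mulr_sumr.
  by apply: eq_bigr => k _; ring.
move=> H; under eq_Ex do rewrite E.
apply: le_trans (H _ _ _ _ _) _.
- move=> k; apply: measurable_funM; first exact: measurable_cst.
  apply: measurable_funB; first exact: mwindow_sum.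
  apply: measurable_funM; first exact: measurable_cst.
  by apply: mnatr; apply: mtau'; exact: isxiN.
- by move=> k; apply: measurable_funM; [exact: measurable_cst|exact: mek].
- exact: A_itau.
- move=> k w; have /andP[x1 x2] := ek0 k w.
  by rewrite mulrC divr_ge0 ?(ltW cn)//= ler_pM2r ?invr_gt0.
- move=> {H} k w tB; rewrite normrM gtr0_norm ?invr_gt0// -mulrA ler_wpM2l ?invr_ge0 ?(ltW cn)//.
  by apply: (window_sum_block fM fL) => //; exact: le_trans h5.
have -> : \sum_(k < n) Ex P (fun w => ((c n)^-1 * ek k w) ^+ 2) =
    (c n) ^- 2 * \sum_(k < n) Ex P (fun w => ek k w ^+ 2).
  rewrite mulr_sumr; apply: eq_bigr => k _; rewrite -ExZ; last first.
    apply: (@integ_bounded _ _ _ _ ((2 * M + dl) ^+ 2)) => [|w].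
      apply: measurable_funX; exact: (measurable_wrt_measurable mF (mek k)).
    have /andP[? ?] := ek0 k w.
    by rewrite ger0_norm ?sqr_ge0//; apply: lerXn2r; rewrite ?nnegrE//; lra.
  by apply: eq_Ex => w; rewrite exprMn exprVn.
set tm := truncated_moment2 _ _ _ in h2 *.
have tm0 : 0 <= tm by exact: truncated_moment2_ge0.
set Se := \sum_(k < n) Ex P _ in sum_ek *.
have f1 : (c n) ^- 2 * (tm * Se) <= C * (eta * D).
  rewrite ler_pdivrMl ?exprn_gt0//.
  have := ler_wpM2l tm0 sum_ek.
  have eD : 0 <= eta * D by rewrite mulr_ge0// ltW.
  have := ler_wpM2r eD h2; lra.
have e4s : 0 <= (e / 4)^-1 * s2 by rewrite mulr_ge0// invr_ge0 ltW.
have := ler_wpM2l e4s f1.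
have -> : (e / 4)^-1 * s2 * (C * (eta * D)) = Q * (eta * D) by rewrite /Q; ring.
have -> : (e / 4)^-1 * s2 * (c n ^- 2 * (tm * Se)) = (e / 4)^-1 * s2 * tm * (c n ^- 2 * Se) by ring.
lra.
Unshelve. all: by end_near. Qed.

End one_function.

(** * Convergence of the law for one test function *)

Section limit_law.
Import complex.
Context {d2} {T2 : measurableType d2} (P2 : probability T2 R).
Variables (Lam : R -> T2 -> R) (a b : R -> R).
Hypothesis shot_cos : forall u,
  n%:R * (Ex P (fun w => cos (u * xi 0%N w * ((tau 0%N w)%:R / c n))) - 1) @[n --> \oo] -->
  - (mu * a u).
Hypothesis shot_sin : forall u,
  n%:R * Ex P (fun w => sin (u * xi 0%N w * ((tau 0%N w)%:R / c n))) @[n --> \oo] --> mu * b u.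
Hypothesis mLam : forall t, measurable_fun setT (Lam t).
Hypothesis incr_indep : forall (m : nat) (s : nat -> R), 0 <= s 0%N ->
  (forall i, (i < m)%N -> s i <= s i.+1) -> s m <= 1 ->
  mutually_indep P2 (fun i : 'I_m => rv_events (fun w => Lam (s i.+1) w - Lam (s i) w)).
Hypothesis incr_law : forall s t : R, 0 <= s -> s <= t -> t <= 1 ->
  same_law P2 (fun w => Lam t w - Lam s w) (Lam (t - s)).
Hypothesis cfLam : forall t u : R, 0 <= t -> t <= 1 ->
  cf P2 (fun w => u * Lam t w) = cexp (t * a u) (t * b u).

Local Notation normc := ComplexField.Normc.normc.

Let mu0 : 0 < mu. Proof. by have := mu1; lra. Qed.

Let phi n u := cf P (fun w => u * xi 0%N w * ((tau 0%N w)%:R / c n)).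

Let mshot k n u : measurable_fun setT (fun w => u * xi k w * ((tau k w)%:R / c n)).
Proof.
apply: measurable_funM; first by apply: measurable_funM => //; exact: measurable_cst.
by apply: measurable_funM; [exact: measurable_natr|exact: measurable_cst].
Qed.

Let xi_tau_indep k D E : measurable D -> measurable E ->
  P (xi k @^-1` D `&` tau k @^-1` E) = (P (xi k @^-1` D) * P (tau k @^-1` E))%E.
Proof.
move=> mD mE; apply: (@measurable_wrt_indep _ _ _ P _ F FT FI mF indepF _ _ _ _
  (pred1 (ixi k)) (pred1 (itau k))) => //.
- move=> i /= /eqP ->; apply/eqP => e; move: (isxiN k); by rewrite -e isxiP.
- by apply: measurable_wrt_rv (@xiF k) _; rewrite /= eqxx.
- by apply: measurable_wrt_rv (@tauF k) _; rewrite /= eqxx.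
Qed.

Let cf_shot k n u : cf P (fun w => u * xi k w * ((tau k w)%:R / c n)) = phi n u.
Proof.
have L := same_law_pair (mxi k) (mxi 0) (mtau k) (mtau 0) (@xi_law k) (@tau_law k)
  (@xi_tau_indep k) (@xi_tau_indep 0).
have mp j : measurable_fun setT (fun w => (xi j w, tau j w)) by exact: measurable_fun_pair.
have mq : measurable_fun setT (fun z : R * nat => u * z.1 * (z.2%:R / c n)).
  apply: measurable_funM.
    by apply: measurable_funM; [exact: measurable_cst|exact: measurable_fst].
  apply: measurable_funM; last exact: measurable_cst.
  by apply: measurable_natr; exact: measurable_snd.
have H (g : R -> R) : measurable_fun setT g -> (forall y, `|g y| <= 1) ->
    Ex P (fun w => g (u * xi k w * ((tau k w)%:R / c n))) =
    Ex P (fun w => g (u * xi 0%N w * ((tau 0%N w)%:R / c n))).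
  move=> mg g1; have mg' := measurableT_comp mg mq.
  have [] // := @Ex_same_law _ _ _ P _ _ _ _ _ (mp k) (mp 0) L mg'.
  apply: (@integ_bounded _ _ _ _ 1) => [|w]; last exact: g1.
  exact: (measurableT_comp mg' (mp k)).
rewrite /phi /cf; congr (Complex _ _); apply: H.
+ by apply: continuous_measurable_fun; exact: continuous_cos.
+ exact: ler_norm_cos1.
+ by apply: continuous_measurable_fun; exact: continuous_sin.
+ exact: ler_norm_sin1.
Qed.

(** Read off from [shot_cos], whose left-hand side is never positive; the signs of
    [Gamma (1 - alpha)] and of the cosine need not be examined. *)
Let a_ge0 u : 0 <= a u.
Proof.
rewrite -(pmulr_rge0 _ mu0) -oppr_le0.
rewrite leNgt; apply/negP => lim_gt0; near \oo => n.
have : 0 < n%:R * (Ex P (fun w => cos (u * xi 0%N w * ((tau 0%N w)%:R / c n))) - 1).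
  by near: n; exact: (cvgr_gt _ (@shot_cos u) _ lim_gt0).
apply/negP; rewrite -leNgt mulr_ge0_le0// subr_le0.
apply: le_trans (ler_norm _) _; apply: le_trans (Re_le_normc _ (Ex P (fun w => sin (u * xi 0%N w * ((tau 0%N w)%:R / c n))))) _.
exact: (normc_cf P (mshot 0 n u)).
Unshelve. all: by end_near. Qed.

Let mum m : (0 < m)%N -> 0 < mu * m%:R.
Proof. by move=> m0; rewrite mulr_gt0// ltr0n. Qed.

Let block_size_cvgy m : (0 < m)%N -> (block_size mu m n)%:R @[n --> \oo] --> (+oo : set_system R).
Proof.
move=> m0; apply/cvgryPge => B; near=> n.
have := truncnS_gt (n%:R / (mu * m%:R)); rewrite -natr1 -/(block_size mu m n).
have : B + 1 <= n%:R / (mu * m%:R).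
  by rewrite ler_pdivlMr ?mum//; near: n; exact: nbhs_infty_ger.
lra.
Unshelve. all: by end_near. Qed.

Let block_size_ratio m : (0 < m)%N ->
  (block_size mu m n)%:R / n%:R @[n --> \oo] --> (mu * m%:R)^-1.
Proof.
move=> m0; apply/cvgrPdist_le => e e0; near=> n.
have n0 : 0 < n%:R :> R by rewrite ltr0n; near: n; exact: nbhs_infty_gt.
have ne : e^-1 <= n%:R by near: n; exact: nbhs_infty_ger.
have nn : 0 <= n%:R / (mu * m%:R) by rewrite divr_ge0// ltW// mum.
have /truncn_itv/andP[k1 k2] := nn.
rewrite -/(block_size mu m n) in k1 k2; rewrite -natr1 in k2.
have -> : (mu * m%:R)^-1 - (block_size mu m n)%:R / n%:R =
    (n%:R / (mu * m%:R) - (block_size mu m n)%:R) / n%:R.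
  by field; rewrite gt_eqF//= gt_eqF ?ltr0n// gt_eqF.
rewrite normrM normfV (gtr0_norm n0) ler_pdivrMr// ger0_norm; last lra.
have : 1 <= e * n%:R by rewrite mulrC -ler_pdivrMr// div1r.
lra.
Unshelve. all: by end_near. Qed.

(** Both terms differ from 1 by a quantity of order [1/n], with the same leading coefficient because
    [m * block_size] is asymptotic to [n / mu]. Dividing the exponents by [m * block_size], and not
    by [n / mu], makes the product over a block exactly the factor of one increment of [Lam]. *)
Let phi_block m u : (0 < m)%N ->
  (block_size mu m n)%:R * normc (phi n u -
    cexp (a u / (m * block_size mu m n)%:R) (b u / (m * block_size mu m n)%:R)) @[n --> \oo] --> (0 : R).
Proof.
move=> m0; have m0' : 0 < m%:R :> R by rewrite ltr0n.
have mk8 : (m * block_size mu m n)%:R @[n --> \oo] --> (+oo : set_system R).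
  apply/cvgryPge => B; near=> n.
  have : B / m%:R <= (block_size mu m n)%:R by near: n; move/cvgryPge : (block_size_cvgy m0); exact.
  by rewrite ler_pdivrMr// natrM mulrC.
have [E1 E2] := cexp_small_time (a u) (b u) mk8.
have R0 := block_size_ratio m0.
pose re n := (block_size mu m n)%:R / n%:R * (n%:R * (Ex P (fun w => cos (u * xi 0%N w * ((tau 0%N w)%:R / c n))) - 1)) -
  m%:R^-1 * ((m * block_size mu m n)%:R * (expR (- (a u / (m * block_size mu m n)%:R)) * cos (b u / (m * block_size mu m n)%:R) - 1)).
pose im n := (block_size mu m n)%:R / n%:R * (n%:R * (Ex P (fun w => sin (u * xi 0%N w * ((tau 0%N w)%:R / c n))))) -
  m%:R^-1 * ((m * block_size mu m n)%:R * (expR (- (a u / (m * block_size mu m n)%:R)) * sin (b u / (m * block_size mu m n)%:R))).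
have reL : re n @[n --> \oo] --> (0 : R).
  have -> : 0 = (mu * m%:R)^-1 * - (mu * a u) - m%:R^-1 * - a u.
    by field; rewrite !gt_eqF.
  apply: cvgB; first by apply: cvgM => //; exact: shot_cos.
  by apply: cvgM => //; exact: cvg_cst.
have imL : im n @[n --> \oo] --> (0 : R).
  have -> : 0 = (mu * m%:R)^-1 * (mu * b u) - m%:R^-1 * b u.
    by field; rewrite !gt_eqF.
  apply: cvgB; first by apply: cvgM => //; exact: shot_sin.
  by apply: cvgM => //; exact: cvg_cst.
have L : `|re n| + `|im n| @[n --> \oo] --> (0 : R).
  rewrite -(addr0 0) -{1}(@normr0 _ R) -{2}(@normr0 _ R).
  by apply: cvgD; apply: cvg_norm.
apply: (squeeze_cvgr _ (cvg_cst 0) L).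
near=> n; rewrite mulr_ge0 ?normc_ge0//=.
have n0 : 0 < n%:R :> R by rewrite ltr0n; near: n; exact: nbhs_infty_gt.
set x := Ex P (fun w => cos (u * xi 0%N w * ((tau 0%N w)%:R / c n))).
set y := Ex P (fun w => sin (u * xi 0%N w * ((tau 0%N w)%:R / c n))).
set x' := expR (- (a u / (m * block_size mu m n)%:R)) * cos (b u / (m * block_size mu m n)%:R).
set y' := expR (- (a u / (m * block_size mu m n)%:R)) * sin (b u / (m * block_size mu m n)%:R).
have -> : re n = (block_size mu m n)%:R * (x - x').
  by rewrite /re -/x -/x' natrM; field; rewrite !gt_eqF.
have -> : im n = (block_size mu m n)%:R * (y - y').
  by rewrite /im -/y -/y' natrM; field; rewrite !gt_eqF.
rewrite (normrM _ (x - x')) (normrM _ (y - y')) (ger0_norm (ler0n _ _)) -mulrDr ler_wpM2l//.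
exact: (normc_le_ReIm (x - x') (y - y')).
Unshelve. all: by end_near. Qed.

Let step f m n k w := block_weight f mu m n k * xi k w * ((tau k w)%:R / c n).

Let block_sumE f m n w : block_sum f m n w = \sum_(k < n) step f m n k w.
Proof. by rewrite /block_sum mulr_sumr; apply: eq_bigr => k _; rewrite /step; ring. Qed.

Let cf_block_sum f m n : cf P (block_sum f m n) =
  \prod_(k < n) phi n (block_weight f mu m n k).
Proof.
rewrite (_ : block_sum f m n = fun w => \sum_(k < n) step f m n k w); last first.
  by apply/funext => w; exact: block_sumE.
have wrt (B : pred I) k : B (ixi k) -> B (itau k) -> measurable_wrt F B (step f m n k).
  move=> B1 B2; have m1 : measurable_wrt F B (xi k) := measurable_wrt_rv (@xiF k) B1.
  have m2 : measurable_wrt F B (tau k) := measurable_wrt_rv (@tauF k) B2.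
  apply: measurable_funM; first by apply: measurable_funM; [exact: measurable_cst|exact: m1].
  apply: measurable_funM; last exact: measurable_cst.
  exact: (@measurableT_comp _ _ _ _ _ _ (fun n : nat => n%:R : R)).
rewrite cf_sum => [|k|k kn D E mD mE].
- by apply: eq_bigr => k _; rewrite -(cf_shot k).
- exact: mshot.
pose B1 : pred I := [pred i | i \in [seq ixi j | j <- iota 0 k] ++ [seq itau j | j <- iota 0 k]].
pose B2 : pred I := [pred i | (i == ixi k) || (i == itau k)].
apply: (@measurable_wrt_indep _ _ _ P _ F FT FI mF indepF _ _ _ _ B1 B2) => //.
- move=> i; rewrite /B1 /B2 /= mem_cat => /orP[] /mapP[j + ->]; rewrite mem_iota add0n /= => jk.
    rewrite negb_or; apply/andP; split.
      by apply/eqP => /ixi_inj jE; rewrite jE ltnn in jk.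
    by apply/eqP => e; move: (isxiN k); rewrite -e isxiP.
  rewrite negb_or; apply/andP; split.
    by apply/eqP => e; move: (isxiN j); rewrite e isxiP.
  by apply/eqP => /itau_inj jE; rewrite jE ltnn in jk.
- apply: measurable_sum => j; apply: wrt; rewrite /B1 /= mem_cat; apply/orP.
    by left; apply/mapP; exists (val j) => //; rewrite mem_iota add0n /=.
  by right; apply/mapP; exists (val j) => //; rewrite mem_iota add0n /=.
- by apply: wrt; rewrite /B2 /= eqxx ?orbT.
Qed.

Let phi0 n : phi n 0 = 1.
Proof.
rewrite /phi /cf; under eq_Ex do rewrite !mul0r cos0.
by under [X in Complex _ X]eq_Ex do rewrite !mul0r sin0; rewrite !Ex_cst.
Qed.

Let phi_le1 n u : normc (phi n u) <= 1. Proof. exact: normc_cf. Qed.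

(** Both characteristic functions are written as products over the same [m * block_size] indices,
    and [normc_prodB] bounds their distance by a sum of [m] terms, each controlled by
    [phi_block]. *)
Lemma cf_block_sum_cvg f m : (0 < m)%N ->
  normc (cf P (block_sum f m n) - cf P2 (riemann_sum f Lam m)) @[n --> \oo] --> (0 : R).
Proof.
move=> m0; have m0' : 0 < m%:R :> R by rewrite ltr0n.
have L : \sum_(i < m) ((block_size mu m n)%:R * normc (phi n (f (i%:R / m%:R)) -
    cexp (a (f (i%:R / m%:R)) / (m * block_size mu m n)%:R)
         (b (f (i%:R / m%:R)) / (m * block_size mu m n)%:R))) @[n --> \oo] --> \sum_(i < m) (0 : R).
  by apply: cvg_big => [|i _]; [exact: add_continuous|exact: phi_block].
rewrite big1// in L.
apply: (squeeze_cvgr _ (cvg_cst 0) L).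
near=> n; rewrite normc_ge0 andTb.
have n0 : 0 < n%:R :> R by rewrite ltr0n; near: n; exact: nbhs_infty_gt.
have k0 : (0 < block_size mu m n)%N.
  rewrite -(ltr_nat R); near: n; move/cvgryPgt : (block_size_cvgy m0); exact.
have kn : (m * block_size mu m n <= n)%N.
  have /truncn_itv/andP[k1 _] : 0 <= n%:R / (mu * m%:R) by rewrite divr_ge0// ltW// mum.
  rewrite -/(block_size mu m n) ler_pdivlMr ?mum// in k1.
  rewrite -(ler_nat R) natrM.
  have : 0 <= (block_size mu m n)%:R * m%:R * (mu - 1) by rewrite !mulr_ge0// subr_ge0.
  lra.
rewrite cf_block_sum (cf_riemann_sum mLam incr_indep incr_law cfLam)//.
set ka := block_size mu m n in k0 kn *.
pose G (i : nat) := f (i%:R / m%:R).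
(* The indices past the last block have weight 0 and contribute the factor [phi n 0 = 1]. *)
have -> : \prod_(k < n) phi n (block_weight f mu m n k) = \prod_(k < m * ka) phi n (G (k %/ ka)%N).
  rewrite -(big_mkord xpredT (fun k => phi n (block_weight f mu m n k))).
  rewrite (@big_cat_nat _ _ _ (m * ka))//= (_ : \prod_(m * ka <= k < n) _ = 1); last first.
    rewrite big_nat; apply: big1 => k /andP[k1 _].
    by rewrite /block_weight ltnNge k1 /= phi0.
  rewrite mulr1 big_mkord; apply: eq_bigr => k _.
  by rewrite /block_weight ltn_ord.
have -> : \prod_(i < m) cexp (m%:R^-1 * a (f (i%:R / m%:R))) (m%:R^-1 * b (f (i%:R / m%:R))) =
    \prod_(k < m * ka) cexp (a (G (k %/ ka)%N) / (m * ka)%:R) (b (G (k %/ ka)%N) / (m * ka)%:R).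
  rewrite (prod_blocks m (fun i => cexp (a (G i) / (m * ka)%:R) (b (G i) / (m * ka)%:R)) k0).
  apply: eq_bigr => i _; rewrite -cexp_exp natrM /G.
  have k0' : ka%:R != 0 :> R by rewrite pnatr_eq0 -lt0n.
  by congr cexp; field; rewrite k0' gt_eqF.
apply: le_trans (normc_prodB _ _ _) _.
- by move=> k; exact: phi_le1.
- by move=> k; apply: normc_cexp; rewrite divr_ge0.
rewrite (sum_blocks m (fun i => normc (phi n (G i) -
  cexp (a (G i) / (m * ka)%:R) (b (G i) / (m * ka)%:R))) k0).
by apply: ler_sum => i _; rewrite mulr_natl.
Unshelve. all: by end_near. Qed.

(** [Y] is compared with the shot sum, then the block sum, then (through characteristic functions
    only, the spaces being different) the Riemann sum, then [Z]. The number [m] of pieces is fixed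
    before [n] grows. With [e / 8] for each error, the factor 2 of [cf_dist] leaves a total of
    [7 / 8 * e]. *)
Theorem shot_sum_cvg (f : R -> R) (M Lf : R) (Y : nat -> T -> R) (Z : T2 -> R) :
  (forall x, `|f x| <= M) -> (forall x y, `|f x - f y| <= Lf * `|x - y|) ->
  (forall n, measurable_fun setT (Y n)) -> measurable_fun setT Z ->
  Ex P (fun w => Num.min 1 `|Y n w - shot_sum f n w|) @[n --> \oo] --> (0 : R) ->
  Ex P2 (fun w => Num.min 1 `|riemann_sum f Lam m w - Z w|) @[m --> \oo] --> (0 : R) ->
  Ex P (fun w => cos (Y n w)) @[n --> \oo] --> Ex P2 (fun w => cos (Z w)) /\
  Ex P (fun w => sin (Y n w)) @[n --> \oo] --> Ex P2 (fun w => sin (Z w)).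
Proof.
have tri (e p q r s t z1 z2 z3 : R) : `|p - q| <= 2 * z1 -> `|q - r| <= 2 * z2 ->
    `|r - s| < e / 8 -> `|s - t| <= 2 * z3 -> z1 < e / 8 -> z2 <= e / 8 -> z3 <= e / 8 ->
    `|t - p| <= e.
  rewrite !ler_norml !ltr_norml => /andP[? ?] /andP[? ?] /andP[? ?] /andP[? ?] ? ? ?.
  by apply/andP; split; lra.
move=> fM fL mY mZ HY HZ1.
have mR m : measurable_fun setT (riemann_sum f Lam m) by exact: measurable_riemann_sum.
suff key (e : R) : 0 < e -> \forall n \near \oo,
    `|Ex P2 (fun w => cos (Z w)) - Ex P (fun w => cos (Y n w))| <= e /\
    `|Ex P2 (fun w => sin (Z w)) - Ex P (fun w => sin (Y n w))| <= e.
  by split; apply/cvgrPdist_le => e /key; apply: filterS => n [].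
move=> e0; have e8 : 0 < e / 8 by lra.
have [m1 Hm1] := block_comparison fM fL e8.
have [m [m0 Hm Hz]] : exists m, [/\ (0 < m)%N,
    \forall n \near \oo, Ex P (fun w => Num.min 1 `|shot_sum f n w - block_sum f m n w|) <= e / 8 &
    Ex P2 (fun w => Num.min 1 `|riemann_sum f Lam m w - Z w|) <= e / 8].
  near \oo => m; exists m; split.
  - by near: m; exact: nbhs_infty_gt.
  - by apply: Hm1; near: m; exact: nbhs_infty_gt.
  - apply: ltW; near: m; exact: (cvgr_lt _ HZ1 _ e8).
have HB := cf_block_sum_cvg f m0.
near=> n.
have mS : measurable_fun setT (shot_sum f n) by exact: measurable_shot_sum.
have mB : measurable_fun setT (block_sum f m n) by exact: measurable_block_sum.
have h1 : Ex P (fun w => Num.min 1 `|Y n w - shot_sum f n w|) < e / 8.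
  near: n; exact: (cvgr_lt _ HY _ e8).
have h2 : Ex P (fun w => Num.min 1 `|shot_sum f n w - block_sum f m n w|) <= e / 8 by near: n.
have h3 : normc (cf P (block_sum f m n) - cf P2 (riemann_sum f Lam m)) < e / 8.
  near: n; exact: (cvgr_lt _ HB _ e8).
have [c1 s1] := cf_dist P (mY n) mS.
have [c2 s2'] := cf_dist P mS mB.
have [c3 s3] := cf_dist P2 (mR m) mZ.
move: h3; rewrite /cf.
set x := Ex P _ => h3.
have c4 := le_lt_trans (Re_le_normc _ _) h3.
have s4 := le_lt_trans (Im_le_normc _ _) h3.
by split; [exact: (tri _ _ _ _ _ _ _ _ _ c1 c2 c4 c3)|exact: (tri _ _ _ _ _ _ _ _ _ s1 s2' s4 s3)].
Unshelve. all: by end_near. Qed.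

End limit_law.

(** * Joint convergence of the Fourier coefficients *)

Section process_limit.
Variables (U : T -> nat) (X : nat -> T -> R) (q : nat) (j : 'I_q -> nat).
Hypothesis c_ell : forall n, (0 < n)%N ->
  (ell P U alpha n)^-1 * n%:R `^ (- alpha^-1) = (c n)^-1.
Hypothesis mX : forall t, measurable_fun setT (X t).
Hypothesis X_shot : forall (f : R -> R) (M Lf : R), (forall x, `|f x| <= M) ->
  (forall x y, `|f x - f y| <= Lf * `|x - y|) ->
  Ex P (fun w => Num.min 1 `|(c n)^-1 * \sum_(1 <= t < n.+1) X t w * f (t%:R / n%:R)
    - shot_sum f n w|) @[n --> \oo] --> (0 : R).
Context {d2} {T2 : measurableType d2} (P2 : probability T2 R).
Variables (Lam : R -> T2 -> R) (ZRe ZIm : 'I_q -> T2 -> R).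
Hypothesis stable : stable_levy P2 Lam alpha
  (mu^-1 * mom_abs P (xi 0%N) alpha * Gamma (1 - alpha) * cos (pi * alpha / 2))
  ((mom_pos P (xi 0%N) alpha - mom_neg P (xi 0%N) alpha) / mom_abs P (xi 0%N) alpha).
Hypothesis mZRe : forall k, measurable_fun setT (ZRe k).
Hypothesis mZIm : forall k, measurable_fun setT (ZIm k).
Hypothesis HZRe : forall k,
  cvg_in_prob P2 (riemann_sum (fun s => cos (2 * pi * (j k)%:R * s)) Lam) (ZRe k).
Hypothesis HZIm : forall k,
  cvg_in_prob P2 (riemann_sum (fun s => sin (2 * pi * (j k)%:R * s)) Lam) (ZIm k).

Let cst_c := mu^-1 * mom_abs P (xi 0%N) alpha * Gamma (1 - alpha) * cos (pi * alpha / 2).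
Let cst_beta := (mom_pos P (xi 0%N) alpha - mom_neg P (xi 0%N) alpha) / mom_abs P (xi 0%N) alpha.
Let a (u : R) := `|u| `^ alpha * cst_c.
Let b (u : R) := a u * cst_beta * Num.sg u * tan (pi * alpha / 2).

Let mu_gt0 : 0 < mu. Proof. by have := mu1; lra. Qed.

Let alpha_gt0 : 0 < alpha. Proof. by have /andP[] := alpha12; lra. Qed.

Let momE : mom_abs P (xi 0%N) alpha = Ex P (fun w => `|xi 0%N w| `^ alpha).
Proof. by rewrite /mom_abs -Ex_fine. Qed.

Let iabs : integ P (fun w => `|xi 0%N w| `^ alpha).
Proof.
apply: (@le_integ _ _ _ _ (fun w => 1 + xi 0%N w ^+ 2)).
- by apply: (@measurableT_comp _ _ _ _ _ _ (fun y : R => y `^ alpha)); [exact: measurable_powR|exact: measurableT_comp].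
- by move=> w; rewrite ger0_norm ?powR_ge0//; exact: powR_le1Dsqr.
- by apply: integD => //; exact: integ_cst.
Qed.

Let part (s : R) := Ex P (fun w => Num.max (s * xi 0%N w) 0 `^ alpha).

Let part_itv (s : R) : `|s| = 1 -> 0 <= part s <= Ex P (fun w => `|xi 0%N w| `^ alpha).
Proof.
move=> s1; rewrite Ex_ge0 => [/=|w]; last exact: powR_ge0.
have le w : Num.max (s * xi 0%N w) 0 `^ alpha <= `|xi 0%N w| `^ alpha.
  apply: ge0_ler_powR; rewrite ?nnegrE ?le_max ?lexx ?orbT//; first exact: ltW.
  by rewrite ge_max normr_ge0 andbT; apply: le_trans (ler_norm _) _; rewrite normrM s1 mul1r.
apply: le_Ex => //; apply: le_integ iabs => [|w]; last by rewrite ger0_norm ?powR_ge0.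
apply: (@measurableT_comp _ _ _ _ _ _ (fun y : R => y `^ alpha)); first exact: measurable_powR.
by apply: measurable_maxr; [apply: measurable_funM => //; exact: measurable_cst|exact: measurable_cst].
Qed.

Let posE : mom_pos P (xi 0%N) alpha = part 1.
Proof. by rewrite /mom_pos -Ex_fine; apply: eq_Ex => w; rewrite mul1r. Qed.

Let negE : mom_neg P (xi 0%N) alpha = part (-1).
Proof. by rewrite /mom_neg -Ex_fine; apply: eq_Ex => w; rewrite mulN1r. Qed.

Let scaled_indep (u : R) D E : measurable D -> measurable E ->
  P ((fun w => u * xi 0%N w)%R @^-1` D `&` tau 0%N @^-1` E) =
  (P ((fun w => u * xi 0%N w)%R @^-1` D) * P (tau 0%N @^-1` E))%E.
Proof.
move=> mD mE; apply: (@measurable_wrt_indep _ _ _ P _ F FT FI mF indepF _ _ _ _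
  (pred1 (ixi 0%N)) (pred1 (itau 0%N))) => //.
- move=> i /= /eqP ->; apply/eqP => e; move: (isxiN 0); by rewrite -e isxiP.
- have m0 : measurable_wrt F (pred1 (ixi 0%N)) (xi 0%N).
    by apply: measurable_wrt_rv (@xiF 0) _; rewrite /= eqxx.
  by apply: measurable_funM; [exact: measurable_cst|exact: m0].
- by apply: measurable_wrt_rv (@tauF 0) _; rewrite /= eqxx.
Qed.

Let mux u : measurable_fun setT (fun w => u * xi 0%N w).
Proof. by apply: measurable_funM => //; exact: measurable_cst. Qed.

Let iux2 u : integ P (fun w => (u * xi 0%N w) ^+ 2).
Proof. by under eq_fun do rewrite exprMn; exact: integZ. Qed.

Let shot_cos u :
  n%:R * (Ex P (fun w => cos (u * xi 0%N w * ((tau 0%N w)%:R / c n))) - 1) @[n --> \oo] -->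
  - (mu * a u).
Proof.
have := shot_cos_limit (mux u) (mtau 0) (@scaled_indep u) (iux2 u) alpha12 ht.
have -> : Ex P (fun w => `|u * xi 0%N w| `^ alpha) = `|u| `^ alpha * mom_abs P (xi 0%N) alpha.
  rewrite momE -ExZ; last exact: iabs.
  by apply: eq_Ex => w; rewrite normrM powRM; [|exact: normr_ge0|exact: normr_ge0].
have -> // : `|u| `^ alpha * mom_abs P (xi 0%N) alpha * (Gamma (1 - alpha) * cos (pi * alpha / 2)) =
  mu * a u.
by rewrite /a /cst_c; field; rewrite gt_eqF.
Qed.

(** A negative factor [u] exchanges the positive and the negative part; this is the origin of
    [sign(u)] in the exponent. *)
Let part_scale u (s : R) : `|s| = 1 -> Ex P (fun w => Num.max (s * (u * xi 0%N w)) 0 `^ alpha) =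
  `|u| `^ alpha * (if 0 <= u then part s else part (- s)).
Proof.
move=> s1; case: ifPn => [u0|]; last rewrite -ltNge => u0.
  rewrite -ExZ; last first.
    apply: le_integ iabs => [|w].
      apply: (@measurableT_comp _ _ _ _ _ _ (fun y : R => y `^ alpha)); first exact: measurable_powR.
      by apply: measurable_maxr; [apply: measurable_funM => //; exact: measurable_cst|exact: measurable_cst].
    rewrite ger0_norm ?powR_ge0//; apply: ge0_ler_powR; rewrite ?nnegrE ?le_max ?lexx ?orbT//; first exact: ltW.
    by rewrite ge_max normr_ge0 andbT; apply: le_trans (ler_norm _) _; rewrite normrM s1 mul1r.
  apply: eq_Ex => w; rewrite -powRM ?le_max ?lexx ?orbT// ger0_norm//.
  by rewrite maxr_pMr// mulr0 mulrCA.
rewrite -ExZ; last first.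
  apply: le_integ iabs => [|w].
    apply: (@measurableT_comp _ _ _ _ _ _ (fun y : R => y `^ alpha)); first exact: measurable_powR.
    by apply: measurable_maxr; [apply: measurable_funM => //; exact: measurable_cst|exact: measurable_cst].
  rewrite ger0_norm ?powR_ge0//; apply: ge0_ler_powR; rewrite ?nnegrE ?le_max ?lexx ?orbT//; first exact: ltW.
  by rewrite ge_max normr_ge0 andbT; apply: le_trans (ler_norm _) _; rewrite normrM normrN s1 mul1r.
apply: eq_Ex => w; rewrite -powRM ?le_max ?lexx ?orbT//.
by rewrite maxr_pMr// mulr0 ltr0_norm// mulrCA !mulNr mulrN opprK.
Qed.

Let cos_neq0 : cos (pi * alpha / 2) != 0.
Proof.
have /andP[a1 a2] := alpha12; have p0 := @pi_gt0 R.
rewrite (_ : pi * alpha / 2 = (pi * (alpha - 1) / 2) + pi / 2); last lra.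
rewrite cosDpihalf oppr_eq0 gt_eqF// sin_gt0_pi//.
by apply/andP; split; [rewrite !mulr_gt0//; lra|nra].
Qed.

Let shot_sin u :
  n%:R * Ex P (fun w => sin (u * xi 0%N w * ((tau 0%N w)%:R / c n))) @[n --> \oo] --> mu * b u.
Proof.
have m0 : Ex P (fun w => u * xi 0%N w) = 0 by rewrite ExZ// xi_mean mulr0.
have := shot_sin_limit (mux u) (mtau 0) (@scaled_indep u) (iux2 u) alpha12 ht m0.
have N1 : `|-1| = 1 :> R by rewrite normrN normr1.
have -> : Ex P (fun w => Num.max (u * xi 0%N w) 0 `^ alpha) =
    `|u| `^ alpha * (if 0 <= u then part 1 else part (-1)).
  by rewrite -(part_scale u (normr1 R)); apply: eq_Ex => w; rewrite mul1r.
have -> : Ex P (fun w => Num.max (- (u * xi 0%N w)) 0 `^ alpha) =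
    `|u| `^ alpha * (if 0 <= u then part (-1) else part 1).
  by rewrite -{2}(opprK 1) -(part_scale u N1); apply: eq_Ex => w; rewrite mulN1r.
suff -> : (`|u| `^ alpha * (if 0 <= u then part 1 else part (-1)) -
     `|u| `^ alpha * (if 0 <= u then part (-1) else part 1)) *
    (Gamma (1 - alpha) * sin (pi * alpha / 2)) = mu * b u by [].
have p1 := part_itv (normr1 R); have pN : 0 <= part (-1) <= Ex P (fun w => `|xi 0%N w| `^ alpha).
  by apply: part_itv; rewrite normrN normr1.
rewrite /b /a /cst_beta /cst_c posE negE momE /tan; apply: skew_constant.
- by rewrite gt_eqF.
- exact: cos_neq0.
- move=> E0; rewrite E0 in p1 pN.
  have /andP[p1l p1r] := p1; have /andP[pNl pNr] := pN.
  split; apply/eqP; rewrite eq_le; apply/andP.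
    by split; [exact: p1r|exact: p1l].
  by split; [exact: pNr|exact: pNl].
- by move=> ->; rewrite normr0 powR0 ?gt_eqF.
Qed.

Let mLam t : measurable_fun setT (Lam t). Proof. by have [m _ _ _ _] := stable. Qed.

Let incr_indep (m : nat) (s : nat -> R) : 0 <= s 0%N ->
  (forall i, (i < m)%N -> s i <= s i.+1) -> s m <= 1 ->
  mutually_indep P2 (fun i : 'I_m => rv_events (fun w => Lam (s i.+1) w - Lam (s i) w)).
Proof. by have [_ _ h _ _] := stable; exact: h. Qed.

Let incr_law (s t : R) : 0 <= s -> s <= t -> t <= 1 ->
  same_law P2 (fun w => Lam t w - Lam s w) (Lam (t - s)).
Proof. by have [_ _ _ h _] := stable; exact: h. Qed.

Let cfLam (t u : R) : 0 <= t -> t <= 1 ->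
  cf P2 (fun w => u * Lam t w) = cexp (t * a u) (t * b u).
Proof.
move=> t0 t1; have [_ _ _ _ h] := stable.
have [h1 h2] := h t u t0 t1; rewrite /cf !Ex_fine h1 h2 /= /cexp.
have -> : t * a u = t * `|u| `^ alpha * cst_c by rewrite /a; ring.
by have -> : t * b u = t * `|u| `^ alpha * cst_c * cst_beta * Num.sg u * tan (pi * alpha / 2)
  by rewrite /b /a; ring.
Qed.

Let om k : R := 2 * pi * (j k)%:R.

Let g (i : 'I_q + 'I_q) (s : R) : R :=
  match i with inl k => cos (om k * s) | inr k => sin (om k * s) end.

Let om_ge0 k : 0 <= om k.
Proof. by rewrite /om !mulr_ge0// pi_ge0. Qed.

Let omi (i : 'I_q + 'I_q) : R := match i with inl k => om k | inr k => om k end.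

Let g_le1 i s : `|g i s| <= 1.
Proof. by case: i => k; [exact: ler_norm_cos1|exact: ler_norm_sin1]. Qed.

Let g_lip i x y : `|g i x - g i y| <= 2 * omi i * `|x - y|.
Proof.
have h k : 2 * Num.min 1 `|om k * x - om k * y| <= 2 * om k * `|x - y|.
  by rewrite -mulrBr normrM (ger0_norm (om_ge0 k)) -mulrA ler_wpM2l// ge_min lexx orbT.
case: i => k /=; apply: le_trans (h k); first exact: (ler_norm_trigB _ _).1.
exact: (ler_norm_trigB _ _).2.
Qed.

(** Cramer-Wold device: a linear combination of real and imaginary parts of the coefficients is
    again one weighted sum, with the bounded Lipschitz weight [gth th], so the theorem for one test
    function suffices. *)
Let gth (th : 'I_q + 'I_q -> R) (s : R) : R := \sum_i th i * g i s.

Let gth_bound th s : `|gth th s| <= \sum_i `|th i|.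
Proof.
apply: le_trans (ler_norm_sum _ _ _) _; apply: ler_sum => i _.
by rewrite normrM ler_piMr.
Qed.

Let gth_lip th x y : `|gth th x - gth th y| <= (\sum_i `|th i| * (2 * omi i)) * `|x - y|.
Proof.
rewrite /gth -sumrB mulr_suml; apply: le_trans (ler_norm_sum _ _ _) _.
apply: ler_sum => i _; by rewrite -mulrBr normrM -mulrA ler_wpM2l.
Qed.

Let Y n (i : 'I_q + 'I_q) w : R := (ell P U alpha n)^-1 * n%:R `^ (- alpha^-1) *
  match i with inl k => DRe X n (j k) w | inr k => DIm X n (j k) w end.

Let YE n i w : (0 < n)%N ->
  Y n i w = (c n)^-1 * \sum_(1 <= t < n.+1) X t w * g i (t%:R / n%:R).
Proof.
move=> n0; rewrite /Y c_ell//; congr (_ * _).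
have om_t k t : t%:R * 2 * pi * (j k)%:R / n%:R = om k * (t%:R / n%:R) by rewrite /om; ring.
by case: i => k; [rewrite /DRe|rewrite /DIm]; apply: eq_bigr => t _; rewrite om_t.
Qed.

Let Z (i : 'I_q + 'I_q) (w : T2) : R := match i with inl k => ZRe k w | inr k => ZIm k w end.

Let mY n i : measurable_fun setT (Y n i).
Proof.
apply: measurable_funM; first exact: measurable_cst.
by case: i => k; apply: measurable_sum => t; apply: measurable_funM => //; exact: measurable_cst.
Qed.

Let mZ i : measurable_fun setT (Z i).
Proof. by case: i => k; [exact: mZRe|exact: mZIm]. Qed.

Let mR i m : measurable_fun setT (riemann_sum (g i) Lam m).
Proof. exact: measurable_riemann_sum. Qed.

Let ZR i : Ex P2 (fun w => Num.min 1 `|riemann_sum (g i) Lam m w - Z i w|) @[m --> \oo] --> (0 : R).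
Proof.
apply: cvg_in_prob_min1 => //.
by case: i => k; [exact: HZRe|exact: HZIm].
Qed.

Let lincombY th n w : (0 < n)%N -> lincomb th (Y n ^~ w) =
  (c n)^-1 * \sum_(1 <= t < n.+1) X t w * gth th (t%:R / n%:R).
Proof.
move=> n0; rewrite /lincomb; under eq_bigr do rewrite YE// mulrCA.
rewrite -mulr_sumr; congr (_ * _).
under eq_bigr do rewrite mulr_sumr.
rewrite exchange_big/=; apply: eq_bigr => t _.
by rewrite /gth mulr_sumr; apply: eq_bigr => i _; rewrite mulrCA.
Qed.

Let mlincomb {d'} {T' : measurableType d'} (V' : 'I_q + 'I_q -> T' -> R) th :
  (forall i, measurable_fun setT (V' i)) -> measurable_fun setT (fun w => lincomb th (V' ^~ w)).
Proof.
by move=> mV'; apply: measurable_sum => i; apply: measurable_funM => //; exact: measurable_cst.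
Qed.

Let lincomb_shot th : Ex P (fun w => Num.min 1 `|lincomb th (Y n ^~ w) - shot_sum (gth th) n w|)
  @[n --> \oo] --> (0 : R).
Proof.
have := X_shot (@gth_bound th) (@gth_lip th).
apply: cvg_trans; apply: near_eq_cvg; near=> n; apply: eq_Ex => w.
rewrite lincombY//; near: n; exact: nbhs_infty_gt.
Unshelve. all: by end_near. Qed.

Let min1_scale (x y : R) : Num.min 1 `|x * y| <= (1 + `|x|) * Num.min 1 `|y|.
Proof.
rewrite normrM; have x0 := normr_ge0 x; have y0 := normr_ge0 y.
have [|] := leP 1 (`|x| * `|y|); have [|] := leP 1 `|y|; nra.
Qed.

Let lincombZ th : Ex P2 (fun w => Num.min 1 `|riemann_sum (gth th) Lam m w - lincomb th (Z ^~ w)|)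
  @[m --> \oo] --> (0 : R).
Proof.
have L : \sum_i (1 + `|th i|) * Ex P2 (fun w => Num.min 1 `|riemann_sum (g i) Lam m w - Z i w|)
    @[m --> \oo] --> \sum_(i : 'I_q + 'I_q) (0 : R).
  apply: cvg_big => [|i _]; first exact: add_continuous.
  by rewrite -(mulr0 (1 + `|th i|)); apply: cvgM; [exact: cvg_cst|exact: ZR].
rewrite big1// in L; apply: (squeeze_cvgr _ (cvg_cst 0) L).
near=> m; apply/andP; split; first by apply: Ex_ge0 => w; rewrite le_min ler01 normr_ge0.
have E w : riemann_sum (gth th) Lam m w - lincomb th (Z ^~ w) =
    \sum_i th i * (riemann_sum (g i) Lam m w - Z i w).
  rewrite /riemann_sum /lincomb /gth; under [RHS]eq_bigr do rewrite mulrBr.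
  rewrite sumrB; congr (_ - _).
  under eq_bigr do rewrite mulr_suml.
  rewrite exchange_big/=; apply: eq_bigr => i _.
  by rewrite mulr_sumr; apply: eq_bigr => l _; rewrite mulrA.
under eq_Ex do rewrite E.
have mD i : measurable_fun setT (fun w => th i * (riemann_sum (g i) Lam m w - Z i w)).
  by apply: measurable_funM; [exact: measurable_cst|exact: measurable_funB].
have tri (r : seq ('I_q + 'I_q)) :
    Ex P2 (fun w => Num.min 1 `|\sum_(i <- r) th i * (riemann_sum (g i) Lam m w - Z i w)|) <=
    \sum_(i <- r) Ex P2 (fun w => Num.min 1 `|th i * (riemann_sum (g i) Lam m w - Z i w)|).
  elim: r => [|i r IH].
    under eq_Ex do rewrite big_nil normr0 (min_idPr ler01).
    by rewrite big_nil Ex_cst.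
  rewrite big_cons; under eq_Ex do rewrite big_cons.
  apply: le_trans (Ex_min1_triangle P2 (mD i) _) _; last by rewrite lerD2l.
  by apply: measurable_sum => l; exact: mD.
apply: le_trans (tri _) _; apply: ler_sum => i _.
have i1 : integ P2 (fun w => Num.min 1 `|riemann_sum (g i) Lam m w - Z i w|).
  by apply: integ_min1; exact: measurable_funB.
rewrite -ExZ//; apply: le_Ex => [||w]; [exact: integ_min1|exact: integZ|exact: min1_scale].
Unshelve. all: by end_near. Qed.

Let tightY i (e : R) : 0 < e -> exists K0, forall K, K0 <= K -> \forall n \near \oo,
  Ex P (fun w => Num.min 1 (`|Y n i w| / K)) <= e.
Proof.
move=> e0; have e20 : 0 < e / 2 by lra.
have [K0 HK] := shot_sum_tight (g_le1 i) e20.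
have XL := X_shot (g_le1 i) (g_lip i).
exists (Num.max 1 K0) => K; rewrite ge_max => /andP[K1 KK].
have Kp : 0 < K by lra.
have H := HK _ KK; near=> n.
have n0 : (0 < n)%N by near: n; exact: nbhs_infty_gt.
have mS : measurable_fun setT (shot_sum (g i) n) by exact: measurable_shot_sum.
have h1 : Ex P (fun w => Num.min 1 (`|shot_sum (g i) n w| / K)) <= e / 2 by near: n.
have h2 : Ex P (fun w => Num.min 1 `|Y n i w - shot_sum (g i) n w|) < e / 2.
  under eq_Ex do rewrite YE//.
  near: n; exact: (cvgr_lt _ XL _ e20).
have iK (V' : T -> R) : measurable_fun setT V' -> integ P (fun w => Num.min 1 (`|V' w| / K)).
  move=> mV'; have : measurable_fun setT (fun w => V' w / K).
    by apply: measurable_funM => //; exact: measurable_cst.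
  move/(integ_min1 P); congr integ; apply/funext => w.
  by rewrite normrM normfV (gtr0_norm Kp).
have i1 : integ P (fun w => Num.min 1 `|Y n i w - shot_sum (g i) n w|).
  by apply: integ_min1; exact: measurable_funB.
apply: le_trans (_ : Ex P (fun w => Num.min 1 `|Y n i w - shot_sum (g i) n w| +
    Num.min 1 (`|shot_sum (g i) n w| / K)) <= _); last by rewrite ExD//; [lra|exact: iK].
apply: le_Ex => [||w]; [exact: iK|by apply: integD => //; exact: iK|exact: min1_triangle_div].
Unshelve. all: by end_near. Qed.

Theorem shot_process_cvg : cvg_in_distribution P (normalized_D P U alpha X j)
  P2 (fun w => (\row_k ZRe k w, \row_k ZIm k w)).
Proof.
move=> G cG [M GM].
have uG := continuous_box_unif_continuous cG.
pose h (y : 'I_q + 'I_q -> R) := G (\row_k y (inl k), \row_k y (inr k)).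
have hM y : `|h y| <= M by exact: GM.
suff : ('E_P[fun w => h (Y n ^~ w)] @[n --> \oo] --> 'E_P2[fun w => h (Z ^~ w)])%E by [].
have i1 n : integ P (fun w => h (Y n ^~ w)).
  by apply: (@integ_bounded _ _ _ _ M) => // ; apply: (box_unif_continuous_measurable (mY n) uG hM).
have i2 : integ P2 (fun w => h (Z ^~ w)).
  by apply: (@integ_bounded _ _ _ _ M) => // ; apply: (box_unif_continuous_measurable mZ uG hM).
under eq_fun do rewrite expectationE//.
rewrite expectationE//; apply: cvg_EFin; first by near=> n.
have key th := shot_sum_cvg shot_cos shot_sin mLam incr_indep incr_law cfLam
  (@gth_bound th) (@gth_lip th) (fun n => mlincomb th (mY n)) (mlincomb th mZ)
  (lincomb_shot th) (lincombZ th).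
apply: (levy_continuity mY mZ _ _ tightY uG hM).
- by move=> th; exact: (key th).1.
- by move=> th; exact: (key th).2.
Unshelve. all: by end_near. Qed.

End process_limit.

End shot_sums.

(** * A weak law of large numbers *)

Lemma ler_norm_amgm {R : realFieldType} (a y : R) : 0 < a -> `|y| <= a + (4 * a)^-1 * y ^+ 2.
Proof.
move=> a0; have : 0 <= (`|y| - 2 * a) ^+ 2 by exact: sqr_ge0.
rewrite -[y ^+ 2]real_normK ?num_real//.
have -> : a + (4 * a)^-1 * `|y| ^+ 2 = (4 * a ^+ 2 + `|y| ^+ 2) / (4 * a).
  by field; rewrite gt_eqF.
by rewrite ler_pdivlMr ?mulr_gt0//; lra.
Qed.

Section weak_law.
Context {d} {T : measurableType d} {R : realType} (P : probability T R).
Context {I : eqType} (F : I -> set (set T)).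
Hypothesis FT : forall i, F i setT.
Hypothesis FI : forall i, setI_closed (F i).
Hypothesis mF : forall i, F i `<=` measurable.
Hypothesis indepF : mutually_indep P F.
Variables (X : nat -> T -> R) (iX : nat -> I).
Hypothesis XF : forall k, rv_events (X k) `<=` F (iX k).
Hypothesis iX_inj : injective iX.
Hypothesis X_law : forall k, same_law P (X k) (X 0%N).
Hypothesis iX0 : integ P (X 0%N).

Let mX k : measurable_fun setT (X k).
Proof. by move=> _ B mB; rewrite setTI; apply: (mF (XF _)); exists B. Qed.

Let law_Ex (g : R -> R) k : measurable_fun setT g -> integ P (g \o X 0%N) ->
  integ P (g \o X k) /\ Ex P (g \o X k) = Ex P (g \o X 0%N).
Proof.
move=> mg ig; have XY : same_law P (X 0%N) (X k) by move=> B mB; rewrite (X_law _ mB).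
by have [] := Ex_same_law (mX 0%N) (mX k) XY mg ig.
Qed.

Let trunc (b x : R) : R := x * (`|x| <= b)%R%:R.

Let mtrunc b : measurable_fun setT (trunc b).
Proof.
apply: measurable_funM => //; apply: measurable_boolr.
by apply: measurable_fun_ler => //; exact: measurableT_comp.
Qed.

Let trunc_bound b x : 0 <= b -> `|trunc b x| <= b.
Proof.
by move=> b0; rewrite /trunc; case: (leP `|x| b) => h; rewrite ?mulr1// mulr0 normr0.
Qed.

Let trunc_cvg : Ex P (fun w => `|X 0%N w - trunc n%:R (X 0%N w)|) @[n --> \oo] --> (0 : R).
Proof.
have <- : Ex P (fun=> 0) = 0 by exact: Ex_cst.
apply: (@Ex_dominated_cvg _ _ _ P _ _ (fun w => `|X 0%N w|) _ _ (integ_norm iX0) _).2.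
- move=> n; apply: measurableT_comp => //; apply: measurable_funB => //.
  exact: measurableT_comp.
- move=> w; apply: cvg_near_cst; near=> n.
  rewrite /trunc (_ : _ <= _) ?mulr1 ?subrr ?normr0//.
  near: n; exact: nbhs_infty_ger.
- move=> n w; rewrite normr_id /trunc.
  by case: (leP `|X 0%N w| n%:R) => _; rewrite ?mulr1 ?subrr ?normr0// mulr0 subr0.
Unshelve. all: by end_near. Qed.

(* Truncate at a level [b]: the bounded part has variance of order [k], and the
   remainder is small in mean, uniformly in the number of summands. *)
Lemma iid_weak_law (e : R) : 0 < e -> \forall n \near \oo, forall k, (k <= n)%N ->
  integ P (fun w => `|\sum_(i < k) (X i w - Ex P (X 0%N))|) /\
  Ex P (fun w => `|\sum_(i < k) (X i w - Ex P (X 0%N))|) <= e * n%:R.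
Proof.
move=> e0; have e8 : 0 < e / 8 by lra.
have [N _ HN] := cvgr_lt _ trunc_cvg _ e8.
pose b : R := N%:R; have b0 : 0 <= b by [].
have {HN} hb : Ex P (fun w => `|X 0%N w - trunc b (X 0%N w)|) < e / 8 := HN N (leqnn N).
pose g x := trunc b x; pose h x := x - g x.
have mh : measurable_fun setT h by apply: measurable_funB => //; exact: mtrunc.
have ig : integ P (g \o X 0%N).
  apply: (@integ_bounded _ _ _ _ b) => [|w]; last exact: trunc_bound.
  exact: (measurableT_comp (mtrunc b)).
have ih : integ P (h \o X 0%N) by exact: integB.
pose mg := Ex P (g \o X 0%N); pose mh' := Ex P (h \o X 0%N).
have mE : Ex P (X 0%N) = mg + mh'.
  by rewrite /mg /mh' -ExD//; apply: eq_Ex => w; rewrite /= /h addrC subrK.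
pose Y i w := g (X i w) - mg; pose Z i w := h (X i w) - mh'.
have iY i : integ P (Y i) /\ Ex P (Y i) = 0.
  have [ii E] := law_Ex i (mtrunc b) ig.
  split; first by apply: integB => //; exact: integ_cst.
  by rewrite /Y ExB ?Ex_cst//; [rewrite [X in X - _]E subrr|exact: integ_cst].
have iZ i : integ P (Z i) /\ Ex P (fun w => `|Z i w|) <= e / 4.
  have [ii E] := law_Ex i mh ih.
  have iZi : integ P (Z i) by apply: integB => //; exact: integ_cst.
  split=> //.
  have ihn := integ_norm ih.
  have [iin En] := @law_Ex (fun x => `|h x|) i (measurableT_comp (@normr_measurable _ _) mh) ihn.
  have mh'e : `|mh'| <= e / 8 := le_trans (Ex_norm ih) (ltW hb).
  have : Ex P (fun w => `|Z i w|) <= Ex P (fun w => `|h (X i w)| + `|mh'|).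
    apply: le_Ex => [||w]; [exact: integ_norm| |exact: ler_normB].
    by apply: integD => //; exact: integ_cst.
  rewrite ExD ?Ex_cst//; last exact: integ_cst.
  move=> /le_trans; apply; rewrite [X in X + _]En.
  have -> : e / 4 = e / 8 + e / 8 by lra.
  by apply: lerD => //; exact: ltW.
have mg2 : measurable_fun setT (fun x => (g x - mg) ^+ 2).
  by apply: measurable_funX; apply: measurable_funB => //; exact: mtrunc.
have [s2 Hs2] : exists s2, forall k, integ P (fun w => Y k w ^+ 2) /\ Ex P (fun w => Y k w ^+ 2) = s2.
  exists (Ex P (fun w => Y 0%N w ^+ 2)) => k.
  apply: (@law_Ex (fun x => (g x - mg) ^+ 2) k mg2).
  apply: (@integ_bounded _ _ _ _ ((b + `|mg|) ^+ 2)) => [|w].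
    exact: (measurableT_comp mg2).
  rewrite normrX; apply: lerXn2r; rewrite ?nnegrE ?addr_ge0//.
  by apply: le_trans (ler_normB _ _) _; rewrite lerD2r; exact: trunc_bound.
have YF k : rv_events (Y k) `<=` F (iX k).
  move=> _ [B mB <-]; apply: XF; exists ((fun x => g x - mg) @^-1` B) => //.
  rewrite -[X in measurable X]setTI; apply: measurable_funB => //; exact: mtrunc.
have n1 (k : nat) (w : T) : `|(fun=> (fun=> 1 : R) : T -> R) k w| <= 1 by rewrite normr1.
have orth k := @Ex_sqr_sum_orthogonal _ _ _ P _ F FT FI mF indepF Y iX predT (fun _ _ => 1) 1 s2 YF
   (fun=> isT) iX_inj Hs2 iY (fun k => @measurable_cst _ _ _ _ _ _) n1 k.
have s20 : 0 <= s2 by rewrite -(Hs2 0%N).2; apply: Ex_ge0 => w; exact: sqr_ge0.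
near=> n => k kn.
have n0 : 0 < n%:R :> R by near: n; exact: nbhs_infty_gtr.
have ns : 4 * s2 / e ^+ 2 <= n%:R by near: n; exact: nbhs_infty_ger.
have iS1 : integ P (fun w => \sum_(i < k) (X i w - Ex P (X 0%N))).
  apply: integ_sum => i _; apply: integB; last exact: integ_cst.
  by have [] := @law_Ex idfun i (@measurable_id _ _ _) iX0.
split; first exact: integ_norm.
have [iS2 ES2] := orth k.
have iZs : integ P (fun w => \sum_(i < k) `|Z i w|).
  by apply: integ_sum => i _; apply/integ_norm/(iZ i).1.
(* Three terms of size [e * n / 4] remain: [a] itself, the variance term by the choice of [n], and
   the means of the remainders [Z i]. *)
pose a := e * n%:R / 4; have a0 : 0 < a by rewrite divr_gt0// mulr_gt0.
have iB : integ P (fun w => a + (4 * a)^-1 * (\sum_(i < k) Y i w * 1) ^+ 2).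
  by apply: integD; [exact: integ_cst|exact: integZ].
have H : Ex P (fun w => `|\sum_(i < k) (X i w - Ex P (X 0%N))|) <=
    Ex P (fun w => (a + (4 * a)^-1 * (\sum_(i < k) Y i w * 1) ^+ 2) + \sum_(i < k) `|Z i w|).
  apply: le_Ex => [||w]; [exact: integ_norm|exact: integD|].
  have -> : \sum_(i < k) (X i w - Ex P (X 0%N)) = \sum_(i < k) Y i w * 1 + \sum_(i < k) Z i w.
    by rewrite -big_split /=; apply: eq_bigr => i _; rewrite /Y /Z /h mE mulr1; ring.
  apply: le_trans (ler_normD _ _) _; apply: lerD; [exact: ler_norm_amgm|exact: ler_norm_sum].
apply: le_trans H _.
rewrite ExD// ExD; [|exact: integ_cst|exact: integZ].
rewrite (Ex_cst P a) (ExZ _ iS2).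
rewrite ES2 Ex_sum; last by move=> i _; apply/integ_norm/(iZ i).1.
have -> : \sum_(i < k) s2 * Ex P (fun w => 1 ^+ 2) = k%:R * s2.
  rewrite expr1n Ex_cst mulr1 sumr_const card_ord mulr_natl//.
have Z4 : \sum_(i < k) Ex P (fun w => `|Z i w|) <= n%:R * (e / 4).
  apply: (@le_trans _ _ (\sum_(i < k) (e / 4))).
    by apply: ler_sum => i _; exact: (iZ i).2.
  rewrite sumr_const card_ord -[X in X <= _]mulr_natl.
  by apply: ler_wpM2r; [rewrite divr_ge0// ltW|rewrite ler_nat].
have Y4 : (4 * a)^-1 * (k%:R * s2) <= e * n%:R / 4.
  apply: (@le_trans _ _ ((4 * a)^-1 * (n%:R * s2))).
    by apply: ler_wpM2l; [rewrite invr_ge0 mulr_ge0// ltW|rewrite ler_wpM2r// ler_nat].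
  have -> : (4 * a)^-1 * (n%:R * s2) = s2 / e.
    by rewrite /a; field; rewrite !gt_eqF.
  move: ns; rewrite ler_pdivrMr ?exprn_gt0// => ns.
  rewrite ler_pdivrMr// (_ : _ * e = n%:R * e ^+ 2 / 4); last by ring.
  by rewrite ler_pdivlMr// mulrC.
apply: le_trans (lerD (lerD (lexx a) Y4) Z4) _.
rewrite (_ : _ + _ = e * n%:R * (3 / 4)); last by rewrite /a; field.
by rewrite ler_piMr ?mulr_ge0 ?(ltW e0)// ler_pdivrMr// mul1r ler_nat.
Unshelve. all: by end_near. Qed.
End weak_law.

(** Used for remainders bounded by a fixed finite variable: no moment of [D] is needed. *)
Lemma Ex_min1_scale_cvg0 {d} {T : measurableType d} {R : realType} (P : probability T R)
    (D : T -> R) (c : nat -> R) : measurable_fun setT D -> c n @[n --> \oo] --> +oo ->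
  Ex P (fun w => Num.min 1 `|(c n)^-1 * D w|) @[n --> \oo] --> (0 : R).
Proof.
move=> mD cy; have <- : Ex P (fun=> 0) = 0 by exact: Ex_cst.
apply: (@Ex_dominated_cvg _ _ _ P _ _ (fun=> 1) _ _ (integ_cst P 1) _).2.
- move=> n; apply: measurable_minr; first exact: measurable_cst.
  by apply: measurableT_comp => //; apply: measurable_funM => //; exact: measurable_cst.
- move=> w.
  have H : (c n)^-1 * D w @[n --> \oo] --> 0 * D w.
    apply: cvgM; last exact: cvg_cst.
    by apply/gtr0_cvgV0 => //; exact: ((cvgryPgt c).1 cy 0).
  rewrite mul0r in H; apply: (@squeeze_cvgr _ _ _ _ (fun=> 0) (fun n => `|(c n)^-1 * D w|)).
  - by near=> n; rewrite le_min ler01 normr_ge0 ge_min lexx orbT.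
  - exact: cvg_cst.
  - by rewrite -(normr0 R); exact: cvg_norm.
- by move=> n w; rewrite ger0_norm ?ge_min ?lexx// le_min ler01 normr_ge0.
Unshelve. all: by end_near. Qed.

(** * Pathwise form of the Taqqu-Levy sums *)

Section taqqu.
Context {T : Type} {R : realType}.
Variables (S0 : T -> nat) (Tk : nat -> T -> nat) (W : nat -> T -> R).
Hypothesis Tk_gt0 : forall k w, (1 <= k)%N -> (0 < Tk k w)%N.

Lemma renewal_SS k w : renewal_S S0 Tk k.+1 w = (renewal_S S0 Tk k w + Tk k.+1 w)%N.
Proof. by rewrite /renewal_S big_nat_recr//= addnA. Qed.

Lemma renewal_S0 w : renewal_S S0 Tk 0 w = S0 w.
Proof. by rewrite /renewal_S big_geq ?addn0. Qed.

Lemma renewal_S_ge k w : (k <= renewal_S S0 Tk k w)%N.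
Proof.
elim: k => // k IH; rewrite renewal_SS.
by have := Tk_gt0 w (ltn0Sn k); lia.
Qed.

(** As the [T_k] are at least 1, [S_k >= k], so the terms with [k >= t + 2] vanish and the series is
    a finite sum at every point. *)
Lemma taqqu_XE N t w : (t.+2 <= N)%N ->
  taqqu_X S0 Tk W t w = W 0%N w * window 0 (S0 w) t +
    \sum_(k < N.-1) W k.+1 w * window (renewal_S S0 Tk k w) (Tk k.+1 w) t.
Proof.
move=> tN.
pose u k := W k w * (if ((k == 0)%N || (renewal_S S0 Tk k.-1 w <= t)%N)
                 && (t < renewal_S S0 Tk k w)%N then 1 else 0).
have uE : \sum_(0 <= k < N) u k = W 0%N w * window 0 (S0 w) t +
    \sum_(k < N.-1) W k.+1 w * window (renewal_S S0 Tk k w) (Tk k.+1 w) t.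
  case: N tN => // N tN; rewrite big_nat_recl// big_mkord; congr (_ + _).
    by rewrite /u /= renewal_S0 windowE add0n; case: (_ < _)%N.
  apply: eq_bigr => k _; rewrite /u /= renewal_SS windowE.
  by case: (_ && _)%N.
rewrite -uE; apply: (lim_near_cst (@Rhausdorff R)); near=> M.
have NM : (N <= M)%N by near: M; exact: nbhs_infty_ge.
rewrite [LHS](big_cat_nat_idem _ _ NM)//= -[RHS]addr0; congr (_ + _).
rewrite big_nat_cond big1// => k /andP[/andP[Nk kM] _].
rewrite /u; case: k Nk {kM} => [|k] Nk; first by rewrite leqn0 in Nk; move: tN; rewrite (eqP Nk).
rewrite /= leqNgt (_ : (t < _)%N) ?mulr0//.
by apply: leq_trans (renewal_S_ge k w); lia.
Unshelve. all: by end_near. Qed.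

(** Two windows are set apart. The one of [W 0] has length [S_0], of a different law; the one of
    [W 1] starts at [S_0], which may be 0, while shot sums need the [k]-th start to exceed [k]. From
    [W 2] on, the start [S_(k+1)] satisfies this. *)
Lemma taqqu_weighted_sum (f : R -> R) n w :
  \sum_(1 <= t < n.+1) taqqu_X S0 Tk W t w * f (t%:R / n%:R) =
  W 0%N w * window_sum f n 0 (S0 w) + W 1%N w * window_sum f n (S0 w) (Tk 1%N w) +
  \sum_(k < n) W k.+2 w * window_sum f n (renewal_S S0 Tk k.+1 w) (Tk k.+2 w).
Proof.
transitivity (\sum_(1 <= t < n.+1) (W 0%N w * (f (t%:R / n%:R) * window 0 (S0 w) t) +
    \sum_(k < n.+1) W k.+1 w * (f (t%:R / n%:R) * window (renewal_S S0 Tk k w) (Tk k.+1 w) t))).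
  apply: eq_big_nat => t /andP[_ tn]; rewrite (@taqqu_XE n.+2)// mulrDl mulr_suml; congr (_ + _).
    by ring.
  by apply: eq_bigr => k _; ring.
rewrite big_split /= -mulr_sumr -addrA; congr (_ + _).
rewrite exchange_big /= big_ord_recl; congr (_ + _).
  by rewrite -mulr_sumr renewal_S0.
by apply: eq_bigr => k _; rewrite -mulr_sumr.
Qed.

End taqqu.

(** * The Taqqu-Levy process *)

Section transfer.
Context {d} {T : measurableType d} {R : realType} (P : probability T R).

Lemma same_law_sym {d'} {V : measurableType d'} (X Y : T -> V) :
  same_law P X Y -> same_law P Y X.
Proof. by move=> XY B mB; rewrite XY. Qed.

Lemma same_law_trans {d'} {V : measurableType d'} (X Y Z : T -> V) :
  same_law P X Y -> same_law P Y Z -> same_law P X Z.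
Proof. by move=> XY YZ B mB; rewrite XY// YZ. Qed.

Lemma heavy_tail_same_law (U V : T -> nat) (alpha : R) (c : nat -> R) :
  measurable_fun setT U -> measurable_fun setT V -> same_law P U V ->
  heavy_tail P U alpha c -> heavy_tail P V alpha c.
Proof.
move=> mU mV UV; have E : tail P U = tail P V.
  by apply/funext => t; rewrite !tailE//; congr fine; exact: (UV [set k | t < k%:R]).
by rewrite /heavy_tail E.
Qed.

Lemma moments_same_law (X Y : T -> R) (alpha : R) : 1 < alpha < 2 ->
  measurable_fun setT X -> measurable_fun setT Y -> same_law P X Y ->
  integ P (fun w => X w ^+ 2) ->
  [/\ mom_abs P X alpha = mom_abs P Y alpha, mom_pos P X alpha = mom_pos P Y alpha
    & mom_neg P X alpha = mom_neg P Y alpha].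
Proof.
move=> a12 mX mY XY iX2.
have E (g : R -> R) : measurable_fun setT g -> (forall x, `|g x| <= `|x|) ->
    Ex P (fun w => `|g (X w)| `^ alpha) = Ex P (fun w => `|g (Y w)| `^ alpha).
  move=> mg gle.
  have mga : measurable_fun setT (fun x => `|g x| `^ alpha).
    by apply: (measurableT_comp (measurable_powR alpha)); exact: measurableT_comp.
  have [|_ //] := @Ex_same_law _ _ _ P _ _ X Y (fun x => `|g x| `^ alpha) mX mY XY mga.
  apply: (@le_integ _ _ _ P (fun w => 1 + X w ^+ 2)).
  - exact: measurableT_comp.
  - move=> w; rewrite ger0_norm ?powR_ge0//.
    apply: le_trans (powR_le1Dsqr _ a12) _; rewrite lerD2l -[leLHS]real_normK ?num_real//.
    by rewrite -[leRHS]real_normK ?num_real// lerXn2r ?nnegrE.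
  - by apply: integD => //; exact: integ_cst.
have posE x : Num.max x 0 = `|Num.max x 0| :> R by rewrite ger0_norm// le_max lexx orbT.
split; rewrite /mom_abs /mom_pos /mom_neg -!Ex_fine.
- by have := @E idfun (@measurable_id _ _ _) (fun x => lexx _).
- have := @E (fun x => Num.max x 0) _ _.
  under eq_Ex do rewrite -posE; under [X in _ = X]eq_Ex do rewrite -posE; apply.
    by apply: measurable_maxr => //; exact: measurable_cst.
  by move=> x; rewrite -posE ge_max normr_ge0 ler_norm.
- have := @E (fun x => Num.max (- x) 0) _ _.
  under eq_Ex do rewrite -posE; under [X in _ = X]eq_Ex do rewrite -posE; apply.
    by apply: measurable_maxr; [exact: measurable_funN|exact: measurable_cst].
  by move=> x; rewrite -posE ge_max normr_ge0 -normrN ler_norm.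
Qed.

End transfer.

Section taqqu_limit.
Context {d} {T : measurableType d} {R : realType} (P : probability T R).
Variables (S0 : T -> nat) (Tk : nat -> T -> nat) (W : nat -> T -> R) (mu alpha : R) (L : R -> R).
Hypothesis mS0 : measurable_fun setT S0.
Hypothesis mTk : forall k, measurable_fun setT (Tk k).
Hypothesis mW : forall k, measurable_fun setT (W k).
Hypothesis Tk_gt0 : forall k w, (1 <= k)%N -> (0 < Tk k w)%N.
Hypothesis Tk_law : forall k, (1 <= k)%N -> same_law P (Tk k) (Tk 1%N).
Hypothesis W_law : forall k, same_law P (W k) (W 0%N).
Hypothesis indep : mutually_indep P (fun i : option (nat + nat) =>
  match i with
  | None => rv_events S0
  | Some (inl k) => rv_events (Tk k.+1)
  | Some (inr k) => rv_events (W k)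
  end).
Hypothesis iT : integ P (fun w => (Tk 1%N w)%:R).
Hypothesis ET : Ex P (fun w => (Tk 1%N w)%:R) = mu.
Hypothesis iW : integ P (W 0%N).
Hypothesis EW : Ex P (W 0%N) = 0.
Hypothesis iW2 : integ P (fun w => W 0%N w ^+ 2).
Hypothesis alpha12 : 1 < alpha < 2.
Hypothesis svL : slowly_varying L.
Hypothesis TL : forall n : nat, (1 <= n)%N ->
  fine (P [set w | (n <= Tk 1%N w)%N]) = L n%:R * n%:R `^ (- alpha).

Let F (i : option (nat + nat)) : set (set T) :=
  match i with
  | None => rv_events S0
  | Some (inl k) => rv_events (Tk k.+1)
  | Some (inr k) => rv_events (W k)
  end.

Let FT i : F i setT.
Proof. by case: i => [[k|k]|]; exact: rv_eventsT. Qed.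

Let FI i : setI_closed (F i).
Proof. by case: i => [[k|k]|]; exact: setI_closed_rv_events. Qed.

Let mF i : F i `<=` measurable.
Proof. by case: i => [[k|k]|]; exact: rv_events_measurable. Qed.

Let c := quantile (fun n : nat => fine (P [set w | (n <= Tk 1%N w)%N])).

Let law k : same_law P (Tk k.+1) (Tk 1%N).
Proof. exact: Tk_law. Qed.

Let Wlaw k l : same_law P (W k) (W l).
Proof. by apply: same_law_trans (W_law k) _; exact/same_law_sym. Qed.

Let ht : heavy_tail P (Tk 2) alpha c.
Proof.
have E : (fun w => Tk 1 w + 0)%N = Tk 1 by apply/funext => w; rewrite addn0.
apply: (@heavy_tail_same_law _ _ _ _ (fun w => Tk 1 w + 0)%N) => //.
- by rewrite E.
- by rewrite E; apply: same_law_sym; exact: law.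
- exact: (heavy_tail_slowly_varying (mTk 1) alpha12 svL TL).
Qed.

Let mu1 : 1 <= mu.
Proof.
have := le_Ex (integ_cst P 1) iT; rewrite ET Ex_cst; apply.
by move=> w; rewrite ler1n; exact: Tk_gt0.
Qed.

(** The indices of [S_0] and [T_1, ..., T_(k+1)], which determine the start [S_(k+1)] of the window
    of length [T_(k+2)]; the index of that length is the first one left out. *)
Let past k (i : option (nat + nat)) : bool :=
  match i with None => true | Some (inl l) => (l < k.+1)%N | _ => false end.

Let mV k : measurable_wrt F (past k) (renewal_S S0 Tk k.+1).
Proof.
rewrite /renewal_S; apply: measurable_fun_addn.
  exact: (@measurable_wrt_rv _ _ _ _ _ _ _ None).
have H m : (m <= k.+1)%N -> measurable_wrt F (past k) (fun w => \sum_(1 <= i < m.+1) Tk i w)%N.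
  elim: m => [|m IH] mk.
    by under eq_fun do rewrite big_geq//; exact: measurable_cst.
  under eq_fun do rewrite big_nat_recr//=.
  apply: measurable_fun_addn; first exact: (IH (ltnW mk)).
  exact: (@measurable_wrt_rv _ _ _ _ _ _ _ (Some (inl m))).
exact: H.
Qed.

(** [S_(k+1) - mu k] is [S_0 + mu] plus a centred sum of [k + 1] terms. A fixed variable exceeds
    [eta n / 2] with vanishing probability, and Markov's inequality with the weak law handles the
    sum, uniformly in [k < n]. *)
Let V_lln (eta : R) : 0 < eta ->
  n%:R^-1 * \sum_(k < n) Ex P (fun w => (eta * n%:R < `|(renewal_S S0 Tk k.+1 w)%:R - mu * k%:R|)%R%:R)
  @[n --> \oo] --> (0 : R).
Proof.
move=> eta0; pose X k w := (Tk k.+1 w)%:R : R.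
have mcast (B : set R) : measurable ((fun n : nat => n%:R : R) @^-1` B) by [].
have XF k : rv_events (X k) `<=` F (Some (inl k)).
  by move=> _ [B mB <-]; exists ((fun n : nat => n%:R : R) @^-1` B).
have Xinj : injective (fun k => Some (inl k) : option (nat + nat)) by move=> k l [].
have Xlaw k : same_law P (X k) (X 0%N).
  by move=> B mB; apply: (@law k ((fun n : nat => n%:R : R) @^-1` B)).
have wl (e : R) (e0 : 0 < e) := @iid_weak_law _ _ _ P _ F FT FI mF indep X _ XF Xinj Xlaw iT e e0.
have {wl} : forall e : R, 0 < e -> \forall n \near \oo, forall k, (k <= n)%N ->
    integ P (fun w => `|\sum_(i < k) (X i w - mu)|) /\
    Ex P (fun w => `|\sum_(i < k) (X i w - mu)|) <= e * n%:R by rewrite -ET.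
move=> wl.
have mI n : measurable_fun setT (fun w => (eta / 2 * n%:R < (S0 w)%:R + mu)%R%:R : R).
  apply: measurable_boolr; apply: measurable_fun_ltr; first exact: measurable_cst.
  by apply: measurable_funD; [exact: measurable_natr|exact: measurable_cst].
have bI n w : `|(eta / 2 * n%:R < (S0 w)%:R + mu)%R%:R : R| <= 1.
  by case: (_ < _)%R; rewrite ?normr1 ?normr0.
have I0 : Ex P (fun w => (eta / 2 * n%:R < (S0 w)%:R + mu)%R%:R) @[n --> \oo] --> (0 : R).
  have <- : Ex P (fun=> 0) = 0 by exact: Ex_cst.
  apply: (@Ex_dominated_cvg _ _ _ P _ _ (fun=> 1) mI _ (integ_cst P 1) bI).2 => w.
  apply: cvg_near_cst; near=> n.
  have : ((S0 w)%:R + mu) / (eta / 2) <= n%:R by near: n; exact: nbhs_infty_ger.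
  by rewrite ler_pdivrMr ?divr_gt0// mulrC leNgt => /negbTE ->.
apply/cvgrPdist_le => e e0.
(* Divided by the threshold [eta * n / 2] in Markov's inequality, the bound [e * eta / 4 * n]
   becomes [e / 2]. *)
have e4 : 0 < e * eta / 4 by rewrite divr_gt0// mulr_gt0.
have e2 : 0 < e / 2 by rewrite divr_gt0.
have Hw := wl _ e4; have HI : \forall n \near \oo, Ex P (fun w => (eta / 2 * n%:R < (S0 w)%:R + mu)%R%:R) < e / 2.
  exact: (cvgr_lt _ I0 _ e2).
near=> n.
have n0 : 0 < n%:R :> R by near: n; exact: nbhs_infty_gtr.
have In : Ex P (fun w => (eta / 2 * n%:R < (S0 w)%:R + mu)%R%:R) < e / 2 by near: n.
have wn : forall k, (k <= n)%N -> integ P (fun w => `|\sum_(i < k) (X i w - mu)|) /\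
    Ex P (fun w => `|\sum_(i < k) (X i w - mu)|) <= e * eta / 4 * n%:R by near: n.
have h0 : 0 < eta * n%:R / 2 by rewrite divr_gt0// mulr_gt0.
rewrite sub0r normrN ger0_norm; last first.
  by rewrite mulr_ge0 ?invr_ge0// sumr_ge0// => k _; apply: Ex_ge0.
rewrite ler_pdivrMl//.
apply: (@le_trans _ _ (\sum_(k < n) e)); last by rewrite sumr_const card_ord mulr_natl.
apply: ler_sum => k _; have [iS ES] := wn k.+1 (ltn_ord k).
have ii : integ P (fun w => (eta / 2 * n%:R < (S0 w)%:R + mu)%R%:R) by exact: (integ_bounded _ (mI n) (bI n)).
apply: (@le_trans _ _ (Ex P (fun w => (eta / 2 * n%:R < (S0 w)%:R + mu)%R%:R +
    (eta * n%:R / 2)^-1 * `|\sum_(i < k.+1) (X i w - mu)|))).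
  apply: le_Ex => [||w].
  - apply: (@integ_bounded _ _ _ _ 1) => [|w]; last by case: (_ < _)%R; rewrite ?normr1 ?normr0.
    apply: measurable_boolr; apply: measurable_fun_ltr; first exact: measurable_cst.
    apply: measurableT_comp => //; apply: measurable_funB => //.
    by apply: measurable_natr; exact: (measurable_wrt_measurable mF (@mV k)).
  - by apply: integD => //; exact: integZ.
  - have -> : (renewal_S S0 Tk k.+1 w)%:R - mu * k%:R =
        (S0 w)%:R + mu + \sum_(i < k.+1) (X i w - mu).
      rewrite /renewal_S natrD natr_sum big_add1 /= big_mkord sumrB sumr_const card_ord /X.
      by rewrite -[mu *+ _]mulr_natr -natr1; ring.
    set s := \sum_(i < _) _; have s0 : 0 <= (eta * n%:R / 2)^-1 * `|s|.
      by rewrite mulr_ge0// invr_ge0 ltW.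
    have [h1|h1] := ltP (eta / 2 * n%:R) ((S0 w)%:R + mu).
      by apply: ler_wpDr => //; case: (_ < _)%R.
    have [h2|h2] := ltP (eta * n%:R) `|(S0 w)%:R + mu + s|; last by rewrite add0r.
    rewrite add0r mulrC ler_pdivlMr// mul1r.
    have h3 := ler_normD ((S0 w)%:R + mu) s.
    rewrite (ger0_norm (_ : 0 <= (S0 w)%:R + mu)) in h3; last by rewrite addr_ge0// (le_trans ler01).
    have h4 : eta / 2 * n%:R + eta * n%:R / 2 = eta * n%:R by field.
    rewrite -(lerD2l (eta / 2 * n%:R)) h4; apply: le_trans (ltW h2) _.
    by apply: le_trans h3 _; rewrite lerD2r.
rewrite ExD//; last exact: integZ.
rewrite ExZ// [leRHS]splitr lerD ?(ltW In)// ler_pdivrMl//.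
by apply: le_trans ES _; rewrite le_eqVlt; apply/orP; left; apply/eqP; field.
Unshelve. all: by end_near. Qed.

Let mwindow (X Y : T -> nat) t : measurable_fun setT X -> measurable_fun setT Y ->
  measurable_fun setT (fun w => window (X w) (Y w) t : R).
Proof.
move=> mX mY; apply: measurable_funM; apply: measurable_boolr.
  by apply: measurable_fun_ler; [exact: measurable_natr|exact: measurable_cst].
by apply: measurable_fun_ltr; [exact: measurable_cst|apply: measurable_funD; exact: measurable_natr].
Qed.

Let mrenewal k : measurable_fun setT (renewal_S S0 Tk k).
Proof.
case: k => [|k]; first by apply/(eq_measurable_fun S0) => // w _; rewrite renewal_S0.
exact: (measurable_wrt_measurable mF (@mV k)).
Qed.

Let mX t : measurable_fun setT (taqqu_X S0 Tk W t).
Proof.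
rewrite (_ : taqqu_X S0 Tk W t = fun w => W 0%N w * window 0 (S0 w) t +
    \sum_(k < t.+1) W k.+1 w * window (renewal_S S0 Tk k w) (Tk k.+1 w) t); last first.
  by apply/funext => w; rewrite (@taqqu_XE _ _ _ _ _ Tk_gt0 t.+2).
apply: measurable_funD.
  by apply: measurable_funM => //; apply: mwindow => //; exact: measurable_cst.
by apply: measurable_sum => k; apply: measurable_funM => //; exact: mwindow.
Qed.

Theorem taqqu_cvg_in_distribution (q : nat) (j : 'I_q -> nat)
    {d2} {T2 : measurableType d2} (P2 : probability T2 R) (Lam : R -> T2 -> R)
    (ZRe ZIm : 'I_q -> T2 -> R) :
  stable_levy P2 Lam alpha
    (mu^-1 * mom_abs P (W 1%N) alpha * Gamma (1 - alpha) * cos (pi * alpha / 2))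
    ((mom_pos P (W 1%N) alpha - mom_neg P (W 1%N) alpha) / mom_abs P (W 1%N) alpha) ->
  (forall k, measurable_fun setT (ZRe k)) ->
  (forall k, measurable_fun setT (ZIm k)) ->
  (forall k, cvg_in_prob P2
     (riemann_sum (fun s => cos (2 * pi * (j k)%:R * s)) Lam) (ZRe k)) ->
  (forall k, cvg_in_prob P2
     (riemann_sum (fun s => sin (2 * pi * (j k)%:R * s)) Lam) (ZIm k)) ->
  cvg_in_distribution P (normalized_D P (Tk 1%N) alpha (taqqu_X S0 Tk W) j)
    P2 (fun w => (\row_k ZRe k w, \row_k ZIm k w)).
Proof.
move=> st mZRe mZIm HRe HIm.
have iW2' k : integ P (fun w => W k w ^+ 2) /\ Ex P (fun w => W k w ^+ 2) = Ex P (fun w => W 0%N w ^+ 2).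
  have [] := @Ex_same_law _ _ _ P _ _ (W 0%N) (W k) (fun x => x ^+ 2) (mW 0) (mW k) (Wlaw 0 k) _ iW2.
    exact: measurable_funX.
  by move=> i ->.
have [iWk EWk] := @Ex_same_law _ _ _ P _ _ (W 0%N) (W 2) idfun (mW 0) (mW 2) (Wlaw 0 2) (@measurable_id _ _ _) iW.
(* The constants are stated with [W 1], while the first shot of the sum is [W 2]. *)
have [E1 E2 E3] := moments_same_law alpha12 (mW 1) (mW 2) (Wlaw 1 2) (iW2' 1%N).1.
rewrite E1 E2 E3 in st.
apply: (@shot_process_cvg _ _ _ P _ F FT FI mF indep (fun k => W k.+2) (fun k => Some (inr k.+2))
  (fun i => if i is Some (inr _) then true else false) (fun k => Tk k.+2) (fun k => Some (inl k.+1))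
  (fun k => renewal_S S0 Tk k.+1) past mu alpha c _ _ _ _ _ _ mV _ _ _ mu1 V_lln _ _ iWk (iW2' 2).1
  _ alpha12 ht (Tk 1%N) (taqqu_X S0 Tk W) q j _ mX _ _ _ P2 Lam ZRe ZIm st mZRe mZIm HRe HIm) => //.
- by move=> k B h; exact: h.
- by move=> k B h; exact: h.
- by move=> k l [].
- by move=> k l [].
- by move=> k [[l|l]|].
- by move=> k; rewrite /past ltnn.
- by move=> k w; exact: renewal_S_ge.
- by move=> k; apply: same_law_trans (Tk_law _) _ => //; apply: same_law_sym; exact: Tk_law.
- by rewrite EW in EWk; rewrite -EWk.
- by move=> n n0; apply: ell_quantile.
move=> f M Lf fM fL.
have M0 : 0 <= M := le_trans (normr_ge0 _) (fM 0).
(* A bound, independent of [n], on the two windows set apart; division by [c n] makes it vanish in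
   probability. *)
pose D w := M * (`|W 0%N w| * (S0 w)%:R + `|W 1%N w| * (Tk 1%N w)%:R).
have mD : measurable_fun setT D.
  apply: measurable_funM; first exact: measurable_cst.
  apply: measurable_funD; apply: measurable_funM; try exact: measurable_natr.
    exact: measurableT_comp.
  exact: measurableT_comp.
have [cy _ _ _] := ht.
have DE w n : (c n)^-1 * (\sum_(1 <= t < n.+1) taqqu_X S0 Tk W t w * f (t%:R / n%:R)) -
    shot_sum (fun k => W k.+2) (fun k => Tk k.+2) (fun k => renewal_S S0 Tk k.+1) c f n w =
    (c n)^-1 * (W 0%N w * window_sum f n 0 (S0 w) + W 1%N w * window_sum f n (S0 w) (Tk 1%N w)).
  by rewrite taqqu_weighted_sum// /shot_sum; ring.
have mR n : measurable_fun setT (fun w => (c n)^-1 *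
    (W 0%N w * window_sum f n 0 (S0 w) + W 1%N w * window_sum f n (S0 w) (Tk 1%N w))).
  apply: measurable_funM; first exact: measurable_cst.
  apply: measurable_funD; apply: measurable_funM => //; apply: measurable_sum => t;
    by apply: measurable_funM; [exact: measurable_cst|apply: mwindow => //; exact: measurable_cst].
apply: (@squeeze_cvgr _ _ _ _ (fun=> 0) (fun n => Ex P (fun w => Num.min 1 `|(c n)^-1 * D w|))).
- near=> n; apply/andP; split; first by apply: Ex_ge0 => w; rewrite le_min ler01 normr_ge0.
  under eq_Ex do rewrite DE.
  apply: le_Ex => [||w]; [exact: integ_min1| |].
    by apply: integ_min1; apply: measurable_funM => //; exact: measurable_cst.
  rewrite le_min !ge_min lexx/=; apply/orP; right.
  have D0 : 0 <= D w by rewrite mulr_ge0// addr_ge0// mulr_ge0.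
  rewrite normrM [leRHS]normrM ler_wpM2l// (ger0_norm D0) /D.
  apply: le_trans (ler_normD _ _) _; rewrite mulrDr !normrM.
  by apply: lerD; rewrite mulrCA ler_wpM2l//; exact: window_sum_bound.
- exact: cvg_cst.
- exact: Ex_min1_scale_cvg0.
Unshelve. all: by end_near. Qed.

End taqqu_limit.

(** * Parke's process *)

Section measurable_limit.
Context {d} {T : measurableType d} {R : realType} (u : nat -> T -> R).
Hypothesis mu : forall n, measurable_fun setT (u n).

Lemma measurable_cvgn_set : measurable [set w | cvgn (fun n => u n w)].
Proof.
rewrite (_ : [set w | _] = \bigcap_k \bigcup_N \bigcap_m
    [set w | `|u N w - u (N + m)%N w| <= k.+1%:R^-1]).
  apply: bigcapT_measurable => k; apply: bigcupT_measurable => N.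
  apply: bigcapT_measurable => m.
  have mf : measurable_fun setT (fun w => `|u N w - u (N + m)%N w|).
    by apply: measurableT_comp => //; exact: measurable_funB.
  have := mf measurableT _ (measurable_itv (`]-oo, k.+1%:R^-1])%R); rewrite setTI.
  by congr measurable; apply/seteqP; split => w /=; rewrite in_itv.
apply/seteqP; split => w /=.
- move=> cu k _; have /cvgrPdist_le/(_ (k.+1%:R^-1 / 2)) := cu.
  case=> [|N _ HN]; first by rewrite divr_gt0// invr_gt0.
  exists N => // m _ /=; rewrite [leRHS]splitr.
  have h1 := HN N (leqnn N); have h2 := HN (N + m)%N (leq_addr m N).
  rewrite -[_ - u (N + m)%N w](subrKA (limn (fun n => u n w))).
  by apply: le_trans (ler_normD _ _) _; rewrite lerD// distrC.
- move=> cu; apply/cauchy_cvgP/cauchy_exP => e e0.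
  have [k ke] : exists k : nat, k.+1%:R^-1 < e :> R.
    by have [k _ /(_ k (leqnn k))] := near_infty_natSinv_lt (PosNum e0); exists k.
  have [N _ HN] := cu k I; exists (u N w); exists N => // n /= Nn.
  have := HN (n - N)%N I; rewrite /= subnKC// => h.
  exact: le_lt_trans h ke.
Qed.

(** Parke's series need not stabilise at every point. On the set of divergence, measurable by the
    Cauchy criterion, [limn] takes the constant default value [point]. *)
Lemma measurable_limn : measurable_fun setT (fun w => limn (fun n => u n w)).
Proof.
have mC := measurable_cvgn_set.
rewrite -(setUv [set w | cvgn (fun n => u n w)]); apply/measurable_funU => //.
  exact: measurableC.
split.
  apply: (@measurable_fun_cvg _ _ _ _ u) => [n|w Cw]; last exact: Cw.
  exact: measurable_funS (mu n).
apply: (eq_measurable_fun (cst point)); last exact: measurable_cst.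
move=> w; rewrite inE => /= Cw; rewrite /= (_ : limn _ = point)//.
by apply: dvgP.
Qed.

End measurable_limit.

Section parke.
Context {T : Type} {R : realType}.
Variables (eps : int -> T -> R) (nn : int -> T -> nat).

(** The hypothesis says that no site [-r] with [r >= r0] is still active at time 1. What remains are
    the sites [1, ..., t], with windows of length [n_s + 1] since both ends of [s <= t <= s + n_s]
    count, and finitely many sites [s <= 0]. *)
Lemma parke_XE (t r0 : nat) w : (0 < t)%N ->
  (forall r, (r0 <= r)%N -> (nn (- r%:Z) w <= r)%N) ->
  parke_X eps nn t%:Z w =
    \sum_(k < t) eps k.+1%:Z w * window k.+1 (nn k.+1%:Z w + 1) t +
    \sum_(r < r0) eps (- r%:Z) w * (r + t <= nn (- r%:Z) w)%N%:R.
Proof.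
move=> t0 nr.
pose u (m : nat) : R := if (m <= nn (t%:Z - m%:Z) w)%N then eps (t%:Z - m%:Z) w else 0.
have uE : \sum_(0 <= m < t + r0) u m =
    \sum_(k < t) eps k.+1%:Z w * window k.+1 (nn k.+1%:Z w + 1) t +
    \sum_(r < r0) eps (- r%:Z) w * (r + t <= nn (- r%:Z) w)%N%:R.
  rewrite [LHS](big_cat_nat_idem _ _ (leq_addr r0 t))//=; last by rewrite addr0.
  congr (_ + _).
    rewrite big_nat_rev big_mkord; apply: eq_bigr => k _; have kt := ltn_ord k.
    rewrite /u add0n (_ : t%:Z - (t - k.+1)%:Z = k.+1%:Z); last by lia.
    rewrite windowE (_ : (k.+1 <= t < k.+1 + _)%N = (t - k.+1 <= nn k.+1%:Z w)%N); last by lia.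
    by case: (_ <= _)%N; rewrite ?mulr1 ?mulr0.
  rewrite -[X in \sum_(X <= _ < _) _](add0n t) big_addn addnC addnK big_mkord.
  apply: eq_bigr => r _; rewrite /u (_ : t%:Z - (r + t)%:Z = - r%:Z); last by lia.
  by case: (_ <= _)%N; rewrite ?mulr1 ?mulr0.
rewrite -uE; apply: (lim_near_cst (@Rhausdorff R)); near=> N.
have NM : (t + r0 <= N)%N by near: N; exact: nbhs_infty_ge.
rewrite [LHS](big_cat_nat_idem _ _ NM)//= -[RHS]addr0; congr (_ + _).
rewrite big_nat_cond big1// => m /andP[/andP[rm mN] _].
have h := nr (m - t)%N; rewrite ifN// -ltnNge.
rewrite (_ : t%:Z - m%:Z = - (m - t)%N%:Z); last by lia.
apply: leq_ltn_trans (h _) _; lia.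
Unshelve. all: by end_near. Qed.

(** The site [-r] acts at the times from 1 to [n_(-r) - r], hence at no more than [n_(-r)] of them,
    which bounds the contribution of the past independently of [n]. *)
Lemma parke_weighted_sum (f : R -> R) (M : R) n r0 w : (forall x, `|f x| <= M) ->
  (forall r, (r0 <= r)%N -> (nn (- r%:Z) w <= r)%N) ->
  `|\sum_(1 <= t < n.+1) parke_X eps nn t%:Z w * f (t%:R / n%:R) -
    \sum_(k < n) eps k.+1%:Z w * window_sum f n k.+1 (nn k.+1%:Z w + 1)| <=
  M * \sum_(r < r0) `|eps (- r%:Z) w| * (nn (- r%:Z) w)%:R.
Proof.
move=> fM nr; have M0 : 0 <= M := le_trans (normr_ge0 _) (fM 0).
have -> : \sum_(1 <= t < n.+1) parke_X eps nn t%:Z w * f (t%:R / n%:R) -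
    \sum_(k < n) eps k.+1%:Z w * window_sum f n k.+1 (nn k.+1%:Z w + 1) =
    \sum_(r < r0) eps (- r%:Z) w * \sum_(1 <= t < n.+1) f (t%:R / n%:R) * (r + t <= nn (- r%:Z) w)%N%:R.
  apply/eqP; rewrite subr_eq addrC; apply/eqP.
  transitivity (\sum_(1 <= t < n.+1) (\sum_(k < n) eps k.+1%:Z w *
      (f (t%:R / n%:R) * window k.+1 (nn k.+1%:Z w + 1) t) +
      \sum_(r < r0) eps (- r%:Z) w * (f (t%:R / n%:R) * (r + t <= nn (- r%:Z) w)%N%:R))).
    apply: eq_big_nat => t /andP[t0 tn]; rewrite (parke_XE t0 nr) mulrDl; congr (_ + _).
      rewrite (big_ord_widen n (fun k => eps k.+1%:Z w * window k.+1 (nn k.+1%:Z w + 1) t))//.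
      rewrite big_mkcond mulr_suml; apply: eq_bigr => k _.
      case: ltnP => [kt|kt]; first by ring.
      rewrite mul0r windowE (_ : (k.+1 <= t < _)%N = false) ?mulr0//; lia.
    by rewrite mulr_suml; apply: eq_bigr => r _; ring.
  rewrite big_split/= ![\sum_(1 <= _ < _) \sum_(_ < _) _]exchange_big /=.
  by congr (_ + _); apply: eq_bigr => k _; rewrite -mulr_sumr.
rewrite mulr_sumr; apply: le_trans (ler_norm_sum _ _ _) _; apply: ler_sum => r _.
rewrite normrM mulrCA ler_wpM2l//; apply: le_trans (ler_norm_sum _ _ _) _.
have : \sum_(1 <= t < n.+1) (window 1 (nn (- r%:Z) w) t : R) <= (nn (- r%:Z) w)%:R by exact: sum_window_le.
move=> /(ler_wpM2l M0); apply: le_trans; rewrite mulr_sumr.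
apply: ler_sum_nat => t /andP[t0 tn]; rewrite normrM ler_pM// windowE.
rewrite normr_nat ler_nat; case: (leqP (r + t) _) => //= h.
by rewrite lt0b; lia.
Qed.

End parke.

Section parke_limit.
Context {d} {T : measurableType d} {R : realType} (P : probability T R).
Variables (eps : int -> T -> R) (nn : int -> T -> nat) (alpha : R) (L : R -> R).
Hypothesis meps : forall s, measurable_fun setT (eps s).
Hypothesis mnn : forall s, measurable_fun setT (nn s).
Hypothesis eps_law : forall s, same_law P (eps s) (eps 0).
Hypothesis nn_law : forall s, same_law P (nn s) (nn 0).
Hypothesis indep : mutually_indep P (fun i : int + int =>
  match i with
  | inl s => rv_events (eps s)
  | inr s => rv_events (nn s)
  end).
Hypothesis ieps : integ P (eps 0).
Hypothesis Eeps : Ex P (eps 0) = 0.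
Hypothesis ieps2 : integ P (fun w => eps 0 w ^+ 2).
Hypothesis alpha12 : 1 < alpha < 2.
Hypothesis svL : slowly_varying L.
Hypothesis NL : forall n : nat, (1 <= n)%N ->
  fine (P [set w | (n <= nn 0 w)%N]) = L n%:R * n%:R `^ (- alpha).

Let F (i : int + int) : set (set T) :=
  match i with
  | inl s => rv_events (eps s)
  | inr s => rv_events (nn s)
  end.

Let FT i : F i setT.
Proof. by case: i => k; exact: rv_eventsT. Qed.

Let FI i : setI_closed (F i).
Proof. by case: i => k; exact: setI_closed_rv_events. Qed.

Let mF i : F i `<=` measurable.
Proof. by case: i => k; exact: rv_events_measurable. Qed.

Let c := quantile (fun n : nat => fine (P [set w | (n <= nn 0 w)%N])).

Let mnn1 s : measurable_fun setT (fun w => nn s w + 1)%N.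
Proof. by apply: measurable_fun_addn => //; exact: measurable_cst. Qed.

Let law1 s s' : same_law P (fun w => nn s w + 1)%N (fun w => nn s' w + 1)%N.
Proof.
move=> B mB; have mB' : measurable [set k | B (k + 1)%N] by [].
by have := nn_law s mB'; have := nn_law s' mB' => <-.
Qed.

Let ht : heavy_tail P (fun w => nn 1 w + 1)%N alpha c.
Proof.
apply: (@heavy_tail_same_law _ _ _ _ (fun w => nn 0 w + 1)%N) => //.
exact: (heavy_tail_slowly_varying (mnn 0) alpha12 svL NL).
Qed.

Let inn : integ P (fun w => (nn 0 w)%:R).
Proof.
have h := heavy_tail_slowly_varying (mnn 0) alpha12 svL NL (leqnn 1).
apply: (@le_integ _ _ _ P (fun w => (nn 0 w + 1)%:R)).
- exact: measurable_natr.
- by move=> w; rewrite normr_nat ler_nat leq_addr.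
- exact: (integ_heavy_tail (mnn1 0) h).
Qed.

(** The indicator that some site [-r] with [r >= r0] is still active at time 1, the event excluded
    in [parke_XE]. *)
Let far r0 w : R := `[< exists2 r, (r0 <= r)%N & (r < nn (- r%:Z) w)%N >]%:R.

Let mlt r s : measurable_fun setT (fun w => (r < nn s w)%N%:R : R).
Proof. exact: (@measurableT_comp _ _ _ _ _ _ (fun k : nat => (r < k)%N%:R : R)). Qed.

Let ilt r s : integ P (fun w => (r < nn s w)%N%:R).
Proof.
apply: (@integ_bounded _ _ _ _ 1) => [|w]; first exact: mlt.
by rewrite normr_nat -[leRHS]/(1%:R) ler_nat leq_b1.
Qed.

Let Elt r s : Ex P (fun w => (r < nn s w)%N%:R) = Ex P (fun w => (r < nn 0 w)%N%:R).
Proof.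
apply: (@Ex_same_law _ _ _ P _ _ (nn s) (nn 0) (fun k : nat => (r < k)%N%:R : R)
  (mnn s) (mnn 0) (nn_law s) _ (ilt r s)).2 => //.
Qed.

(* Borel-Cantelli: [E[n_0]] is finite, so almost surely only finitely many
   sites [-r] still act at time [1] or later. *)
Let far_small (e : R) : 0 < e -> exists r0, integ P (far r0) /\ Ex P (far r0) <= e.
Proof.
move=> e0.
have mD r : measurable_fun setT (fun w => (nn 0 w - r)%N%:R : R).
  exact: (@measurableT_comp _ _ _ _ _ _ (fun k : nat => (k - r)%N%:R : R)).
have DN r w : `|(nn 0 w - r)%N%:R : R| <= (nn 0 w)%:R by rewrite normr_nat ler_nat leq_subr.
have H : Ex P (fun w => (nn 0 w - r)%N%:R) @[r --> \oo] --> (0 : R).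
  have <- : Ex P (fun=> 0) = 0 by exact: Ex_cst.
  apply: (Ex_dominated_cvg mD _ inn DN).2 => w; apply: cvg_near_cst; near=> r.
  have : (nn 0 w <= r)%N by near: r; exact: nbhs_infty_ge.
  by rewrite -subn_eq0 => /eqP ->.
have [r0 _ /(_ r0 (leqnn r0)) Hr] := cvgr_lt _ H _ e0.
pose g r w : R := (r0 + r < nn (- (r0 + r)%:Z) w)%N%:R.
have g0 r w : 0 <= g r w by [].
(* Counts of active sites capped at 1 converge to the indicator [far r0], which gives its
   measurability too. Their means are at most the sum of [P(n_0 > r0 + r)], hence at most the mean
   of the truncated difference [n_0 - r0]. *)
pose b m w : R := Num.min 1 (\sum_(r < m) g r w).
have ig r : integ P (g r) by exact: ilt.
have isg m : integ P (fun w => \sum_(r < m) g r w) by apply: integ_sum => r _; exact: ig.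
have mb m : measurable_fun setT (b m).
  by apply: measurable_minr; [exact: measurable_cst|exact: integ_measurable (isg m)].
have bb m w : `|b m w| <= 1.
  by rewrite ger0_norm ?ge_min ?lexx// le_min ler01 sumr_ge0.
have cb w : b m w @[m --> \oo] --> far r0 w.
  apply: cvg_near_cst; rewrite /far; case: asboolP => [[r rr0 rn]|h].
    near=> m; have rm : (r - r0 < m)%N by near: m; exact: nbhs_infty_gt.
    rewrite /b min_l// (bigD1 (Ordinal rm))//= {1}/g subnKC// rn.
    by rewrite lerDl sumr_ge0.
  near=> m; rewrite /b big1 ?min_r// => r _; rewrite /g.
  by case: ltnP => // rn; case: h; exists (r0 + r)%N => //; exact: leq_addr.
have [ifar cfar] := Ex_dominated_cvg mb cb (integ_cst P 1) bb.
exists r0; split => //.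
rewrite -(cvg_lim (@Rhausdorff R) cfar); apply: limr_le; first exact: cvgP cfar.
near=> m; apply: le_trans (ltW Hr).
apply: (@le_trans _ _ (Ex P (fun w => \sum_(r < m) g r w))).
  apply: le_Ex => [||w]; [exact: integ_bounded (mb m) (bb m)|exact: isg|].
  by rewrite /b ge_min lexx orbT.
rewrite Ex_sum => [|r _]; last exact: ig.
under eq_bigr do rewrite /g Elt; rewrite -Ex_sum => [|r _]; last exact: ilt.
apply: le_Ex => [||w].
- by apply: integ_sum => r _; exact: ilt.
- exact: le_integ (mD r0) (DN r0) inn.
- have := @sum_window_le R 0 m 0 (nn 0 w - r0); rewrite big_mkord; apply: le_trans.
  by apply: ler_sum => r _; rewrite windowE ler_nat add0n ltn_subRL.
Unshelve. all: by end_near. Qed.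

Let mX (t : nat) : measurable_fun setT (parke_X eps nn t%:Z).
Proof.
apply: measurable_limn => N; apply: measurable_sum => m.
set s := t%:Z - _.
rewrite (_ : (fun _ => _) = fun w => (m <= nn s w)%N%:R * eps s w); last first.
  by apply/funext => w; case: (_ <= _)%N; rewrite ?mul1r ?mul0r.
apply: measurable_funM => //.
exact: (@measurableT_comp _ _ _ _ _ _ (fun k : nat => (m <= k)%N%:R : R)).
Qed.

Theorem parke_cvg_in_distribution (q : nat) (j : 'I_q -> nat)
    {d2} {T2 : measurableType d2} (P2 : probability T2 R) (Lam : R -> T2 -> R)
    (ZRe ZIm : 'I_q -> T2 -> R) :
  stable_levy P2 Lam alpha
    (mom_abs P (eps 1) alpha * Gamma (1 - alpha) * cos (pi * alpha / 2))
    ((mom_pos P (eps 1) alpha - mom_neg P (eps 1) alpha) / mom_abs P (eps 1) alpha) ->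
  (forall k, measurable_fun setT (ZRe k)) ->
  (forall k, measurable_fun setT (ZIm k)) ->
  (forall k, cvg_in_prob P2
     (riemann_sum (fun s => cos (2 * pi * (j k)%:R * s)) Lam) (ZRe k)) ->
  (forall k, cvg_in_prob P2
     (riemann_sum (fun s => sin (2 * pi * (j k)%:R * s)) Lam) (ZIm k)) ->
  cvg_in_distribution P (normalized_D P (nn 0) alpha (fun t : nat => parke_X eps nn t%:Z) j)
    P2 (fun w => (\row_k ZRe k w, \row_k ZIm k w)).
Proof.
move=> st mZRe mZIm HRe HIm.
have [i1 E1] := @Ex_same_law _ _ _ P _ _ (eps 0) (eps 1) idfun (meps 0) (meps 1)
  (same_law_sym (eps_law 1)) (@measurable_id _ _ _) ieps.
have [|i2 _] := @Ex_same_law _ _ _ P _ _ (eps 0) (eps 1) (fun x => x ^+ 2) (meps 0) (meps 1)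
  (same_law_sym (eps_law 1)) _ ieps2; first exact: measurable_funX.
have ce : (1 : R)^-1 * mom_abs P (eps 1) alpha * Gamma (1 - alpha) * cos (pi * alpha / 2) =
  mom_abs P (eps 1) alpha * Gamma (1 - alpha) * cos (pi * alpha / 2) by rewrite invr1 mul1r.
rewrite -ce in st.
apply: (@shot_process_cvg _ _ _ P _ F FT FI mF indep (fun k => eps k.+1%:Z) (fun k => inl k.+1%:Z)
  (fun i => if i is inl _ then true else false) (fun k w => nn k.+1%:Z w + 1)%N (fun k => inr k.+1%:Z)
  (fun k _ => k.+1) (fun _ => pred0) 1 alpha c _ _ _ _ _ _ _ _ _ _ (lexx _) _ _ _ i1 i2
  _ alpha12 ht (nn 0) (fun t : nat => parke_X eps nn t%:Z) q j _ mX _ _ _ P2 Lam ZRe ZIm st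
  mZRe mZIm HRe HIm) => //.
- by move=> k B h; exact: h.
- move=> k _ [B mB <-]; by exists [set m | B (m + 1)%N].
- by move=> k l [].
- by move=> k l [].
- by move=> k; exact: measurable_cst.
(* With [V k = k + 1] and [mu = 1] the deviation is always exactly 1, which does not exceed
   [eta * n] for large [n]. *)
- move=> eta eta0; apply: cvg_near_cst; near=> n.
  rewrite big1 ?mulr0// => k _.
  rewrite -[RHS](Ex_cst P 0); apply: eq_Ex => w.
  rewrite mul1r -natrB; last exact: leqnSn.
  rewrite subSnn normr1 ltNge (_ : 1 <= eta * n%:R)//.
  rewrite -ler_pdivrMl// mulr1; near: n; exact: nbhs_infty_ger.
- move=> k B mB; rewrite [LHS]eps_law// eps_law//.
- by rewrite -E1.
- by move=> n n0; apply: ell_quantile.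
move=> f M Lf fM fL.
have M0 : 0 <= M := le_trans (normr_ge0 _) (fM 0).
have mS n : measurable_fun setT (shot_sum (fun k => eps k.+1%:Z) (fun k w => nn k.+1%:Z w + 1)%N
    (fun k _ => k.+1) c f n).
  apply: measurable_funM; first exact: measurable_cst.
  apply: measurable_sum => k; apply: measurable_funM => //.
  have h : forall m : nat, measurable_fun setT (fun v : nat => window_sum f n m v) by [].
  exact: (measurableT_comp (h k.+1) (mnn1 k.+1%:Z)).
have mR n : measurable_fun setT (fun w => (c n)^-1 * \sum_(1 <= t < n.+1)
    parke_X eps nn t%:Z w * f (t%:R / n%:R) - shot_sum (fun k => eps k.+1%:Z)
    (fun k w => nn k.+1%:Z w + 1)%N (fun k _ => k.+1) c f n w).
  apply: measurable_funB => //; apply: measurable_funM; first exact: measurable_cst.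
  apply: measurable_sum => t; apply: measurable_funM; [exact: mX|exact: measurable_cst].
apply/cvgrPdist_le => e e0; have e2 : 0 < e / 2 by rewrite divr_gt0.
(* Off an event of probability at most [e / 2], the past consists of fewer than [r0] later fixed
   sites, and its contribution is at most the variable [D], independent of [n]. *)
have [r0 [ifar Efar]] := far_small e2.
pose D w := M * \sum_(r < r0) `|eps (- r%:Z) w| * (nn (- r%:Z) w)%:R.
have mD : measurable_fun setT D.
  apply: measurable_funM; first exact: measurable_cst.
  apply: measurable_sum => r; apply: measurable_funM; last exact: measurable_natr.
  exact: measurableT_comp.
have [cy _ _ _] := ht.
have HD : \forall n \near \oo, Ex P (fun w => Num.min 1 `|(c n)^-1 * D w|) < e / 2.
  exact: (cvgr_lt _ (Ex_min1_scale_cvg0 P mD cy) _ e2).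
near=> n.
have Dn : Ex P (fun w => Num.min 1 `|(c n)^-1 * D w|) < e / 2 by near: n.
rewrite sub0r normrN ger0_norm; last by apply: Ex_ge0 => w; rewrite le_min ler01 normr_ge0.
have iD : integ P (fun w => Num.min 1 `|(c n)^-1 * D w|).
  by apply: integ_min1; apply: measurable_funM => //; exact: measurable_cst.
apply: (@le_trans _ _ (Ex P (fun w => far r0 w + Num.min 1 `|(c n)^-1 * D w|))); last first.
  by rewrite ExD// [leRHS]splitr lerD// ltW.
apply: le_Ex => [||w]; [exact: integ_min1 (mR n)|exact: integD|].
have D0 : 0 <= Num.min 1 `|(c n)^-1 * D w| by rewrite le_min ler01 normr_ge0.
rewrite /far; case: asboolP => h; first by rewrite ge_min ler_wpDr.
rewrite add0r le_min !ge_min lexx/=; apply/orP; right.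
rewrite -mulrBr normrM [leRHS]normrM ler_wpM2l//.
apply: le_trans (ler_norm _); apply: parke_weighted_sum => // r rr0.
by case: leqP => // rn; case: h; exists r.
Unshelve. all: by end_near. Qed.

End parke_limit.


Theorem theorem2 (R : realType) (alpha : R) (q : nat) (j : 'I_q -> nat) :
  1 < alpha < 2 ->
  (forall k, (0 < j k)%N) ->
  (forall k1 k2 : 'I_q, (k1 < k2)%N -> (j k1 < j k2)%N) ->
  (* (a) the Taqqu-Levy process *)
  (forall (d : measure_display) (Om : measurableType d) (P : probability Om R)
     (S0 : Om -> nat) (Tk : nat -> Om -> nat) (W : nat -> Om -> R)
     (mu : R) (L : R -> R)
     (d2 : measure_display) (Om2 : measurableType d2) (P2 : probability Om2 R)
     (Lam : R -> Om2 -> R) (ZRe ZIm : 'I_q -> Om2 -> R),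
     measurable_fun setT S0 ->
     (forall k, measurable_fun setT (Tk k)) ->
     (forall k, measurable_fun setT (W k)) ->
     (forall k w, (1 <= k)%N -> (0 < Tk k w)%N) ->
     (forall k, (1 <= k)%N -> same_law P (Tk k) (Tk 1%N)) ->
     (forall k, same_law P (W k) (W 0%N)) ->
     mutually_indep P (fun i : option (nat + nat) =>
       match i with
       | None => rv_events S0
       | Some (inl k) => rv_events (Tk k.+1)
       | Some (inr k) => rv_events (W k)
       end) ->
     P.-integrable setT (EFin \o (fun w => (Tk 1%N w)%:R)) ->
     ('E_P[fun w => (Tk 1%N w)%:R] = mu%:E)%E ->
     (0 < P [set w | Tk 1%N w = 1%N])%E ->
     (forall u : nat, P [set w | S0 w = u] =
        (mu^-1 * fine (P [set w | (u.+1 <= Tk 1%N w)%N]))%:E) ->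
     P.-integrable setT (EFin \o W 0%N) ->
     ('E_P[W 0%N] = 0)%E ->
     P.-integrable setT (EFin \o (fun w => W 0%N w ^+ 2)) ->
     slowly_varying L ->
     (forall n : nat, (1 <= n)%N ->
        fine (P [set w | (n <= Tk 1%N w)%N]) = L n%:R * n%:R `^ (- alpha)) ->
     stable_levy P2 Lam alpha
       (mu^-1 * mom_abs P (W 1%N) alpha * Gamma (1 - alpha) * cos (pi * alpha / 2))
       ((mom_pos P (W 1%N) alpha - mom_neg P (W 1%N) alpha) / mom_abs P (W 1%N) alpha) ->
     (forall k, measurable_fun setT (ZRe k)) ->
     (forall k, measurable_fun setT (ZIm k)) ->
     (forall k, cvg_in_prob P2
        (riemann_sum (fun s => cos (2 * pi * (j k)%:R * s)) Lam) (ZRe k)) ->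
     (forall k, cvg_in_prob P2
        (riemann_sum (fun s => sin (2 * pi * (j k)%:R * s)) Lam) (ZIm k)) ->
     cvg_in_distribution P (normalized_D P (Tk 1%N) alpha (taqqu_X S0 Tk W) j)
       P2 (fun w => (\row_k ZRe k w, \row_k ZIm k w)))
  /\
  (* (b) Parke's process *)
  (forall (d : measure_display) (Om : measurableType d) (P : probability Om R)
     (eps : int -> Om -> R) (nn : int -> Om -> nat) (L : R -> R)
     (d2 : measure_display) (Om2 : measurableType d2) (P2 : probability Om2 R)
     (Lam : R -> Om2 -> R) (ZRe ZIm : 'I_q -> Om2 -> R),
     (forall s, measurable_fun setT (eps s)) ->
     (forall s, measurable_fun setT (nn s)) ->
     (forall s, same_law P (eps s) (eps 0)) ->
     (forall s, same_law P (nn s) (nn 0)) ->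
     mutually_indep P (fun i : int + int =>
       match i with
       | inl s => rv_events (eps s)
       | inr s => rv_events (nn s)
       end) ->
     P.-integrable setT (EFin \o eps 0) ->
     ('E_P[eps (0:int)] = 0)%E ->
     P.-integrable setT (EFin \o (fun w => eps 0 w ^+ 2)) ->
     slowly_varying L ->
     (forall n : nat, (1 <= n)%N ->
        fine (P [set w | (n <= nn (0:int) w)%N]) = L n%:R * n%:R `^ (- alpha)) ->
     stable_levy P2 Lam alpha
       (mom_abs P (eps 1) alpha * Gamma (1 - alpha) * cos (pi * alpha / 2))
       ((mom_pos P (eps 1) alpha - mom_neg P (eps 1) alpha) / mom_abs P (eps 1) alpha) ->
     (forall k, measurable_fun setT (ZRe k)) ->
     (forall k, measurable_fun setT (ZIm k)) ->
     (forall k, cvg_in_prob P2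
        (riemann_sum (fun s => cos (2 * pi * (j k)%:R * s)) Lam) (ZRe k)) ->
     (forall k, cvg_in_prob P2
        (riemann_sum (fun s => sin (2 * pi * (j k)%:R * s)) Lam) (ZIm k)) ->
     cvg_in_distribution P
       (normalized_D P (nn 0) alpha (fun t : nat => parke_X eps nn t%:Z) j)
       P2 (fun w => (\row_k ZRe k w, \row_k ZIm k w))).
Proof.
move=> a12 _ _; split.
- move=> d Om P S0 Tk W mu L d2 Om2 P2 Lam ZRe ZIm mS0 mTk mW T0 lT lW ind iT ET _ _ iW EW iW2 sv TL st m1 m2 h1 h2.
  apply: (taqqu_cvg_in_distribution mS0 mTk mW T0 lT lW ind iT _ iW _ iW2 a12 sv TL st m1 m2 h1 h2).
  + by rewrite Ex_fine ET.
  + by rewrite Ex_fine EW.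
- move=> d Om P eps nn L d2 Om2 P2 Lam ZRe ZIm me mn le ln ind ie Ee ie2 sv NL st m1 m2 h1 h2.
  apply: (parke_cvg_in_distribution me mn le ln ind ie _ ie2 a12 sv NL st m1 m2 h1 h2).
  by rewrite Ex_fine Ee.
Qed.
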